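(* Let $G$ be a planar graph and let $S$ be a collinear set of $G$. Then every set $P$ of $|S|$ points in the plane is a universal point subset for $G$, i.e., $G$ has a plane straight-line drawing in which $|S|$ vertices of $G$ are mapped to the $|S|$ points of $P$.
   Context: A plane straight-line drawing of a graph maps vertices to distinct points and edges to straight-line segments between their endpoints, with no two edges intersecting except at a common endpoint. A set $S\subseteq V(G)$ of a planar graph $G$ is a collinear set if $G$ has a plane straight-line drawing in which all vertices of $S$ lie on a single line. A set $P$ of $k\le |V(G)|$ points in the plane is a universal point subset for $G$ if $G$ has a plane straight-line drawing in which $k$ vertices of $G$ are mapped to the $k$ points of $P$. *)

(* Defs.v *)
From HB Require Import structures.
From mathcomp Require Import all_boot all_order all_algebra.
From mathcomp Require Import reals.
Set Implicit Arguments. Unset Strict Implicit. Unset Printing Implicit Defensive.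
Import Order.TTheory GRing.Theory Num.Theory.
Local Open Scope ring_scope.

Definition point (R : realType) := (R * R)%type.

Definition on_seg (R : realType) (a b p : point R) : Prop :=
  exists t : R, 0 <= t <= 1 /\
    p.1 = (1 - t) * a.1 + t * b.1 /\ p.2 = (1 - t) * a.2 + t * b.2.

(* A simple graph is given by a symmetric irreflexive relation e on a finType T.
   A plane straight-line drawing d : T -> R^2:
   - vertices go to distinct points;
   - no vertex lies on an edge other than at the edge's endpoints;
   - two distinct edges meet only at a common endpoint. *)
Definition plane_drawing (R : realType) (T : finType) (e : rel T)
    (d : T -> point R) : Prop :=
  injective d /\
  (forall u v w, e u v -> w != u -> w != v -> ~ on_seg (d u) (d v) (d w)) /\
  (forall a b c x (p : point R), e a b -> e c x ->
     [set a; b] != [set c; x] ->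
     on_seg (d a) (d b) p -> on_seg (d c) (d x) p ->
     exists2 v, (v \in [set a; b]) && (v \in [set c; x]) & p = d v).

(* Planar: admits a plane straight-line drawing (equivalent to planarity by Fary). *)
Definition planar (R : realType) (T : finType) (e : rel T) : Prop :=
  exists d : T -> point R, plane_drawing e d.

Definition collinear_set (R : realType) (T : finType) (e : rel T) (S : {set T})
  : Prop :=
  exists d : T -> point R, plane_drawing e d /\
    exists a b c : R, (a != 0 \/ b != 0) /\
      forall v, v \in S -> a * (d v).1 + b * (d v).2 = c.

(* P (a list of k distinct points, k <= |V|) is a universal point subset:
   some plane straight-line drawing maps k vertices onto the k points of P
   (d being injective, it suffices that every point of P is hit). *)
Definition universal_point_subset (R : realType) (T : finType) (e : rel T)
    (P : seq (point R)) : Prop :=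
  uniq P /\ (size P <= #|T|)%N /\
  exists d : T -> point R, plane_drawing e d /\
    forall p, p \in P -> exists v, d v = p.

(* Submission.v *)
(** After an affine change of coordinates the line is x = 0.  Enclose the drawing
    in a large triangle, put extra vertices on the line and triangulate so that
    every face crossing the line has a vertex on it; let s_0, ..., s_M be the
    vertices on the line from bottom to top.  In the dual coordinates
    u = -1/|x|, v = u * y the slope of a segment from a vertex to (0, h) is the
    linear expression v - u * h, and the edges from the line to its neighbours
    form a word in which consecutive edges share an end.  For any new heights
    b_0 < ... < b_M a nonnegative linear system, solvable because the given
    drawing exists, yields dual coordinates of the neighbours for which the word
    keeps its order; each neighbour then lies in the convex hull of its own
    neighbours.  Placing the other vertices harmonically, perturbing the weights
    slightly and moving s_k to (eps a_k, b_k) gives a map of the triangulation in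
    which every inner vertex is surrounded by its neighbours.  Such a map is a
    plane drawing (a form of Tutte's theorem, by counting local extrema), and
    scaling x by 1/eps moves s_k to (a_k, b_k).  A shear makes the second
    coordinates of the prescribed points distinct beforehand. *)

Require Import Defs.
From HB Require Import structures.
From mathcomp Require Import all_boot all_order all_algebra.
From mathcomp Require Import reals.
From mathcomp Require Import ring lra zify.
From Stdlib Require Import Classical.
Set Implicit Arguments. Unset Strict Implicit. Unset Printing Implicit Defensive.
Import Order.TTheory GRing.Theory Num.Theory.
Local Open Scope ring_scope.

(** * Segments and plane drawings *)

Section Segments.
Variable R : realType.
Implicit Types a b c x p q : point R.

(** The vertices on the line are pinned at arbitrary points, so they are not barycentres of their
    neighbours for weights chosen in advance, and Tutte's theorem in its usual form does not apply.
    Its proof needs less: no linear functional may have a one-sided extremum at an inner vertex. At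
    a vertex of the line this is an open condition on its neighbours, so it is enough to satisfy it
    in the limit where the line stays straight and then to move the [s_k] slightly off it. In the
    limit the condition concerns the extreme edges on the two sides of [s_k]: the sum of their dual
    slopes is positive at the bottom and negative at the top, unless the next vertex of the line is
    adjacent. These inequalities, and the order inside a fan, are linear in the dual coordinates.
    The unknowns are one depth for each excursion, a stretch of the word between two consecutive
    visits of the same vertex; the slopes must close up over every excursion, which gives one
    equation per unknown. A set of excursions obstructing the solution would violate a balance of
    slopes that the given drawing satisfies, whatever its heights are. *)

Definition cr a b c : R :=
  (b.1 - a.1) * (c.2 - a.2) - (b.2 - a.2) * (c.1 - a.1).

(** [cr] is twice a signed area, so a negative product means that a line strictly separates two
    points. Touching at an end does not count, which keeps edges with a common end from crossing. *)
Definition pcross a b c x : bool :=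
  (cr a b c * cr a b x < 0) && (cr c x a * cr c x b < 0).

Definition lerp (t : R) a b : point R :=
  ((1 - t) * a.1 + t * b.1, (1 - t) * a.2 + t * b.2).

Lemma point_eq p q : p.1 = q.1 -> p.2 = q.2 -> p = q.
Proof. by case: p q => [? ?] [? ?] /= -> ->. Qed.

Lemma on_segP a b p : on_seg a b p <-> exists t, 0 <= t <= 1 /\ p = lerp t a b.
Proof.
split=> [[t [t01 [p1 p2]]]|[t [t01 ->]]]; exists t; split=> //.
exact: point_eq.
Qed.

Lemma on_seg_lerp t a b : 0 <= t <= 1 -> on_seg a b (lerp t a b).
Proof. by move=> t01; apply/on_segP; exists t. Qed.

Lemma on_segC a b p : on_seg a b p -> on_seg b a p.
Proof.
move=> [t [t01 [p1 p2]]]; exists (1 - t); split; first lra.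
by split; rewrite ?p1 ?p2; ring.
Qed.

Lemma cr_lerp t a b c x :
  cr a b (lerp t c x) = (1 - t) * cr a b c + t * cr a b x.
Proof. by rewrite /cr /lerp /=; ring. Qed.

Lemma cr_cyc a b c : cr b c a = cr a b c.
Proof. by rewrite /cr; ring. Qed.

Lemma cr_swap a b c : cr a c b = - cr a b c.
Proof. by rewrite /cr; ring. Qed.

Lemma cr_swap12 a b c : cr b a c = - cr a b c.
Proof. by rewrite /cr; ring. Qed.

Lemma cr_aab a b : cr a a b = 0. Proof. by rewrite /cr; ring. Qed.
Lemma cr_aba a b : cr a b a = 0. Proof. by rewrite /cr; ring. Qed.
Lemma cr_abb a b : cr a b b = 0. Proof. by rewrite /cr; ring. Qed.

Lemma cr_sum a b c p : cr a b p + cr b c p + cr c a p = cr a b c.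
Proof. by rewrite /cr; ring. Qed.

Lemma on_seg_cr a b p : on_seg a b p -> cr a b p = 0.
Proof. by move=> /on_segP[t [_ ->]]; rewrite cr_lerp cr_aba cr_abb; ring. Qed.

(** Divided by [cr a b c], the three values are the barycentric coordinates of [p]; the one of [c]
    vanishes and the other two are nonnegative. *)
Lemma bary_edge a b c p : 0 < cr a b c -> cr a b p = 0 ->
  0 <= cr b c p -> 0 <= cr c a p -> on_seg a b p.
Proof.
move=> D0 p0 p1 p2; have S := cr_sum a b c p.
have Dn : cr a b c != 0 by rewrite gt_eqF.
have [t tE] : exists t, cr c a p = t * cr a b c.
  by exists (cr c a p / cr a b c); rewrite divfK.
have sE : cr b c p = (1 - t) * cr a b c by lra.
have I1 : cr a b c * p.1 = cr b c p * a.1 + cr c a p * b.1 + cr a b p * c.1.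
  by rewrite /cr; ring.
have I2 : cr a b c * p.2 = cr b c p * a.2 + cr c a p * b.2 + cr a b p * c.2.
  by rewrite /cr; ring.
apply/on_segP; exists t; split; first by nra.
by apply: point_eq; apply: (mulfI Dn); rewrite /lerp /= ?I1 ?I2 p0 tE sE; ring.
Qed.

Lemma pcross_meet a b c x : pcross a b c x ->
  exists t s, [/\ 0 < t < 1, 0 < s < 1 & lerp t a b = lerp s c x].
Proof.
case/andP=> h1 h2.
(* An affine function with values [y] and [z] of opposite signs at the ends of a segment vanishes at
   the parameter [y / (y - z)]. *)
have L : forall y z : R, y * z < 0 -> y - z != 0 /\ 0 < y / (y - z) < 1.
  move=> y z yz.
  have [y0|y0|y0] := ltgtP y 0; last by rewrite y0 mul0r ltxx in yz.
    have z0 : 0 < z by nra.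
    have n0 : y - z < 0 by lra.
    split; first by rewrite lt_eqF.
    by rewrite ltr_ndivlMr // ltr_ndivrMr // mul0r mul1r; lra.
  have z0 : z < 0 by nra.
  have n0 : 0 < y - z by lra.
  split; first by rewrite gt_eqF.
  by rewrite ltr_pdivlMr // ltr_pdivrMr // mul0r mul1r; lra.
have [n1 s01] := L _ _ h1; have [n2 t01] := L _ _ h2.
exists (cr c x a / (cr c x a - cr c x b)), (cr a b c / (cr a b c - cr a b x)).
split=> //.
move: (_ / _) (_ / _) (divfK n2 (cr c x a)) (divfK n1 (cr a b c)) => t s tE sE.
have E : cr c x a - cr c x b = - (cr a b c - cr a b x) by rewrite /cr; ring.
rewrite E in tE.
apply: point_eq; apply: (mulfI n1); rewrite /lerp /=.
  transitivity ((cr a b c - cr a b x) * a.1 - cr c x a * (b.1 - a.1)).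
    by rewrite -tE; ring.
  transitivity ((cr a b c - cr a b x) * c.1 + cr a b c * (x.1 - c.1)).
    by rewrite /cr; ring.
  by rewrite -{2}sE; ring.
transitivity ((cr a b c - cr a b x) * a.2 - cr c x a * (b.2 - a.2)).
  by rewrite -tE; ring.
transitivity ((cr a b c - cr a b x) * c.2 + cr a b c * (x.2 - c.2)).
  by rewrite /cr; ring.
by rewrite -{2}sE; ring.
Qed.

(** Two segments from [a] with a second common point lie on one ray, so the shorter one ends on the
    longer one. *)
Lemma seg_share a b c p : on_seg a b p -> on_seg a c p ->
  p = a \/ on_seg a b c \/ on_seg a c b.
Proof.
move=> [t [t01 [p1 p2]]] [s [s01 [q1 q2]]].
have [t0|t0] := eqVneq t 0.
  by left; apply: point_eq; rewrite ?p1 ?p2 t0; ring.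
have [s0|s0] := eqVneq s 0.
  by left; apply: point_eq; rewrite ?q1 ?q2 s0; ring.
have tp : 0 < t by rewrite lt_def t0; lra.
have sp : 0 < s by rewrite lt_def s0; lra.
have e1 : t * (b.1 - a.1) = s * (c.1 - a.1) by rewrite p1 in q1; lra.
have e2 : t * (b.2 - a.2) = s * (c.2 - a.2) by rewrite p2 in q2; lra.
right; have [ts|st] := leP t s.
  left; exists (t / s); split.
    by rewrite divr_ge0 ?(ltW tp) ?(ltW sp) //= ler_pdivrMr // mul1r.
  have f1 : c.1 = a.1 + t / s * (b.1 - a.1).
    by apply: (mulfI s0); rewrite mulrDr mulrA [s * (t / s)]mulrC divfK //; lra.
  have f2 : c.2 = a.2 + t / s * (b.2 - a.2).
    by apply: (mulfI s0); rewrite mulrDr mulrA [s * (t / s)]mulrC divfK //; lra.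
  by split; rewrite ?f1 ?f2; ring.
right; exists (s / t); split.
  by rewrite divr_ge0 ?(ltW tp) ?(ltW sp) //= ler_pdivrMr // mul1r ltW.
have f1 : b.1 = a.1 + s / t * (c.1 - a.1).
  by apply: (mulfI t0); rewrite mulrDr mulrA [t * (s / t)]mulrC divfK //; lra.
have f2 : b.2 = a.2 + s / t * (c.2 - a.2).
  by apply: (mulfI t0); rewrite mulrDr mulrA [t * (s / t)]mulrC divfK //; lra.
by split; rewrite ?f1 ?f2; ring.
Qed.

(** Turns a mere common point into the obstructions that maximality speaks of: a vertex on an edge,
    or a proper crossing. *)
Lemma seg_cross a b c x p : on_seg a b p -> on_seg c x p ->
  [\/ on_seg a b c, on_seg a b x, on_seg c x a | on_seg c x b] \/ pcross a b c x.
Proof.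
move=> abp cxp.
have zero : forall u v y z p, on_seg u v p -> on_seg y z p ->
    [\/ on_seg u v y, on_seg u v z | cr u v y * cr u v z < 0] \/
    cr u v y = 0 /\ cr u v z = 0.
  move=> u v y z {abp cxp}q uvq /on_segP[t [t01 qE]].
  have := on_seg_cr uvq; rewrite qE cr_lerp => Z.
  have [y0|y0] := eqVneq (cr u v y) 0.
    have [z0|z0] := eqVneq (cr u v z) 0; first by right.
    left; apply: Or31; move: Z; rewrite y0 mulr0 add0r => /eqP.
    rewrite mulf_eq0 (negPf z0) orbF => /eqP t0.
    by move: uvq; rewrite qE t0; congr on_seg; apply: point_eq => /=; ring.
  have [z0|z0] := eqVneq (cr u v z) 0.
    left; apply: Or32; move: Z; rewrite z0 mulr0 addr0 => /eqP.
    rewrite mulf_eq0 (negPf y0) orbF subr_eq0 => /eqP t1.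
    by move: uvq; rewrite qE -t1; congr on_seg; apply: point_eq => /=; ring.
  left; apply: Or33.
  have [yp|yn] := ltP 0 (cr u v y); have [zp|zn] := ltP 0 (cr u v z).
  - by have [t0|t0] := eqVneq t 0; [rewrite t0 in Z | have : 0 < t by rewrite lt_def t0; lra]; nra.
  - by rewrite pmulr_rlt0 // lt_def zn eq_sym z0.
  - by rewrite pmulr_llt0 // lt_def yn eq_sym y0.
  have yn' : cr u v y < 0 by rewrite lt_def yn eq_sym y0.
  have zn' : cr u v z < 0 by rewrite lt_def zn eq_sym z0.
  by have [t0|t0] := eqVneq t 0; [rewrite t0 in Z | have : 0 < t by rewrite lt_def t0; lra]; nra.
have [[?|?|h1]|[z1 z2]] := zero _ _ _ _ _ abp cxp.
- by left; apply: Or41.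
- by left; apply: Or42.
- have [[?|?|h2]|[w1 w2]] := zero _ _ _ _ _ cxp abp.
  + by left; apply: Or43.
  + by left; apply: Or44.
  + by right; apply/andP.
  have : cr a b c - cr a b x = cr c x b - cr c x a by rewrite /cr; ring.
  by rewrite w1 w2 subrr => /eqP; rewrite subr_eq0 => /eqP E; rewrite E in h1; nra.
have [ab|ab] := eqVneq a b.
  left; apply: Or43; move: abp cxp; rewrite ab => /on_segP[t [_ ->]].
  by congr on_seg; apply: point_eq => /=; ring.
(* all four points are collinear; compare the parameters of c and x along ab *)
have [k1 [k2 kab]] : exists k1 k2 : R, k1 * (b.1 - a.1) + k2 * (b.2 - a.2) = 1.
  have [h|h] := eqVneq (b.1 - a.1) 0.
    have h2 : b.2 - a.2 != 0.
      apply: contraNneq ab => h2; apply/eqP; apply: point_eq; apply/eqP.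
        by rewrite eq_sym -subr_eq0 h.
      by rewrite eq_sym -subr_eq0 h2.
    by exists 0, (b.2 - a.2)^-1; rewrite mul0r add0r mulVf.
  by exists (b.1 - a.1)^-1, 0; rewrite mul0r addr0 mulVf.
pose tp q := k1 * (q.1 - a.1) + k2 * (q.2 - a.2).
have tpE : forall q, cr a b q = 0 -> q = lerp (tp q) a b.
  move=> q Z; have e1 : q.1 - a.1 = tp q * (b.1 - a.1).
    rewrite -[LHS]mul1r -kab; apply/eqP; rewrite -subr_eq0; apply/eqP.
    transitivity (- (k2 * cr a b q)); last by rewrite Z mulr0 oppr0.
    by rewrite /tp /cr; ring.
  have e2 : q.2 - a.2 = tp q * (b.2 - a.2).
    rewrite -[LHS]mul1r -kab; apply/eqP; rewrite -subr_eq0; apply/eqP.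
    transitivity (k1 * cr a b q); last by rewrite Z mulr0.
    by rewrite /tp /cr; ring.
  by apply: point_eq; rewrite /lerp /=; lra.
have cE := tpE _ z1; have xE := tpE _ z2.
have tpl : forall t u v, tp (lerp t u v) = (1 - t) * tp u + t * tp v.
  by move=> t u v; rewrite /tp /=; ring.
have tpa : tp a = 0 by rewrite /tp !subrr !mulr0 addr0.
have tpb : tp b = 1 by rewrite /tp.
have [cb|cb] := boolP (0 <= tp c <= 1).
  by left; apply: Or41; rewrite cE; apply: on_seg_lerp.
have [xb|xb] := boolP (0 <= tp x <= 1).
  by left; apply: Or42; rewrite xE; apply: on_seg_lerp.
have /on_segP[t [t01 pE]] := abp; have /on_segP[s [s01 pE']] := cxp.
have tpp : tp p = t by rewrite pE tpl tpa tpb; ring.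
have tpp' : tp p = (1 - s) * tp c + s * tp x by rewrite pE' tpl.
have key : forall u v : R, u < 0 -> 0 < v -> 0 <= - u / (v - u) <= 1.
  move=> u v u0 v0; have h : 0 < v - u by lra.
  by apply/andP; split; [apply: divr_ge0; lra | rewrite ler_pdivrMr //; lra].
have c1e : c.1 = (1 - tp c) * a.1 + tp c * b.1 by rewrite {1}cE.
have c2e : c.2 = (1 - tp c) * a.2 + tp c * b.2 by rewrite {1}cE.
have x1e : x.1 = (1 - tp x) * a.1 + tp x * b.1 by rewrite {1}xE.
have x2e : x.2 = (1 - tp x) * a.2 + tp x * b.2 by rewrite {1}xE.
left; apply: Or43; apply/on_segP.
have [c0|c0] := ltP (tp c) 0; have [x0|x0] := ltP (tp x) 0.
- have h : tp p < 0 by rewrite tpp'; nra.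
  by rewrite tpp in h; lra.
- have x1 : 1 < tp x by move: xb; rewrite x0 /= -ltNge.
  exists (- tp c / (tp x - tp c)); split; first by apply: key; lra.
  have h : tp x - tp c != 0 by apply/negP => /eqP; lra.
  by apply: point_eq; rewrite /lerp /= ?c1e ?c2e ?x1e ?x2e; field.
- have c1 : 1 < tp c by move: cb; rewrite c0 /= -ltNge.
  exists (1 - - tp x / (tp c - tp x)); split.
    by have := key _ _ x0 (lt_trans ltr01 c1); lra.
  have h : tp c - tp x != 0 by apply/negP => /eqP; lra.
  by apply: point_eq; rewrite /lerp /= ?c1e ?c2e ?x1e ?x2e; field.
have c1 : 1 < tp c by move: cb; rewrite c0 /= -ltNge.
have x1 : 1 < tp x by move: xb; rewrite x0 /= -ltNge.
suff h : 1 < tp p by rewrite tpp in h; lra.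
rewrite tpp'; have [h|h] := leP (tp x) (tp c).
  have : 0 <= (1 - s) * (tp c - tp x) by apply: mulr_ge0; lra.
  lra.
have : 0 <= s * (tp x - tp c) by apply: mulr_ge0; lra.
lra.
Qed.

End Segments.

Section PlaneDrawing.
Variables (R : realType) (V : finType) (d : V -> point R).
Implicit Types e : rel V.

Lemma pd_meet e a b c x p : plane_drawing e d -> e a b -> e c x ->
  on_seg (d a) (d b) p -> on_seg (d c) (d x) p ->
  [set a; b] = [set c; x] \/
  exists v, [/\ v = a \/ v = b, v = c \/ v = x & p = d v].
Proof.
move=> [_ [_ h]] ab cx pab pcx.
have [->|ne] := eqVneq [set a; b] [set c; x]; [by left | right].
have [v /andP[]] := h _ _ _ _ _ ab cx ne pab pcx.
by rewrite !inE => /orP v1 /orP v2 pE; exists v; split=> //;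
  [case: v1 | case: v2] => /eqP; auto.
Qed.

Lemma pd_not_pcross e a b c x : plane_drawing e d -> e a b -> e c x ->
  ~~ pcross (d a) (d b) (d c) (d x).
Proof.
move=> pd ab cx; apply/negP => /[dup] /andP[h1 h2] /pcross_meet[t [s [t01 s01 E]]].
have t01' : 0 <= t <= 1 by lra.
have s01' : 0 <= s <= 1 by lra.
have [E2|[v [va vc _]]] := pd_meet pd ab cx (on_seg_lerp _ _ t01')
  (eq_ind_r (on_seg _ _) (on_seg_lerp _ _ s01') E).
  have : c \in [set a; b] by rewrite E2 !inE eqxx.
  by rewrite !inE => /orP[]/eqP E3; move: h1; rewrite E3 ?cr_aba ?cr_abb mul0r ltxx.
by case: vc => vE; case: va => vE'; move: h1; rewrite -vE vE' ?cr_aba ?cr_abb ?mul0r ?mulr0 ltxx.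
Qed.

Definition add_edge e (u v : V) : rel V :=
  fun a b => e a b || ((a, b) == (u, v)) || ((a, b) == (v, u)).

Lemma plane_add_edge e u v : symmetric e -> irreflexive e ->
  plane_drawing e d -> u != v ->
  (forall w, w != u -> w != v -> ~ on_seg (d u) (d v) (d w)) ->
  (forall a b, e a b -> ~~ pcross (d u) (d v) (d a) (d b)) ->
  plane_drawing (add_edge e u v) d.
Proof.
move=> se ie pd uv hw hc; have [dinj [hv hm]] := pd.
have hv2 : forall w, w != v -> w != u -> ~ on_seg (d v) (d u) (d w).
  by move=> w wv wu /on_segC; apply: hw.
split=> //; split.
  by move=> a b w /orP[/orP[|/eqP[-> ->]]|/eqP[-> ->]]; [apply: hv|apply: hw|apply: hv2].
have share : forall a b c p, on_seg (d a) (d b) p -> on_seg (d a) (d c) p ->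
    ~ on_seg (d a) (d b) (d c) -> ~ on_seg (d a) (d c) (d b) -> p = d a.
  by move=> a b c p h1 h2 n1 n2; case: (seg_share h1 h2) => [|[]].
have main : forall c x p, e c x -> [set u; v] != [set c; x] ->
    on_seg (d u) (d v) p -> on_seg (d c) (d x) p ->
    exists2 y, (y \in [set u; v]) && (y \in [set c; x]) & p = d y.
  move=> c x p cx ne puv pcx.
  have cxn : c != x by apply: contraTneq cx => ->; rewrite ie.
  have [uc|uc] := eqVneq u c.
    have xv : x != v by apply: contraNneq ne => ->; rewrite uc.
    exists u; first by rewrite uc !inE !eqxx.
    rewrite uc in puv hw *; apply: share puv pcx _ _; first by apply: hw; rewrite // eq_sym.
    by apply: hv => //; rewrite -1?uc eq_sym // eq_sym.
  have [ux|ux] := eqVneq u x.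
    have cv : c != v by apply: contraNneq ne => ->; rewrite ux setUC.
    exists u; first by rewrite ux !inE !eqxx orbT.
    rewrite ux in puv hw uv *; apply: share puv (on_segC pcx) _ _; first exact: hw.
    by apply: hv; rewrite 1?se // eq_sym.
  have [vc|vc] := eqVneq v c.
    exists v; first by rewrite vc !inE !eqxx orbT.
    rewrite vc in puv hw uv *; apply: share (on_segC puv) pcx _ _.
      by move/on_segC; apply: hw; rewrite eq_sym // eq_sym.
    by apply: hv.
  have [vx|vx] := eqVneq v x.
    exists v; first by rewrite vx !inE !eqxx !orbT.
    rewrite vx in puv hw uv *; apply: share (on_segC puv) (on_segC pcx) _ _.
      by move/on_segC; apply: hw; rewrite eq_sym // eq_sym.
    by apply: hv; rewrite 1?se // eq_sym.
  case: (seg_cross puv pcx) => [[]|].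
  - by move/hw; rewrite ![c == _]eq_sym => /(_ uc vc).
  - by move/hw; rewrite ![x == _]eq_sym => /(_ ux vx).
  - by move/(hv _ _ _ cx uc ux).
  - by move/(hv _ _ _ cx vc vx).
  by rewrite (negPf (hc _ _ cx)).
have C : forall a b : V, [set a; b] = [set b; a] by move=> a b; rewrite setUC.
move=> a b c x p /orP[/orP[ab|/eqP[-> ->]]|/eqP[-> ->]]
  /orP[/orP[cx|/eqP[-> ->]]|/eqP[-> ->]] ne pab pcx.
- exact: hm pcx.
- rewrite eq_sym in ne; have [y Y pE] := main _ _ _ ab ne pcx pab.
  by exists y; rewrite 1?andbC.
- rewrite eq_sym C in ne; have [y Y pE] := main _ _ _ ab ne (on_segC pcx) pab.
  by exists y; rewrite 1?andbC // [[set v; u]]C.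
- exact: main.
- by rewrite eqxx in ne.
- by rewrite C eqxx in ne.
- by rewrite C in ne *; apply: main (on_segC pab) pcx.
- by rewrite C eqxx in ne.
by rewrite eqxx in ne.
Qed.

Lemma add_edge_sym e u v : symmetric e -> symmetric (add_edge e u v).
Proof.
move=> se a b; rewrite /add_edge se -!orbA; congr orb.
by rewrite orbC !xpair_eqE [(b == v) && _]andbC [(b == u) && _]andbC.
Qed.

Lemma add_edge_irr e u v : u != v -> irreflexive e -> irreflexive (add_edge e u v).
Proof.
move=> uv ie a; rewrite /add_edge ie /= !xpair_eqE.
by apply/negbTE; rewrite negb_or; apply/andP; split; apply/negP => /andP[/eqP-> /eqP vu];
  rewrite vu eqxx in uv.
Qed.

(** Edges are added as long as some pair is unobstructed; each addition lowers the number of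
    non-adjacent pairs. All later facts about faces are drawn from this geometric maximality. *)
Lemma maximal_plane e : symmetric e -> irreflexive e -> plane_drawing e d ->
  exists e', [/\ symmetric e', irreflexive e', subrel e e', plane_drawing e' d &
    forall u v, u != v -> ~~ e' u v ->
      (exists w, [/\ w != u, w != v & on_seg (d u) (d v) (d w)]) \/
      (exists a b, e' a b && pcross (d u) (d v) (d a) (d b))].
Proof.
have [n] := ubnP #|[pred z : V * V | ~~ e z.1 z.2]|.
elim: n e => // n IH e hn se ie pd.
have [ok|] := classic (forall u v, u != v -> ~~ e u v ->
      (exists w, [/\ w != u, w != v & on_seg (d u) (d v) (d w)]) \/
      (exists a b, e a b && pcross (d u) (d v) (d a) (d b))).
  by exists e; split.
move=> /not_all_ex_not[u /not_all_ex_not[v nok]].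
have [uv nok1] := imply_to_and _ _ nok; have [nuv nok2] := imply_to_and _ _ nok1.
have [h1 h2] := not_or_and _ _ nok2.
have [] := IH (add_edge e u v).
- rewrite -ltnS; apply: leq_trans hn; rewrite ltnS.
  apply: proper_card; apply/properP; split.
    by apply/subsetP => z; rewrite !inE; apply: contra => ez; rewrite /add_edge ez.
  by exists (u, v); rewrite !inE //= /add_edge eqxx orbT.
- exact: add_edge_sym.
- exact: add_edge_irr.
- apply: plane_add_edge => //.
    by move=> w wu wv uvw; apply: h1; exists w.
  by move=> a b ab; apply/negP => ?; apply: h2; exists a, b; rewrite ab.
move=> e' [? ? sub ? ?]; exists e'; split=> // a b ab.
by apply: sub; rewrite /add_edge ab.
Qed.

End PlaneDrawing.

(** * Faces of a triangulation *)

(** A triangulation is encoded as a maximal plane drawing inside a triangle: by [tri_max] every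
    missing edge is blocked by a vertex or by a crossing edge. That the faces are triangles is a
    consequence. *)
Record triang (R : realType) (V : finType) (d : V -> point R) (adj : rel V)
    (o1 o2 o3 : V) : Prop := Triang {
  tri_sym : symmetric adj;
  tri_irr : irreflexive adj;
  tri_pd : plane_drawing adj d;
  tri_max : forall u v, u != v -> ~~ adj u v ->
    (exists w, [/\ w != u, w != v & on_seg (d u) (d v) (d w)]) \/
    (exists a b, adj a b && pcross (d u) (d v) (d a) (d b));
  tri_o12 : adj o1 o2; tri_o23 : adj o2 o3; tri_o31 : adj o3 o1;
  tri_pos : 0 < cr (d o1) (d o2) (d o3);
  tri_in : forall v, v != o1 -> v != o2 -> v != o3 ->
    [/\ 0 < cr (d o1) (d o2) (d v), 0 < cr (d o2) (d o3) (d v) &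
        0 < cr (d o3) (d o1) (d v)] }.

(* Discards the context first: only the facts moved into the goal are used. *)
Ltac flra := clear; lra.

Lemma strictly_between (R : realType) (V : finType) (d : V -> point R) u v w :
  injective d -> w != u -> w != v -> on_seg (d u) (d v) (d w) ->
  exists t, 0 < t < 1 /\ d w = lerp t (d u) (d v).
Proof.
move=> dinj wu wv /on_segP[t [t01 wE]]; exists t; split=> //.
have t0 : t != 0.
  by apply: contraNneq wu => t0; apply/eqP/dinj; rewrite wE t0; apply: point_eq => /=; ring.
have t1 : t != 1.
  by apply: contraNneq wv => t1; apply/eqP/dinj; rewrite wE t1; apply: point_eq => /=; ring.
by rewrite lt_def t0 lt_def eq_sym t1.
Qed.

(* Among the vertices of the open half-plane take the one, z0, nearest to the
   boundary line; if v z0 is blocked, follow the first blocking edge from its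
   crossing point r to an endpoint a in the half-plane, and turn the ray v r
   towards a until it meets a vertex. *)
Lemma visible_neighbour (R : realType) (V : finType) (d : V -> point R)
    (adj : rel V) (o1 o2 o3 v : V) (al be : R) : triang d adj o1 o2 o3 ->
  let phi (p : point R) := al * (p.1 - (d v).1) + be * (p.2 - (d v).2) in
  (exists z, 0 < phi (d z)) -> exists a, adj v a /\ 0 < phi (d a).
Proof.
move=> [sadj iadj pd max _ _ _ _ _] phi [z1 z1p].
have dinj : injective d by case: pd.
have [//|no] := classic (exists a, adj v a /\ 0 < phi (d a)); exfalso.
have phil t p q : phi (lerp t p q) = (1 - t) * phi p + t * phi q.
  by rewrite /phi /lerp /=; ring.
have phiv : phi (d v) = 0 by rewrite /phi !subrr; ring.
case: (@Order.TotalTheory.arg_minP _ _ _ z1 (fun z => 0 < phi (d z)) (fun z => phi (d z)) z1p).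
move=> z0 z0p z0min.
have vz0 : v != z0 by apply: contraTneq z0p => <-; rewrite phiv ltxx.
have nobetween w : w != v -> (exists k, 0 <= k < 1 /\ d w = lerp k (d v) (d z0)) -> False.
  move=> wv [k [k01 wE]].
  have k0 : k != 0.
    by apply: contraNneq wv => t0; apply/eqP/dinj; rewrite wE t0; apply: point_eq => /=; ring.
  have kp : 0 < k by rewrite lt_def k0; lra.
  have e1 : phi (d w) = k * phi (d z0) by rewrite wE phil phiv; ring.
  have := z0min w; rewrite e1 => /(_ (mulr_gt0 kp z0p)).
  by rewrite leNgt gtr_pMl // (_ : k < 1) //; lra.
have nadj : ~~ adj v z0 by apply/negP => h; apply: no; exists z0.
have crossings : exists a b, adj a b && pcross (d v) (d z0) (d a) (d b).
  case: (max _ _ vz0 nadj) => // [[w [wv wz wS]]].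
  have [t [t01 wE]] := strictly_between dinj wv wz wS.
  by case: (nobetween w wv); exists t; split=> //; lra.
pose par (ab : V * V) := cr (d ab.1) (d ab.2) (d v) / (cr (d ab.1) (d ab.2) (d v) - cr (d ab.1) (d ab.2) (d z0)).
pose crs := [pred ab : V * V | adj ab.1 ab.2 && pcross (d v) (d z0) (d ab.1) (d ab.2)].
have parP a b k : pcross (d v) (d z0) (d a) (d b) ->
    cr (d a) (d b) (lerp k (d v) (d z0)) = 0 -> par (a, b) = k.
  move=> /andP[_ /= h]; rewrite cr_lerp /par /= => E.
  have n : cr (d a) (d b) (d v) - cr (d a) (d b) (d z0) != 0.
    by apply: contraTneq h => h; rewrite (_ : cr (d a) (d b) (d v) = cr (d a) (d b) (d z0)) 1?ltNge ?sqr_ge0 //; lra.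
  by apply: (mulIf n); rewrite divfK //; lra.
have [a0 [b0 ab0]] := crossings.
case: (@Order.TotalTheory.arg_minP _ _ _ (a0, b0) crs par ab0) => [[a' e'] /= /andP[ae' cr'] parmin].
have [k [s [k01 s01 rE]]] := pcross_meet cr'.
have ks : par (a', e') = k.
  by apply: (parP _ _ _ cr'); rewrite rE cr_lerp cr_aba cr_abb; ring.
have phir : 0 < phi (lerp k (d v) (d z0)).
  by rewrite phil phiv mulr0 add0r mulr_gt0 //; lra.
have [a [e [ka [ae pa ka01 rE' crae]]]] : exists a e ka, [/\ adj a e, 0 < phi (d a), 0 < ka < 1,
    lerp k (d v) (d z0) = lerp ka (d a) (d e) & pcross (d v) (d z0) (d a) (d e)].
  have [pa|pa] := ltP 0 (phi (d a')); first by exists a', e', s; split.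
  have [pe|pe] := ltP 0 (phi (d e')).
    exists e', a', (1 - s); split; rewrite 1?sadj //; first lra.
      by rewrite rE; apply: point_eq => /=; ring.
    case/andP: cr' => h1 h2; apply/andP; split; first by rewrite mulrC.
    by rewrite !(cr_swap12 (d a')) mulrNN.
  exfalso; move: phir; rewrite rE phil.
  have : 0 <= (1 - s) * (- phi (d a')) by apply: mulr_ge0; lra.
  have : 0 <= s * (- phi (d e')) by apply: mulr_ge0; lra.
  lra.
set r := lerp k (d v) (d z0) in phir rE'.
have kp : 0 < k by move: k01; flra.
have [k0 kn] : 0 < k /\ k != 0 by rewrite gt_eqF.
(* [D] is the determinant of the frame with origin [v] and axis vectors to [r] and to [a]; [B] and
   [A] are the two coordinates in this frame. *)
pose D := cr (d v) r (d a).
have DE : D = k * cr (d v) (d z0) (d a) by rewrite /D /r /cr /lerp /=; ring.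
have Dn : D != 0.
  rewrite DE mulf_neq0 //; case/andP: crae => h _.
  by apply: contraTneq h => ->; rewrite mul0r ltxx.
have [A AD] : exists A, forall p, A p * D = cr (d v) r p.
  by exists (fun p => cr (d v) r p / D) => p; rewrite divfK.
have [B BD] : exists B, forall p, B p * D = cr (d v) p (d a).
  by exists (fun p => cr (d v) p (d a) / D) => p; rewrite divfK.
have Al t p q : A (lerp t p q) = (1 - t) * A p + t * A q.
  apply: (mulIf Dn); transitivity ((1 - t) * (A p * D) + t * (A q * D)); last by ring.
  by rewrite !AD cr_lerp.
have Bl t p q : B (lerp t p q) = (1 - t) * B p + t * B q.
  apply: (mulIf Dn); transitivity ((1 - t) * (B p * D) + t * (B q * D)); last by ring.
  by rewrite !BD !(cr_swap (d v) (d a)) cr_lerp; ring.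
have pE1 p : p.1 = (d v).1 + B p * (r.1 - (d v).1) + A p * ((d a).1 - (d v).1).
  apply: (mulIf Dn); transitivity ((d v).1 * D + B p * D * (r.1 - (d v).1) + A p * D * ((d a).1 - (d v).1)).
    by rewrite AD BD /D /cr; ring.
  by ring.
have pE2 p : p.2 = (d v).2 + B p * (r.2 - (d v).2) + A p * ((d a).2 - (d v).2).
  apply: (mulIf Dn); transitivity ((d v).2 * D + B p * D * (r.2 - (d v).2) + A p * D * ((d a).2 - (d v).2)).
    by rewrite AD BD /D /cr; ring.
  by ring.
have phiE p : phi p = B p * phi r + A p * phi (d a).
  by rewrite /phi {1}pE1 {1}pE2; ring.
have [Av Bv] : A (d v) = 0 /\ B (d v) = 0.
  by split; apply: (mulIf Dn); rewrite ?AD ?BD ?cr_aba ?cr_aab mul0r.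
have [Ar Br] : A r = 0 /\ B r = 1.
  by split; apply: (mulIf Dn); rewrite ?AD ?BD ?cr_abb ?mul0r ?mul1r.
have [Aa Ba] : A (d a) = 1 /\ B (d a) = 0.
  by split; apply: (mulIf Dn); rewrite ?AD ?BD ?cr_abb ?mul0r ?mul1r.
have rv : r = lerp 1 (d v) r by apply: point_eq => /=; ring.
have Az : A (d z0) = 0.
  by move: Ar; rewrite /r Al Av mulr0 add0r => /eqP; rewrite mulf_eq0 (negPf kn) => /eqP.
have Bz : k * B (d z0) = 1 by move: Br; rewrite /r Bl Bv; flra.
have Ae : A (d e) < 0.
  have : (1 - ka) * 1 + ka * A (d e) = 0 by rewrite -[RHS]Ar rE' Al Aa.
  move: ka01; clear; nra.
have Se : A (d e) + B (d e) = 1.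
  have h1 : (1 - ka) * 1 + ka * A (d e) = 0 by rewrite -[RHS]Ar rE' Al Aa.
  have h2 : (1 - ka) * 0 + ka * B (d e) = 1 by rewrite -[RHS]Br rE' Bl Ba.
  have kan : ka != 0 by rewrite gt_eqF //; move: ka01; flra.
  by apply: (mulfI kan); move: h1 h2; flra.
(* [K] consists of the vertices other than [v] in the closed triangle [v r a]. Maximising [rho]
   picks the direction nearest to [v r], and minimising [A] the nearest vertex in that direction. *)
pose K := [pred w | [&& w != v, 0 <= A (d w), 0 <= B (d w) & A (d w) + B (d w) <= 1]].
have KA w : K w -> 0 < A (d w).
  case/and4P=> wv A0 B0 S1; rewrite lt_def A0 andbT; apply/eqP => Aw0.
  apply: (nobetween _ wv); exists (B (d w) * k); split.
    have Bw : B (d w) <= 1 by move: S1 A0; flra.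
    have := mulr_ge0 B0 (ltW kp); have : B (d w) * k <= 1 * k by rewrite ler_pM2r.
    by move: k01; flra.
  by apply: point_eq; rewrite /= [LHS](pE1, pE2) Aw0 /r /lerp /=; ring.
have Ka : K a.
  rewrite /K /= Aa Ba addr0 ler01 !lexx !andbT.
  by apply: contraTneq pa => ->; rewrite phiv ltxx.
pose rho w := B (d w) / A (d w).
have rhoP w : K w -> B (d w) = rho w * A (d w).
  by move=> /KA h; rewrite divfK // gt_eqF.
case: (@Order.TotalTheory.arg_maxP _ _ _ a K rho Ka) => w1 Kw1 w1max.
pose K' := [pred w | K w && (rho w1 <= rho w)].
have K'1 : K' w1 by apply/andP; split; [exact: Kw1 | exact: lexx].
case: (@Order.TotalTheory.arg_minP _ _ _ w1 K' (fun w => A (d w)) K'1) => w /andP[Kw rhow] wmin.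
have {}w1max y : K y -> rho y <= rho w by move=> Ky; apply: le_trans rhow; apply: w1max.
have {}wmin y : K y -> rho w <= rho y -> A (d w) <= A (d y).
  by move=> Ky hy; apply: wmin; apply/andP; split; [exact: Ky | exact: le_trans rhow hy].
have Aw := KA _ Kw; have /and4P[wv _ Bw Sw] := Kw.
have vw : v != w by rewrite eq_sym.
have nvw : ~~ adj v w.
  apply/negP => h; apply: no; exists w; split=> //; rewrite phiE.
  by apply: ltr_wpDl; [apply: mulr_ge0 => //; apply: ltW | apply: mulr_gt0].
case: (max _ _ vw nvw) => [[y [yv yw yS]]|].
  have [t [t01 yE]] := strictly_between dinj yv yw yS.
  have Ay : A (d y) = t * A (d w) by rewrite yE Al Av; ring.
  have By : B (d y) = t * B (d w) by rewrite yE Bl Bv; ring.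
  have [t0 t1] : 0 <= t /\ t < 1 by move: t01; flra.
  have tA : t * A (d w) < A (d w) by rewrite gtr_pMl.
  have A0 := ltW Aw.
  have Ky : K y.
    apply/and4P; split=> //; rewrite ?Ay ?By ?mulr_ge0 //.
    rewrite (_ : _ + _ = t * (A (d w) + B (d w))); last by ring.
    by apply: le_trans Sw; rewrite ler_piMl ?addr_ge0 // ltW.
  have tn : t != 0 by rewrite gt_eqF //; move: t01; flra.
  have hr : rho w <= rho y by rewrite /rho Ay By invfM [leRHS]mulrACA divff // mul1r.
  by have := wmin _ Ky hr; rewrite Ay leNgt tA.
(* The side of the line [v w], negative towards [r]. *)
pose sg p := A p * B (d w) - B p * A (d w).
have sgl t p q : sg (lerp t p q) = (1 - t) * sg p + t * sg q.
  by rewrite /sg Al Bl; ring.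
have sgE p : cr (d v) (d w) p = D * sg p.
  by rewrite /cr [(d w).1]pE1 [(d w).2]pE2 [p.1]pE1 [p.2]pE2 /sg /D /cr; ring.
(* The edge [c x] blocks [v w], with [c] on the side of [r]. Followed from the crossing point
   towards [c], it either ends in the triangle, where [c] beats [w] in [rho], or leaves through
   [r a] and meets the edge [a e] ([C2]), or leaves through [v r] and blocks [v z0] before the first
   blocking edge ([C1]). *)
suff main : forall c x t s, adj c x -> sg (d c) < 0 -> 0 < sg (d x) -> 0 < t < 1 -> 0 < s < 1 ->
    lerp t (d v) (d w) = lerp s (d c) (d x) -> False.
  move=> [c [x /andP[cx hc]]]; have [t [s' [t01 s'01 qE]]] := pcross_meet hc.
  have : sg (d c) * sg (d x) < 0.
    have D2 : 0 < D * D by rewrite -expr2 exprn_even_gt0.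
    by case/andP: hc; rewrite !sgE mulrACA (pmulr_rlt0 _ D2).
  have [c0|c0] := ltP (sg (d c)) 0 => h.
    by apply: (main c x t s') => //; rewrite -(nmulr_rlt0 _ c0).
  have c1 : 0 < sg (d c).
    by rewrite lt_def c0 andbT; apply: contraTneq h => ->; rewrite mul0r ltxx.
  apply: (main x c t (1 - s')) => //; rewrite 1?sadj //.
  - by rewrite -(pmulr_rlt0 _ c1).
  - by move: s'01; flra.
  by rewrite qE; apply: point_eq => /=; ring.
move=> c x t s' cx c0 x0 t01 s'01 qE {crossings a0 b0 ab0}.
have cv : c != v by apply: contraTneq c0 => ->; rewrite /sg Av Bv !mul0r subrr ltxx.
have xv : x != v by apply: contraTneq x0 => ->; rewrite /sg Av Bv !mul0r subrr ltxx.
have szle y : y = z0 -> sg (d y) <= 0.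
  move=> ->; rewrite /sg Az mul0r sub0r oppr_le0 mulr_ge0 ?(ltW Aw) //.
  by rewrite -(@pmulr_rge0 _ k) // Bz ler01.
have xz : x != z0 by apply: contraTneq x0 => /szle; rewrite leNgt.
have Aq : (1 - s') * A (d c) + s' * A (d x) = t * A (d w) by rewrite -Al -qE Al Av; ring.
have Bq : (1 - s') * B (d c) + s' * B (d x) = t * B (d w) by rewrite -Bl -qE Bl Bv; ring.
have tA : 0 < t * A (d w) by rewrite mulr_gt0 //; move: t01; flra.
have tS : t * (A (d w) + B (d w)) < 1.
  have : t * (A (d w) + B (d w)) <= t * 1 by rewrite ler_wpM2l //; move: t01; flra.
  by move: t01; flra.
have sgm s2 : 0 <= s2 < s' -> sg (lerp s2 (d c) (d x)) < 0.
  have : (1 - s') * sg (d c) + s' * sg (d x) = 0.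
    by rewrite -sgl -qE sgl {2}/sg /sg Av Bv; ring.
  rewrite sgl => h h2.
  have : (s' - s2) * (sg (d c) - sg (d x)) < 0.
    by rewrite pmulr_rlt0; [move: c0 x0|move: h2]; flra.
  by move: h; flra.
have C2 s2 : 0 <= s2 < s' -> 0 <= A (lerp s2 (d c) (d x)) ->
    A (lerp s2 (d c) (d x)) + B (lerp s2 (d c) (d x)) = 1 -> False.
  move=> s2s; have := sgm _ s2s.
  have mcx : on_seg (d c) (d x) (lerp s2 (d c) (d x)) by apply: on_seg_lerp; move: s2s s'01; flra.
  set m := lerp s2 _ _ in mcx *; move=> sgm0 Am Sm.
  have Am1 : A m <= 1.
    rewrite leNgt; apply/negP => A1; move: sgm0; rewrite /sg.
    have := mulr_ge0 Am Bw.
    have : 0 < (- B m) * A (d w) by rewrite mulr_gt0 //; move: Sm A1; flra.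
    flra.
  have mra : on_seg (d a) (d e) m.
    apply/on_segP; exists (ka * (1 - A m)); split.
      have : 0 <= ka * (1 - A m) by rewrite mulr_ge0 //; [move: ka01|move: Am1]; flra.
      have : ka * (1 - A m) <= 1 * (1 - A m) by rewrite ler_wpM2r //; [move: Am1|move: ka01]; flra.
      by move: Am; flra.
    have r1 : r.1 = (1 - ka) * (d a).1 + ka * (d e).1 by rewrite rE'.
    have r2 : r.2 = (1 - ka) * (d a).2 + ka * (d e).2 by rewrite rE'.
    have BE : B m = 1 - A m by move: Sm; flra.
    by apply: point_eq; [rewrite [m.1]pE1 | rewrite [m.2]pE2]; rewrite BE ?r1 ?r2 /lerp /=; ring.
  have [E|[y [ya yc mE]]] := pd_meet pd ae cx mra mcx.
    have S1 y : y \in [set a; e] -> A (d y) + B (d y) = 1.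
      by rewrite !inE => /orP[]/eqP-> //; rewrite Aa Ba addr0.
    have Sc : A (d c) + B (d c) = 1 by apply: S1; rewrite E !inE eqxx.
    have Sx : A (d x) + B (d x) = 1 by apply: S1; rewrite E !inE eqxx orbT.
    have : t * (A (d w) + B (d w)) = (1 - s') * (A (d c) + B (d c)) + s' * (A (d x) + B (d x)).
      by move: Aq Bq; flra.
    by rewrite Sc Sx; move: tS; flra.
  case: yc => yc; last by move: sgm0 x0; rewrite mE yc; flra.
  case: ya => ya; last by move: Am Ae; rewrite mE ya; flra.
  by move: sgm0 Bw; rewrite mE ya /sg Aa Ba; flra.
have C1 s2 : 0 <= s2 < s' -> A (lerp s2 (d c) (d x)) = 0 ->
    A (lerp s2 (d c) (d x)) + B (lerp s2 (d c) (d x)) <= 1 -> False.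
  move=> s2s; have := sgm _ s2s; have := @C2 _ s2s.
  have mcx : on_seg (d c) (d x) (lerp s2 (d c) (d x)) by apply: on_seg_lerp; move: s2s s'01; flra.
  set m := lerp s2 _ _ in mcx *; move=> C2m sgm0 Am0 Sm.
  have Bm : 0 < B m.
    by move: sgm0; rewrite /sg Am0 mul0r sub0r oppr_lt0 pmulr_lgt0.
  have [B1|B1] := eqVneq (B m) 1; first by apply: C2m; rewrite ?Am0 ?B1 ?add0r.
  have {}B1 : B m < 1 by rewrite lt_def eq_sym B1; move: Sm; rewrite Am0; flra.
  have mE : m = lerp (B m * k) (d v) (d z0).
    by apply: point_eq; [rewrite [m.1]pE1 | rewrite [m.2]pE2]; rewrite Am0 /r /lerp /=; ring.
  have Bk : 0 < B m * k < k by rewrite mulr_gt0 //= gtr_pMl.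
  have mvz : on_seg (d v) (d z0) m by rewrite mE; apply: on_seg_lerp; move: Bk k01; flra.
  have cz : c = z0 -> False.
    move=> cE; move: Am0; rewrite /m Al cE Az mulr0 add0r => /eqP.
    move: Aq; rewrite cE Az mulr0 add0r => Ax; rewrite mulf_eq0 => /orP[/eqP s20|/eqP Ax0].
      have mE2 : m = d c by rewrite /m s20; apply: point_eq => /=; ring.
      have : k * B (d z0) < 1 by rewrite -cE -mE2; move: Bk k01; flra.
      by rewrite Bz ltxx.
    by move: tA; rewrite -Ax Ax0 mulr0 ltxx.
  have [_ [hv _]] := pd.
  case: (seg_cross mvz mcx) => [[h|h|h|h]|h].
  - have [/cz//|cz0] := eqVneq c z0.
    have [t' [t'01 cE]] := strictly_between dinj cv cz0 h.
    by apply: (nobetween _ cv); exists t'; split=> //; move: t'01; flra.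
  - have [t' [t'01 xE]] := strictly_between dinj xv xz h.
    by apply: (nobetween _ xv); exists t'; split=> //; move: t'01; flra.
  - by apply: (hv _ _ v cx) h; rewrite eq_sym.
  - have [/cz//|cz0] := eqVneq c z0.
    by apply: (hv _ _ z0 cx) h; rewrite eq_sym.
  have pk : par (c, x) = B m * k.
    by apply: parP => //; rewrite -mE /m cr_lerp cr_aba cr_abb; ring.
  have := parmin (c, x); rewrite /crs /= cx h => /(_ isT).
  by rewrite ks pk; move: Bk; flra.
have zero f (f0 : R) : f < 0 -> 0 < f0 -> exists s2, 0 < s2 < s' /\
    (1 - s2 / s') * f + s2 / s' * f0 = 0.
  move=> fn fp; exists (s' * (- f / (f0 - f))).
  have h : 0 < f0 - f by move: fn fp; flra.
  have hn : f0 - f != 0 by rewrite gt_eqF.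
  have sn : s' != 0 by rewrite gt_eqF //; move: s'01; flra.
  have q01 : 0 < - f / (f0 - f) < 1.
    by rewrite divr_gt0 //= ?ltr_pdivrMr ?mul1r //; move: fn fp; flra.
  split; last by field; rewrite hn sn.
  by rewrite mulr_gt0 ?gtr_pMr //; move: q01 s'01; flra.
have interp (f : point R -> R) s2 : (forall t p q, f (lerp t p q) = (1 - t) * f p + t * f q) ->
    f (lerp s2 (d c) (d x)) = (1 - s2 / s') * f (d c) + s2 / s' * f (lerp t (d v) (d w)).
  move=> fl; rewrite qE !fl; have sn : s' != 0 by rewrite gt_eqF //; move: s'01; flra.
  by field.
have Sl t' p q : A (lerp t' p q) + B (lerp t' p q) = (1 - t') * (A p + B p) + t' * (A q + B q).
  by rewrite Al Bl; ring.
have Aqv : A (lerp t (d v) (d w)) = t * A (d w) by rewrite Al Av; ring.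
have Bqv : B (lerp t (d v) (d w)) = t * B (d w) by rewrite Bl Bv; ring.
have goS s1 : 0 <= s1 < s' -> 0 <= A (lerp s1 (d c) (d x)) ->
    1 < A (lerp s1 (d c) (d x)) + B (lerp s1 (d c) (d x)) -> False.
  move=> h1 hA hS.
  have : exists u, 0 < u < 1 /\ (1 - u) * (1 - (A (lerp s1 (d c) (d x)) + B (lerp s1 (d c) (d x)))) + u * (1 - t * (A (d w) + B (d w))) = 0.
    have [u [u01 uE]] := zero (1 - (A (lerp s1 (d c) (d x)) + B (lerp s1 (d c) (d x)))) (1 - t * (A (d w) + B (d w))) ltac:(move: hS; flra) ltac:(move: tS; flra).
    exists (u / s'); split=> //.
    have sp : 0 < s' by move: s'01; flra.
    by rewrite divr_gt0 ?ltr_pdivrMr ?mul1r //; move: u01; flra.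
  move=> [u [u01 uE]].
  have mE : lerp ((1 - u) * s1 + u * s') (d c) (d x) =
      lerp u (lerp s1 (d c) (d x)) (lerp t (d v) (d w)).
    by rewrite qE; apply: point_eq => /=; ring.
  have hs : 0 <= (1 - u) * s1 + u * s' < s'.
    have : 0 <= (1 - u) * s1 by apply: mulr_ge0; move: u01 h1; flra.
    have : 0 <= u * s' by apply: mulr_ge0; move: u01 s'01; flra.
    have : 0 < (1 - u) * (s' - s1) by apply: mulr_gt0; move: u01 h1; flra.
    flra.
  apply: (C2 _ hs); rewrite mE.
    by rewrite Al Aqv addr_ge0 // mulr_ge0 // ?(ltW tA) //; move: u01; flra.
  by rewrite Sl Aqv Bqv; move: uE; flra.
have c01 : 0 <= (0 : R) < s' by move: s'01; flra.
have c0E : lerp 0 (d c) (d x) = d c by apply: point_eq => /=; ring.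
have [Ac|Ac] := ltP (A (d c)) 0.
  have [s1 [s1s s1E]] := zero _ _ Ac tA.
  have Am1 : A (lerp s1 (d c) (d x)) = 0 by rewrite (interp A) // Aqv.
  have s1' : 0 <= s1 < s' by move: s1s; flra.
  have [S1|S1] := leP (A (lerp s1 (d c) (d x)) + B (lerp s1 (d c) (d x))) 1.
    exact: C1 S1.
  by apply: (goS _ s1') => //; rewrite Am1.
have Bc : 0 <= B (d c).
  rewrite leNgt; apply/negP => h; move: c0; rewrite /sg.
  have := mulr_ge0 Ac Bw.
  have : 0 < - B (d c) * A (d w) by rewrite mulr_gt0 //; move: h; flra.
  flra.
have [Sc|Sc] := leP (A (d c) + B (d c)) 1; last by apply: (goS _ c01); rewrite c0E.
have Kc : K c by rewrite /K /= cv Ac Bc Sc.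
have := w1max _ Kc; rewrite leNgt => /negP; apply.
rewrite /rho ltr_pdivrMr // mulrAC ltr_pdivlMr ?KA //.
by move: c0; rewrite /sg; flra.
Qed.

Section Algebra.
Variable R : realType.
Implicit Types v a b c p q z : point R.

(** The dot product of the vectors from [v]; [cr] is their determinant, and [dt / cr] the cotangent
    of the angle between them. *)
Definition dt v a b : R :=
  (a.1 - v.1) * (b.1 - v.1) + (a.2 - v.2) * (b.2 - v.2).

Lemma dt_gt0 v a : a != v -> 0 < dt v a a.
Proof.
move=> av; rewrite lt_def /dt -!expr2 addr_ge0 ?sqr_ge0 // andbT.
apply: contra av; rewrite paddr_eq0 ?sqr_ge0 // !sqrf_eq0 !subr_eq0.
by case/andP=> /eqP h1 /eqP h2; apply/eqP/point_eq.
Qed.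

Lemma dt_cr v a z c :
  dt v a z * cr v a c - dt v a c * cr v a z = dt v a a * cr v z c.
Proof. by rewrite /dt /cr; ring. Qed.

Lemma dt_cr2 v b c c' : cr v c c' = 0 ->
  dt v c c' * cr v b c = cr v b c' * dt v c c.
Proof.
move=> h; apply/eqP; rewrite -subr_eq0; apply/eqP.
transitivity (- dt v b c * cr v c c'); last by rewrite h mulr0.
by rewrite /dt /cr; ring.
Qed.

(* Grassmann-Pluecker relation for the four directions from v. *)
Lemma cr_plucker v a b c e :
  cr v a e * cr v b c = cr v a b * cr v e c + cr v a c * cr v b e.
Proof. by rewrite /cr; ring. Qed.

Lemma collinear_on_seg v a b : a != v -> cr v a b = 0 -> 0 <= dt v a b ->
  on_seg v a b \/ on_seg v b a.
Proof.
move=> av h0 h1; have N := dt_gt0 av; have Nn := lt0r_neq0 N.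
have [k kE] : exists k, dt v a b = k * dt v a a.
  by exists (dt v a b / dt v a a); rewrite divfK.
have k0 : 0 <= k by rewrite -(pmulr_lge0 _ N) -kE.
have E1 : b.1 - v.1 = k * (a.1 - v.1).
  apply: (mulIf Nn); transitivity (dt v a b * (a.1 - v.1) - cr v a b * (a.2 - v.2)).
    by rewrite /dt /cr; ring.
  by rewrite h0 kE; ring.
have E2 : b.2 - v.2 = k * (a.2 - v.2).
  apply: (mulIf Nn); transitivity (dt v a b * (a.2 - v.2) + cr v a b * (a.1 - v.1)).
    by rewrite /dt /cr; ring.
  by rewrite h0 kE; ring.
have [k1|k1] := leP k 1.
  left; apply/on_segP; exists k; rewrite k0 k1; split=> //.
  by apply: point_eq; rewrite /lerp /=; lra.
have kn : k != 0 by rewrite gt_eqF //; lra.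
right; apply/on_segP; exists k^-1; split; first by rewrite invr_ge0 k0 invf_le1 ?ltW //; lra.
have F1 : a.1 - v.1 = k^-1 * (b.1 - v.1) by rewrite E1 mulKf.
have F2 : a.2 - v.2 = k^-1 * (b.2 - v.2) by rewrite E2 mulKf.
by apply: point_eq; rewrite /lerp /=; lra.
Qed.

Lemma parallel2 a b p q : a != b -> cr a b p = 0 -> cr a b q = 0 -> cr a p q = 0.
Proof.
move=> ab hp hq; have N : dt a b b != 0 by rewrite lt0r_neq0 ?dt_gt0 // eq_sym.
apply: (mulfI N); rewrite mulr0.
by rewrite -dt_cr hp hq; ring.
Qed.

Lemma zero_between (f g : R) : f < 0 -> 0 <= g -> exists k, 0 <= k < 1 /\ (1 - k) * g + k * f = 0.
Proof.
move=> f0 g0; have h : 0 < g - f by lra.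
exists (g / (g - f)); split; last by field; rewrite gt_eqF.
by rewrite divr_ge0 ?(ltW h) //= ltr_pdivrMr //; lra.
Qed.

End Algebra.

Section Triangulation.
Variables (R : realType) (V : finType) (d : V -> point R) (adj : rel V).
Variables (o1 o2 o3 : V).
Hypothesis T : triang d adj o1 o2 o3.
Notation X a b c := (cr (d a) (d b) (d c)).
Implicit Types a b c v w z : V.

Lemma tri_inj : injective d. Proof. by case: (tri_pd T). Qed.

Lemma tri_vert u v w : adj u v -> w != u -> w != v -> ~ on_seg (d u) (d v) (d w).
Proof. by case: (tri_pd T) => _ [h _]; apply: h. Qed.

Lemma adj_neq a b : adj a b -> a != b.
Proof. by apply: contraTneq => ->; rewrite (tri_irr T). Qed.

Lemma tri_d_neq a b : a != b -> d a != d b.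
Proof. by apply: contra => /eqP/tri_inj->. Qed.

Lemma adj_same_side v a b : adj v a -> adj v b -> a != b -> X v a b = 0 ->
  dt (d v) (d a) (d b) < 0.
Proof.
move=> va vb ab h; rewrite ltNge; apply/negP => h2.
have av : a != v by rewrite eq_sym adj_neq.
have bv : b != v by rewrite eq_sym adj_neq.
case: (collinear_on_seg (tri_d_neq av) h h2).
  by apply: tri_vert; rewrite // eq_sym.
exact: tri_vert.
Qed.

(** Inner faces are ordered triples in counterclockwise order, so each face occurs as its three
    rotations. *)
Definition face a b c : bool :=
  [&& adj a b, adj b c, adj c a, 0 < X a b c & [forall z, (z \notin [:: a; b; c]) ==>
     ~~ [&& 0 <= X a b z, 0 <= X b c z & 0 <= X c a z]]].

Lemma face_cyc a b c : face a b c = face b c a.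
Proof.
rewrite /face (cr_cyc (d a)); case ab: (adj a b); case bc: (adj b c); case ca: (adj c a) => //=.
congr andb; apply: eq_forallb => z; rewrite !inE.
rewrite orbA orbC [in LHS]orbA orbC orbA.
by case: (0 <= X a b z); case: (0 <= X b c z); case: (0 <= X c a z); case: (z == a); case: (z == b); case: (z == c).
Qed.

Lemma faceP a b c : face a b c ->
  [/\ adj a b, adj b c, adj c a, 0 < X a b c &
    forall z, z != a -> z != b -> z != c ->
      0 <= X a b z -> 0 <= X b c z -> 0 <= X c a z -> False].
Proof.
case/and5P=> ab bc ca p /forallP h; split=> // z za zb zc h1 h2 h3.
by have := h z; rewrite !inE (negPf za) (negPf zb) (negPf zc) h1 h2 h3.
Qed.

(** An edge from [v] into the angle cannot end in the empty triangle, so it would cross [a b]. *)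
Lemma face_wedge v a b z : face v a b -> adj v z -> 0 < X v a z -> 0 < X v z b -> False.
Proof.
move=> /faceP[va ab bv p e] vz h1 h2.
have za : z != a by apply: contraTneq h1 => ->; rewrite cr_abb ltxx.
have zb : z != b by apply: contraTneq h2 => ->; rewrite cr_abb ltxx.
have zv : z != v by rewrite eq_sym adj_neq.
have h3 : 0 < X b v z by rewrite -cr_cyc.
have h4 : X a b z < 0.
  by rewrite ltNge; apply/negP => h4; apply: (e z) => //; apply: ltW.
have /negP[] := pd_not_pcross (tri_pd T) vz ab.
apply/andP; split; last by rewrite (cr_cyc (d v)) pmulr_rlt0.
by rewrite nmulr_rlt0 // cr_swap oppr_lt0.
Qed.

(* A vertex p beyond the sides v b, v c (but on the v-side of b c) cannot be
   joined to a point m of the triangle by part of an edge. *)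
Lemma stab v b c p q (s : R) : adj v b -> adj v c -> 0 < X v b c -> adj p q ->
  0 <= s <= 1 -> p != v -> p != b -> p != c -> q != v ->
  let m := lerp s (d p) (d q) in
  0 <= cr (d v) (d b) m -> 0 <= cr (d c) (d v) m -> 0 <= cr (d b) (d c) m ->
  0 < X b c p -> 0 < cr (d b) (d c) m \/ 0 < cr (d v) (d b) m /\ 0 < cr (d c) (d v) m ->
  X v b p < 0 \/ X c v p < 0 -> False.
Proof.
move=> vb vc D pq s01 pv pb pc qv m m1 m2 m3 bcp mpos out.
have onpq k : 0 <= k <= 1 -> on_seg (d p) (d q) (lerp k m (d p)).
  move=> k01; have -> : lerp k m (d p) = lerp (s * (1 - k)) (d p) (d q).
    by apply: point_eq; rewrite /m /lerp /=; ring.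
  apply: on_seg_lerp.
  have : 0 <= s * (1 - k) by apply: mulr_ge0; lra.
  have : s * (1 - k) <= 1 * (1 - k) by apply: ler_wpM2r; lra.
  lra.
clearbody m.
have bcm k : 0 <= k <= 1 -> 0 <= cr (d b) (d c) (lerp k m (d p)).
  by move=> k01; rewrite cr_lerp addr_ge0 // mulr_ge0 ?(ltW bcp) //; lra.
have bcm0 k : 0 <= k <= 1 -> cr (d b) (d c) (lerp k m (d p)) = 0 -> k = 0 /\ cr (d b) (d c) m = 0.
  move=> k01; rewrite cr_lerp => E.
  have h1 : 0 <= (1 - k) * cr (d b) (d c) m by apply: mulr_ge0; lra.
  have h2 : 0 <= k * X b c p by apply: mulr_ge0; lra.
  have /eqP : k * X b c p = 0 by lra.
  rewrite mulf_eq0 (gt_eqF bcp) orbF => /eqP k0; split=> //.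
  by move: E; rewrite k0; lra.
have term u k : 0 <= k <= 1 -> u = b \/ u = c -> on_seg (d v) (d u) (lerp k m (d p)) ->
    (k = 0 -> cr (d b) (d c) m = 0 -> False) -> False.
  move=> k01 ubc h hk.
  have vu : adj v u by case: ubc => ->.
  have notu : d u = lerp k m (d p) -> False.
    move=> E; have [] := bcm0 k k01; last by apply: hk.
    by rewrite -E; case: ubc => ->; rewrite ?cr_aba ?cr_abb.
  have [E|[y [yvu ypq yE]]] := pd_meet (tri_pd T) vu pq h (onpq _ k01).
    have : p \in [set v; u] by rewrite E !inE eqxx.
    by rewrite !inE (negPf pv) /=; case: ubc => ->; rewrite ?(negPf pb) ?(negPf pc).
  case: yvu => yE'; last by apply: notu; rewrite -yE'.
  by case: ypq => E; [rewrite -E yE' eqxx in pv | rewrite -E yE' eqxx in qv].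
have T1 k : 0 <= k <= 1 -> cr (d v) (d b) (lerp k m (d p)) = 0 ->
    0 <= cr (d c) (d v) (lerp k m (d p)) -> False.
  move=> k01 h1 h2; apply: (term b k k01); [by left| |].
    by apply: (bary_edge D) => //; apply: bcm.
  move=> k0 m0; case: mpos => [|[h _]]; first by rewrite m0 ltxx.
  by move: h1; rewrite k0 cr_lerp; lra.
have T2 k : 0 <= k <= 1 -> cr (d c) (d v) (lerp k m (d p)) = 0 ->
    0 <= cr (d v) (d b) (lerp k m (d p)) -> False.
  move=> k01 h1 h2; apply: (term c k k01); [by right| |].
    apply: on_segC; apply: (bary_edge (c := d b)) => //; last exact: bcm.
    by rewrite -cr_cyc.
  move=> k0 m0; case: mpos => [|[_ h]]; first by rewrite m0 ltxx.
  by move: h1; rewrite k0 cr_lerp; lra.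
have goT2 : X c v p < 0 -> (forall k, 0 <= k <= 1 -> cr (d c) (d v) (lerp k m (d p)) = 0 ->
    0 <= cr (d v) (d b) (lerp k m (d p))) -> False.
  move=> h1 h2; have [k [k01 kE]] := zero_between h1 m2.
  have k01' : 0 <= k <= 1 by lra.
  by apply: (T2 k) => //; [|apply: h2 => //]; rewrite cr_lerp.
have [h|h] := ltP (X v b p) 0; last first.
  case: out => h2; first lra.
  by apply: goT2 => // k k01 _; rewrite cr_lerp addr_ge0 // mulr_ge0 //; lra.
have [k [k01 kE]] := zero_between h m1.
have k01' : 0 <= k <= 1 by lra.
have [hc|hc] := leP 0 (cr (d c) (d v) (lerp k m (d p))).
  by apply: (T1 k) => //; rewrite cr_lerp.
have hcp : X c v p < 0.
  rewrite ltNge; apply/negP => h2; move: hc; rewrite ltNge => /negP; apply.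
  by rewrite cr_lerp addr_ge0 // mulr_ge0 //; lra.
apply: goT2 => // j j01 jE; rewrite cr_lerp.
have jk : j <= k.
  rewrite leNgt; apply/negP => kj; move: hc jE; rewrite !cr_lerp => hc jE.
  have : 0 <= (j - k) * (cr (d c) (d v) m - X c v p) by apply: mulr_ge0; lra.
  lra.
have : 0 <= (k - j) * (cr (d v) (d b) m - X v b p) by apply: mulr_ge0; lra.
lra.
Qed.

Lemma corner_eq v b c w : 0 < X v b c -> 0 <= X v b w -> 0 <= X c v w ->
  X v b c <= X b c w -> w = v.
Proof.
move=> D h1 h2 h3; have S := cr_sum (d v) (d b) (d c) (d w).
have e1 : X v b w = 0 by lra.
have e2 : X c v w = 0 by lra.
have e3 : X b c w = X v b c by lra.
have Dn : X v b c != 0 by rewrite gt_eqF.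
apply: tri_inj; apply: point_eq; apply: (mulfI Dn); rewrite -{2}e3.
  transitivity (X b c w * (d v).1 + X c v w * (d b).1 + X v b w * (d c).1).
    by rewrite /cr; ring.
  by rewrite e1 e2; ring.
transitivity (X b c w * (d v).2 + X c v w * (d b).2 + X v b w * (d c).2).
  by rewrite /cr; ring.
by rewrite e1 e2; ring.
Qed.

(** Only edges at [v] are assumed to be absent from the angle. A vertex of the triangle farthest
    from [b c] is not adjacent to [v]; a vertex blocking that edge would be farther still, and an
    edge blocking it is excluded by [stab]. Once the triangle is known to be empty, [stab] and the
    empty angle show that nothing blocks [b c]. *)
Lemma face_of_wedge v b c : adj v b -> adj v c -> 0 < X v b c ->
  (forall z, adj v z -> 0 < X v b z -> 0 < X v z c -> False) -> face v b c.
Proof.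
move=> vb vc D nowedge.
have bcn : b != c by apply: contraTneq D => ->; rewrite cr_abb ltxx.
pose inT w := [&& w != v, w != b, w != c, 0 <= X v b w, 0 <= X b c w & 0 <= X c v w].
have cvb : 0 < X c v b by rewrite -cr_cyc.
have adjin w : inT w -> ~~ adj v w.
  case/and5P=> wv wb wc h1 /andP[h2 h3]; apply/negP => vw.
  have [e|n] := eqVneq (X v b w) 0.
    by apply: (tri_vert vb wv wb); apply: (bary_edge D).
  have [e|n'] := eqVneq (X c v w) 0.
    by apply: (tri_vert vc wv wc); apply/on_segC/(bary_edge cvb).
  apply: (nowedge w vw); first by rewrite lt_def n.
  by rewrite -[X v w c](cr_cyc (d v)) -cr_cyc lt_def n' .
have empty w : ~~ inT w.
  apply/negP => iw.
  case: (@Order.TotalTheory.arg_maxP _ _ _ w inT (fun z => X b c z) iw).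
  move=> {}w {}iw wmax; have nvw := adjin w iw.
  case/and5P: (iw) => wv wb wc h1 /andP[h2 h3].
  have wlt : X b c w < X v b c.
    by rewrite ltNge; apply: contraNN wv => h; apply/eqP; apply: corner_eq h.
  have bcv : X b c v = X v b c by rewrite cr_cyc.
  have vw : v != w by rewrite eq_sym.
  have ray t : 0 < t < 1 -> [/\ 0 <= cr (d v) (d b) (lerp t (d v) (d w)),
      0 <= cr (d c) (d v) (lerp t (d v) (d w)) & X b c w < cr (d b) (d c) (lerp t (d v) (d w))].
    move=> t01; rewrite !cr_lerp cr_aba cr_abb !mulr0 !add0r bcv.
    split; [apply: mulr_ge0 => //; lra..|].
    have : 0 < (1 - t) * (X v b c - X b c w) by apply: mulr_gt0; lra.
    lra.
  case: (tri_max T vw nvw) => [[y [yv yw /(strictly_between tri_inj yv yw)[t [t01 yE]]]]|].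
    have [r1 r2 r3] := ray t t01; rewrite -yE in r1 r2 r3.
    have iy : inT y.
      apply/and5P; split=> //; last by apply/andP; split=> //; lra.
        by apply: contraTneq r3 => ->; rewrite cr_aba; lra.
      by apply: contraTneq r3 => ->; rewrite cr_abb; lra.
    by have /= := wmax _ iy; lra.
  move=> [p0 [q0 /andP[pq0 cr0]]].
  have [t [s0 [t01 s01 mE]]] := pcross_meet cr0.
  have [r1 r2 r3] := ray t t01.
  have [p [q [s [pq pr s01' mE' [pv qv]]]]] : exists p q s, [/\ adj p q,
      cr (d b) (d c) (lerp t (d v) (d w)) <= X b c p, 0 < s < 1,
      lerp t (d v) (d w) = lerp s (d p) (d q) & p != v /\ q != v].
    have pv : p0 != v by apply: contraTneq cr0 => ->; rewrite /pcross cr_aba mul0r ltxx.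
    have qv : q0 != v by apply: contraTneq cr0 => ->; rewrite /pcross cr_aba mulr0 ltxx.
    have [h|h] := leP (cr (d b) (d c) (lerp t (d v) (d w))) (X b c p0).
      by exists p0, q0, s0.
    exists q0, p0, (1 - s0); split; rewrite 1?(tri_sym T) //; last 2 first.
    - lra.
    - by rewrite mE; apply: point_eq => /=; ring.
    move: h; rewrite mE cr_lerp => h; rewrite leNgt; apply/negP => h'.
    have : 0 < s0 * ((1 - s0) * X b c p0 + s0 * X b c q0 - X b c q0) by apply: mulr_gt0; lra.
    have : 0 < (1 - s0) * ((1 - s0) * X b c p0 + s0 * X b c q0 - X b c p0) by apply: mulr_gt0; lra.
    lra.
  have bcp : X b c w < X b c p by lra.
  have pb : p != b by apply: contraTneq bcp => ->; rewrite cr_aba; lra.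
  have pc : p != c by apply: contraTneq bcp => ->; rewrite cr_abb; lra.
  have s01c : 0 <= s <= 1 by lra.
  apply: (stab vb vc D pq s01c pv pb pc qv); rewrite -?mE' //; try lra.
  have [h|h] := ltP (X v b p) 0; [by left | right].
  rewrite ltNge; apply/negP => h'.
  have ip : inT p by apply/and5P; split=> //; apply/andP; split=> //; lra.
  by have /= := wmax _ ip; lra.
have notin w : w != v -> w != b -> w != c -> 0 <= X v b w -> 0 <= X b c w -> 0 <= X c v w -> False.
  by move=> h1 h2 h3 h4 h5 h6; have /negP := empty w; apply; rewrite /inT h1 h2 h3 h4 h5 h6.
suff bc : adj b c.
  apply/and5P; split=> //; first by rewrite (tri_sym T).
  apply/forallP => z; apply/implyP; rewrite !inE !negb_or => /and3P[zv zb zc].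
  by apply/negP => /and3P[h1 h2 h3]; apply: (notin z).
have bv : b != v by rewrite eq_sym adj_neq.
have cv : c != v by rewrite eq_sym adj_neq.
apply/negPn/negP => nbc.
have side t : 0 < t < 1 -> [/\ 0 < cr (d v) (d b) (lerp t (d b) (d c)),
     cr (d b) (d c) (lerp t (d b) (d c)) = 0 & 0 < cr (d c) (d v) (lerp t (d b) (d c))].
  move=> t01; rewrite !cr_lerp cr_aba !cr_abb cr_aba !mulr0 !add0r addr0.
  by split=> //; apply: mulr_gt0 => //; lra.
case: (tri_max T bcn nbc) => [[y [yb yc /(strictly_between tri_inj yb yc)[t [t01 yE]]]]|].
  have [r1 r2 r3] := side t t01; rewrite -yE in r1 r2 r3.
  apply: (notin y) => //; rewrite ?r2 ?(ltW r1) ?(ltW r3) //.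
  by apply: contraTneq r1 => ->; rewrite cr_aba ltxx.
move=> [p0 [q0 /andP[pq0 cr0]]].
have [t [s0 [t01 s01 mE]]] := pcross_meet cr0.
have [r1 r2 r3] := side t t01.
have [p [q [s [pq pr qr s01' mE']]]] : exists p q s, [/\ adj p q,
      0 < X b c p, X b c q < 0, 0 < s < 1 & lerp t (d b) (d c) = lerp s (d p) (d q)].
  case/andP: cr0 => h _; have [h'|h'] := ltP 0 (X b c p0).
    by exists p0, q0, s0; split; rewrite // -(pmulr_rlt0 _ h').
  have h2 : X b c p0 < 0.
    by rewrite lt_def h' andbT eq_sym; apply: contraTneq h => ->; rewrite mul0r ltxx.
  have h3 : 0 < X b c q0 by rewrite -(nmulr_rlt0 _ h2).
  exists q0, p0, (1 - s0); split; rewrite 1?(tri_sym T) //; first lra.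
  by rewrite mE; apply: point_eq => /=; ring.
have qv : q != v by apply: contraTneq qr => ->; rewrite cr_cyc -leNgt ltW.
have pb : p != b by apply: contraTneq pr => ->; rewrite cr_aba ltxx.
have pc : p != c by apply: contraTneq pr => ->; rewrite cr_abb ltxx.
have s01c : 0 <= s <= 1 by lra.
have [pv|pv] := eqVneq p v.
  rewrite pv in pq mE'; move: r1 r3; rewrite mE' !cr_lerp cr_aba cr_abb !mulr0 !add0r.
  have sp : 0 < s by lra.
  rewrite !(pmulr_rgt0 _ sp) => r1 r3; apply: (nowedge q) => //.
  by rewrite cr_cyc.
apply: (stab vb vc D pq s01c pv pb pc qv); rewrite -?mE' ?r2 ?(ltW r1) ?(ltW r3) //; first by right.
have [h|h] := ltP (X v b p) 0; [by left | right].
by rewrite ltNge; apply/negP => h'; apply: (notin p) => //; apply: ltW.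
Qed.

Lemma face_exists_at v a : adj v a -> (exists z, 0 < X v a z) -> exists c, face v a c.
Proof.
move=> va [z0 z0p].
pose al := - ((d a).2 - (d v).2); pose be := (d a).1 - (d v).1.
have phiE p : al * (p.1 - (d v).1) + be * (p.2 - (d v).2) = cr (d v) (d a) p.
  by rewrite /al /be /cr; ring.
have [c0 [vc0 c0p]] : exists c, adj v c /\ 0 < X v a c.
  have [|c [vc]] := visible_neighbour (v := v) (al := al) (be := be) T.
    by exists z0; rewrite phiE.
  by rewrite phiE; exists c.
have P0 : [pred z | adj v z && (0 < X v a z)] c0 by rewrite /= vc0.
(* The quotient is the cotangent of the angle from [v a], so [c] is the neighbour at the least angle
   counterclockwise from [a]. *)
case: (@Order.TotalTheory.arg_maxP _ _ _ c0 [pred z | adj v z && (0 < X v a z)]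
  (fun z => dt (d v) (d a) (d z) / X v a z) P0) => c /andP[vc cp] cmax.
exists c; apply: face_of_wedge => // z vz zp zc.
have := cmax z; rewrite /= vz zp => /(_ isT); rewrite leNgt => /negP; apply.
rewrite ltr_pdivrMr // mulrAC ltr_pdivlMr // -subr_gt0 dt_cr mulr_gt0 //.
by apply: dt_gt0; apply: tri_d_neq; rewrite eq_sym adj_neq.
Qed.

Lemma same_ray v a b c : adj v a -> adj v b -> X v a b = 0 -> 0 < X v c a -> 0 < X v c b -> a = b.
Proof.
move=> va vb h ca cb; apply/eqP/negPn/negP => ab.
have := adj_same_side va vb ab h; have := dt_cr2 (d c) h.
have N : 0 < dt (d v) (d a) (d a) by apply/dt_gt0/tri_d_neq; rewrite eq_sym adj_neq.
move=> E L; have : dt (d v) (d a) (d b) * X v c a < 0 by rewrite pmulr_llt0.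
by rewrite E ltNge mulr_ge0 // ltW.
Qed.

Lemma face_uniq a b c c' : face a b c -> face a b c' -> c = c'.
Proof.
move=> f f'; have [ab bc ca D _] := faceP f; have [_ bc' ca' D' _] := faceP f'.
have ac : adj a c by rewrite (tri_sym T).
have ac' : adj a c' by rewrite (tri_sym T).
have [h|h|h] := ltgtP (X a c' c) 0.
- by case: (face_wedge f' ac D); rewrite cr_swap oppr_gt0.
- by case: (face_wedge f ac' D').
by symmetry; apply: (same_ray ac' ac h D' D).
Qed.

Lemma tri_rot : triang d adj o2 o3 o1.
Proof.
case: T => h1 h2 h3 h4 h5 h6 h7 h8 h9; split=> //; first by rewrite cr_cyc.
by move=> v v2 v3 v1; have [] := h9 v v1 v2 v3.
Qed.

End Triangulation.

Lemma bary_cr (R : realType) (a b c x y p : point R) :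
  cr b c p * cr x y a + cr c a p * cr x y b + cr a b p * cr x y c =
  cr a b c * cr x y p.
Proof. by rewrite /cr; ring. Qed.

Lemma bary_lin (R : realType) (a b c p q : point R) (al be : R) :
  let f (z : point R) := al * (z.1 - q.1) + be * (z.2 - q.2) in
  cr b c p * f a + cr c a p * f b + cr a b p * f c = cr a b c * f p.
Proof. by rewrite /cr /=; ring. Qed.

Section Triangulation.
Variables (R : realType) (V : finType) (d : V -> point R) (adj : rel V).
Variables (o1 o2 o3 : V).
Hypothesis T : triang d adj o1 o2 o3.
Notation X a b c := (cr (d a) (d b) (d c)).
Implicit Types a b c v w z : V.
Notation face := (face d adj).

Definition outer v := v \in [:: o1; o2; o3].

(** The boundary triangle is listed clockwise, so that the unbounded facet and the inner face beside
    it traverse a boundary edge in opposite directions. *)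
Definition ogon a b c := (a, b, c) \in [:: (o1, o3, o2); (o3, o2, o1); (o2, o1, o3)].

(* Facial triangles of the sphere: the inner ones and the unbounded one. *)
Definition facet a b c := face a b c || ogon a b c.

Lemma outerP v : reflect [\/ v = o1, v = o2 | v = o3] (outer v).
Proof.
by rewrite /outer !inE; apply: (iffP or3P) => -[] /eqP ?; [apply: Or31|apply: Or32|apply: Or33|apply: Or31|apply: Or32|apply: Or33].
Qed.

Lemma ogonP a b c : ogon a b c ->
  [\/ [/\ a = o1, b = o3 & c = o2], [/\ a = o3, b = o2 & c = o1] |
      [/\ a = o2, b = o1 & c = o3]].
Proof.
rewrite /ogon !inE !xpair_eqE => /or3P[] /andP[/andP[/eqP-> /eqP->] /eqP->].
- by apply: Or31.
- by apply: Or32.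
- by apply: Or33.
Qed.

Lemma outer_neq : [/\ o1 != o2, o2 != o3 & o3 != o1].
Proof.
by split; apply/(adj_neq T); [apply: tri_o12 T|apply: tri_o23 T|apply: tri_o31 T].
Qed.

Lemma ogon_pos a b c : ogon a b c -> X a b c < 0.
Proof.
have D := tri_pos T; case/ogonP=> -[-> -> ->].
- by rewrite cr_swap oppr_lt0.
- by rewrite cr_cyc cr_swap oppr_lt0.
- by rewrite -cr_cyc cr_swap oppr_lt0.
Qed.

Lemma ogon_side a b c z : ogon a b c -> X a b z <= 0.
Proof.
move=> og; have [p1|] := boolP (outer z).
  have D := tri_pos T; have := ogon_pos og.
  by case/ogonP: og => -[-> -> ->] N; case/outerP: p1 => ->; rewrite ?cr_aba ?cr_abb // ltW.
rewrite /outer !inE !negb_or => /and3P[z1 z2 z3].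
have [h1 h2 h3] := tri_in T z1 z2 z3.
by case/ogonP: og => -[-> -> _]; rewrite cr_swap12 oppr_le0 ltW.
Qed.

Lemma ogon_cyc a b c : ogon a b c = ogon b c a.
Proof.
by rewrite /ogon !inE !xpair_eqE; case: (a == o1); case: (a == o2); case: (a == o3);
  case: (b == o1); case: (b == o2); case: (b == o3); case: (c == o1); case: (c == o2); case: (c == o3).
Qed.

Lemma facet_cyc a b c : facet a b c = facet b c a.
Proof. by rewrite /facet (face_cyc _ _ a) ogon_cyc. Qed.

Lemma facet_adj a b c : facet a b c -> adj a b.
Proof.
case/orP=> [/faceP[]//|/ogonP[][-> -> _]]; rewrite (tri_sym T).
- exact: tri_o31 T.
- exact: tri_o23 T.
- exact: tri_o12 T.
Qed.

Lemma facet_uniq a b c c' : facet a b c -> facet a b c' -> c = c'.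
Proof.
have [n1 n2 n3] := outer_neq.
have no x y z z' : face x y z -> ogon x y z' -> False.
  move=> /faceP[_ _ _ D _] og; have := ogon_side z og; lra.
case/orP=> f /orP[] f'; first exact: face_uniq T _ _ _ _ f f'.
- by case: (no _ _ _ _ f f').
- by case: (no _ _ _ _ f' f).
by case/ogonP: f => -[e1 _ ->]; case/ogonP: f' => -[e2 _ ->] //;
  move: n1 n2 n3; rewrite -e1 e2 eqxx.
Qed.

Lemma outer_coords v : [/\ 0 <= X o2 o3 v, 0 <= X o3 o1 v & 0 <= X o1 o2 v].
Proof.
have og1 : ogon o1 o3 o2 by rewrite /ogon !inE eqxx.
have og2 : ogon o3 o2 o1 by rewrite -ogon_cyc.
have og3 : ogon o2 o1 o3 by rewrite -ogon_cyc.
have := ogon_side v og1; have := ogon_side v og2; have := ogon_side v og3.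
by rewrite !(cr_swap12 (d o3)) (cr_swap12 (d o1)) (cr_swap12 (d o2)) => *; split; lra.
Qed.

Lemma collinear3 a b : a != b -> X a b o1 = 0 -> X a b o2 = 0 -> X a b o3 = 0 -> False.
Proof.
move=> ab h1 h2 h3; have D := tri_pos T.
have N := tri_d_neq T ab.
have := cr_plucker (d a) (d o1) (d o2) (d o3) (d b).
have e1 := parallel2 N h1 h2; have e2 := parallel2 N h2 h3; have e3 := parallel2 N h3 h1.
by move: D; rewrite -(cr_sum (d o1) (d o2) (d o3) (d a)) !(cr_cyc (d a)) e1 e2 e3; lra.
Qed.

(** If some vertex is to the left of [a b], there is an inner face. Otherwise an inner [a], a
    barycentre of the outer vertices with positive weights, would force all three onto the line
    [a b]; so both ends are outer and [a b] is a clockwise boundary edge. *)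
Lemma facet_exists a b : adj a b -> exists c, facet a b c.
Proof.
move=> ab; have abn := adj_neq T ab.
have [[z zp]|no] := classic (exists z, 0 < X a b z).
  by have [c fc] := face_exists_at T ab (ex_intro _ z zp); exists c; rewrite /facet fc.
have le z : X a b z <= 0 by rewrite leNgt; apply/negP => h; apply: no; exists z.
have [h1 h2 h3] := outer_coords a; have [n1 n2 n3] := outer_neq.
have := bary_cr (d o1) (d o2) (d o3) (d a) (d b) (d a).
rewrite cr_aba mulr0 => S.
have t1 : X o2 o3 a * X a b o1 <= 0 by apply: mulr_ge0_le0.
have t2 : X o3 o1 a * X a b o2 <= 0 by apply: mulr_ge0_le0.
have t3 : X o1 o2 a * X a b o3 <= 0 by apply: mulr_ge0_le0.
have {t1} z1 : X o2 o3 a * X a b o1 = 0 by lra.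
have {t2} z2 : X o3 o1 a * X a b o2 = 0 by lra.
have {t3 S} z3 : X o1 o2 a * X a b o3 = 0 by lra.
have [oa|] := boolP (outer a); last first.
  rewrite /outer !inE !negb_or => /and3P[a1 a2 a3].
  have [p1 p2 p3] := tri_in T a1 a2 a3.
  case: (@collinear3 a b abn); apply/eqP.
  - by move/eqP: z1; rewrite mulf_eq0 (gt_eqF p2).
  - by move/eqP: z2; rewrite mulf_eq0 (gt_eqF p3).
  - by move/eqP: z3; rewrite mulf_eq0 (gt_eqF p1).
have D := tri_pos T.
have bb : outer b.
  apply/negPn/negP; rewrite /outer !inE !negb_or => /and3P[b1 b2 b3].
  have [p1 p2 p3] := tri_in T b1 b2 b3.
  case/outerP: oa => aE; subst a.
  - by have := le o3; rewrite cr_cyc leNgt p3.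
  - by have := le o1; rewrite cr_cyc leNgt p1.
  - by have := le o2; rewrite cr_cyc leNgt p2.
case/outerP: oa abn le => ->; case/outerP: bb => ->; rewrite ?eqxx // => _ le.
- by have := le o3; rewrite leNgt D.
- by exists o2; rewrite /facet /ogon !inE eqxx !orbT.
- by exists o3; rewrite /facet /ogon !inE eqxx !orbT.
- by have := le o1; rewrite cr_cyc leNgt D.
- by have := le o2; rewrite -cr_cyc leNgt D.
- by exists o1; rewrite /facet /ogon !inE eqxx !orbT.
Qed.

(** The rotation of the neighbours of [v]; the default value occurs only if [a] is not adjacent to
    [v]. *)
Definition succ v a := if [pick b | facet v a b] is Some b then b else a.

Lemma succP v a : adj v a -> facet v a (succ v a).
Proof.
move=> va; rewrite /succ; case: pickP => [b //|no].
by have [c fc] := facet_exists va; rewrite no in fc.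
Qed.

Lemma facet_adj3 v a b : facet v a b -> adj v b.
Proof. by rewrite facet_cyc facet_cyc => /facet_adj; rewrite (tri_sym T). Qed.

Lemma succ_inj v : {in adj v &, injective (succ v)}.
Proof.
move=> a b va vb E; have := succP va; have := succP vb; rewrite -E.
rewrite !(facet_cyc v) !(facet_cyc _ _ v) => h1 h2.
exact: facet_uniq h2 h1.
Qed.

Lemma succ_E v a b : facet v a b -> succ v a = b.
Proof. by move=> f; apply: facet_uniq (succP (facet_adj f)) f. Qed.

Lemma wedge_dt v a a' b : v != b -> 0 < X v a a' -> 
  dt (d v) (d a) (d b) * X v a' b < dt (d v) (d a') (d b) * X v a b.
Proof.
move=> vb h; rewrite -subr_gt0.
have -> : dt (d v) (d a') (d b) * X v a b - dt (d v) (d a) (d b) * X v a' b =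
  dt (d v) (d b) (d b) * X v a a' by rewrite /dt /cr; ring.
by rewrite mulr_gt0 // dt_gt0 // (tri_d_neq T) // eq_sym.
Qed.

(* The successor permutation of the neighbours of v is a single cycle. *)
Lemma link_connected v (A : pred V) : (exists2 a, adj v a & A a) ->
  (forall a b, A a -> facet v a b -> A b) -> forall z, adj v z -> A z.
Proof.
move=> [a0 va0 Aa0] Acl z0 vz0; apply/negPn/negP => nAz0.
pose SA := [set a | adj v a & A a].
have imA : succ v @: SA = SA.
  apply/eqP; rewrite eqEcard card_in_imset ?leqnn ?andbT; last first.
    by move=> x y; rewrite !inE => /andP[vx _] /andP[vy _]; apply: succ_inj.
  apply/subsetP => x /imsetP[y]; rewrite !inE => /andP[vy Ay] ->.
  by rewrite (facet_adj3 (succP vy)) (Acl y) // succP.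
have Bcl b b' : adj v b -> ~~ A b -> facet v b b' -> ~~ A b'.
  move=> vb nb f; apply: contra nb => Ab'.
  have : b' \in SA by rewrite inE Ab' (facet_adj3 f).
  rewrite -imA => /imsetP[y]; rewrite inE => /andP[vy Ay] E.
  by have <- // : y = b by apply: (succ_inj vy vb); rewrite (succ_E f).
(* Otherwise take such a pair with the least angle from [a] to [b], that is, the largest cotangent
   [F]; the successor of [a] is again in [P] and makes a smaller angle. *)
have key (P Q : pred V) : (forall a b, adj v a -> P a -> facet v a b -> P b) ->
    (forall a, ~~ (P a && Q a)) -> forall a b, adj v a -> adj v b -> P a -> Q b -> X v a b <= 0.
  move=> Pcl PQ a1 b1 va1 vb1 Pa1 Qb1; rewrite leNgt; apply/negP => D1.
  pose K := [pred ab : V * V | [&& adj v ab.1, adj v ab.2, P ab.1, Q ab.2 & 0 < X v ab.1 ab.2]].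
  have K1 : K (a1, b1) by apply/and5P.
  pose F (ab : V * V) := dt (d v) (d ab.1) (d ab.2) / X v ab.1 ab.2.
  case: (@Order.TotalTheory.arg_maxP _ _ _ (a1, b1) K F K1) => [[a b] /and5P[/= va vb Pa Qb D] Kmax].
  have f := succP va; set a' := succ v a in f.
  have Pa' := Pcl _ _ va Pa f; have va' := facet_adj3 f.
  have a'b : a' != b by apply: contraTneq Qb => <-; have := PQ a'; rewrite Pa'.
  case/orP: f => [f|og]; last by have := ogon_side b og; rewrite leNgt D.
  have [_ _ _ Da' _] := faceP f.
  have [h|h|h] := ltgtP (X v a' b) 0.
  - by apply: (face_wedge T f vb D); rewrite cr_swap oppr_gt0.
  - have := Kmax (a', b); rewrite /K /= va' vb Pa' Qb h => /(_ isT).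
    rewrite leNgt /F /= => /negP; apply.
    rewrite ltr_pdivrMr // mulrAC ltr_pdivlMr //; apply: wedge_dt => //.
    exact: adj_neq T _ _ vb.
  - by move/eqP: a'b; apply; apply: (same_ray T va' vb h Da' D).
(* By [key] in both directions every neighbour in [A] is collinear with [v] and [z0], so two
   consecutive ones span a degenerate facet. *)
have zero a b : adj v a -> adj v b -> A a -> ~~ A b -> X v a b = 0.
  move=> va vb Aa nAb; apply/eqP; rewrite eq_le; apply/andP; split.
    apply: (key A (fun x => ~~ A x)) => //; first by move=> x y _; apply: Acl.
    by move=> x; rewrite andbN.
  rewrite -oppr_le0 -cr_swap; apply: (key (fun x => ~~ A x) A) => //.
  by move=> x; rewrite andNb.
have f := succP va0; have := zero _ _ va0 vz0 Aa0 nAz0.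
have := zero _ _ (facet_adj3 f) vz0 (Acl _ _ Aa0 f) nAz0.
rewrite ![X v _ z0]cr_swap => /eqP; rewrite oppr_eq0 => /eqP e1 /eqP.
rewrite oppr_eq0 => /eqP e2.
have E := parallel2 (tri_d_neq T (adj_neq T vz0)) e2 e1.
case/orP: f => [/faceP[_ _ _ D _]|/ogon_pos D]; by rewrite E ltxx in D.
Qed.

(** By [visible_neighbour] any vertex in the open half-plane is enough. If there is none, the
    functional is nonpositive on the outer vertices and zero at [v], a barycentre of them with
    positive weights; so it vanishes on three points that are not collinear. *)
Lemma interior_surrounded v (al be : R) : ~~ outer v -> al != 0 \/ be != 0 ->
  exists2 a, adj v a & 0 < al * ((d a).1 - (d v).1) + be * ((d a).2 - (d v).2).
Proof.
rewrite /outer !inE !negb_or => /and3P[v1 v2 v3] ab0.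
have [p1 p2 p3] := tri_in T v1 v2 v3.
suff [a [va a0]] : exists a, adj v a /\ 0 < al * ((d a).1 - (d v).1) + be * ((d a).2 - (d v).2).
  by exists a.
apply: (visible_neighbour (v := v) (al := al) (be := be) T).
apply: NNPP => no.
pose f (z : point R) := al * (z.1 - (d v).1) + be * (z.2 - (d v).2).
have le z : f (d z) <= 0 by rewrite leNgt; apply/negP => h; apply: no; exists z.
have := bary_lin (d o1) (d o2) (d o3) (d v) (d v) al be; rewrite /= -!/(f _).
have -> : f (d v) = 0 by rewrite /f !subrr; ring.
rewrite mulr0 => S.
have t1 : X o2 o3 v * f (d o1) <= 0 := mulr_ge0_le0 (ltW p2) (le _).
have t2 : X o3 o1 v * f (d o2) <= 0 := mulr_ge0_le0 (ltW p3) (le _).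
have t3 : X o1 o2 v * f (d o3) <= 0 := mulr_ge0_le0 (ltW p1) (le _).
have {t1} z1 : X o2 o3 v * f (d o1) = 0 by lra.
have {t2} z2 : X o3 o1 v * f (d o2) = 0 by lra.
have {t3 S} z3 : X o1 o2 v * f (d o3) = 0 by lra.
have {}z1 : f (d o1) = 0 by move/eqP: z1; rewrite mulf_eq0 (gt_eqF p2) => /eqP.
have {}z2 : f (d o2) = 0 by move/eqP: z2; rewrite mulf_eq0 (gt_eqF p3) => /eqP.
have {}z3 : f (d o3) = 0 by move/eqP: z3; rewrite mulf_eq0 (gt_eqF p1) => /eqP.
have D := tri_pos T; rewrite /f in z1 z2 z3.
have E1 : al * X o1 o2 o3 = 0.
  transitivity (((d o3).2 - (d o1).2) * (al * ((d o2).1 - (d v).1) + be * ((d o2).2 - (d v).2) - (al * ((d o1).1 - (d v).1) + be * ((d o1).2 - (d v).2)))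
    - ((d o2).2 - (d o1).2) * (al * ((d o3).1 - (d v).1) + be * ((d o3).2 - (d v).2) - (al * ((d o1).1 - (d v).1) + be * ((d o1).2 - (d v).2)))); last by rewrite z1 z2 z3; ring.
  by rewrite /cr; ring.
have E2 : be * X o1 o2 o3 = 0.
  transitivity (((d o2).1 - (d o1).1) * (al * ((d o3).1 - (d v).1) + be * ((d o3).2 - (d v).2) - (al * ((d o1).1 - (d v).1) + be * ((d o1).2 - (d v).2)))
    - ((d o3).1 - (d o1).1) * (al * ((d o2).1 - (d v).1) + be * ((d o2).2 - (d v).2) - (al * ((d o1).1 - (d v).1) + be * ((d o1).2 - (d v).2)))); last by rewrite z1 z2 z3; ring.
  by rewrite /cr; ring.
move/eqP: E1; move/eqP: E2; rewrite !mulf_eq0 (gt_eqF D) !orbF => /eqP e1 /eqP e2.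
by case: ab0; rewrite ?e1 ?e2 eqxx.
Qed.

(* In the drawing d itself, a generic level line through v leaves v in only
   one direction of each orientation, hence through at most one facet. *)
Lemma up_uniq v (p : point R -> R) a b a' b' :
  (forall x y z : V, p (d x) * X v y z + p (d y) * X v z x + p (d z) * X v x y = 0) ->
  facet v a b -> facet v a' b' -> p (d a) < 0 -> 0 < p (d b) -> p (d a') < 0 -> 0 < p (d b') ->
  a = a'.
Proof.
move=> P f f' pa pb pa' pb'; have va := facet_adj f; have va' := facet_adj f'.
have one x y z : face v x y -> p (d x) < 0 -> 0 < p (d y) -> adj v z -> p (d z) < 0 -> X v x z <= 0.
  move=> fx px py vz pz; rewrite leNgt; apply/negP => h.
  have [_ _ _ D _] := faceP fx.
  apply: (face_wedge T fx vz h).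
  have E := P x z y; have h1 : p (d z) * X v x y < 0 by rewrite nmulr_rlt0.
  have h2 : 0 < p (d y) * X v x z by rewrite mulr_gt0.
  rewrite [X v y x]cr_swap in E; rewrite -(nmulr_rlt0 _ px).
  by move: E h1 h2; flra.
have og x y x' y' : ogon v x y -> p (d x) < 0 -> 0 < p (d y) -> face v x' y' ->
    p (d x') < 0 -> 0 < p (d y') -> False.
  move=> o px py fx px' py'; have [_ _ _ D _] := faceP fx.
  have E := P x' y' x; have h1 := ogon_side y' o; have h2 := ogon_side x' o.
  have h3 : p (d y') * X v x x' <= 0 by rewrite pmulr_rle0.
  have h4 : p (d x') * X v y' x <= 0 by rewrite nmulr_rle0 // cr_swap oppr_ge0.
  have h5 : p (d x) * X v x' y' < 0 by rewrite nmulr_rlt0.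
  by move: E h3 h4 h5; flra.
case/orP: f => [f|o]; case/orP: f' => [f'|o'].
- have h1 := one _ _ _ f pa pb va' pa'; have h2 := one _ _ _ f' pa' pb' va pa.
  have E : X v a a' = 0 by move: h2; rewrite cr_swap oppr_le0 => h2; apply/eqP; rewrite eq_le h1.
  have [_ _ _ D _] := faceP f; have [_ _ _ D' _] := faceP f'.
  apply/eqP/negPn/negP => ne.
  have := adj_same_side T va va' ne E; rewrite ltNge => /negP; apply.
  have Q := P a a' b; have N : 0 < dt (d v) (d a) (d a) by apply/dt_gt0/(tri_d_neq T); rewrite eq_sym (adj_neq T).
  have Q2 := dt_cr2 (d b) E.
  have s1 : X v b a < 0 by rewrite cr_swap oppr_lt0.
  have : p (d a') * X v b a = p (d a) * X v b a'.
    by move: Q; rewrite E mulr0 addr0 [X v a' b]cr_swap; flra.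
  have h : 0 < p (d a') * X v b a by rewrite nmulr_rgt0.
  move=> E3; rewrite E3 nmulr_rgt0 // in h.
  have : dt (d v) (d a) (d a') * X v b a < 0 by rewrite Q2 nmulr_rlt0.
  by rewrite nmulr_llt0 // => /ltW.
- by case: (og _ _ _ _ o' pa' pb' f pa pb).
- by case: (og _ _ _ _ o pa pb f' pa' pb').
have [n1 n2 n3] := outer_neq.
by case/ogonP: o => -[e1 -> _]; case/ogonP: o' => -[e2 -> _] //;
  move: n1 n2 n3; rewrite -e1 e2 eqxx.
Qed.

End Triangulation.

Lemma outer_rot (V : finType) (o1 o2 o3 v : V) : outer o2 o3 o1 v = outer o1 o2 o3 v.
Proof. by rewrite /outer !inE orbA orbC. Qed.

(** * Tutte's theorem for triangulations *)

Lemma avoid_finite (R : realType) (s : seq R) : exists m, 0 < m /\ m \notin s.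
Proof.
exists (1 + \sum_(x <- s) `|x|); have S0 : 0 <= \sum_(x <- s) `|x| by apply: sumr_ge0.
split; first by lra.
apply/negP => h; have : `|1 + \sum_(x <- s) `|x| | <= \sum_(x <- s) `|x|.
  by rewrite [leRHS](big_rem _ h) /= lerDl sumr_ge0.
by rewrite ger0_norm; lra.
Qed.

Section Triangulation.
Variables (R : realType) (V : finType) (d : V -> point R) (adj : rel V).
Variables (o1 o2 o3 : V).
Hypothesis T : triang d adj o1 o2 o3.
Notation X a b c := (cr (d a) (d b) (d c)).
Implicit Types a b c v w z : V.
Notation face := (face d adj).
Notation facet := (facet d adj o1 o2 o3).
Notation outer := (outer o1 o2 o3).

Definition strict_total (lt : rel V) :=
  [/\ irreflexive lt, transitive lt & forall a b, a != b -> lt a b || lt b a].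

(** The number of times the rotation at [v] passes from a lower neighbour to a higher one; the
    converse order counts the passages back. At an ordinary vertex both numbers are 1. *)
Definition ups (lt : rel V) v : nat :=
  \sum_(ab : V * V) (facet v ab.1 ab.2 && (lt ab.1 v && lt v ab.2)).

Definition converse (lt : rel V) : rel V := fun a b => lt b a.

Lemma strict_total_conv lt : strict_total lt -> strict_total (converse lt).
Proof.
move=> [h1 h2 h3]; split=> [x|y x z h h'|a b ab]; rewrite /converse //.
- exact: h2 h' h.
by rewrite orbC h3.
Qed.

Lemma facet_neq a b c : facet a b c -> [/\ a != b, b != c & c != a].
Proof.
move=> f; split; apply/(adj_neq T)/(facet_adj T); first exact: f.
  by rewrite facet_cyc in f; exact: f.
by rewrite facet_cyc facet_cyc in f; exact: f.
Qed.

(** Each facet has exactly one vertex in the middle of the order and is counted there, by [lt] or by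
    its converse. The factor 3 accounts for the rotations of a facet on the right. *)
Lemma sum_ups lt : strict_total lt ->
  (3 * \sum_v (ups lt v + ups (converse lt) v) = \sum_v \sum_a \sum_b facet v a b)%N.
Proof.
move=> [irr tr tot].
pose med v a b : nat := facet v a b && (lt a v && lt v b || lt b v && lt v a).
have E : (\sum_v (ups lt v + ups (converse lt) v) = \sum_v \sum_a \sum_b med v a b)%N.
  apply: eq_bigr => v _; rewrite /ups -big_split /= pair_bigA /=.
  apply: eq_bigr => -[a b] _; rewrite /med /converse /=; case: facet => //=.
  case av: (lt a v); case vb: (lt v b); case bv: (lt b v); case va: (lt v a) => //=;
    by have := tr _ _ _ av va; rewrite irr.
have E2 : (\sum_v \sum_a \sum_b med v a b = \sum_v \sum_a \sum_b med a b v)%N.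
  by rewrite [RHS]exchange_big /=; apply: eq_bigr => x _; rewrite [RHS]exchange_big.
have E3 : (\sum_v \sum_a \sum_b med v a b = \sum_v \sum_a \sum_b med b v a)%N.
  rewrite [RHS](eq_bigr (fun y => \sum_x \sum_z med x y z)%N); last first.
    by move=> y _; rewrite exchange_big.
  by rewrite [RHS]exchange_big.
rewrite E mulSn mul2n -addnn {1}E2 {1}E3 -!big_split /=.
apply: eq_bigr => v _; rewrite -!big_split; apply: eq_bigr => a _.
rewrite -!big_split; apply: eq_bigr => b _ /=.
rewrite /med -(facet_cyc d adj o1 o2 o3 v) (facet_cyc d adj o1 o2 o3 b).
case f: (facet v a b) => //=; have [va ab bv] := facet_neq f.
have cmp x y : x != y -> lt y x = ~~ lt x y.
  move=> xy; have := tot _ _ xy; case h: (lt x y) => //= _.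
  by apply: contraFF (irr x) => h'; apply: tr h h'.
have t1 : ~~ [&& lt v a, lt a b & lt b v].
  by apply/negP => /and3P[h1 h2 h3]; have := tr _ _ _ (tr _ _ _ h1 h2) h3; rewrite irr.
have t2 : ~~ [&& lt a v, lt b a & lt v b].
  by apply/negP => /and3P[h1 h2 h3]; have := tr _ _ _ (tr _ _ _ h3 h2) h1; rewrite irr.
move: t1 t2; rewrite (cmp _ _ va) (cmp _ _ ab) (cmp _ _ bv).
by case: (lt v a); case: (lt a b); case: (lt b v).
Qed.

(** Without such a passage the lower neighbours would be closed under the rotation, hence be all
    neighbours. *)
Lemma ups_gt0 lt v : strict_total lt -> (exists2 a, adj v a & lt a v) ->
  (exists2 b, adj v b & lt v b) -> (0 < ups lt v)%N.
Proof.
move=> [irr tr tot] [a0 va0 lav] [b0 vb0 lvb].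
have [[a [b [f av vb]]]|no] := classic (exists a b, [/\ facet v a b, lt a v & lt v b]).
  rewrite /ups (bigD1 (a, b)) //= f av vb; lia.
have cl a b : lt a v -> facet v a b -> lt b v.
  move=> av f; have [_ _ bv] := facet_neq f.
  by have /orP[//|vb] := tot _ _ bv; case: no; exists a, b.
have lbv := link_connected T (ex_intro2 _ _ a0 va0 lav) cl vb0.
by have := tr _ _ _ lvb lbv; rewrite irr.
Qed.

Lemma ups_le1 (lt : rel V) v : (forall a b a' b', facet v a b -> facet v a' b' ->
    lt a v -> lt v b -> lt a' v -> lt v b' -> a = a') -> (ups lt v <= 1)%N.
Proof.
move=> U; have [/existsP[[a b] /and3P[/= f av vb]]|/existsPn no] :=
  boolP [exists ab : V * V, [&& facet v ab.1 ab.2, lt ab.1 v & lt v ab.2]].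
  rewrite /ups (bigD1 (a, b)) //= f av vb big1 // => -[a' b'] /= ne.
  apply/eqP; rewrite eqb0; apply: contra ne => /and3P[f' av' vb'].
  have E := U _ _ _ _ f f' av vb av' vb'; subst a'.
  by rewrite (facet_uniq T f f').
by rewrite /ups big1 // => ab _; rewrite (negPf (no ab)).
Qed.

Lemma ups_uniq (lt : rel V) v a b a' b' : (ups lt v <= 1)%N -> facet v a b -> facet v a' b' ->
    lt a v -> lt v b -> lt a' v -> lt v b' -> a = a' /\ b = b'.
Proof.
move=> U f f' av vb av' vb'.
have [[-> ->] //|ne] := eqVneq (a', b') (a, b).
by move: U; rewrite /ups (bigD1 (a, b)) //= (bigD1 (a', b')) //= f f' av vb av' vb'; lia.
Qed.

(** For the new map, [f] is a functional of the new positions and [g] a generic one of the given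
    drawing. Breaking ties by the old drawing makes the count of passages available before the new
    map is known to be nondegenerate. *)
Definition lex (f g : V -> R) : rel V :=
  fun a b => (f a < f b) || (f a == f b) && (g a < g b).

Lemma lex_total f g : injective g -> strict_total (lex f g).
Proof.
move=> gi; split=> [x|y x z|a b ab]; rewrite /lex ?ltxx ?eqxx //.
  move=> /orP[h|/andP[/eqP-> h]] /orP[h'|/andP[/eqP<- h']].
  - by rewrite (lt_trans h h').
  - by rewrite h.
  - by rewrite h'.
  by rewrite eqxx (lt_trans h h') orbT.
have [//|//|_] /= := ltgtP (f a) (f b).
by have [//|//|/gi/eqP] := ltgtP (g a) (g b); rewrite (negPf ab).
Qed.

Definition lin (al be : R) (p : point R) : R := al * p.1 + be * p.2.

Lemma lin_plucker al be v x y z :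
  let p := fun u => lin al be u - lin al be (d v) in
  p (d x) * X v y z + p (d y) * X v z x + p (d z) * X v x y = 0.
Proof. by rewrite /lin /cr /=; ring. Qed.

(* Every c in R^2 is realised by arbitrarily close generic functionals; we only
   need one direction at a time. *)
Lemma generic_lin (n1 n2 m1 m2 : R) :
  (forall a b, a != b -> n1 * ((d a).1 - (d b).1) + n2 * ((d a).2 - (d b).2) != 0 \/
     m1 * ((d a).1 - (d b).1) + m2 * ((d a).2 - (d b).2) != 0) ->
  forall e, 0 < e -> exists t, 0 < t < e /\ 
    injective (fun v => lin (n1 + t * m1) (n2 + t * m2) (d v)).
Proof.
move=> H e e0.
pose q (ab : V * V) := - (m1 * ((d ab.1).1 - (d ab.2).1) + m2 * ((d ab.1).2 - (d ab.2).2)) /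
   (n1 * ((d ab.1).1 - (d ab.2).1) + n2 * ((d ab.1).2 - (d ab.2).2)).
have [m [m0 mn]] := avoid_finite [seq q ab - e^-1 | ab : V * V].
have em : 0 < e^-1 + m by rewrite addr_gt0 // invr_gt0.
exists (e^-1 + m)^-1; split.
  by rewrite invr_gt0 em /= invf_plt ?posrE // ltrDl.
move=> a b /eqP; rewrite -subr_eq0 => /eqP E; apply/eqP/negPn/negP => ab.
set t := (_)^-1 in E; have tn : t != 0 by rewrite invr_eq0 gt_eqF.
have E' : n1 * ((d a).1 - (d b).1) + n2 * ((d a).2 - (d b).2) =
  - t * (m1 * ((d a).1 - (d b).1) + m2 * ((d a).2 - (d b).2)).
  apply/eqP; rewrite -subr_eq0; apply/eqP; rewrite -[RHS]E /lin; ring.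
have [n0|n0] := eqVneq (n1 * ((d a).1 - (d b).1) + n2 * ((d a).2 - (d b).2)) 0.
  case: (H a b ab); rewrite ?n0 ?eqxx // => m0'.
  by move/eqP: E'; rewrite n0 eq_sym mulf_eq0 oppr_eq0 (negPf tn) (negPf m0').
move/negP: mn; apply; apply/mapP; exists (a, b); first by rewrite mem_enum.
rewrite /q /=; apply/eqP; rewrite -(inj_eq (addrI e^-1)) addrCA subrr addr0 -[_ + m]invrK -/t.
apply/eqP; apply: (mulIf n0); rewrite divfK // E'.
by field.
Qed.

Lemma generic_exists : exists al be, injective (fun v => lin al be (d v)).
Proof.
have [|t [_ h]] := @generic_lin 1 0 0 1 _ 1 ltr01; last by eexists; eexists; exact: h.
move=> a b ab; apply/orP; rewrite !mul1r !mul0r addr0 add0r !subr_eq0 -negb_and.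
by apply: contra ab => /andP[/eqP h1 /eqP h2]; apply/eqP/(tri_inj T)/point_eq.
Qed.

Lemma sum_not2 (lo hi : V) : lo != hi ->
  (\sum_v (2 * ((v != lo) && (v != hi))) = 2 * (#|V| - 2))%N.
Proof.
move=> n; rewrite -big_distrr /=.
have -> : (\sum_v ((v != lo) && (v != hi)) = #|~: [set lo; hi]|)%N.
  rewrite -sum1_card [RHS]big_mkcond /=; apply: eq_bigr => v _.
  by rewrite !inE negb_or; case: (_ && _).
have := cardsC [set lo; hi]; rewrite cards2 n => <-; by rewrite addnC addnK.
Qed.

(** Euler's bound read off the given straight-line drawing: for a generic linear order every vertex
    has at most one passage of each kind ([up_uniq]), and the lowest and highest have none. The
    constant 6 is two passages times three rotations. *)
Lemma facets_le : (\sum_v \sum_a \sum_b facet v a b <= 6 * (#|V| - 2))%N.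
Proof.
have [al [be gi]] := generic_exists; pose g v := lin al be (d v).
have st : strict_total (lex g g) := lex_total g gi.
have lexE a b : lex g g a b = (g a < g b) by rewrite /lex; case: (_ < _); rewrite ?andbF.
rewrite -(sum_ups st).
have [n1 n2 n3] := outer_neq T.
case: (@Order.TotalTheory.arg_minP _ _ _ o1 xpredT g isT) => lo _ lomin.
case: (@Order.TotalTheory.arg_maxP _ _ _ o1 xpredT g isT) => hi _ himax.
have lohi : lo != hi.
  apply: contraNneq n1 => E; apply/eqP/gi; apply/eqP; rewrite eq_le -!/(g _).
  by rewrite (le_trans (himax o1 isT)) -?E ?lomin //= (le_trans (himax o2 isT)) -?E ?lomin.
have le2 v : (ups (lex g g) v + ups (converse (lex g g)) v <= 2 * ((v != lo) && (v != hi)))%N.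
  have U1 : (ups (lex g g) v <= 1)%N.
    apply: ups_le1 => a b a' b' f f'; rewrite !lexE -![g _ < _]subr_lt0 => h1 h2 h3 h4.
    apply: (up_uniq (d := d) (p := fun u => lin al be u - lin al be (d v)) T _ f f') => //.
    - by move=> x y z; apply: lin_plucker.
    - by rewrite -oppr_lt0 opprB.
    - by rewrite -oppr_lt0 opprB.
  have U2 : (ups (converse (lex g g)) v <= 1)%N.
    apply: ups_le1 => a b a' b' f f'; rewrite /converse !lexE -![g _ < _]subr_lt0 => h1 h2 h3 h4.
    apply: (up_uniq (d := d) (p := fun u => lin (- al) (- be) u - lin (- al) (- be) (d v)) T _ f f');
      first (by move=> x y z; apply: lin_plucker); by move: h1 h2 h3 h4; rewrite /g /lin; flra.
  have [->|nlo] /= := eqVneq v lo.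
    have F w : (g w < g lo) = false by rewrite ltNge lomin.
    by rewrite /ups !big1 // => ab _; rewrite /converse !lexE F ?andbF.
  have [->|nhi] /= := eqVneq v hi; last lia.
  have F w : (g hi < g w) = false by apply/negbTE; rewrite -leNgt; apply: himax.
  by rewrite /ups !big1 // => ab _; rewrite /converse !lexE F ?andbF.
have S := sum_not2 lohi.
have : (\sum_v (ups (lex g g) v + ups (converse (lex g g)) v) <= 2 * (#|V| - 2))%N.
  by rewrite -S; apply: leq_sum.
lia.
Qed.

(** A count without slack. Every vertex except the lowest and the highest outer one has at least one
    passage of each kind, the middle outer vertex by its outer neighbours; [facets_le] leaves room
    for just two per such vertex, so there is no excess at [v]. *)
Lemma ups1 (lt : rel V) v : strict_total lt ->
  (forall u, ~~ outer u -> (exists2 a, adj u a & lt a u) /\ (exists2 b, adj u b & lt u b)) ->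
  ~~ outer v -> (ups lt v <= 1)%N.
Proof.
move=> st H vi; have [irr tr tot] := st; rewrite leqNgt; apply/negP => U.
have [n1 n2 n3] := outer_neq T.
have [lo [mid [hi [lo_ mid_ hi_]]]] : exists lo mid hi,
    [/\ [/\ adj mid lo, lt lo mid & outer lo], [/\ adj mid hi, lt mid hi & outer hi] &
    forall u, u != lo -> u != mid -> u != hi -> ~~ outer u].
  have a12 := tri_o12 T; have a23 := tri_o23 T; have a31 := tri_o31 T.
  have [a21 a32 a13] : [/\ adj o2 o1, adj o3 o2 & adj o1 o3] by split; rewrite (tri_sym T).
  have O u : u != o1 -> u != o2 -> u != o3 -> ~~ outer u.
    by rewrite /Submission.outer !inE !negb_or => -> -> ->.
  have [O1 O2 O3] : [/\ outer o1, outer o2 & outer o3] by rewrite /Submission.outer !inE !eqxx !orbT.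
  case/orP: (tot _ _ n1) => l12; case/orP: (tot _ _ n2) => l23; case/orP: (tot _ _ n3) => l31.
  - by have := tr _ _ _ (tr _ _ _ l12 l23) l31; rewrite irr.
  - by exists o1, o2, o3; split=> // u *; apply: O.
  - by exists o3, o1, o2; split=> // u *; apply: O.
  - by exists o1, o3, o2; split=> // u *; apply: O.
  - by exists o2, o3, o1; split=> // u *; apply: O.
  - by exists o2, o1, o3; split=> // u *; apply: O.
  - by exists o3, o2, o1; split=> // u *; apply: O.
  - by have := tr _ _ _ (tr _ _ _ l31 l23) l12; rewrite irr.
have G u : u != lo -> u != hi -> (0 < ups lt u)%N /\ (0 < ups (converse lt) u)%N.
  move=> ulo uhi; have [e1 e2] : (exists2 a, adj u a & lt a u) /\ (exists2 b, adj u b & lt u b).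
    have [->|um] := eqVneq u mid; last by apply/H/hi_.
    by case: lo_ mid_ => [? ? _] [? ? _]; split; [exists lo | exists hi].
  by split; apply: ups_gt0 => //; apply: strict_total_conv.
have lohi : lo != hi.
  by case: lo_ mid_ => [_ h _] [_ h' _]; apply: contraTneq (tr _ _ _ h h') => ->; rewrite irr.
have := facets_le; rewrite -(sum_ups st).
have : (\sum_u (2 * ((u != lo) && (u != hi)) + (u == v)) <=
  \sum_u (ups lt u + ups (converse lt) u))%N.
  have [_ _ olo] := lo_; have [_ _ ohi] := mid_.
  have [vlo vhi] : v != lo /\ v != hi by split; apply: contraNneq vi => ->.
  apply: leq_sum => u _; have [->|uv] := eqVneq u v.
    by rewrite vlo vhi; have [_ g] := G _ vlo vhi; exact: leq_add U g.
  have [->//|ulo] := eqVneq u lo; have [->//|uhi] := eqVneq u hi.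
  by have [g g'] := G _ ulo uhi; exact: leq_add g g'.
have S := sum_not2 lohi.
rewrite big_split /= S (bigD1 v) //= eqxx; lia.
Qed.

End Triangulation.

Lemma lin_pos_small (R : realType) (A B : R) : 0 < A ->
  exists e, 0 < e /\ forall t, 0 < t < e -> 0 < A + t * B.
Proof.
move=> A0; have h : 0 < 1 + `|B| by rewrite ltr_pwDl.
exists (A / (1 + `|B|)); split; first exact: divr_gt0.
move=> t /andP[t0]; rewrite ltr_pdivlMr // => h2.
have : t * - B <= t * `|B| by rewrite ler_pM2l // -normrN ler_norm.
by move: h2 t0; rewrite mulrDr mulr1 mulrN; flra.
Qed.

Lemma collinear_lin (R : realType) (p q r : point R) : cr p q r = 0 ->
  exists al be, (al != 0 \/ be != 0) /\ lin al be p = lin al be q /\ lin al be p = lin al be r.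
Proof.
move=> E; have [pq|pq] := eqVneq p q.
  subst q; have [pr|pr] := eqVneq p r.
    by subst r; exists 1, 0; split; [left; rewrite oner_eq0 | split].
  exists (- (r.2 - p.2)), (r.1 - p.1); split; last by rewrite /lin; split; ring.
  have [h|h] := eqVneq (r.1 - p.1) 0; [left | by right].
  rewrite oppr_eq0 subr_eq0; apply: contra pr => /eqP h2.
  by move/eqP: h; rewrite subr_eq0 => /eqP h; apply/eqP/point_eq.
exists (- (q.2 - p.2)), (q.1 - p.1); split.
  have [h|h] := eqVneq (q.1 - p.1) 0; [left | by right].
  rewrite oppr_eq0 subr_eq0; apply: contra pq => /eqP h2.
  by move/eqP: h; rewrite subr_eq0 => /eqP h; apply/eqP/point_eq.
split; first by rewrite /lin; ring.
by move: E; rewrite /lin /cr; lra.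
Qed.

Lemma lin_collinear (R : realType) (al be : R) (p q r : point R) : al != 0 \/ be != 0 ->
  lin al be p = lin al be q -> lin al be p = lin al be r -> cr p q r = 0.
Proof.
rewrite /lin => ab /eqP; rewrite -subr_eq0 => /eqP e1 /eqP; rewrite -subr_eq0 => /eqP e2.
have E1 : al * cr p q r = 0.
  transitivity ((q.2 - p.2) * (al * p.1 + be * p.2 - (al * r.1 + be * r.2))
     - (r.2 - p.2) * (al * p.1 + be * p.2 - (al * q.1 + be * q.2))); last by rewrite e1 e2; ring.
  by rewrite /cr; ring.
have E2 : be * cr p q r = 0.
  transitivity ((r.1 - p.1) * (al * p.1 + be * p.2 - (al * q.1 + be * q.2))
     - (q.1 - p.1) * (al * p.1 + be * p.2 - (al * r.1 + be * r.2))); last by rewrite e1 e2; ring.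
  by rewrite /cr; ring.
by case: ab => n; [move/eqP: E1 | move/eqP: E2]; rewrite mulf_eq0 (negPf n) => /eqP.
Qed.

Lemma pos_trans (R : realType) (x y z : R) : 0 < x * y -> 0 < y * z -> 0 < x * z.
Proof.
move=> h1 h2; have y0 : y != 0 by apply: contraTneq h1 => ->; rewrite mulr0 ltxx.
have y2 : 0 < y * y by rewrite -expr2 exprn_even_gt0.
have E : x * z * (y * y) = (x * y) * (y * z) by ring.
by rewrite -(pmulr_lgt0 _ y2) E mulr_gt0.
Qed.

(** A vertex of [K] farthest from the line [o2 o3] is not inner, because an inner one has a
    neighbour farther away; its distance is positive, so it is [o1]. *)
Lemma reach_outer1 (R : realType) (V : finType) (d : V -> point R) (adj : rel V)
    (o1 o2 o3 : V) (K : pred V) : triang d adj o1 o2 o3 ->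
  (exists2 v, K v & ~~ outer o1 o2 o3 v) ->
  (forall v w, K v -> ~~ outer o1 o2 o3 v -> adj v w -> K w) -> K o1.
Proof.
move=> T [v0 Kv0 iv0] Kcl.
case: (@Order.TotalTheory.arg_maxP _ _ _ v0 K (fun z => cr (d o2) (d o3) (d z)) Kv0) => v Kv vmax.
have {}vmax w : K w -> cr (d o2) (d o3) (d w) <= cr (d o2) (d o3) (d v) by apply: vmax.
have v0p : 0 < cr (d o2) (d o3) (d v0).
  by move: iv0; rewrite /outer !inE !negb_or => /and3P[h1 h2 h3]; have [] := tri_in T h1 h2 h3.
have vp : 0 < cr (d o2) (d o3) (d v) by apply: lt_le_trans v0p (vmax _ Kv0).
have [/outerP[<- //|E|E]|iv] := boolP (outer o1 o2 o3 v).
- by rewrite E cr_aba ltxx in vp.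
- by rewrite E cr_abb ltxx in vp.
have n23 := tri_d_neq T (adj_neq T (tri_o23 T)).
have [|a va ap] := interior_surrounded (al := - ((d o3).2 - (d o2).2)) (be := (d o3).1 - (d o2).1) T iv.
  have [h|h] := eqVneq ((d o3).1 - (d o2).1) 0; [left | by right].
  rewrite oppr_eq0 subr_eq0; apply: contra n23 => /eqP h2.
  by move/eqP: h; rewrite subr_eq0 => /eqP h; apply/eqP/point_eq.
have := vmax a (Kcl _ _ Kv iv va); rewrite leNgt => /negP[].
by rewrite -subr_gt0 (_ : _ - _ = - ((d o3).2 - (d o2).2) * ((d a).1 - (d v).1) +
     ((d o3).1 - (d o2).1) * ((d a).2 - (d v).2)) //; rewrite /cr; ring.
Qed.

Lemma reach_outer (R : realType) (V : finType) (d : V -> point R) (adj : rel V)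
    (o1 o2 o3 : V) (K : pred V) : triang d adj o1 o2 o3 ->
  (exists2 v, K v & ~~ outer o1 o2 o3 v) ->
  (forall v w, K v -> ~~ outer o1 o2 o3 v -> adj v w -> K w) -> [/\ K o1, K o2 & K o3].
Proof.
move=> T ex cl; split; first exact: reach_outer1 T ex cl.
  apply: (reach_outer1 (tri_rot T)) => [|v w]; rewrite ?(outer_rot o1 o2 o3); last exact: cl.
  by case: ex => v Kv iv; exists v; rewrite ?(outer_rot o1 o2 o3).
apply: (reach_outer1 (tri_rot (tri_rot T))) => [|v w];
  rewrite ?(outer_rot o2 o3 o1) ?(outer_rot o1 o2 o3); last exact: cl.
by case: ex => v Kv iv; exists v; rewrite ?(outer_rot o2 o3 o1) ?(outer_rot o1 o2 o3).
Qed.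

(** * Nondegeneracy and common orientation of the faces under a surrounded map *)

Section Drawing.
Variables (R : realType) (V : finType) (d : V -> point R) (adj : rel V).
Variables (o1 o2 o3 : V).
Hypothesis T : triang d adj o1 o2 o3.
Notation X a b c := (cr (d a) (d b) (d c)).
Implicit Types a b c v w z : V.
Notation face := (face d adj).
Notation facet := (facet d adj o1 o2 o3).
Notation outer := (outer o1 o2 o3).

Lemma link_exit v (A : pred V) : (exists2 a, adj v a & A a) -> (exists2 a, adj v a & ~~ A a) ->
  exists a b, [/\ facet v a b, A a & ~~ A b].
Proof.
move=> ex [z vz nz]; apply: NNPP => no; move/negP: nz; apply.
apply: (link_connected T ex _ vz) => a b Aa f; apply/negPn/negP => nb.
by apply: no; exists a, b.
Qed.

Lemma facet_inner v a b : ~~ outer v -> facet v a b -> face v a b.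
Proof.
move=> iv /orP[//|/ogonP h]; case/negP: iv; apply/outerP.
by case: h => -[? _ _]; [constructor 1|constructor 3|constructor 2].
Qed.

Lemma generic_sep v a b : 0 < X v a b -> exists ga de,
  [/\ injective (fun u => lin ga de (d u)), lin ga de (d a) < lin ga de (d v) & lin ga de (d v) < lin ga de (d b)].
Proof.
(* The sum of the vectors to [a] and [b], turned by a right angle, takes opposite values on the two;
   [generic_lin] then perturbs it along a second, orthogonal direction. *)
move=> D; pose n1 := - ((d a).2 - (d v).2) - ((d b).2 - (d v).2).
pose n2 := (d a).1 - (d v).1 + ((d b).1 - (d v).1).
have na : lin n1 n2 (d v) - lin n1 n2 (d a) = X v a b by rewrite /n1 /n2 /lin /cr; ring.
have nb : lin n1 n2 (d b) - lin n1 n2 (d v) = X v a b by rewrite /n1 /n2 /lin /cr; ring.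
have N : 0 < n1 ^+ 2 + n2 ^+ 2.
  rewrite lt_def addr_ge0 ?sqr_ge0 // andbT paddr_eq0 ?sqr_ge0 // !sqrf_eq0.
  by apply: contraTN D => /andP[/eqP h1 /eqP h2]; rewrite -na /lin h1 h2; lra.
have [e1 [e10 h1]] := lin_pos_small (lin (- n2) n1 (d v) - lin (- n2) n1 (d a)) D.
have [e2 [e20 h2]] := lin_pos_small (lin (- n2) n1 (d b) - lin (- n2) n1 (d v)) D.
have e0 : 0 < Num.min e1 e2 by rewrite lt_min e10.
have [|t [/andP[t0]]] := @generic_lin _ _ d n1 n2 (- n2) n1 _ _ e0.
  move=> x y xy; apply/orP; rewrite -negb_and; apply: contra xy => /andP[/eqP E1 /eqP E2].
  apply/eqP/(tri_inj T)/point_eq; apply/eqP; rewrite -subr_eq0 -(mulrI_eq0 _ (mulfI (lt0r_neq0 N))).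
    apply/eqP; transitivity (n1 * (n1 * ((d x).1 - (d y).1) + n2 * ((d x).2 - (d y).2))
      - n2 * (- n2 * ((d x).1 - (d y).1) + n1 * ((d x).2 - (d y).2))); first by ring.
    by rewrite E1 E2; ring.
  apply/eqP; transitivity (n2 * (n1 * ((d x).1 - (d y).1) + n2 * ((d x).2 - (d y).2))
      + n1 * (- n2 * ((d x).1 - (d y).1) + n1 * ((d x).2 - (d y).2))); first by ring.
  by rewrite E1 E2; ring.
rewrite lt_min => /andP[t1 t2] inj; exists (n1 + t * - n2), (n2 + t * n1); split=> //.
  by have := h1 t; rewrite t0 t1 -{1}na /lin => /(_ isT); flra.
by have := h2 t; rewrite t0 t2 -{1}nb /lin => /(_ isT); flra.
Qed.

Variable D : V -> point R.
(** Says that [D v] lies in the relative interior of the convex hull of its neighbours; the hull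
    itself may be degenerate. *)
Hypothesis surrounded : forall v al be, ~~ outer v ->
  (forall a, adj v a -> lin al be (D v) <= lin al be (D a)) ->
  forall a, adj v a -> lin al be (D a) = lin al be (D v).
Hypothesis noncol : cr (D o1) (D o2) (D o3) != 0.
Notation S a b c := (cr (D a) (D b) (D c)).

Section Order.
Variables al be ga de : R.
Hypothesis gen : injective (fun u => lin ga de (d u)).
Let F v := lin al be (D v).
Let G v := lin ga de (d v).
Let lt := lex F G.

Let st : strict_total lt. Proof. exact: lex_total. Qed.

Lemma nbr_below v : ~~ outer v -> (exists2 a, adj v a & F a != F v) -> exists2 a, adj v a & F a < F v.
Proof.
move=> iv [a va ne]; apply: NNPP => no; move/eqP: ne; apply.
apply: (surrounded iv) va => b vb; rewrite leNgt; apply/negP => h.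
by apply: no; exists b.
Qed.

Lemma nbr_above v : ~~ outer v -> (exists2 a, adj v a & F a != F v) -> exists2 a, adj v a & F v < F a.
Proof.
move=> iv [a va ne]; apply: NNPP => no; move/eqP: ne; apply.
have := surrounded (al := - al) (be := - be) iv _ va.
rewrite /F /lin => E; apply: oppr_inj; rewrite !opprD -!mulNr.
apply: E => b vb; rewrite -subr_ge0 leNgt; apply/negP => h.
by apply: no; exists b => //; move: h; rewrite /F /lin; lra.
Qed.

(** If [F] is not constant around [v], [surrounded] gives both neighbours. If it is, all comparisons
    are ties, and the given drawing decides them by [interior_surrounded]. *)
Lemma both_sides v : ~~ outer v ->
  (exists2 a, adj v a & lt a v) /\ (exists2 b, adj v b & lt v b).
Proof.
move=> iv; have [ne|no] := classic (exists2 a, adj v a & F a != F v).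
  have [a va ha] := nbr_below iv ne; have [b vb hb] := nbr_above iv ne.
  by split; [exists a | exists b] => //; rewrite /lt /lex ?ha ?hb.
have {no}eqF a : adj v a -> F a = F v.
  by move=> va; apply/eqP/negPn/negP => h; apply: no; exists a.
have gd : ga != 0 \/ de != 0.
  have [g0|] := eqVneq ga 0; [right | by left].
  have [n1 _ _] := outer_neq T; apply: contra n1 => /eqP d0.
  by apply/eqP/gen; rewrite g0 d0 /lin !mul0r.
have gd' : - ga != 0 \/ - de != 0 by rewrite !oppr_eq0.
have [a va ha] := interior_surrounded T iv gd'; have [b vb hb] := interior_surrounded T iv gd.
split; [exists a => // | exists b => //]; rewrite /lt /lex eqF ?eqxx ?ltxx //= /G /lin.
  by move: ha; lra.
by move: hb; lra.
Qed.

Lemma up_trans_uniq v a b a' b' : ~~ outer v -> facet v a b -> facet v a' b' ->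
  lt a v -> lt v b -> lt a' v -> lt v b' -> a = a' /\ b = b'.
Proof. by move=> iv; apply: ups_uniq; apply: (ups1 T st) iv => u; apply: both_sides. Qed.

Lemma down_trans_uniq v a b a' b' : ~~ outer v -> facet v a b -> facet v a' b' ->
  lt v a -> lt b v -> lt v a' -> lt b' v -> a = a' /\ b = b'.
Proof.
move=> iv f f' h1 h2 h3 h4; apply: (@ups_uniq _ _ d adj o1 o2 o3 (converse lt) v) => //.
by apply: (ups1 T (strict_total_conv st)) iv => u /both_sides[].
Qed.

End Order.

(** Choose a tie-break with [k] below and [k'] above [v]. Under the reversed tie-break the flat face
    [v k k'] is the only passage from above to below, so the rotation leaves [F > F v] towards a
    flat neighbour [a'] and enters [F < F v] from a flat neighbour [c]. Under the original tie-break
    these become two passages from above to below, and they differ because [F a > F c]. *)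
Lemma flat_nbrs v k k' al be : ~~ outer v -> face v k k' ->
  lin al be (D k) = lin al be (D v) -> lin al be (D k') = lin al be (D v) ->
  forall a, adj v a -> lin al be (D a) = lin al be (D v).
Proof.
move=> iv f Fk Fk'; apply: NNPP => no.
have {no}ne : exists2 a, adj v a & lin al be (D a) != lin al be (D v).
  apply: NNPP => no'; apply: no => a va; apply/eqP/negPn/negP => h.
  by apply: no'; exists a.
have [q vq Fq] := nbr_below iv ne; have [p vp Fp] := nbr_above iv ne.
have [vk _ _ Dp _] := faceP f.
have [ga [de [gen Gk Gk']]] := generic_sep Dp.
have gen' : injective (fun u => lin (- ga) (- de) (d u)).
  by move=> x y E; apply: gen; move: E; rewrite /lin; lra.
have neg u : lin (- ga) (- de) (d u) = - lin ga de (d u) by rewrite /lin; ring.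
pose F u := lin al be (D u); pose G u := lin ga de (d u).
have ff : facet v k k' by rewrite /Submission.facet f.
have up1 := up_trans_uniq (al := al) (be := be) gen iv.
have dn1 := down_trans_uniq (al := al) (be := be) gen iv.
have dn2 := down_trans_uniq (al := al) (be := be) gen' iv.
have Gv u : adj v u -> G u != G v.
  by move=> vu; apply: contraTneq vu => /gen ->; rewrite (tri_irr T).
have dn2k a b : facet v a b -> lex F (fun u => lin (- ga) (- de) (d u)) v a ->
    lex F (fun u => lin (- ga) (- de) (d u)) b v -> a = k /\ b = k'.
  move=> fab h1 h2; apply: dn2 fab ff h1 h2 _ _; rewrite /lex ?Fk ?Fk' eqxx /= !neg ltrN2.
    by rewrite Gk orbT.
  by rewrite Gk' orbT.
have [a [a' [faa' /= Pa nPa']]] : exists a b, [/\ facet v a b, F v < F a & ~~ (F v < F b)].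
  by apply: (link_exit (A := fun z => F v < F z)); [exists p | exists k; rewrite //= /F Fk ltxx].
have [c [c' [fcc' /= nNc /negPn Nc']]] : exists a b, [/\ facet v a b, ~~ (F a < F v) & ~~ ~~ (F b < F v)].
  apply: (link_exit (A := fun a => ~~ (F a < F v))); first by exists k; rewrite //= /F Fk ltxx.
  by exists q; rewrite //= negbK.
have va' := facet_adj3 T faa'; have vc := facet_adj T fcc'.
have a'B : F a' = F v /\ G a' < G v.
  have nl : ~~ lex F (fun u => lin (- ga) (- de) (d u)) a' v.
    apply/negP => h; have [|ak _] := dn2k _ _ faa' _ h; first by rewrite /lex Pa.
    by move: Pa; rewrite ak /F Fk ltxx.
  move: nl nPa'; rewrite /lex; have [//|//|E] /= := ltgtP (F a') (F v).
  by rewrite !neg ltrN2 -leNgt => h _; split=> //; rewrite lt_def h eq_sym Gv.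
have cA : F c = F v /\ G v < G c.
  have nl : ~~ lex F (fun u => lin (- ga) (- de) (d u)) v c.
    apply/negP => h; have [|_ ck] := dn2k _ _ fcc' h; first by rewrite /lex Nc'.
    by move: Nc'; rewrite ck /F Fk' ltxx.
  move: nl nNc; rewrite /lex; have [//|//|E] /= := ltgtP (F v) (F c); last first.
    by rewrite !neg ltrN2 -leNgt => h _; split=> //; rewrite lt_def h Gv.
have [||||E _] := dn1 _ _ _ _ faa' fcc'; rewrite /lex ?Pa ?Nc' //.
- by rewrite -/(F _) -/(F _) a'B.1 eqxx -/(G _) -/(G _) a'B.2 orbT.
- by rewrite -/(F _) -/(F _) cA.1 eqxx -/(G _) -/(G _) cA.2 orbT.
by move: Pa; rewrite E cA.1 ltxx.
Qed.

Lemma face_rot a b c : face a b c -> face b c a.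
Proof. by rewrite face_cyc. Qed.

Lemma face_all_outer a b c : face a b c -> outer a -> outer b -> outer c ->
  [/\ o1 \in [:: a; b; c], o2 \in [:: a; b; c] & o3 \in [:: a; b; c]].
Proof.
move=> /faceP[ab bc ca _ _]; move: (adj_neq T ab) (adj_neq T bc) (adj_neq T ca).
by move=> n1 n2 n3 /outerP[] ? /outerP[] ? /outerP[] ?; subst; rewrite ?eqxx // in n1 n2 n3 *; rewrite !inE !eqxx !orbT.
Qed.

(** By [flat_nbrs] a degenerate face at an inner vertex puts all neighbours of that vertex on one
    level line. This spreads until the three outer vertices lie on the line, against [noncol]. *)
Lemma face_nonflat a b c : face a b c -> S a b c != 0.
Proof.
move=> f; apply/negP => /eqP /collinear_lin[al [be [ab0 [e1 e2]]]].
pose c0 := lin al be (D a).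
pose K v := [exists x, [exists y, [&& face v x y, lin al be (D v) == c0,
  lin al be (D x) == c0 & lin al be (D y) == c0]]].
have KI v x y : face v x y -> lin al be (D v) = c0 -> lin al be (D x) = c0 ->
    lin al be (D y) = c0 -> K v.
  by move=> f' h1 h2 h3; apply/existsP; exists x; apply/existsP; exists y; rewrite f' h1 h2 h3 eqxx.
have KE v : K v -> lin al be (D v) = c0 by move=> /existsP[x /existsP[y /and4P[_ /eqP]]].
have contra_outer : lin al be (D o1) = c0 -> lin al be (D o2) = c0 -> lin al be (D o3) = c0 -> False.
  by move=> h1 h2 h3; move/eqP: noncol; apply; apply: (lin_collinear ab0); rewrite h1.
have cl v w : K v -> ~~ outer v -> adj v w -> K w.
  move=> /existsP[x /existsP[y /and4P[f' /eqP h1 /eqP h2 /eqP h3]]] iv vw.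
  have fl := flat_nbrs (al := al) (be := be) iv f'.
  have [z fz] := facet_exists T vw; have fz' := facet_inner iv fz.
  have {}fl u : adj v u -> lin al be (D u) = c0.
    by move=> vu; rewrite -h1; apply: fl vu; rewrite h1.
  exact: KI (face_rot fz') (fl _ vw) (fl _ (facet_adj3 T fz)) h1.
have reach : (exists2 v, K v & ~~ outer v) -> False.
  by move=> ex; have [h1 h2 h3] := reach_outer T ex cl; apply: contra_outer; apply: KE.
have [oa|ia] := boolP (outer a); last first.
  by apply: reach; exists a => //; apply: KI f _ _ _.
have [ob|ib] := boolP (outer b); last first.
  by apply: reach; exists b => //; apply: KI (face_rot f) _ _ _.
have [oc|ic] := boolP (outer c); last first.
  by apply: reach; exists c => //; apply: KI (face_rot (face_rot f)) _ _ _.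
have [h1 h2 h3] := face_all_outer f oa ob oc.
have E u : u \in [:: a; b; c] -> lin al be (D u) = c0.
  by rewrite !inE => /or3P[]/eqP->.
by apply: contra_outer; apply: E.
Qed.

(** If the orientation changes across [v b], then [a] and [c] are on the same side of the image of
    this edge. With a tie-break that puts [b] below [v], uniqueness of the passages makes [b] the
    only lower neighbour; the functional then has a one-sided minimum at [v], against
    [surrounded]. *)
Lemma orient_step v a b c : ~~ outer v -> face v a b -> face v b c -> 0 < S v a b * S v b c.
Proof.
move=> iv f1 f2; rewrite ltNge; apply/negP => neg.
have n1 := face_nonflat f1; have n2 := face_nonflat f2.
have {}neg : S v a b * S v b c < 0 by rewrite lt_def neg eq_sym mulf_neq0.
have [va ab bv _ _] := faceP f1; have [vb bc cv _ _] := faceP f2.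
have vc : adj v c by rewrite (tri_sym T).
have [sg [sgn [h1 h2]]] : exists sg : R, sg != 0 /\ 0 < sg * S v b a /\ 0 < sg * S v b c.
  have [p|p|E] := ltgtP (S v a b) 0; last by rewrite E eqxx in n1.
    exists 1; rewrite oner_eq0 !mul1r cr_swap oppr_gt0 p; split=> //; split=> //.
    by rewrite -(nmulr_rlt0 _ p).
  exists (-1); rewrite oppr_eq0 oner_eq0 !mulN1r [S v b a]cr_swap opprK p; split=> //; split=> //.
  by rewrite oppr_gt0 -(pmulr_rlt0 _ p).
have [al [be LE]] : exists al be, forall z : point R, lin al be z - lin al be (D v) = sg * cr (D v) (D b) z.
  exists (- sg * ((D b).2 - (D v).2)), (sg * ((D b).1 - (D v).1)) => z.
  by rewrite /lin /cr; ring.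
pose F u := lin al be (D u).
have Fa : F v < F a by rewrite -subr_gt0 LE.
have Fc : F v < F c by rewrite -subr_gt0 LE.
have Fb : F b = F v by apply/eqP; rewrite -subr_eq0 LE cr_abb mulr0.
have [ga [de [gen Gb]]] : exists ga de, injective (fun u => lin ga de (d u)) /\ lin ga de (d b) < lin ga de (d v).
  have [ga [de gen]] := generic_exists T.
  have [h|h|h] := ltgtP (lin ga de (d b)) (lin ga de (d v)); first by exists ga, de.
    exists (- ga), (- de); split; last by move: h; rewrite /lin; lra.
    by move=> x y E; apply: gen; move: E; rewrite /lin; lra.
  by move/gen: h => h; rewrite h (tri_irr T) in bv.
pose lt := lex F (fun u => lin ga de (d u)).
have lb : lt b v by rewrite /lt /lex Fb eqxx Gb orbT.
have la : lt v a by rewrite /lt /lex Fa.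
have lc : lt v c by rewrite /lt /lex Fc.
have [irr tr tot] : strict_total lt by apply: lex_total.
have dn := down_trans_uniq (al := al) (be := be) gen iv.
have up := up_trans_uniq (al := al) (be := be) gen iv.
have ff1 : facet v a b by rewrite /Submission.facet f1.
have ff2 : facet v b c by rewrite /Submission.facet f2.
have above z : adj v z -> z != b -> lt v z.
  move=> vz zb; apply/negPn/negP => nl.
  have zv : z != v by rewrite eq_sym (adj_neq T vz).
  have lz : lt z v by have := tot _ _ zv; rewrite (negPf nl) orbF.
  suff : lt a v && (a != b) by move=> /andP[h _]; have := tr _ _ _ la h; rewrite irr.
  apply: (link_connected T (A := fun x => lt x v && (x != b)) _ _ va); first by exists z; rewrite ?lz.
  move=> x y /andP[lx xb] f.
  have [_ _ yv] := facet_neq T f.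
  have ly : lt y v.
    have /orP[//|vy] := tot _ _ yv.
    by have [E _] := up _ _ _ _ f ff2 lx vy lb lc; rewrite E eqxx in xb.
  rewrite ly; apply: contraTneq lx => E; subst y.
  rewrite !(facet_cyc _ _ _ _ _ v) !(facet_cyc _ _ _ _ _ _ _ v) in f ff1.
  rewrite (facet_uniq T f ff1); apply/negP => h.
  by have := tr _ _ _ la h; rewrite irr.
have : F a = F v.
  apply: (surrounded iv) va => z vz; have [->|zb] := eqVneq z b; first by rewrite -!/(F _) Fb.
  have := above z vz zb; rewrite /lt /lex -!/(F _) => /orP[/ltW //|/andP[/eqP-> _]] //.
by move=> E; rewrite E ltxx in Fa.
Qed.

Lemma orient_at v a b a' b' : ~~ outer v -> face v a b -> face v a' b' -> 0 < S v a b * S v a' b'.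
Proof.
move=> iv f f'.
have fs z : adj v z -> face v z (succ d adj o1 o2 o3 v z).
  by move=> vz; apply: facet_inner => //; apply: succP.
have ff : facet v a b by rewrite /Submission.facet f.
have ff' : facet v a' b' by rewrite /Submission.facet f'.
have va := facet_adj T ff; have va' := facet_adj T ff'.
have := link_connected T (A := fun z => adj v z && (0 < S v a b * S v z (succ d adj o1 o2 o3 v z))) _ _ va'.
rewrite (succ_E T ff') va' /=; apply.
  exists a => //; rewrite va (succ_E T ff) /= -expr2 exprn_even_gt0 //=; exact: face_nonflat f.
move=> x y /andP[vx hx] fxy; have vy := facet_adj3 T fxy; rewrite vy /=.
apply: pos_trans hx _; rewrite (succ_E T fxy).
by apply: orient_step => //; [apply: facet_inner | apply: fs].
Qed.

(** Consecutive faces at [o1] agree because their common edge ends in an inner vertex. Elsewhere a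
    face of the wrong sign would spread through inner vertices as far as [o1]. *)
Lemma orient a b c a' b' c' : face a b c -> face a' b' c' -> 0 < S a b c * S a' b' c'.
Proof.
have [n12 n23 n31] := outer_neq T.
have og : ogon o1 o2 o3 o1 o3 o2 by rewrite /ogon !inE eqxx.
have [c0 fc0] := facet_exists T (tri_o12 T).
have f0 : face o1 o2 c0.
  case/orP: fc0 => // /ogonP[][e1 e2 _].
  - by rewrite e2 eqxx in n23.
  - by rewrite e1 eqxx in n31.
  by rewrite e1 eqxx in n12.
have SS : 0 < S o1 o2 c0 * S o1 o2 c0.
  by rewrite -expr2 exprn_even_gt0 //=; exact: face_nonflat f0.
pose nx := succ d adj o1 o2 o3 o1.
have no3 x y : face o1 x y -> x != o3.
  move=> /faceP[_ _ _ h _]; apply: contraTneq h => ->.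
  by rewrite -leNgt (ogon_side T _ og).
have at1 x y : face o1 x y -> 0 < S o1 o2 c0 * S o1 x y.
  move=> f; have ff : facet o1 x y by rewrite /Submission.facet f.
  have v1 := facet_adj T ff.
  have := link_connected T (A := fun z => (z == o3) || (0 < S o1 o2 c0 * S o1 z (nx z))) _ _ v1.
  rewrite (negPf (no3 _ _ f)) /nx (succ_E T ff); apply.
    exists o2; first exact: tri_o12 T.
    by rewrite (succ_E T fc0) SS orbT.
  move=> z z' h fz; have [->|z'3] := eqVneq z' o3; first by [].
  have [z3|z3] := eqVneq z o3.
    have ff3 : facet o1 z o2 by rewrite z3 /Submission.facet og orbT.
    by rewrite (facet_uniq T fz ff3) (succ_E T fc0) SS orbT.
  have z'2 : z' != o2.
    apply: contraNneq z3 => E; subst z'.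
    have ff3 : facet o1 o3 o2 by rewrite /Submission.facet og orbT.
    rewrite !(facet_cyc _ _ _ _ _ o1) !(facet_cyc _ _ _ _ _ _ _ o1) in fz ff3.
    by rewrite (facet_uniq T fz ff3).
  have [_ _ z'1] := facet_neq T fz.
  have iz' : ~~ outer z' by rewrite /Submission.outer !inE !negb_or z'1 z'2.
  have v1z' := facet_adj3 T fz; have fz'' := succP T v1z'.
  have in_ u w : facet o1 u w -> u != o3 -> face o1 u w.
    move=> /orP[//|/ogonP[][e1 e2 _]]; first by rewrite e2 eqxx.
      by rewrite e1 eqxx in n31.
    by rewrite e1 eqxx in n12.
  move: h; rewrite (negPf z3) (succ_E T fz) /= => h; apply: pos_trans h _.
  rewrite (cr_cyc (D z') (D o1) (D z)) -(cr_cyc (D o1) (D z')).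
  by apply: orient_at => //; [apply/face_rot/face_rot/in_ | apply/face_rot/in_].
have all a1 b1 c1 : face a1 b1 c1 -> 0 < S o1 o2 c0 * S a1 b1 c1.
  move=> f; rewrite ltNge; apply/negP => neg.
  have n1 := face_nonflat f; have n2 := face_nonflat f0.
  pose K v := [exists x, [exists y, face v x y && (S o1 o2 c0 * S v x y <= 0)]].
  have KI v x y : face v x y -> S o1 o2 c0 * S v x y <= 0 -> K v.
    by move=> f' h; apply/existsP; exists x; apply/existsP; exists y; rewrite f'.
  have K1 : K o1 -> False.
    by move=> /existsP[x /existsP[y /andP[f' h]]]; have := at1 _ _ f'; rewrite ltNge h.
  have cl v w : K v -> ~~ outer v -> adj v w -> K w.
    move=> /existsP[x /existsP[y /andP[f' h]]] iv vw.
    have [z /(facet_inner iv) fz] := facet_exists T vw.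
    apply: (KI w z v); first exact: face_rot.
    rewrite (cr_cyc (D v)) leNgt; apply/negP => h'; move: h; rewrite leNgt => /negP; apply.
    by apply: pos_trans h' _; apply: orient_at.
  have reach : (exists2 v, K v & ~~ outer v) -> False.
    by move=> ex; apply: K1; have [] := reach_outer T ex cl.
  have neg2 : S o1 o2 c0 * S b1 c1 a1 <= 0 by rewrite (cr_cyc (D a1)).
  have neg3 : S o1 o2 c0 * S c1 a1 b1 <= 0 by rewrite -(cr_cyc (D c1)).
  have Ka := KI _ _ _ f neg; have Kb := KI _ _ _ (face_rot f) neg2.
  have Kc := KI _ _ _ (face_rot (face_rot f)) neg3.
  have [oa|ia] := boolP (outer a1); last by apply: reach; exists a1.
  have [ob|ib] := boolP (outer b1); last by apply: reach; exists b1.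
  have [oc|ic] := boolP (outer c1); last by apply: reach; exists c1.
  have [h1 _ _] := face_all_outer f oa ob oc; apply: K1.
  by move: h1; rewrite !inE => /or3P[]/eqP->.
by move=> f f'; have h := all _ _ _ f; rewrite mulrC in h; apply: pos_trans h (all _ _ _ f').
Qed.

End Drawing.

(** * Signed ray crossings, degree, and injectivity of the map *)

Section Crossing.
Variable R : realType.
Implicit Types p q r z : point R.

(* Signed crossing of the downward vertical ray from z with the segment p q. *)
Definition chi z p q : R :=
  ([&& p.1 < z.1, z.1 < q.1 & 0 < cr p q z])%:R - ([&& q.1 < z.1, z.1 < p.1 & 0 < cr q p z])%:R.

Definition inside z p q r := [&& 0 < cr p q z, 0 < cr q r z & 0 < cr r p z].

Lemma chi_anti z p q : chi z q p = - chi z p q.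
Proof. by rewrite /chi opprB. Qed.

Lemma inside_rot z p q r : inside z q r p = inside z p q r.
Proof. by rewrite /inside andbA andbC. Qed.

Lemma x_balance z p q r : (p.1 - z.1) * cr q r z + (q.1 - z.1) * cr r p z + (r.1 - z.1) * cr p q z = 0.
Proof. by rewrite /cr; ring. Qed.

Lemma chi_left z p q r : 0 < cr p q r -> cr p q z != 0 -> cr r p z != 0 ->
  p.1 < z.1 -> z.1 < q.1 -> z.1 < r.1 ->
  chi z p q + chi z q r + chi z r p = (inside z p q r)%:R.
Proof.
move=> D0 nA nC hp hq hr; have W := x_balance z p q r; have Sm := cr_sum p q r z.
rewrite /chi /inside hp hq hr (ltNge r.1) (ltW hr) (ltNge q.1) (ltW hq) (ltNge z.1 p.1) (ltW hp) /=.
rewrite ?andbF /= (cr_swap12 r p) oppr_gt0 !subr0 sub0r addr0.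
have [C|C|C] := ltgtP (cr r p z) 0; last by rewrite C eqxx in nC.
  have [A|A|A] := ltgtP (cr p q z) 0; last by rewrite A eqxx in nA.
    have h1 : 0 <= (q.1 - z.1) * (- cr r p z) by apply: mulr_ge0; lra.
    have h2 : 0 <= (r.1 - z.1) * (- cr p q z) by apply: mulr_ge0; lra.
    have : 0 <= (z.1 - p.1) * (- cr q r z) by lra.
    by rewrite pmulr_rge0 ?subr_gt0 //; lra.
  by rewrite !andbF /= subrr.
have [A|A|A] := ltgtP (cr p q z) 0; last by rewrite A eqxx in nA.
  by rewrite /= subrr.
have h1 : 0 < (q.1 - z.1) * cr r p z by apply: mulr_gt0; lra.
have h2 : 0 < (r.1 - z.1) * cr p q z by apply: mulr_gt0; lra.
have : 0 < (z.1 - p.1) * cr q r z by lra.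
by rewrite pmulr_rgt0 ?subr_gt0 // => ->; rewrite subr0.
Qed.

Lemma chi_right z p q r : 0 < cr p q r -> cr p q z != 0 -> cr r p z != 0 ->
  z.1 < p.1 -> q.1 < z.1 -> r.1 < z.1 ->
  chi z p q + chi z q r + chi z r p = (inside z p q r)%:R.
Proof.
move=> D0 nA nC hp hq hr; have W := x_balance z p q r; have Sm := cr_sum p q r z.
rewrite /chi /inside hp hq hr (ltNge z.1 r.1) (ltW hr) (ltNge z.1 q.1) (ltW hq) (ltNge p.1) (ltW hp) /=.
rewrite ?andbF /= (cr_swap12 p q) oppr_gt0 !subr0 sub0r addr0.
have [C|C|C] := ltgtP (cr r p z) 0; last by rewrite C eqxx in nC.
  have [A|A|A] := ltgtP (cr p q z) 0; last by rewrite A eqxx in nA.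
    have h1 : 0 <= (z.1 - q.1) * (- cr r p z) by apply: mulr_ge0; lra.
    have h2 : 0 <= (z.1 - r.1) * (- cr p q z) by apply: mulr_ge0; lra.
    have : 0 <= (p.1 - z.1) * (- cr q r z) by lra.
    by rewrite pmulr_rge0 ?subr_gt0 //; lra.
  by rewrite !andbF /= oppr0 addr0.
have [A|A|A] := ltgtP (cr p q z) 0; last by rewrite A eqxx in nA.
  by rewrite /= addrC subrr.
have h1 : 0 < (z.1 - q.1) * cr r p z by apply: mulr_gt0; lra.
have h2 : 0 < (z.1 - r.1) * cr p q z by apply: mulr_gt0; lra.
have : 0 < (p.1 - z.1) * cr q r z by lra.
by rewrite pmulr_rgt0 ?subr_gt0 // => ->; rewrite oppr0 add0r.
Qed.

Lemma chi_same z p q : (p.1 < z.1) = (q.1 < z.1) -> (z.1 < p.1) = (z.1 < q.1) -> chi z p q = 0.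
Proof.
rewrite /chi => -> ->; have [h|h|h] := ltgtP q.1 z.1; rewrite ?andbF ?subrr //=.
Qed.

(** The sum is the winding number of the triangle around [z]. Up to rotation, either one corner is
    alone on its side of the vertical through [z] ([chi_left], [chi_right]), or the ray meets no
    side. *)
Lemma chi_inside z p q r : 0 < cr p q r -> cr p q z != 0 -> cr q r z != 0 -> cr r p z != 0 ->
  p.1 != z.1 -> q.1 != z.1 -> r.1 != z.1 ->
  chi z p q + chi z q r + chi z r p = (inside z p q r)%:R.
Proof.
move=> D0 nA nB nC np nq nr; have W := x_balance z p q r.
have D1 : 0 < cr q r p by rewrite cr_cyc.
have D2 : 0 < cr r p q by rewrite -cr_cyc.
have rot1 : chi z p q + chi z q r + chi z r p = chi z q r + chi z r p + chi z p q by ring.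
have rot2 : chi z p q + chi z q r + chi z r p = chi z r p + chi z p q + chi z q r by ring.
have [hp|hp|hp] := ltgtP p.1 z.1; last by rewrite hp eqxx in np.
- have [hq|hq|hq] := ltgtP q.1 z.1; last by rewrite hq eqxx in nq.
  + have [hr|hr|hr] := ltgtP r.1 z.1; last by rewrite hr eqxx in nr.
    * rewrite !chi_same ?hp ?hq ?hr ?(ltNge z.1) ?(ltW hp) ?(ltW hq) ?(ltW hr) // !addr0.
      rewrite (_ : inside _ _ _ _ = false) //; apply/negP => /and3P[a b c].
      have h1 : 0 < (z.1 - p.1) * cr q r z by apply: mulr_gt0; lra.
      have h2 : 0 < (z.1 - q.1) * cr r p z by apply: mulr_gt0; lra.
      have h3 : 0 < (z.1 - r.1) * cr p q z by apply: mulr_gt0; lra.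
      lra.
    * by rewrite rot2 -2!inside_rot; apply: chi_right.
  have [hr|hr|hr] := ltgtP r.1 z.1; last by rewrite hr eqxx in nr.
  * by rewrite rot1 -inside_rot; apply: chi_right.
  * exact: chi_left.
have [hq|hq|hq] := ltgtP q.1 z.1; last by rewrite hq eqxx in nq.
+ have [hr|hr|hr] := ltgtP r.1 z.1; last by rewrite hr eqxx in nr.
  * exact: chi_right.
  * by rewrite rot1 -inside_rot; apply: chi_left.
have [hr|hr|hr] := ltgtP r.1 z.1; last by rewrite hr eqxx in nr.
* by rewrite rot2 -2!inside_rot; apply: chi_left.
rewrite !chi_same ?hp ?hq ?hr ?(ltNge _ z.1) ?(ltW hp) ?(ltW hq) ?(ltW hr) // !addr0.
rewrite (_ : inside _ _ _ _ = false) //; apply/negP => /and3P[a b c].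
have h1 : 0 < (p.1 - z.1) * cr q r z by apply: mulr_gt0; lra.
have h2 : 0 < (q.1 - z.1) * cr r p z by apply: mulr_gt0; lra.
have h3 : 0 < (r.1 - z.1) * cr p q z by apply: mulr_gt0; lra.
lra.
Qed.

Lemma chi_ge z p q r : cr p q r != 0 -> cr p q z != 0 -> cr q r z != 0 -> cr r p z != 0 ->
  p.1 != z.1 -> q.1 != z.1 -> r.1 != z.1 -> -1 <= chi z p q + chi z q r + chi z r p.
Proof.
move=> n nA nB nC np nq nr; have [h|h|h] := ltgtP (cr p q r) 0; last by rewrite h eqxx in n.
  have E : chi z r q + chi z q p + chi z p r = (inside z r q p)%:R.
    apply: chi_inside => //; rewrite cr_swap12 ?oppr_eq0 ?oppr_gt0 //.
    by rewrite cr_cyc.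
  rewrite (chi_anti z q r) (chi_anti z p q) (chi_anti z r p) in E.
  have : (inside z r q p)%:R <= 1 :> R by rewrite lern1 leq_b1.
  lra.
by rewrite chi_inside // (le_trans _ (ler0n _ _)) // lerN10.
Qed.

(** The filter of statements valid for all sufficiently small positive [e]; it collects finitely
    many open conditions. *)
Definition small (P : R -> Prop) := exists e0, 0 < e0 /\ forall e, 0 < e < e0 -> P e.

Lemma small_and (P Q : R -> Prop) : small P -> small Q -> small (fun e => P e /\ Q e).
Proof.
move=> [e1 [p1 h1]] [e2 [p2 h2]]; exists (Num.min e1 e2); split; first by rewrite lt_min p1.
by move=> e; rewrite lt_min => /and3P[e0 h h']; split; [apply: h1|apply: h2]; rewrite e0.
Qed.

Lemma small_sub (P Q : R -> Prop) : (forall e, 0 < e -> P e -> Q e) -> small P -> small Q.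
Proof.
by move=> PQ [e1 [p1 h1]]; exists e1; split=> // e h; apply: PQ (h1 _ h); case/andP: h.
Qed.

Lemma small_all (I : finType) (P : I -> R -> Prop) : (forall i, small (P i)) -> small (fun e => forall i, P i e).
Proof.
move=> H; suff [e0 [e0p h]] : small (fun e => forall i, i \in enum I -> P i e).
  by exists e0; split=> // e he i; apply: h; rewrite // mem_enum.
elim: (enum I) => [|x s IH]; first by exists 1; split.
apply: small_sub (small_and (H x) IH) => e _ [h1 h2] i; rewrite inE => /orP[/eqP-> //|].
exact: h2.
Qed.

Lemma small_ex (P : R -> Prop) : small P -> exists e, 0 < e /\ P e.
Proof.
by move=> [e [e0 h]]; exists (e / 2); split; [lra | apply: h; lra].
Qed.

Lemma small_lin (A B : R) : 0 < A \/ A = 0 /\ 0 < B -> small (fun e => 0 < A + e * B).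
Proof.
case=> [h|[-> B0]]; first exact: lin_pos_small.
by exists 1; split=> // e /andP[e0 _]; rewrite add0r mulr_gt0.
Qed.

Lemma small_neq (A B : R) : A != 0 \/ B != 0 -> small (fun e => A + e * B != 0).
Proof.
move=> h; have [A0|A0|A0] := ltgtP A 0.
- apply: small_sub (@small_lin (- A) (- B) _); last by left; lra.
  by move=> e _ h'; rewrite lt_eqF //; lra.
- by apply: small_sub (@small_lin A B _) => [e _ h'|]; [rewrite gt_eqF | left].
have {}h : B != 0 by case: h => //; rewrite A0 eqxx.
by exists 1; split=> // e /andP[e0 _]; rewrite A0 add0r mulf_neq0 // gt_eqF.
Qed.

Definition shift p (m e : R) : point R := (p.1 + e, p.2 + e * m).

Lemma cr_shift p q z m e : cr p q (shift z m e) = cr p q z + e * ((q.1 - p.1) * m - (q.2 - p.2)).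
Proof. by rewrite /cr /shift /=; ring. Qed.

End Crossing.

Section Drawing.
Variables (R : realType) (V : finType) (d : V -> point R) (adj : rel V).
Variables (o1 o2 o3 : V).
Hypothesis T : triang d adj o1 o2 o3.
Implicit Types (a b c v w : V) (z : point R).
Notation face := (face d adj).
Notation facet := (facet d adj o1 o2 o3).
Notation outer := (outer o1 o2 o3).
Variable D : V -> point R.
Hypothesis surrounded : forall v al be, ~~ outer v ->
  (forall a, adj v a -> lin al be (D v) <= lin al be (D a)) ->
  forall a, adj v a -> lin al be (D a) = lin al be (D v).
Hypothesis noncol : cr (D o1) (D o2) (D o3) != 0.
Hypothesis pos : forall a b c, face a b c -> 0 < cr (D a) (D b) (D c).
Notation S a b c := (cr (D a) (D b) (D c)).

Definition generic_pt (z : point R) := (forall u, (D u).1 != z.1) /\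
  forall a b, D a != D b -> cr (D a) (D b) z != 0.

Lemma face_D_neq a b c : face a b c -> D a != D b.
Proof. by move/pos; apply: contraTneq => ->; rewrite cr_aab ltxx. Qed.

(** Each directed edge lies in exactly one facet and [chi] is antisymmetric, so the two directions
    of an edge cancel. *)
Lemma sum_chi z : \sum_a \sum_b \sum_c (facet a b c)%:R * chi z (D a) (D b) = 0.
Proof.
pose X := \sum_a \sum_b (adj a b)%:R * chi z (D a) (D b).
have E : \sum_a \sum_b \sum_c (facet a b c)%:R * chi z (D a) (D b) = X.
  apply: eq_bigr => a _; apply: eq_bigr => b _; rewrite -big_distrl /=; congr (_ * _).
  case ab: (adj a b); last first.
    by rewrite big1 // => c _; case f: (facet a b c) => //; rewrite (facet_adj T f) in ab.
  have [c fc] := facet_exists T ab.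
  rewrite (bigD1 c) //= fc big1 ?addr0 // => c' ne.
  case f: (facet a b c') => //; by rewrite (facet_uniq T f fc) eqxx in ne.
have : X = - X.
  rewrite {1}/X exchange_big -sumrN; apply: eq_bigr => a _; rewrite -sumrN.
  by apply: eq_bigr => b _; rewrite (tri_sym T) chi_anti mulrN.
by rewrite E; lra.
Qed.

Lemma rot_sum (F : V -> V -> V -> R) :
  \sum_a \sum_b \sum_c F b c a = \sum_a \sum_b \sum_c F a b c.
Proof.
rewrite exchange_big /=; apply: eq_bigr => b _; rewrite exchange_big; apply: eq_bigr => c _.
by [].
Qed.

(** A degree argument: the contributions of all facets cancel, an inner face contributes 1 or 0, and
    the unbounded facet at least -1. Everything is counted with three rotations, so the bound 3
    means a single face. *)
Lemma cover_le3 z : generic_pt z ->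
  (#|[set t : V * V * V | face t.1.1 t.1.2 t.2 && inside z (D t.1.1) (D t.1.2) (D t.2)]| <= 3)%N.
Proof.
move=> [gx gc]; set A := [set t | _].
pose F a b c : R := (facet a b c)%:R * chi z (D a) (D b).
pose F3 a b c : R := (facet a b c)%:R * (chi z (D a) (D b) + chi z (D b) (D c) + chi z (D c) (D a)).
have E3 : \sum_a \sum_b \sum_c F3 a b c = 0.
  transitivity (\sum_a \sum_b \sum_c (F a b c + F b c a + F c a b)).
    apply: eq_bigr => a _; apply: eq_bigr => b _; apply: eq_bigr => c _.
    by rewrite /F3 /F (facet_cyc _ _ _ _ _ c) -(facet_cyc _ _ _ _ _ a); ring.
  have split3 (F1 F2 : V -> V -> V -> R) : \sum_a \sum_b \sum_c (F1 a b c + F2 a b c) =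
      \sum_a \sum_b \sum_c F1 a b c + \sum_a \sum_b \sum_c F2 a b c.
    rewrite -big_split; apply: eq_bigr => a _; rewrite -big_split.
    by apply: eq_bigr => b _; rewrite -big_split.
  have F0 : \sum_a \sum_b \sum_c F a b c = 0 by apply: sum_chi.
  rewrite !split3 F0 (rot_sum F) F0 -(rot_sum (fun a b c => F c a b)) F0; ring.
pose P (t : V * V * V) : R := (t \in A)%:R - (ogon o1 o2 o3 t.1.1 t.1.2 t.2)%:R.
have le0 : \sum_t P t <= 0.
  have E4 : \sum_(t : V * V * V) F3 t.1.1 t.1.2 t.2 = 0 by rewrite -[RHS]E3 !pair_bigA.
  rewrite -[X in _ <= X]E4; apply: ler_sum => -[[a b] c] _ /=.
  rewrite /P /F3 inE /= /Submission.facet.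
  have neq x y : S x y x = 0 by rewrite cr_aba.
  case f: (face a b c) => /=.
    have -> : ogon o1 o2 o3 a b c = false.
      apply/negP => og; have := ogon_side T c og; have [_ _ _ h _] := faceP f; lra.
    rewrite mul1r subr0 chi_inside //; first exact: pos.
    - exact: gc (face_D_neq f).
    - by apply: gc (face_D_neq (face_rot f)).
    - by apply: gc (face_D_neq (face_rot (face_rot f))).
  case og: (ogon o1 o2 o3 a b c); rewrite ?mul0r ?subrr // mul1r sub0r.
  have n : S a b c != 0.
    case/ogonP: og => -[-> -> ->].
    - by rewrite cr_swap oppr_eq0.
    - by rewrite cr_cyc cr_swap oppr_eq0.
    - by rewrite cr_swap12 oppr_eq0.
  apply: chi_ge => //; apply: gc; apply: contraNneq n => ->; rewrite ?cr_aab ?cr_aba ?cr_abb //.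
have O3 : \sum_(t : V * V * V) (ogon o1 o2 o3 t.1.1 t.1.2 t.2)%:R <= 3%:R :> R.
  rewrite -natr_sum ler_nat.
  have -> : (\sum_(t : V * V * V) ogon o1 o2 o3 t.1.1 t.1.2 t.2 =
     #|[set t in [:: (o1, o3, o2); (o3, o2, o1); (o2, o1, o3)]]|)%N.
    by rewrite -sum1_card [RHS]big_mkcond; apply: eq_bigr => -[[a b] c] _; rewrite inE; case: ifP => //=; rewrite /ogon => ->.
  by rewrite cardsE; apply: leq_trans (card_size _) _.
move: le0; rewrite /P sumrB subr_le0 => le0; have := le_trans le0 O3.
rewrite -natr_sum ler_nat (_ : \sum_t _ = #|A|)%N //.
by rewrite -sum1_card [RHS]big_mkcond; apply: eq_bigr => t _; case: ifP.
Qed.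

Lemma cover_uniq z a b c a' b' c' : generic_pt z ->
  face a b c -> face a' b' c' -> inside z (D a) (D b) (D c) -> inside z (D a') (D b') (D c') ->
  (a', b', c') \in [:: (a, b, c); (b, c, a); (c, a, b)].
Proof.
move=> gz f f' i i'; apply/negPn/negP => no.
have := cover_le3 gz; rewrite leqNgt => /negP; apply.
have [/faceP[ab bc ca _ _] /faceP[ab' bc' ca' _ _]] := (f, f').
move: (adj_neq T ab) (adj_neq T bc) (adj_neq T ca) (adj_neq T ab') (adj_neq T bc') (adj_neq T ca') => n1 n2 n3 n4 n5 n6.
have sub : {subset [:: (a, b, c); (b, c, a); (c, a, b); (a', b', c')] <=
   [set t : V * V * V | face t.1.1 t.1.2 t.2 && inside z (D t.1.1) (D t.1.2) (D t.2)]}.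
  move=> t; rewrite !inE => /or4P[] /eqP-> /=; rewrite ?f ?f' ?i //=.
  - by rewrite (face_rot f) inside_rot.
  - by rewrite (face_rot (face_rot f)) -inside_rot.
have u : uniq [:: (a, b, c); (b, c, a); (c, a, b); (a', b', c')].
  rewrite /= !inE !negb_or !xpair_eqE (negPf n1) (negPf n2) andbF /= [a == c]eq_sym (negPf n3) /= andbT.
  by move: no; rewrite !inE !negb_or !xpair_eqE ![_ == a']eq_sym ![_ == b']eq_sym ![_ == c']eq_sym.
apply: leq_trans (subset_leq_card (A := [set t in [:: (a, b, c); (b, c, a); (c, a, b); (a', b', c')]]) _).
  by rewrite cardsE (card_uniqP u).
by apply/subsetP => t; rewrite inE => /sub.
Qed.


Lemma generic_dir : exists m, forall u v, D u != D v ->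
  ((D u).1 - (D v).1) * m - ((D u).2 - (D v).2) != 0.
Proof.
have [m [_ mn]] := avoid_finite [seq ((D uv.1).2 - (D uv.2).2) / ((D uv.1).1 - (D uv.2).1) | uv : V * V].
exists m => u v uv; apply/negP => /eqP E.
have [h|h] := eqVneq ((D u).1 - (D v).1) 0.
  move/negP: uv; apply; apply/eqP/point_eq; apply/eqP; rewrite -subr_eq0 ?h //.
  by move: E; rewrite h mul0r sub0r => /eqP; rewrite oppr_eq0.
move/negP: mn; apply; apply/mapP; exists (u, v); first by rewrite mem_enum.
by apply: (mulfI h); rewrite [RHS]mulrC divfK //=; lra.
Qed.

Variable m : R.
Hypothesis mgen : forall u v, D u != D v ->
  ((D u).1 - (D v).1) * m - ((D u).2 - (D v).2) != 0.

Lemma small_generic p : small (fun e => generic_pt (shift p m e)).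
Proof.
apply: small_and.
  apply: small_all => u; have := @small_neq R (p.1 - (D u).1) 1 (or_intror (oner_neq0 R)).
  apply: small_sub => e _; apply: contraNneq => ->; rewrite /shift /=; apply/eqP; ring.
apply: small_all => a; apply: small_all => b.
have [E|n] := eqVneq (D a) (D b); first by exists 1; split.
have h : ((D b).1 - (D a).1) * m - ((D b).2 - (D a).2) != 0 by apply: mgen; rewrite eq_sym.
apply: small_sub (@small_neq R (cr (D a) (D b) p) _ (or_intror h)) => e _ h' _.
by rewrite cr_shift.
Qed.

(** Open cells of dimension 0 and 1 under [D], indexed by their vertex sets. *)
Definition relint (c : {set V}) p := (exists2 v, c = [set v] & p = D v) \/
  (exists a b t, [/\ adj a b, c = [set a; b], 0 < t < 1 & p = lerp t (D a) (D b)]).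

(** The vertices of the triangle at which [p] has a nonzero barycentric coordinate: the cell of [p],
    recovered from a face. *)
Definition carrier a b c p u := [|| (u == a) && (cr (D b) (D c) p != 0),
  (u == b) && (cr (D c) (D a) p != 0) | (u == c) && (cr (D a) (D b) p != 0)].

(** For a vertex, the functional [lin m (-1)] is constant along the direction of the shift, and the
    face entered is the one where its value around [v] passes from above to below. For an edge it is
    the face on the left, after orienting the edge so that the shift goes left. *)
Lemma near_relint (c : {set V}) p : relint c p -> (forall v, v \in c -> ~~ outer v) ->
  exists x y w, [/\ face x y w, small (fun e => inside (shift p m e) (D x) (D y) (D w)) &
     forall u, (u \in c) = carrier x y w p u].
Proof.
case=> [[v cE pE]|[a0 [b0 [t0 [ab0 cE t01 pE]]]]] int.
  have iv : ~~ outer v by apply: int; rewrite cE set11.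
  have nb u : adj v u -> D u != D v.
    move=> vu; have [w /(facet_inner iv) f] := facet_exists T vu.
    by rewrite eq_sym; apply: face_D_neq f.
  have F u : lin m (-1) (D u) - lin m (-1) (D v) = ((D u).1 - (D v).1) * m - ((D u).2 - (D v).2).
    by rewrite /lin; ring.
  have [gen1 [gen2 gen]] := generic_exists T.
  have [u0 vu0 _] := interior_surrounded T iv (or_introl (oner_neq0 R) : 1 != 0 \/ (0 : R) != 0).
  have ex : exists2 u, adj v u & lin m (-1) (D u) != lin m (-1) (D v).
    by exists u0; rewrite // -subr_eq0 F mgen // nb.
  have [lo vlo hlo] := nbr_below surrounded iv ex.
  have [hi vhi hhi] := nbr_above surrounded iv ex.
  have [a [b [fab pa nb']]] : exists a b, [/\ facet v a b, lin m (-1) (D v) < lin m (-1) (D a)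
      & ~~ (lin m (-1) (D v) < lin m (-1) (D b))].
    apply: (link_exit T (A := fun u => lin m (-1) (D v) < lin m (-1) (D u))); first by exists hi.
    by exists lo; rewrite // -leNgt ltW.
  have f := facet_inner iv fab; have Sp := pos f.
  have hb : lin m (-1) (D b) < lin m (-1) (D v).
    rewrite lt_def leNgt nb' andbT eq_sym -subr_eq0 F mgen // nb //; exact: (facet_adj3 T fab).
  have pvE : cr (D a) (D b) p = S v a b by rewrite pE cr_cyc.
  exists v, a, b; split=> // [|u].
    have h1 := @small_lin R (cr (D v) (D a) p) (((D a).1 - (D v).1) * m - ((D a).2 - (D v).2)).
    have h2 := @small_lin R (cr (D a) (D b) p) (((D b).1 - (D a).1) * m - ((D b).2 - (D a).2)).
    have h3 := @small_lin R (cr (D b) (D v) p) (((D v).1 - (D b).1) * m - ((D v).2 - (D b).2)).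
    have z1 : cr (D v) (D a) p = 0 by rewrite pE cr_aba.
    have z3 : cr (D b) (D v) p = 0 by rewrite pE cr_abb.
    have k1 : 0 < ((D a).1 - (D v).1) * m - ((D a).2 - (D v).2) by rewrite -F subr_gt0.
    have k3 : 0 < ((D v).1 - (D b).1) * m - ((D v).2 - (D b).2).
      by have := F b; move: hb; lra.
    have k2 : 0 < cr (D a) (D b) p by rewrite pvE.
    apply: small_sub (small_and (h1 _) (small_and (h2 _) (h3 _))) => [e _ [g1 [g2 g3]]|||]; [|by auto..].
    by rewrite /inside !cr_shift g1 g2 g3.
  rewrite /carrier cE inE pvE (gt_eqF Sp) andbT pE cr_abb cr_aba eqxx !andbF !orbF //.
wlog up : a0 b0 t0 ab0 cE t01 pE / 0 < ((D b0).1 - (D a0).1) * m - ((D b0).2 - (D a0).2).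
  move=> W; have ia : ~~ outer a0 by apply: int; rewrite cE !inE eqxx.
  have [w /(facet_inner ia) f] := facet_exists T ab0.
  have n := face_D_neq f; rewrite eq_sym in n.
  have [h|h|h] := ltgtP 0 (((D b0).1 - (D a0).1) * m - ((D b0).2 - (D a0).2)).
  - exact: W ab0 cE t01 pE h.
  - apply: (W b0 a0 (1 - t0)).
    + by rewrite (tri_sym T).
    + by rewrite cE setUC.
    + lra.
    + by rewrite pE; apply: point_eq => /=; ring.
    + lra.
  by have := mgen n; rewrite -h eqxx.
have ia : ~~ outer a0 by apply: int; rewrite cE !inE eqxx.
have [c0 /(facet_inner ia) f] := facet_exists T ab0; have Sp := pos f.
exists a0, b0, c0.
have z1 : cr (D a0) (D b0) p = 0 by rewrite pE cr_lerp cr_aba cr_abb; ring.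
have k2 : 0 < cr (D b0) (D c0) p.
  by rewrite pE cr_lerp cr_aba cr_cyc mulr0 addr0 mulr_gt0 //; lra.
have k3 : 0 < cr (D c0) (D a0) p.
  by rewrite pE cr_lerp cr_abb -cr_cyc mulr0 add0r mulr_gt0 //; lra.
split=> // [|u].
  have h1 := @small_lin R (cr (D a0) (D b0) p) (((D b0).1 - (D a0).1) * m - ((D b0).2 - (D a0).2)).
  have h2 := @small_lin R (cr (D b0) (D c0) p) (((D c0).1 - (D b0).1) * m - ((D c0).2 - (D b0).2)).
  have h3 := @small_lin R (cr (D c0) (D a0) p) (((D a0).1 - (D c0).1) * m - ((D a0).2 - (D c0).2)).
  apply: small_sub (small_and (h1 _) (small_and (h2 _) (h3 _))) => [e _ [g1 [g2 g3]]|||]; [|by auto..].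
  by rewrite /inside !cr_shift g1 g2 g3.
by rewrite /carrier cE !inE z1 (gt_eqF k2) (gt_eqF k3) eqxx !andbT andbF orbF.
Qed.

(** The shifted point lies in a single face, and this face determines the cell through [carrier]. *)
Lemma relint_uniq (c c' : {set V}) p : relint c p -> relint c' p -> (forall v, v \in c -> ~~ outer v) ->
  (forall v, v \in c' -> ~~ outer v) -> c = c'.
Proof.
move=> r r' i i'; have [x [y [w [f s cE]]]] := near_relint r i.
have [x' [y' [w' [f' s' cE']]]] := near_relint r' i'.
have [e [_ [g [s1 s1']]]] := small_ex (small_and (small_generic p) (small_and s s')).
have := cover_uniq g f f' s1 s1'; rewrite !inE !xpair_eqE => /or3P E.
by apply/setP => u; rewrite cE cE' /carrier;
  case: E => /andP[/andP[/eqP-> /eqP->] /eqP->] //; rewrite orbC -?orbA // orbC -orbA.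
Qed.

Lemma seg_relint a b p : adj a b -> on_seg (D a) (D b) p ->
  [\/ p = D a, p = D b | relint [set a; b] p].
Proof.
move=> ab /on_segP[t [t01 pE]].
have [t0|t0] := eqVneq t 0; first by apply: Or31; rewrite pE t0; apply: point_eq => /=; ring.
have [t1|t1] := eqVneq t 1; first by apply: Or32; rewrite pE t1; apply: point_eq => /=; ring.
apply: Or33; right; exists a, b, t; split=> //.
by rewrite lt_def t0 lt_def eq_sym t1.
Qed.

Lemma drawing_plane (U : finType) (e : rel U) (i : U -> V) : injective i ->
  (forall u, ~~ outer (i u)) -> (forall u v : U, e u v -> adj (i u) (i v)) ->
  plane_drawing e (fun u => D (i u)).
Proof.
move=> ii io ea.
have int1 (u : U) v : v \in [set i u] -> ~~ outer v by rewrite inE => /eqP->.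
have int2 (a b : U) v : v \in [set i a; i b] -> ~~ outer v by rewrite !inE => /orP[]/eqP->.
have rv (u : U) : relint [set i u] (D (i u)) by left; exists (i u).
have inj (u v : U) : D (i u) = D (i v) -> u = v.
  move=> E; have := relint_uniq (rv u) _ (@int1 u) (@int1 v); rewrite E => /(_ (rv v)) /set1_inj.
  exact: ii.
have vs (u v w : U) : e u v -> w != u -> w != v -> ~ on_seg (D (i u)) (D (i v)) (D (i w)).
  move=> uv wu wv /(seg_relint (ea _ _ uv))[/inj/eqP|/inj/eqP|r].
  - by rewrite (negPf wu).
  - by rewrite (negPf wv).
  have E := relint_uniq r (rv w) (@int2 u v) (@int1 w).
  have : i u \in [set i w] by rewrite -E !inE eqxx.
  by rewrite inE => /eqP/ii/eqP; rewrite eq_sym (negPf wu).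
split=> //; split=> // a b c x p ab cx ne pab pcx.
have V1 (v : U) : v = a \/ v = b -> p = D (i v) ->
    exists2 w, (w \in [set a; b]) && (w \in [set c; x]) & p = D (i w).
  move=> vab pE; exists v => //; apply/andP; split; first by rewrite !inE; case: vab => ->; rewrite eqxx ?orbT.
  rewrite !inE; apply/negPn/negP; rewrite negb_or => /andP[vc vx].
  by apply: (vs _ _ _ cx vc vx); rewrite -pE.
have V2 (v : U) : v = c \/ v = x -> p = D (i v) ->
    exists2 w, (w \in [set a; b]) && (w \in [set c; x]) & p = D (i w).
  move=> vab pE; exists v => //; apply/andP; split; last by rewrite !inE; case: vab => ->; rewrite eqxx ?orbT.
  rewrite !inE; apply/negPn/negP; rewrite negb_or => /andP[vc vx].
  by apply: (vs _ _ _ ab vc vx); rewrite -pE.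
case: (seg_relint (ea _ _ ab) pab) => [h|h|r]; [by apply: V1 h; left|by apply: V1 h; right|].
case: (seg_relint (ea _ _ cx) pcx) => [h|h|r']; [by apply: V2 h; left|by apply: V2 h; right|].
have E := relint_uniq r r' (@int2 a b) (@int2 c x).
case/negP: ne; apply/eqP/setP => u.
have memi (v w : U) : (u \in [set v; w]) = (i u \in [set i v; i w]) by rewrite !inE !(inj_eq ii).
by rewrite !memi E.
Qed.

End Drawing.

Lemma plane_affine (R : realType) (U : finType) (e : rel U) (d d' : U -> point R) (f : point R -> point R) :
  (forall u, d' u = f (d u)) -> injective f -> (forall t p q, f (lerp t p q) = lerp t (f p) (f q)) ->
  plane_drawing e d -> plane_drawing e d'.
Proof.
move=> dE finj fl pd; have [inj [h _]] := pd.
have pull u v p : on_seg (d' u) (d' v) p -> exists2 q, p = f q & on_seg (d u) (d v) q.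
  by rewrite !dE => /on_segP[t [t01 ->]]; exists (lerp t (d u) (d v)); [rewrite fl | apply: on_seg_lerp].
split; first by move=> u v; rewrite !dE => /finj/inj.
split=> [u v w uv wu wv /pull[q]|a b c x p ab cx nE /pull[q -> q1] /pull[q' /finj E q2]].
  by rewrite dE => /finj <-; apply: h.
rewrite -E in q2; have [_ [_ h3]] := pd.
by have [v vv ->] := h3 a b c x q ab cx nE q1 q2; exists v; rewrite ?dE.
Qed.

Lemma plane_reflect (R : realType) (U : finType) (e : rel U) (d d' : U -> point R) :
  (forall u, d' u = (- (d u).1, (d u).2)) -> plane_drawing e d -> plane_drawing e d'.
Proof.
move=> dE; apply: (plane_affine (f := fun p => (- p.1, p.2))) => //.
  by move=> p q [/oppr_inj E1 E2]; apply: point_eq.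
by move=> t p q; apply: point_eq => /=; ring.
Qed.

(** The conclusion concerns a graph embedded among the inner vertices, since cells are compared only
    away from the boundary triangle. If the faces are negatively oriented, the map is reflected. *)
Theorem surrounded_plane (R : realType) (V : finType) (d : V -> point R) (adj : rel V)
    (o1 o2 o3 : V) (D : V -> point R) (U : finType) (e : rel U) (i : U -> V) :
  triang d adj o1 o2 o3 ->
  (forall v al be, ~~ outer o1 o2 o3 v ->
    (forall a, adj v a -> lin al be (D v) <= lin al be (D a)) ->
    forall a, adj v a -> lin al be (D a) = lin al be (D v)) ->
  cr (D o1) (D o2) (D o3) != 0 ->
  injective i -> (forall u, ~~ outer o1 o2 o3 (i u)) ->
  (forall u v, e u v -> adj (i u) (i v)) ->
  plane_drawing e (fun u => D (i u)).
Proof.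
move=> T sur nc ii io ea.
have [c0 fc0] := facet_exists T (tri_o12 T).
have f0 : face d adj o1 o2 c0.
  have [n12 n23 n31] := outer_neq T.
  case/orP: fc0 => // /ogonP[][e1 e2 _].
  - by rewrite e2 eqxx in n23.
  - by rewrite e1 eqxx in n31.
  by rewrite e1 eqxx in n12.
have [neg|pos|E] := ltgtP (cr (D o1) (D o2) (D c0)) 0; last first.
- by have := face_nonflat T sur nc f0; rewrite E eqxx.
- have P a b c : face d adj a b c -> 0 < cr (D a) (D b) (D c).
    by move=> f; have := orient T sur nc f0 f; rewrite pmulr_rgt0.
  have [m mg] := generic_dir D.
  exact: (drawing_plane T sur nc P mg).
pose D' v := (- (D v).1, (D v).2) : point R.
have crE a b c : cr (D' a) (D' b) (D' c) = - cr (D a) (D b) (D c) by rewrite /cr /=; ring.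
have linE al be v : lin al be (D' v) = lin (- al) be (D v) by rewrite /lin /=; ring.
have P a b c : face d adj a b c -> 0 < cr (D' a) (D' b) (D' c).
  by move=> f; rewrite crE oppr_gt0; have := orient T sur nc f0 f; rewrite nmulr_rgt0.
have [m mg] := generic_dir D'.
apply: (plane_reflect (d := fun u => D' (i u))).
  by move=> u; rewrite /= opprK -surjective_pairing.
apply: (drawing_plane T _ _ P mg) => //; last by rewrite crE oppr_eq0.
by move=> v al be iv h a va; rewrite !linE; apply: sur => // b vb; rewrite -!linE; apply: h.
Qed.

(** * Words of incidences along a line *)

Lemma solve_linear (R : realType) (C : finType) (B : C -> C -> R) :
  (forall z, (forall c, \sum_x B c x * z x = 0) -> forall c, z c = 0) ->
  forall e, exists y, forall c, \sum_x B c x * y x = e c.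
Proof.
move=> H e; pose Mx := \matrix_(i < #|C|, j < #|C|) B (enum_val j) (enum_val i).
have E (z : C -> R) c : ((\row_j z (enum_val j)) *m Mx) 0 (enum_rank c) = \sum_x B c x * z x.
  rewrite mxE (reindex _ (onW_bij _ (@enum_val_bij C))) /=.
  by apply: eq_bigr => i _; rewrite !mxE enum_rankK mulrC.
have U : Mx \in unitmx.
  rewrite -row_free_unit -kermx_eq0; apply/eqP/row_matrixP => i; rewrite row0.
  pose z c := kermx Mx i (enum_rank c).
  have rE : row i (kermx Mx) = \row_j z (enum_val j).
    by apply/rowP => j; rewrite [LHS]mxE [RHS]mxE /z enum_valK.
  have z0 c : \sum_x B c x * z x = 0.
    by rewrite -E -rE -row_mul mulmx_ker row0 mxE.
  by rewrite rE; apply/rowP => j; rewrite [LHS]mxE [RHS]mxE H.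
exists (fun c => ((\row_j e (enum_val j)) *m invmx Mx) 0 (enum_rank c)) => c.
rewrite -E (_ : \row_j _ = (\row_j e (enum_val j)) *m invmx Mx).
  by rewrite mulmxKV // mxE enum_rankK.
by apply/rowP => j; rewrite mxE enum_valK.
Qed.

(** The hypothesis on [z] bounds the spectral radius of [A] by excluding subinvariant vectors.
    Applied to absolute values it makes the system injective, and applied to the negative part of
    the solution it gives nonnegativity. *)
Lemma nonneg_system (R : realType) (C : finType) (A : C -> C -> R) (e : C -> R) :
  (forall c x, 0 <= A c x) -> (forall c, 0 <= e c) ->
  (forall z, (forall c, 0 <= z c) -> (forall c, z c <= \sum_x A c x * z x) -> forall c, z c = 0) ->
  exists y, (forall c, 0 <= y c) /\ forall c, y c = e c + \sum_x A c x * y x.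
Proof.
move=> A0 e0 H.
have BE z c : \sum_x ((c == x)%:R - A c x) * z x = z c - \sum_x A c x * z x.
  under eq_bigr do rewrite mulrBl; rewrite sumrB; congr (_ - _).
  rewrite (bigD1 c) //= eqxx mul1r big1 ?addr0 // => x xc.
  by rewrite eq_sym (negPf xc) mul0r.
have [|y yE] := @solve_linear R C (fun c x => (c == x)%:R - A c x) _ e.
  move=> z zE c; apply/normr0_eq0.
  apply: (H (fun c => `|z c|)) => [x|x]; first exact: normr_ge0.
  have /eqP := zE x; rewrite BE subr_eq0 => /eqP {1}->.
  apply: le_trans (ler_norm_sum _ _ _) _; apply: ler_sum => t _.
  by rewrite normrM (ger0_norm (A0 _ _)).
have {}yE c : y c = e c + \sum_x A c x * y x by rewrite -yE BE subrK.
exists y; split=> // c; rewrite leNgt; apply/negP => yn.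
have := H (fun c => Num.max 0 (- y c)) _ _ c.
suff : Num.max 0 (- y c) != 0.
  move=> n h; move/eqP: n; apply; apply: h => x; first by rewrite le_max lexx.
  rewrite ge_max; apply/andP; split.
    by apply: sumr_ge0 => t _; rewrite mulr_ge0 // le_max lexx.
  rewrite yE opprD; apply: le_trans (_ : - \sum_t A x t * y t <= _).
    by rewrite -[leRHS]add0r lerD2r oppr_le0.
  rewrite -sumrN; apply: ler_sum => t _; rewrite -mulrN ler_wpM2l //.
  by rewrite le_max lexx orbT.
by rewrite gt_eqF // lt_max oppr_gt0 yn orbT.
Qed.

Section Words.
Variables (R : realType) (V : eqType) (N J M : nat).
Variables (kk : nat -> nat) (lab : nat -> V).

(* A word lists the incidences of the vertices s_0, ..., s_M of the line x = 0
   with the vertices off the line, from bottom to top, those on the left at the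
   positions 0, ..., J and those on the right at J+1, ..., N: position i is the
   edge from s_(kk i) to lab i.  Consecutive edges share the vertex on the line
   (fan) or the one off it (rise). *)
Definition stp i := (i < N)%N && (i != J).
Definition fan i := stp i && (kk i.+1 == kk i).
Definition rise i := stp i && (kk i.+1 == (kk i).+1).

(** [w_nc] is planarity: two labels never alternate as p, q, p, q. By [w_inc] the height grows
    between two occurrences of a label, so every excursion gains height. *)
Record is_word : Prop := IsWord {
  w_JN : (J < N)%N;
  w_stp : forall i, stp i -> kk i.+1 = kk i /\ lab i.+1 != lab i \/
     kk i.+1 = (kk i).+1 /\ lab i.+1 = lab i;
  w_k0 : kk 0%N = 0%N; w_kJ : kk J = M; w_kJ1 : kk J.+1 = 0%N; w_kN : kk N = M;
  w_side : forall i j, (i <= J < j)%N -> (j <= N)%N -> lab i != lab j;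
  w_nc : forall i j k l, (i < j < k)%N -> (k < l <= N)%N ->
     lab i = lab k -> lab j = lab l -> lab i = lab j;
  w_inc : forall i j, (i < j <= N)%N -> lab i = lab j -> (kk i < kk j)%N }.

Hypothesis W : is_word.

Notation I2 := ('I_N.+1 * 'I_N.+1)%type.

(* Excursions: pairs of consecutive, non-adjacent occurrences of a label. *)
Definition exc (c : I2) : bool :=
  [&& (c.1.+1 < c.2)%N, lab c.1 == lab c.2 &
      [forall i : 'I_N.+1, (c.1 < i < c.2)%N ==> (lab i != lab c.1)]].

(** [cov] concerns steps, from [i] to [i.+1], hence the half-open range; [strict] concerns positions
    between the two occurrences. *)
Definition cov (c : I2) (i : nat) := exc c && (c.1 <= i < c.2)%N.
Definition strict (c : I2) (i : nat) := exc c && (c.1 < i < c.2)%N.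
(** The innermost excursion over the step [i]; as excursions are laminar, it is the one that starts
    last. *)
Definition own (c : I2) i := cov c i && [forall x : I2, cov x i ==> (x.1 <= c.1)%N].

Lemma excP c : exc c -> [/\ (c.1.+1 < c.2)%N, (c.2 <= N)%N, lab c.1 = lab c.2 &
  forall i, (c.1 < i < c.2)%N -> lab i != lab c.1].
Proof.
case/and3P=> h1 /eqP h2 /forallP h3; have h4 : (c.2 <= N)%N by rewrite -ltnS.
split=> // i ci; have iN : (i < N.+1)%N by lia.
by have := h3 (Ordinal iN); rewrite /= ci.
Qed.

Lemma stp_case i : stp i -> fan i && ~~ rise i || rise i && ~~ fan i.
Proof.
move=> s; rewrite /fan /rise s /=; case: (w_stp W s) => -[-> _].
  by rewrite eqxx -[X in X == _.+1]addn0 -addn1 eqn_add2l.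
by rewrite eqxx -[X in _ == X]addn0 -addn1 eqn_add2l.
Qed.

Lemma fan_lab i : fan i -> lab i.+1 != lab i.
Proof.
case/andP=> s /eqP E; case: (w_stp W s) => -[] //; rewrite E; lia.
Qed.

Lemma rise_lab i : rise i -> lab i.+1 = lab i.
Proof.
case/andP=> s /eqP E; case: (w_stp W s) => -[] //; rewrite E; lia.
Qed.

Lemma cov_stp c i : cov c i -> stp i.
Proof.
case/andP=> /excP[h1 h2 h3 h4] ci; rewrite /stp; apply/andP; split; first lia.
apply/eqP => iJ; subst i.
by have := @w_side W c.1 c.2 ci h2; rewrite h3 eqxx.
Qed.

Lemma exc_fan c : exc c -> fan c.1.
Proof.
move=> e; have [h1 h2 h3 h4] := excP e.
have s : stp c.1 by apply: (@cov_stp c); rewrite /cov e leqnn /=; lia.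
case/orP: (stp_case s) => /andP[] // r _.
have := h4 c.1.+1; rewrite (rise_lab r) eqxx h1 ltnSn => /(_ isT) //.
Qed.

Lemma exc_uniq c c' : exc c -> exc c' -> c.1 = c'.1 :> nat -> c = c'.
Proof.
move=> /excP[h1 h2 h3 h4] /excP[g1 g2 g3 g4] E.
have E2 : c.2 = c'.2 :> nat.
  have [l|l|//] := ltngtP c.2 c'.2.
    by have := g4 c.2; rewrite -E -h3 eqxx => /(_ ltac:(lia)).
  by have := h4 c'.2; rewrite E -g3 eqxx => /(_ ltac:(lia)).
by case: c c' {h1 h2 h3 h4 g1 g2 g3 g4} E E2 => [a b] [a' b'] /= /val_inj-> /val_inj->.
Qed.

(** Overlapping excursions would show the alternating pattern excluded by [w_nc]. *)
Lemma laminar c c' : exc c -> exc c' -> (c.1 < c'.1)%N -> (c'.1 < c.2)%N -> (c'.2 <= c.2)%N.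
Proof.
move=> /excP[h1 h2 h3 h4] /excP[g1 g2 g3 g4] l1 l2; rewrite leqNgt; apply/negP => l3.
have E := @w_nc W c.1 c'.1 c.2 c'.2 ltac:(lia) ltac:(lia) h3 g3.
by have := h4 c'.1; rewrite -E eqxx l1 l2 => /(_ isT).
Qed.

Lemma laminar_strict c c' : exc c -> exc c' -> (c.1 < c'.1)%N -> (c'.1 < c.2)%N -> (c'.2 < c.2)%N.
Proof.
move=> e e' l1 l2; rewrite ltn_neqAle (laminar e e') // andbT.
have [h1 h2 h3 h4] := excP e; have [g1 g2 g3 g4] := excP e'.
apply/eqP => E; have := h4 c'.1; rewrite l1 l2 => /(_ isT).
by rewrite g3 E h3 eqxx.
Qed.

Lemma own_cov c i : own c i -> cov c i. Proof. by case/andP. Qed.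
Lemma own_exc c i : own c i -> exc c. Proof. by case/andP=> /andP[]. Qed.

Lemma own_uniq c c' i : own c i -> own c' i -> c = c'.
Proof.
move=> /andP[h /forallP H] /andP[h' /forallP H'].
have e : exc c by case/andP: h. have e' : exc c' by case/andP: h'.
apply: exc_uniq => //; apply/eqP; rewrite eqn_leq.
by have := H c'; have := H' c; rewrite h h' /= => -> ->.
Qed.

Lemma own_exists c i : cov c i -> exists2 x, own x i & (c.1 <= x.1)%N /\ (x.2 <= c.2)%N.
Proof.
move=> ci; have [x [xi xmax]] : exists x : I2, cov x i /\ forall z : I2, cov z i -> (z.1 <= x.1)%N.
  by case: (@arg_maxnP _ c (fun x => cov x i) (fun x => x.1 : nat) ci) => x xi xmax; exists x.
have /= le := xmax _ ci; exists x.
  by apply/andP; split=> //; apply/forallP => z; apply/implyP; apply: xmax.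
split=> //; have ec : exc c by case/andP: ci. have ex : exc x by case/andP: xi.
case/andP: ci => _ ci; case/andP: xi => _ xi.
have [E|l] : c.1 = x.1 :> nat \/ (c.1 < x.1)%N by lia.
  by rewrite (exc_uniq ec ex E).
by apply: laminar => //; lia.
Qed.

Lemma sum_range n m (P : pred nat) (F : nat -> R) : (m <= N)%N ->
  \sum_(i < N | P i && (n <= i < m)%N) F i = \sum_(n <= i < m | P i) F i.
Proof.
move=> mN; rewrite big_geq_mkord.
rewrite (big_ord_widen_cond N (fun i => P i && (n <= i)%N)) //.
by apply: eq_bigl => i; rewrite andbA.
Qed.

Lemma telescope_rise (b : nat -> R) n m : (n <= m)%N -> (m <= N)%N ->
  (forall i, (n <= i < m)%N -> stp i) ->
  \sum_(i < N | rise i && (n <= i < m)%N) (b (kk i).+1 - b (kk i)) = b (kk m) - b (kk n).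
Proof.
move=> nm mN; rewrite (@sum_range n m rise (fun i => b (kk i).+1 - b (kk i)) mN).
elim: m nm mN => [|m IH] nm mN st.
  have n0 : n = 0%N by lia.
  by rewrite n0 big_geq // subrr.
have [E|l] := eqVneq n m.+1; first by rewrite E big_geq // subrr.
rewrite big_mkcond big_nat_recr /=; last lia.
rewrite -big_mkcond IH //; [|lia..|by move=> i h; apply: st; lia].
have s : stp m by apply: st; lia.
case/orP: (stp_case s) => /andP[h /negPf h'].
  by rewrite h'; case/andP: h => _ /eqP->; rewrite addr0.
by rewrite h; case/andP: h => _ /eqP->; ring.
Qed.

End Words.

(** * Slope sums along the line *)

Section Heights.
Variables (R : realType) (V : eqType) (N J M : nat).
Variables (kk : nat -> nat) (lab : nat -> V) (SS : nat -> bool).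
Hypothesis W : is_word N J M kk lab.
Notation stp := (stp N J).
Notation fan := (fan N J kk).
Notation rise := (rise N J kk).

(* A point (x, y) off the line has dual coordinates u = -1/|x|, v = u * y; then
   v - u * h is, up to sign, the slope of its segment to (0, h). *)
Definition xi (y : nat -> R) (u v : V -> R) i := v (lab i) - u (lab i) * y (kk i).

(** [xi] decreases when the edges of a fan turn upwards. The other conditions say that the extreme
    edges on the two sides enclose an angle less than pi, below the bottom vertex, above the top
    one, and on both ends of every gap that is not an edge of the line ([SS] false). *)
Record drawn (y : nat -> R) (u v : V -> R) : Prop := Drawn {
  dr_neg : forall i, (i <= N)%N -> u (lab i) < 0;
  dr_fan : forall i, fan i -> xi y u v i.+1 < xi y u v i;
  dr_low : 0 < xi y u v 0%N + xi y u v J.+1;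
  dr_high : xi y u v J + xi y u v N < 0;
  dr_mid : forall n m, rise n -> rise m -> (n < J < m)%N -> kk n = kk m ->
     ~~ SS (kk n) -> xi y u v n + xi y u v m < 0 /\ 0 < xi y u v n.+1 + xi y u v m.+1 }.

Definition increasing (y : nat -> R) := forall k, (k < M)%N -> y k < y k.+1.

Lemma fan_kk i : fan i -> kk i.+1 = kk i.
Proof. by case/andP=> _ /eqP. Qed.

Lemma rise_kk i : rise i -> kk i.+1 = (kk i).+1.
Proof. by case/andP=> _ /eqP. Qed.

Lemma rise_not_fan i : rise i -> ~~ fan i.
Proof. by move=> /rise_kk E; apply/negP => /fan_kk; lia. Qed.

Lemma kk_step i : stp i -> (kk i <= kk i.+1)%N.
Proof. by move=> s; case: (w_stp W s) => -[-> _]. Qed.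

Lemma kk_mono i j : (i <= j)%N -> (forall l, (i <= l < j)%N -> stp l) -> (kk i <= kk j)%N.
Proof.
elim: j => [|j IH] ij st; first by rewrite (_ : i = 0%N) //; lia.
have [->//|l] := eqVneq i j.+1.
apply: leq_trans (IH _ _) (kk_step (st j _)); [lia| |lia].
by move=> l0 h; apply: st; lia.
Qed.

Lemma stp_left i : (i < J)%N -> stp i.
Proof. by move=> h; have := w_JN W; rewrite /Submission.stp; lia. Qed.

Lemma stp_right i : (J < i < N)%N -> stp i.
Proof. by rewrite /Submission.stp; lia. Qed.

Lemma kk_mono_left i j : (i <= j <= J)%N -> (kk i <= kk j)%N.
Proof. by move=> h; apply: kk_mono => [|l hl]; [lia | apply: stp_left; lia]. Qed.

Lemma kk_mono_right i j : (J < i <= j)%N -> (j <= N)%N -> (kk i <= kk j)%N.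
Proof. by move=> h h'; apply: kk_mono => [|l hl]; [lia | apply: stp_right; lia]. Qed.

Lemma kk_le i : (i <= N)%N -> (kk i <= M)%N.
Proof.
move=> iN; have [h|h] := leqP i J.
  by rewrite -(w_kJ W); apply: kk_mono_left; lia.
by rewrite -(w_kN W); apply: kk_mono_right; lia.
Qed.

Lemma rise_lt i : rise i -> (kk i < M)%N.
Proof.
move=> r; have := rise_kk r; have : (i < N)%N by case/andP: r => /andP[].
by move=> /kk_le; lia.
Qed.

Lemma rise_between i j k : (i <= j)%N -> (forall l, (i <= l < j)%N -> stp l) ->
  (kk i <= k < kk j)%N -> exists n, [/\ rise n, (i <= n < j)%N & kk n = k].
Proof.
elim: j => [|j IH] ij st kb; first by exfalso; move: kb; rewrite (_ : i = 0%N); lia.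
have [E|l] := eqVneq i j.+1; first by move: kb; rewrite E; lia.
have sj : stp j by apply: st; lia.
have [h|h] := leqP (kk j) k.
  exists j; split; [|lia|].
    by rewrite /Submission.rise sj /=; case: (w_stp W sj) => -[E _]; rewrite E ?eqxx //; lia.
  by case: (w_stp W sj) => -[E _]; lia.
have [|||n [rn nb nk]] := IH; [lia|by move=> l0 h0; apply: st; lia|lia|].
by exists n; split=> //; lia.
Qed.

Lemma rises_at k : (k < M)%N -> exists n m, [/\ rise n, rise m, (n < J < m)%N, kk n = k & kk m = k].
Proof.
move=> kM; have JN := w_JN W.
have [||n [rn nb nk]] := @rise_between 0%N J k (leq0n _); first by move=> l h; apply: stp_left; lia.
  by rewrite (w_k0 W) (w_kJ W).
have [||m [rm mb mk]] := @rise_between J.+1 N k JN; first by move=> l h; apply: stp_right; lia.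
  by rewrite (w_kJ1 W) (w_kN W).
by exists n, m; split=> //; lia.
Qed.

Section Sums.
Variables (y : nat -> R) (u v : V -> R).
Notation xi := (xi y u v).
Definition dlt i := xi i - xi i.+1.

(** The sum runs over the two edges that climb from [k] to [k.+1], one on each side. Crossing the
    gap raises the sum of the left and right slopes by [flow k] times its height ([bot_top]). *)
Definition flow k := \sum_(i < N | rise i && (kk i == k)) (- u (lab i)).

(** The sum of [xi] over the two topmost edges at [s_k], accumulated from the bottom: fans lower it,
    gaps raise it. [bot_sum] is the same for the two lowest edges. The accumulated form avoids
    naming the positions of these edges. *)
Definition top_sum k := xi 0%N + xi J.+1 - \sum_(i < N | fan i && (kk i <= k)%N) dlt i
   + \sum_(j < M | (j < k)%N) flow j * (y j.+1 - y j).

Definition bot_sum k := xi 0%N + xi J.+1 - \sum_(i < N | fan i && (kk i < k)%N) dlt i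
   + \sum_(j < M | (j < k)%N) flow j * (y j.+1 - y j).

Lemma rise_dlt i : rise i -> dlt i = u (lab i) * (y (kk i).+1 - y (kk i)).
Proof. by move=> r; rewrite /dlt /xi (rise_lab W r) (rise_kk r); ring. Qed.

Lemma sum_flow (P : pred nat) : \sum_(j < M | P j) flow j * (y j.+1 - y j) =
  - \sum_(i < N | rise i && P (kk i)) dlt i.
Proof.
rewrite /flow; under eq_bigr do rewrite big_distrl /=.
rewrite (exchange_big_dep (fun i : 'I_N => rise i && P (kk i))) /=; last first.
  by move=> i j Pi /andP[-> /eqP->].
rewrite -sumrN; apply: eq_bigr => i /andP[r Pk].
have h := rise_lt r; rewrite (big_pred1 (Ordinal h)).
  by rewrite /= (rise_dlt r) mulNr.
move=> j; rewrite r /= -val_eqE /= eq_sym; case: eqP => [E|]; rewrite ?andbF //.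
by rewrite E Pk.
Qed.

Lemma xi_telescope i j : (i <= j)%N -> (j <= N)%N ->
  \sum_(l < N | (i <= l < j)%N) dlt l = xi i - xi j.
Proof.
move=> ij jN; rewrite (@sum_range R N i j xpredT dlt jN).
elim: j ij jN => [|j IH] ij jN.
  have -> : i = 0%N by lia. by rewrite big_geq // subrr.
have [E|l] := eqVneq i j.+1; first by rewrite E big_geq // subrr.
by rewrite big_nat_recr /=; [rewrite IH; [rewrite /dlt; ring|lia|lia]|lia].
Qed.

Lemma sum_split (P : pred nat) : (forall i, P i -> stp i) ->
  \sum_(i < N | P i) dlt i = \sum_(i < N | fan i && P i) dlt i + \sum_(i < N | rise i && P i) dlt i.
Proof.
move=> Ps; rewrite [LHS](bigID (fun i : 'I_N => fan i)) /=; congr (_ + _); apply: eq_bigl => i.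
  by rewrite andbC.
case Pi: (P i); rewrite ?andbF //=.
by case/orP: (stp_case W (Ps _ Pi)) => /andP[-> /negPf->].
Qed.

Lemma sum_ends n m : (n <= J < m)%N -> (m <= N)%N ->
  xi n + xi m = xi 0%N + xi J.+1 - \sum_(i < N | fan i && ((i < n)%N || (J < i < m)%N)) dlt i
    - \sum_(i < N | rise i && ((i < n)%N || (J < i < m)%N)) dlt i.
Proof.
move=> nm mN; have JN := w_JN W.
have e1 := @xi_telescope 0%N n isT ltac:(lia); have e2 := @xi_telescope J.+1 m ltac:(lia) mN.
have := @sum_split (fun i => (i < n)%N || (J < i < m)%N) _.
have st : forall i, (i < n)%N || (J < i < m)%N -> stp i.
  by move=> i /orP[h|h]; [apply: stp_left|apply: stp_right]; lia.
move/(_ st); rewrite (bigID (fun i : 'I_N => (i < n)%N)) /=.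
have -> : \sum_(i < N | ((i < n)%N || (J < i < m)%N) && (i < n)%N) dlt i = xi 0%N - xi n.
  by rewrite -e1; apply: eq_bigl => i; lia.
have -> : \sum_(i < N | ((i < n)%N || (J < i < m)%N) && ~~ (i < n)%N) dlt i = xi J.+1 - xi m.
  by rewrite -e2; apply: eq_bigl => i; lia.
lra.
Qed.

Lemma kk_lt_left i n : rise n -> (i < N)%N -> (n < J)%N -> (i <= J)%N -> (kk i <= kk n)%N = (i <= n)%N.
Proof.
move=> r iN nJ iJ; have E := rise_kk r.
apply/idP/idP => h; last by apply: kk_mono_left; lia.
by rewrite leqNgt; apply/negP => h'; have := @kk_mono_left n.+1 i; lia.
Qed.

Lemma kk_lt_right i n : rise n -> (i <= N)%N -> (J < n)%N -> (J < i)%N -> (kk i <= kk n)%N = (i <= n)%N.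
Proof.
move=> r iN nJ iJ; have E := rise_kk r; have nN : (n < N)%N by case/andP: r => /andP[].
apply/idP/idP => h; last by apply: kk_mono_right; lia.
by rewrite leqNgt; apply/negP => h'; have := @kk_mono_right n.+1 i; lia.
Qed.

Lemma top_sumE n m : rise n -> rise m -> (n < J < m)%N -> kk n = kk m ->
  xi n + xi m = top_sum (kk n).
Proof.
move=> rn rm nJm E; have mN : (m < N)%N by case/andP: rm => /andP[].
rewrite (@sum_ends n m) /top_sum ?(sum_flow (fun j => (j < kk n)%N)); [|lia|lia].
congr (_ - _ - _); apply: eq_bigl => i.
  case f: (fan i) => //=; have iJ : (i : nat) != J by case/andP: f => /andP[].
  have [h|h] := leqP i J.
    rewrite (kk_lt_left rn) //; last lia.
    have : (i : nat) != n.
      by apply: contraTneq f => ->; apply: rise_not_fan.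
    lia.
  rewrite E (kk_lt_right rm) //; [|exact: ltnW|lia].
  have : (i : nat) != m.
    by apply: contraTneq f => ->; apply: rise_not_fan.
  lia.
case f: (rise i) => //=; have iJ : (i : nat) != J by case/andP: f => /andP[].
have [h|h] := leqP i J.
  have := @kk_lt_left n i f; have := @kk_lt_left i n rn; have := ltn_ord i; lia.
have := @kk_lt_right m i f; have := @kk_lt_right i m rm; have := ltn_ord i; lia.
Qed.

Lemma bot_top k : (k < M)%N -> bot_sum k.+1 = top_sum k + flow k * (y k.+1 - y k).
Proof.
move=> h; rewrite /bot_sum /top_sum; under eq_bigl do rewrite ltnS.
rewrite (bigD1 (Ordinal h)) ?leqnn //=.
rewrite [X in _ + (_ + X) = _](eq_bigl (fun j : 'I_M => (j < k)%N)); first by ring.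
by move=> j; rewrite ltnS -val_eqE /=; lia.
Qed.

Lemma bot_sub_top k : bot_sum k - top_sum k = \sum_(i < N | fan i && (kk i == k)) dlt i.
Proof.
rewrite /bot_sum /top_sum.
have -> : \sum_(i < N | fan i && (kk i <= k)%N) dlt i =
  \sum_(i < N | fan i && (kk i == k)) dlt i + \sum_(i < N | fan i && (kk i < k)%N) dlt i; last by ring.
rewrite (bigID (fun i : 'I_N => kk i == k)) /=; congr (_ + _); apply: eq_bigl => i.
  by case: (fan i) => //=; lia.
by case: (fan i) => //=; lia.
Qed.

Lemma bot_sumE n m : rise n -> rise m -> (n < J < m)%N -> kk n = kk m ->
  xi n.+1 + xi m.+1 = bot_sum (kk n).+1.
Proof.
move=> rn rm nJm E; have e := top_sumE rn rm nJm E.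
have e1 := rise_dlt rn; have e2 := rise_dlt rm; rewrite /dlt in e1 e2.
rewrite (bot_top (rise_lt rn)) -e; suff -> : flow (kk n) = - u (lab n) - u (lab m) by rewrite E in e1 *; lra.
have nN : (n < N)%N by have := w_JN W; lia.
have mN : (m < N)%N by case/andP: rm => /andP[].
rewrite /flow (bigD1 (Ordinal nN)) /= ?rn ?eqxx // (bigD1 (Ordinal mN)) /= ?rm ?E ?eqxx //; last first.
  by rewrite -val_eqE /=; lia.
rewrite big1 ?addr0 // => i /andP[/andP[/andP[ri /eqP ki] i1] i2]; exfalso.
rewrite -!val_eqE /= in i1 i2; have iN := ltn_ord i.
have iJ : (i : nat) != J by case/andP: ri => /andP[].
have [h|h] := leqP i J.
  by have := @kk_lt_left n i ri; have := @kk_lt_left i n rn; lia.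
by have := @kk_lt_right m i ri; have := @kk_lt_right i m rm; lia.
Qed.

Lemma top_sum_last : xi J + xi N = top_sum M.
Proof.
have JN := w_JN W.
rewrite (@sum_ends J N) /top_sum ?(sum_flow (fun j => (j < M)%N)) //; last lia.
congr (_ - _ - _); apply: eq_bigl => i.
  case f: (fan i) => //=; have iJ : (i : nat) != J by case/andP: f => /andP[].
  by rewrite (kk_le (ltnW (ltn_ord i))); have := ltn_ord i; lia.
case f: (rise i) => //=; have iJ : (i : nat) != J by case/andP: f => /andP[].
by rewrite (rise_lt f); have := ltn_ord i; lia.
Qed.

Lemma bot_sum0 : bot_sum 0%N = xi 0%N + xi J.+1.
Proof. by rewrite /bot_sum !big1 ?subr0 ?addr0 // => i; rewrite ?ltn0 ?andbF. Qed.

End Sums.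

(** The index of the block of [k], a block being a maximal run of line vertices joined by edges. No
    sign condition is imposed inside a block. *)
Definition beta k : nat := (\sum_(j < k) ~~ SS j)%N.

Lemma beta_mono j k : (j <= k)%N -> (beta j <= beta k)%N.
Proof.
move=> jk; rewrite /beta (big_ord_widen k (fun i => (~~ SS i : nat)) jk) big_mkcond /=.
by apply: leq_sum => i _; case: ifP.
Qed.

Lemma betaS k : beta k.+1 = (beta k + ~~ SS k)%N.
Proof. by rewrite /beta big_ord_recr. Qed.

End Heights.

(** * A given drawing admits no closed set of excursions *)

Section Drawn.
Variables (R : realType) (V : eqType) (N J M : nat).
Variables (kk : nat -> nat) (lab : nat -> V) (SS : nat -> bool).
Hypothesis W : is_word N J M kk lab.
Notation stp := (stp N J).
Notation fan := (fan N J kk).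
Notation rise := (rise N J kk).
Notation I2 := ('I_N.+1 * 'I_N.+1)%type.
Notation beta := (beta SS).
Variables (y : nat -> R) (u v : V -> R).
Hypothesis yinc : increasing M y.
Hypothesis D : drawn N J kk lab SS y u v.
Notation xi := (xi kk lab y u v).
Notation T := (top_sum N J M kk lab y u v).
Notation T' := (bot_sum N J M kk lab y u v).
Notation flow := (flow N J kk lab u).
Notation dl := (dlt kk lab y u v).

Lemma flow_gt0 k : (k < M)%N -> 0 < flow k.
Proof.
move=> kM; have [n [m [rn _ _ kn _]]] := rises_at W kM.
have nN : (n < N)%N by case/andP: rn => /andP[].
rewrite /Submission.flow (bigD1 (Ordinal nN)) /= ?rn ?kn ?eqxx // ltr_pwDl ?oppr_gt0 ?(dr_neg D) ?(ltnW nN) //.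
by apply: sumr_ge0 => i _; rewrite oppr_ge0 ltW // (dr_neg D) // ltnW.
Qed.

Lemma flow_dl k : (k < M)%N -> 0 < flow k * (y k.+1 - y k).
Proof. by move=> kM; rewrite mulr_gt0 ?flow_gt0 // subr_gt0 yinc. Qed.

Lemma top_lt0 k : (k < M)%N -> ~~ SS k -> T k < 0 /\ 0 < T' k.+1.
Proof.
move=> kM nS; have [n [m [rn rm nm kn km]]] := rises_at W kM.
rewrite -kn -(top_sumE W _ _ _ rn rm) -?(bot_sumE W _ _ _ rn rm) ?kn ?km //.
by apply: (dr_mid D) => //; rewrite kn.
Qed.

(** What a gap demands of the fans in the blocks of [Q]: its whole flow if both of its ends are in
    [Q], and a nonnegative part if only one is, by the sign conditions at an unjoined gap. *)
Lemma share_ge0 (Q : pred nat) k : (k < M)%N ->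
  0 <= (Q (beta k.+1))%:R * T' k.+1 - (Q (beta k))%:R * T k.
Proof.
move=> kM; have [S|nS] := boolP (SS k).
  have -> : beta k.+1 = beta k by rewrite betaS S addn0.
  rewrite -mulrBr (bot_top _ _ _ _ _ _ _ kM); apply: mulr_ge0 => //.
  by rewrite addrC addKr ltW // flow_dl.
have [h1 h2] := top_lt0 kM nS.
by rewrite addr_ge0 -?mulrN // mulr_ge0 // ?oppr_ge0 ltW.
Qed.

Lemma share_full (Q : pred nat) k : (k < M)%N -> Q (beta k) -> Q (beta k.+1) ->
  (Q (beta k.+1))%:R * T' k.+1 - (Q (beta k))%:R * T k = flow k * (y k.+1 - y k).
Proof.
by move=> kM -> ->; rewrite !mul1r (bot_top _ _ _ _ _ _ _ kM); ring.
Qed.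

(** The fans at [k] account for [T' k - T k]; summation by parts regroups these differences by
    gaps. *)
Lemma blocksE (Q : pred nat) : \sum_(i < N | fan i && Q (beta (kk i))) dl i =
  \sum_(k < M) ((Q (beta k.+1))%:R * T' k.+1 - (Q (beta k))%:R * T k)
  + (Q (beta 0))%:R * T' 0%N - (Q (beta M))%:R * T M.
Proof.
transitivity (\sum_(k < M.+1) (Q (beta k))%:R * (T' k - T k)).
  under [RHS]eq_bigr do rewrite bot_sub_top mulr_sumr.
  rewrite (exchange_big_dep (fun i : 'I_N => fan i)) /=; last by move=> i j _ /andP[].
  rewrite big_mkcondr /=; apply: eq_bigr => i f.
  have h : (kk i < M.+1)%N by rewrite ltnS (kk_le W) // ltnW.
  rewrite (big_pred1 (Ordinal h)) /=; first by case: (Q _); rewrite ?mul1r ?mul0r.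
  by move=> k; rewrite f /= -val_eqE /= eq_sym.
under eq_bigr do rewrite mulrBr.
rewrite sumrB big_ord_recl big_ord_recr /= sumrB; ring.
Qed.

Lemma ends_ge0 (Q : pred nat) : 0 <= (Q (beta 0))%:R * T' 0%N /\ 0 <= - ((Q (beta M))%:R * T M).
Proof.
split; first by rewrite mulr_ge0 // bot_sum0 ltW // (dr_low D).
by rewrite -mulrN mulr_ge0 // oppr_ge0 -(top_sum_last W) ltW // (dr_high D).
Qed.

(** Without fans in a block the slope sum could not fall from its positive value at the bottom of
    the block to the negative one at the top. *)
Lemma block_fan k : (k <= M)%N -> exists2 i : 'I_N, fan i & beta (kk i) = beta k.
Proof.
move=> kM; apply: NNPP => no; have := blocksE (pred1 (beta k)).
rewrite big1 => [E|i /andP[f /eqP E]]; last by case: no; exists i.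
have [e1 e2] := ends_ge0 (pred1 (beta k)).
have S0 : 0 <= \sum_(k0 < M) ((pred1 (beta k) (beta k0.+1))%:R * T' k0.+1 - (pred1 (beta k) (beta k0))%:R * T k0).
  by apply: sumr_ge0 => i _; apply: share_ge0.
have [kE|kl] := eqVneq k M.
  move: E e2; rewrite [pred1 (beta k) (beta M)]/= kE eqxx mul1r -(top_sum_last W).
  by have := dr_high D; move: S0 e1; rewrite kE; lra.
have kM' : (k < M)%N by rewrite ltn_neqAle kl.
move: E S0; rewrite (bigD1 (Ordinal kM')) //=.
set s := \sum_(i < M | _) _.
have s0 : 0 <= s by apply: sumr_ge0 => i _; apply: (share_ge0 (pred1 (beta k))).
rewrite eqxx mul1r; have [S|nS] := boolP (SS k).
  have -> : beta k.+1 = beta k by rewrite betaS S addn0.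
  rewrite eqxx mul1r (bot_top _ _ _ _ _ _ _ kM').
  by have := flow_dl kM'; move: e1 e2 s0 => /=; lra.
have [h1 h2] := top_lt0 kM' nS.
rewrite betaS nS addn1 -[X in _ == X]addn0 -addn1 eqn_add2l /= mul0r.
by move: e1 e2 s0 => /=; lra.
Qed.

(** The fans of the blocks at the two ends of a gap have to absorb its whole flow, for all gaps of
    [U] at once; the remaining shares are nonnegative. *)
Lemma fans_lower (U P : pred nat) :
  (forall k i, (k < M)%N -> U k -> (i < N)%N -> fan i ->
     beta (kk i) = beta k \/ beta (kk i) = beta k.+1 -> P i) ->
  \sum_(k < M | U k) flow k * (y k.+1 - y k) <= \sum_(i < N | fan i && P i) dl i.
Proof.
move=> H; pose Q B := [exists k : 'I_M, U k && ((B == beta k) || (B == beta k.+1))].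
have QU k : (k < M)%N -> U k -> Q (beta k) /\ Q (beta k.+1).
  by move=> kM Uk; split; apply/existsP; exists (Ordinal kM); rewrite Uk eqxx ?orbT.
apply: (@le_trans _ _ (\sum_(i < N | fan i && Q (beta (kk i))) dl i)).
  have [e1 e2] := ends_ge0 Q.
  rewrite blocksE -addrA -[leLHS]addr0; apply: lerD; last exact: addr_ge0.
  rewrite [leRHS](bigID (fun k : 'I_M => U k)) /= -[leLHS]addr0; apply: lerD.
    apply: ler_sum => k Uk; have [q1 q2] := QU _ (ltn_ord k) Uk.
    by rewrite (share_full (Q := Q)).
  by apply: sumr_ge0 => k _; apply: share_ge0.
rewrite big_mkcond [leRHS]big_mkcond; apply: ler_sum => i _.
case f: (fan i) => //=; have d0 : 0 <= dl i by rewrite /dlt subr_ge0 ltW // (dr_fan D).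
case q: (Q _); last by case: ifP.
suff -> : P i by [].
case/existsP: q => k /andP[Uk h]; apply: (H k i) => //.
by case/orP: h => /eqP->; [left|right].
Qed.

Variable X : pred I2.
Hypothesis Xexc : forall c, X c -> exc lab c.
Hypothesis Xex : exists c, X c.
Definition covered i := [exists c : I2, X c && cov lab c i].

Lemma coveredP i : reflect (exists c : I2, X c /\ cov lab c i) (covered i).
Proof.
apply: (iffP existsP) => -[c]; first by move=> /andP[h1 h2]; exists c.
by move=> [h1 h2]; exists c; rewrite h1.
Qed.

Lemma covered_stp i : covered i -> stp i.
Proof. by case/coveredP=> c [_ /(cov_stp W)]. Qed.

Lemma y_mono i j : (i < j <= M)%N -> y i < y j.
Proof.
elim: j => [|j IH] h; first by lia.
have [->|l] := eqVneq i j; first by apply: yinc; lia.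
by apply: lt_trans (IH _) (yinc _); lia.
Qed.

(** Over an outermost excursion the steps telescope to [u] times the gained height, which is
    negative. The predicate [free n] says that no excursion straddles [n], so the sum can be cut
    there. *)
Lemma covered_neg : \sum_(i < N | covered i) dl i < 0.
Proof.
pose S n := \sum_(i < N | covered i && (n <= i)%N) dl i.
pose free n := forall c, X c -> ~~ (c.1 < n < c.2)%N.
suff H : forall m n, (n + m = N)%N -> free n -> S n <= 0 /\ ((exists2 c, X c & (n <= c.1)%N) -> S n < 0).
  have [|_ h] := H N 0%N erefl; first by move=> c _; rewrite ltn0.
  have [c Xc] := Xex; rewrite (eq_bigl (fun i : 'I_N => covered i && (0 <= i)%N)); first by apply: h; exists c.
  by move=> i; rewrite andbT.
elim/ltn_ind => m IH n nm fr.
have [m0|m0] := posnP m.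
  have nN : n = N by lia.
  have -> : S n = 0 by apply: big1 => i; have := ltn_ord i; lia.
  split=> // -[c Xc h]; have [h1 h2 _ _] := excP (Xexc Xc); lia.
have nN : (n < N)%N by lia.
have [[c [Xc cn]]|no] := classic (exists c, X c /\ c.1 = n :> nat).
  have ec := Xexc Xc; have [h1 h2 h3 h4] := excP ec.
  have SE : S n = xi n - xi c.2 + S c.2.
    rewrite -(@xi_telescope _ _ N kk lab y u v n c.2) //; last lia.
    rewrite /S (bigID (fun i : 'I_N => (i < c.2)%N)) /=; congr (_ + _); apply: eq_bigl => i.
      rewrite -andbA; case h: (n <= i < c.2)%N; rewrite ?andbF //= andbT.
      by apply/coveredP; exists c; rewrite Xc /cov ec cn.
    by case: (covered i) => //=; lia.
  have frc : free c.2.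
    move=> x Xx; apply/negP => hx; have ex := Xexc Xx.
    have [g1 g2 g3 g4] := excP ex.
    have [l|l|l] := ltngtP x.1 c.1.
    - by have := fr x Xx; lia.
    - by have := laminar_strict W ec ex l; lia.
    by have := exc_uniq ec ex (esym l) => E; subst x; lia.
  have [S1 _] := IH (N - c.2)%N ltac:(lia) c.2 ltac:(lia) frc.
  have lt0 : xi n - xi c.2 < 0.
    rewrite /Submission.xi -h3 cn (_ : _ - _ = u (lab n) * (y (kk c.2) - y (kk n))); last by rewrite -cn; ring.
    rewrite nmulr_rlt0 ?(dr_neg D) ?(ltnW nN) // subr_gt0 y_mono // (kk_le W h2) andbT.
    apply: (w_inc W); lia || by rewrite -cn h3.
  by rewrite SE; split; [|move=> _]; lra.
have ncov : ~~ covered n.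
  apply/negP => /coveredP[c [Xc /andP[_ ci]]].
  have [E|l] := eqVneq (c.1 : nat) n; first by apply: no; exists c.
  by have := fr c Xc; lia.
have fr' : free n.+1.
  move=> c Xc; apply/negP => h; have [E|l] := eqVneq (c.1 : nat) n; first by apply: no; exists c.
  by have := fr c Xc; lia.
have SE : S n = S n.+1.
  apply: eq_bigl => i; case: (eqVneq (i : nat) n) => [->|ne]; first by rewrite (negPf ncov).
  by case: (covered i) => //=; lia.
have [S1 S2] := IH m.-1 ltac:(lia) n.+1 ltac:(lia) fr'.
rewrite SE; split=> // -[c Xc h]; apply: S2; exists c => //.
by have [E|l] := eqVneq (c.1 : nat) n; [case: no; exists c | lia].
Qed.

(** Closed means: when a member of [X] passes over an edge climbing a gap, all fans in the blocks at
    this gap are covered by [X]. The covered fans then absorb the flow of all gaps concerned, which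
    outweighs the covered rises, against [covered_neg]. *)
Lemma no_closed : ~ (forall c k i, X c -> (k < M)%N ->
   (exists2 j, rise j & kk j = k /\ strict lab c j) -> (i < N)%N -> fan i ->
   beta (kk i) = beta k \/ beta (kk i) = beta k.+1 -> exists2 x, X x & cov lab x i).
Proof.
move=> H.
pose U k := [exists c : I2, [exists j : 'I_N, [&& X c, rise j, kk j == k & strict lab c j]]].
have low : \sum_(k < M | U k) flow k * (y k.+1 - y k) <= \sum_(i < N | fan i && covered i) dl i.
  apply: fans_lower => k i kM /existsP[c /existsP[j /and4P[Xc rj /eqP kj cj]]] iN f h.
  have [|x Xx xi] := H c k i Xc kM _ iN f h; first by exists j.
  by apply/coveredP; exists x; rewrite Xx.
have := covered_neg; rewrite (sum_split W _ _ _ covered_stp) => neg.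
have : \sum_(i < N | rise i && U (kk i)) dl i <= \sum_(i < N | rise i && covered i) dl i.
  rewrite big_mkcond [leRHS]big_mkcond; apply: ler_sum => i _; case r: (rise i) => //=.
  have dn : dl i <= 0.
    rewrite (rise_dlt W _ _ _ r) nmulr_rle0 ?(dr_neg D) // ?(ltnW (ltn_ord i)) //.
    by rewrite subr_ge0 ltW // yinc // (rise_lt W r).
  case c: (covered i); last by case: ifP.
  suff -> : U (kk i) by [].
  case/coveredP: c => c [Xc /andP[ec ci]].
  apply/existsP; exists c; apply/existsP; exists i; rewrite Xc r eqxx /= /strict ec /=.
  have n : (c.1 : nat) != i.
    by apply: contraTneq r => <-; apply: contraL (exc_fan W ec); apply: rise_not_fan.
  lia.
move=> le; have F := sum_flow W y u v U; move: low neg; rewrite [X in X <= _]F; lra.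
Qed.

End Drawn.

(** * Redrawing the word at new heights *)

Section Transport.
Variables (R : realType) (V : eqType) (N J M : nat).
Variables (kk : nat -> nat) (lab : nat -> V) (SS : nat -> bool).
Hypothesis W : is_word N J M kk lab.
Notation stp := (stp N J).
Notation fan := (fan N J kk).
Notation rise := (rise N J kk).
Notation I2 := ('I_N.+1 * 'I_N.+1)%type.
Notation beta := (beta SS).
Notation exc := (@exc V N lab).
Notation cov := (@cov V N lab).
Notation strict := (@strict V N lab).
Notation own := (@own V N lab).
Variables (y : nat -> R) (u0 v0 : V -> R).
Hypothesis yinc : increasing M y.
Hypothesis D0 : drawn N J kk lab SS y u0 v0.
Variable b : nat -> R.
Hypothesis binc : increasing M b.
Implicit Types c x z : I2.

Let Dl k := b k.+1 - b k.
Let D c := b (kk c.2) - b (kk c.1).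
Let bt i := beta (kk i).

Let Dl_gt0 k : (k < M)%N -> 0 < Dl k. Proof. by move=> h; rewrite subr_gt0 binc. Qed.

Let D_gt0 c : exc c -> 0 < D c.
Proof.
move=> /excP[h1 h2 h3 _]; rewrite subr_gt0 (y_mono binc) // (kk_le W h2) andbT.
by apply: (w_inc W) => //; rewrite h2 andbT; lia.
Qed.

(** The fans of a block share its drop equally; by [block_fan] every block has a fan to receive
    it. *)
Let w i : R := (#|[set j : 'I_N | fan j && (bt j == bt i)]|%:R)^-1.

Let w_gt0 i : (i < N)%N -> fan i -> 0 < w i.
Proof.
move=> iN f; rewrite invr_gt0 ltr0n card_gt0; apply/set0Pn.
by exists (Ordinal iN); rewrite inE /= f eqxx.
Qed.

Let wsum (Q : pred nat) k : (k <= M)%N ->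
  \sum_(i < N | fan i && Q (bt i)) w i * (bt i == beta k)%:R = (Q (beta k))%:R.
Proof.
move=> kM; have [i0 f0 b0] := block_fan W yinc D0 kM.
case q: (Q (beta k)); last first.
  by apply: big1 => i /andP[_ h]; case: eqP => [E|_]; [rewrite E q in h | rewrite mulr0].
pose A := [set j : 'I_N | fan j && (bt j == beta k)].
have A0 : (#|A|%:R : R) != 0.
  by rewrite pnatr_eq0 -lt0n card_gt0; apply/set0Pn; exists i0; rewrite inE f0 /bt b0 eqxx.
transitivity (\sum_(i in A) (#|A|%:R : R)^-1); last first.
  by rewrite sumr_const -[LHS]mulr_natr mulVf.
rewrite big_mkcond [RHS]big_mkcond; apply: eq_bigr => i _; rewrite inE.
case: eqP => [E|_]; rewrite ?andbF ?mulr0 ?if_same // andbT E q andbT.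
by case: (fan i) => //; rewrite mulr1 /w E.
Qed.

(** The flow of a gap is split evenly between the blocks at its two ends; at a joined gap both
    halves go to the same block. *)
Let h k B : R := 2^-1 * (B == beta k)%:R + 2^-1 * (B == beta k.+1)%:R.

Let h_ge0 k B : 0 <= h k B.
Proof. by rewrite addr_ge0 // mulr_ge0 // invr_ge0. Qed.

Let hsum (Q : pred nat) k : (k < M)%N ->
  \sum_(i < N | fan i && Q (bt i)) w i * h k (bt i) =
    2^-1 * (Q (beta k))%:R + 2^-1 * (Q (beta k.+1))%:R.
Proof.
move=> kM; rewrite -(wsum Q (ltnW kM)) -(wsum Q kM) !mulr_sumr -big_split /=.
by apply: eq_bigr => i _; rewrite /h; ring.
Qed.

Let Rr k x : R := \sum_(i < N | rise i && (kk i == k)) (strict x i)%:R.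

Let Rr_ge0 k x : 0 <= Rr k x. Proof. exact: sumr_ge0. Qed.

Let rstrict x : exc x -> \sum_(i < N | rise i && strict x i) Dl (kk i) = D x.
Proof.
move=> ex; have [h1 h2 h3 h4] := excP ex.
rewrite /D -(telescope_rise W b (n := x.1) (m := x.2)) //; last first.
- by move=> i hi; apply: (cov_stp W (c := x)); rewrite /Submission.cov ex.
- by lia.
apply: eq_bigl => i; case r: (rise i) => //=; rewrite /Submission.strict ex /=.
have n : (x.1 : nat) != i.
  by apply: contraTneq r => <-; apply: contraL (exc_fan W ex); apply: rise_not_fan.
lia.
Qed.

Let Rsum x : exc x -> \sum_(k < M) Dl k * Rr k x = D x.
Proof.
move=> ex; rewrite -(rstrict ex).
under [LHS]eq_bigr do rewrite /Rr mulr_sumr.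
rewrite (exchange_big_dep (fun i : 'I_N => rise i)) /=; last by move=> i j _ /andP[].
rewrite [RHS]big_mkcondr /=; apply: eq_bigr => i r; have hk := rise_lt W r.
rewrite (big_pred1 (Ordinal hk)) /=; first by case: (strict x i); rewrite ?mulr1 ?mulr0.
by move=> k; rewrite r /= -val_eqE /= eq_sym.
Qed.

(** The unknown of [x] is its depth times its gain [D x]. The depth increases the flow of the gaps
    climbed strictly inside [x], and [A c x] is the fraction of the unknown that the fans owned by
    [c] have to drop on this account. The constant term [e c] comes from the base value of [u] and
    from the two ends. *)
Let A c x : R := \sum_(i < N | fan i && own c i) w i * \sum_(k < M) h k (bt i) * (Dl k * (Rr k x / D x)).
Let f1 k : R := \sum_(i < N | rise i && (kk i == k)) 1.
(** One extra unit of drop for the bottom block and one for the top block, so that the slope sum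
    goes from 1 at the lowest edges to -1 at the topmost ones. *)
Let ends B : R := (B == beta 0)%:R + (B == beta M)%:R.
Let MB1 B : R := \sum_(k < M) h k B * (Dl k * f1 k) + ends B.
Let e c : R := \sum_(i < N | fan i && own c i) w i * MB1 (bt i).

Let own_nexc c i : ~~ exc c -> own c i = false.
Proof. by move=> n; apply: contraNF n; apply: own_exc. Qed.

Let Rr_nexc k x : ~~ exc x -> Rr k x = 0.
Proof. by move=> n; apply: big1 => i _; rewrite /Submission.strict (negPf n). Qed.

Let A_ge0 c x : 0 <= A c x.
Proof.
apply: sumr_ge0 => i /andP[f _]; apply: mulr_ge0; first by rewrite ltW // w_gt0.
apply: sumr_ge0 => k _; apply: mulr_ge0 => //; apply: mulr_ge0; first by rewrite ltW // Dl_gt0.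
have [ex|nx] := boolP (exc x); first by rewrite divr_ge0 // ltW // D_gt0.
by rewrite Rr_nexc // mul0r.
Qed.

Let e_ge0 c : 0 <= e c.
Proof.
apply: sumr_ge0 => i /andP[f _]; apply: mulr_ge0; first by rewrite ltW // w_gt0.
apply: addr_ge0; last exact: addr_ge0.
apply: sumr_ge0 => k _; apply: mulr_ge0 => //; apply: mulr_ge0; first by rewrite ltW // Dl_gt0.
exact: sumr_ge0.
Qed.

(** The columns of [A] sum to at most 1, so adding up the inequalities over the support of [z]
    leaves no loss. Hence every fan at a gap climbed by the support is owned by it, and the support
    is a closed set excluded by [no_closed]. *)
Let no_closed_sol (z : I2 -> R) : (forall c, 0 <= z c) -> (forall c, z c <= \sum_x A c x * z x) ->
  forall c, z c = 0.
Proof.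
move=> z0 zA c0; apply/eqP/negPn/negP => nz.
pose X : pred I2 := fun c => 0 < z c.
have Xexc c : X c -> exc c.
  move=> Xc; apply/negPn/negP => nc; have := zA c; rewrite big1 => [|x _].
    by move=> h0; move: Xc; rewrite /X ltNge h0.
  by rewrite /A big1 ?mul0r // => i; rewrite (own_nexc _ nc) andbF.
have Xc0 : X c0 by rewrite /X lt_def nz z0.
pose a x := z x / D x.
have aE x : X x -> z x = a x * D x by move=> Xx; rewrite divfK // gt_eqF // D_gt0 // Xexc.
have a_gt0 x : X x -> 0 < a x by move=> Xx; rewrite divr_gt0 // D_gt0 // Xexc.
pose ownX i := [exists c : I2, X c && own c i].
pose O k := \sum_(i < N | fan i && ownX i) w i * h k (bt i).
have total k : (k < M)%N -> \sum_(i < N | fan i) w i * h k (bt i) = 1.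
  by move=> kM; have := hsum predT kM; rewrite (eq_bigl (fun i : 'I_N => fan i)) => [->|i]; [rewrite /=; lra | rewrite andbT].
have O1 k : (k < M)%N -> 1 - O k = \sum_(i < N | fan i && ~~ ownX i) w i * h k (bt i).
  by move=> kM; have := total k kM; rewrite (bigID (fun i : 'I_N => ownX i)) /= => <-; rewrite /O addrAC subrr add0r.
have Ole k : (k < M)%N -> 0 <= 1 - O k.
  move=> kM; rewrite O1 //; apply: sumr_ge0 => i /andP[f _].
  by rewrite mulr_ge0 // ltW // w_gt0.
have OE k : \sum_(c | X c) \sum_(i < N | fan i && own c i) w i * h k (bt i) = O k.
  rewrite (exchange_big_dep (fun i : 'I_N => fan i)) /=; last by move=> i j _ /andP[].
  rewrite /O [RHS]big_mkcondr /=; apply: eq_bigr => i f; case: ifP => [/existsP[c /andP[Xc oc]]|no].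
    rewrite (big_pred1 c) // => x; rewrite f /=; apply/idP/eqP => [/andP[_ ox]|->]; last by rewrite Xc.
    exact: own_uniq ox oc.
  by apply: big1 => x /andP[Xx /andP[_ ox]]; move/existsP: no; case; exists x; rewrite Xx.
have sum1 : \sum_(c | X c) z c <= \sum_(x | X x) a x * \sum_(k < M) Dl k * Rr k x * O k.
  apply: (@le_trans _ _ (\sum_(c | X c) \sum_(x | X x) A c x * z x)).
    apply: ler_sum => c _; apply: le_trans (zA c) _.
    rewrite (bigID X) /= [X in _ + X]big1 ?addr0 // => x nX.
    by have := z0 x; rewrite le_eqVlt => /orP[/eqP<-|h0]; rewrite ?mulr0 //; case/negP: nX.
  rewrite exchange_big /=; apply: ler_sum => x Xx.
  have Dn : D x != 0 by rewrite gt_eqF // D_gt0 // Xexc.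
  rewrite le_eqVlt; apply/orP; left; apply/eqP.
  have AE c : A c x = \sum_(k < M) \sum_(i < N | fan i && own c i) w i * h k (bt i) * (Dl k * (Rr k x / D x)).
    rewrite [RHS]exchange_big; apply: eq_bigr => i _; rewrite mulr_sumr.
    by apply: eq_bigr => k _; ring.
  rewrite -mulr_suml (eq_bigr _ (fun c _ => AE c)).
  rewrite exchange_big /= mulr_suml mulr_sumr; apply: eq_bigr => k _.
  rewrite -(OE k) !mulr_sumr mulr_suml; apply: eq_bigr => c _.
  rewrite !mulr_sumr mulr_suml; apply: eq_bigr => i _ /=.
  by rewrite -mulr_sumr -/(Rr k x) /a; field.
have sum2 : \sum_(x | X x) \sum_(k < M) a x * (Dl k * Rr k x * (1 - O k)) <= 0.
  rewrite (_ : \sum_(x | X x) _ = \sum_(c | X c) z c - \sum_(x | X x) a x * \sum_(k < M) Dl k * Rr k x * O k).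
    by rewrite subr_le0.
  rewrite -sumrB; apply: eq_bigr => x Xx; rewrite aE // -(Rsum (Xexc _ Xx)).
  by rewrite -mulrBr -sumrB mulr_sumr; apply: eq_bigr => k _; ring.
have term_ge0 x k : X x -> (k < M)%N -> 0 <= a x * (Dl k * Rr k x * (1 - O k)).
  by move=> Xx kM; rewrite mulr_ge0 ?(ltW (a_gt0 _ Xx)) // mulr_ge0 ?Ole // mulr_ge0 // ltW // Dl_gt0.
have term0 x k : X x -> (k < M)%N -> Rr k x != 0 -> 1 - O k = 0.
  move=> Xx kM Rn; have s2 : \sum_(x | X x) \sum_(k < M) a x * (Dl k * Rr k x * (1 - O k)) = 0.
    apply/eqP; rewrite eq_le sum2; apply: sumr_ge0 => x' Xx'; apply: sumr_ge0 => k' _.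
    exact: term_ge0.
  have s3 : \sum_(k < M) a x * (Dl k * Rr k x * (1 - O k)) = 0.
    have /eqP := s2; rewrite psumr_eq0 => [/allP/(_ x)|x' Xx'].
      by rewrite mem_index_enum Xx => /(_ isT)/eqP.
    by apply: sumr_ge0 => k' _; apply: term_ge0.
  have /eqP := s3; rewrite psumr_eq0 => [/allP/(_ (Ordinal kM))|k' _]; last exact: term_ge0.
  rewrite mem_index_enum => /(_ isT) /=.
  by rewrite mulf_eq0 (gt_eqF (a_gt0 _ Xx)) mulf_eq0 (mulf_eq0 (Dl k)) (gt_eqF (Dl_gt0 kM)) (negPf Rn) /= => /eqP.
apply: (no_closed W yinc D0 (X := X)) => //; first by exists c0.
move=> c k i Xc kM [j rj [kj sj]] iN f hb.
have jN : (j < N)%N by case/andP: rj => /andP[].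
have Rn : Rr k c != 0.
  rewrite /Rr (bigD1 (Ordinal jN)) /= ?rj ?kj ?eqxx // sj gt_eqF // ltr_pwDl //.
  exact: sumr_ge0.
have := term0 c k Xc kM Rn; rewrite O1 // => /eqP.
rewrite psumr_eq0 => [/allP/(_ (Ordinal iN))|i' /andP[f' _]]; last first.
  by rewrite mulr_ge0 // ltW // w_gt0.
rewrite mem_index_enum f /= => /(_ isT); case oX: (ownX i) => /=.
  by move=> _; case/existsP: oX => x /andP[Xx ox]; exists x => //; apply: own_cov.
have hp : 0 < h k (bt i).
  by case: hb => E; rewrite /h /bt E eqxx; [apply: ltr_pwDl|apply: ltr_wpDl];
    rewrite ?mulr1 ?invr_gt0 ?ltr0n // mulr_ge0 // invr_ge0.
by rewrite mulf_eq0 (gt_eqF (w_gt0 iN f)) (gt_eqF hp).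
Qed.

Let solution : exists al : I2 -> R, [/\ forall c, 0 <= al c, forall c, ~~ exc c -> al c = 0 &
  forall c, exc c -> al c * D c = e c + \sum_x A c x * (al x * D x)].
Proof.
have [z [z0 zE]] := nonneg_system A_ge0 e_ge0 no_closed_sol.
have zn c : ~~ exc c -> z c = 0.
  move=> nc; rewrite zE /e big1 ?add0r => [|i]; last by rewrite (own_nexc _ nc) andbF.
  by apply: big1 => x _; rewrite /A big1 ?mul0r // => i; rewrite (own_nexc _ nc) andbF.
have aE x : z x / D x * D x = z x.
  have [ex|nx] := boolP (exc x); first by rewrite divfK // gt_eqF // D_gt0.
  by rewrite zn // !mul0r.
exists (fun c => z c / D c); split=> [c|c nc|c ec].
- have [ec|nc] := boolP (exc c); first by rewrite divr_ge0 // ltW // D_gt0.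
  by rewrite zn // mul0r.
- by rewrite zn // mul0r.
by rewrite aE zE; congr (_ + _); apply: eq_bigr => x _; rewrite aE.
Qed.

Section Solution.
Variable al : I2 -> R.
Hypothesis al_ge0 : forall c, 0 <= al c.
Hypothesis al_nexc : forall c, ~~ exc c -> al c = 0.
Hypothesis alE : forall c, exc c -> al c * D c = e c + \sum_x A c x * (al x * D x).

(** The dual coordinate [u] at position [n]: a base value, lowered by the depth of every excursion
    strictly around [n]. Nested labels are therefore nearer to the line. *)
Let un n : R := -1 - \sum_c (strict c n)%:R * al c.
Let fl k : R := \sum_(i < N | rise i && (kk i == k)) - un i.
Let MB B : R := \sum_(k < M) h k B * (Dl k * fl k) + ends B.
Let del i := w i * MB (bt i).

Let un_lt0 n : un n < 0.
Proof.
have : 0 <= \sum_c (strict c n)%:R * al c by apply: sumr_ge0 => c _; rewrite mulr_ge0.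
by rewrite /un; lra.
Qed.

Let flE k : fl k = f1 k + \sum_x Rr k x * al x.
Proof.
rewrite /fl /un; under eq_bigr do rewrite opprB opprK addrC.
rewrite big_split /=; congr (_ + _); rewrite exchange_big /=.
by apply: eq_bigr => x _; rewrite mulr_suml.
Qed.

Let fl_gt0 k : (k < M)%N -> 0 < fl k.
Proof.
move=> kM; have [n [m [rn _ _ kn _]]] := rises_at W kM.
have nN : (n < N)%N by case/andP: rn => /andP[].
rewrite /fl (bigD1 (Ordinal nN)) /= ?rn ?kn ?eqxx // ltr_pwDl ?oppr_gt0 ?un_lt0 //.
by apply: sumr_ge0 => i _; rewrite oppr_ge0 ltW.
Qed.

Let MB_gt0 k : (k <= M)%N -> 0 < MB (beta k).
Proof.
move=> kM; have pos j : (j < M)%N -> 0 <= h j (beta k) * (Dl j * fl j).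
  by move=> jM; rewrite mulr_ge0 // ltW // mulr_gt0 ?Dl_gt0 ?fl_gt0.
have e0 : 0 <= ends (beta k) by rewrite addr_ge0.
have [->|kl] := eqVneq k M.
  rewrite /MB ltr_wpDl //; last by rewrite /ends eqxx ltr_wpDl.
  apply: sumr_ge0 => j _; rewrite mulr_ge0 // ltW // mulr_gt0 ?Dl_gt0 ?fl_gt0 //.
have kM' : (k < M)%N by rewrite ltn_neqAle kl.
rewrite /MB ltr_pwDl // (bigD1 (Ordinal kM')) //= ltr_pwDl //; last by apply: sumr_ge0 => j _; apply: pos.
rewrite !mulr_gt0 ?Dl_gt0 ?fl_gt0 // /h eqxx ltr_pwDl ?mulr1 ?invr_gt0 ?ltr0n //.
by rewrite mulr_ge0 // invr_ge0.
Qed.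

Let del_gt0 i : (i < N)%N -> fan i -> 0 < del i.
Proof. by move=> iN f; rewrite mulr_gt0 ?w_gt0 // MB_gt0 // (kk_le W) // ltnW. Qed.

Let MBE B : MB B = MB1 B + \sum_x al x * \sum_(k < M) h k B * (Dl k * Rr k x).
Proof.
rewrite /MB /MB1 addrAC; congr (_ + _).
under [X in _ = _ + X]eq_bigr do rewrite mulr_sumr.
rewrite exchange_big -big_split /=; apply: eq_bigr => k _.
rewrite flE !mulrDr; congr (_ + _); rewrite mulr_sumr mulr_sumr; apply: eq_bigr => x _; ring.
Qed.

(** The linear system in its geometric form: depth times gain is the total drop of the fans owned by
    the excursion. *)
Let al_own c : exc c -> al c * D c = \sum_(i < N | fan i && own c i) del i.
Proof.
move=> ec; rewrite alE // /del.
under [RHS]eq_bigr do rewrite MBE mulrDr.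
rewrite big_split /=; congr (_ + _).
under [RHS]eq_bigr do rewrite mulr_sumr.
rewrite exchange_big /=; apply: eq_bigr => x _; rewrite /A mulr_suml.
apply: eq_bigr => i _.
have [ex|nx] := boolP (exc x); last by rewrite (al_nexc nx) mul0r !mulr0 mul0r mulr0.
have Dn : D x != 0 by rewrite gt_eqF // D_gt0.
rewrite -mulrA; congr (_ * _); rewrite mulr_suml mulr_sumr; apply: eq_bigr => k _.
have [Rk RkE] : exists Rk, Rr k x = Rk by eexists.
by rewrite RkE; field.
Qed.

(** By [w_nc] an excursion surrounds either all occurrences of a label or none. *)
Let un_lab n m : (n <= m <= N)%N -> lab n = lab m -> un n = un m.
Proof.
move=> nm E; have [->//|ne] := eqVneq n m.
suff main c : strict c n = strict c m.
  by rewrite /un; congr (_ - _); apply: eq_bigr => c _; rewrite main.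
have [ec|nc] := boolP (exc c); last by rewrite /Submission.strict (negPf nc).
have [h1 h2 h3 h4] := excP ec; rewrite /Submission.strict ec /=.
apply/idP/idP => hc.
  have mc : m != c.2 by apply: contraTneq (h4 _ hc) => mc; rewrite E mc h3 eqxx.
  suff : (m < c.2)%N by lia.
  rewrite ltnNge; apply/negP => cm.
  have F := w_nc W (i := c.1) (j := n) (k := c.2) (l := m) ltac:(lia) ltac:(lia) h3 E.
  by have := h4 _ hc; rewrite F eqxx.
have nc : n != c.1 by apply: contraTneq (h4 _ hc) => nc; rewrite -E nc eqxx.
suff : (c.1 < n)%N by lia.
rewrite ltnNge; apply/negP => cn.
have F := w_nc W (i := n) (j := c.1) (k := m) (l := c.2) ltac:(lia) ltac:(lia) E h3.
by have := h4 _ hc; rewrite -E F eqxx.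
Qed.

Let stepd i : R := (fan i)%:R * del i + (rise i)%:R * (un i * Dl (kk i)).

(** The offset on the right makes [xn J.+1] equal to 1. Position [J] itself contributes nothing,
    being neither a fan nor a rise. *)
Let base n : R := if (n <= J)%N then 0 else 1 + \sum_(i < N | (i < J.+1)%N) stepd i.
Let xn n : R := base n - \sum_(i < N | (i < n)%N) stepd i.

Let xn_range i j : (i <= j)%N -> (j <= N)%N -> (i <= J)%N = (j <= J)%N ->
  xn i - xn j = \sum_(l < N | (i <= l < j)%N) stepd l.
Proof.
move=> ij jN side; rewrite /xn /base side.
have -> : \sum_(l < N | (l < j)%N) stepd l = \sum_(l < N | (l < i)%N) stepd l + \sum_(l < N | (i <= l < j)%N) stepd l.
  rewrite (bigID (fun l : 'I_N => (l < i)%N)) /=; congr (_ + _); apply: eq_bigl => l; lia.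
by ring.
Qed.

Let xn_step i : stp i -> xn i - xn i.+1 = stepd i.
Proof.
move=> /andP[iN iJ]; rewrite (@xn_range i i.+1) //; last lia.
by rewrite (big_pred1 (Ordinal iN)) // => l; rewrite /= -val_eqE /=; lia.
Qed.

Let xn_fan i : fan i -> xn i - xn i.+1 = del i.
Proof.
move=> f; have s : stp i by case/andP: f.
rewrite xn_step // /stepd f mul1r; case r: (rise i); last by rewrite mul0r addr0.
by have := rise_not_fan r; rewrite f.
Qed.

Let exc_side c : exc c -> (c.1 <= J)%N = (c.2 <= J)%N.
Proof.
move=> ec; have [h1 h2 h3 h4] := excP ec.
have [l1|l1] := leqP c.1 J; have [l2|l2] := leqP c.2 J; rewrite ?l2 //; last lia.
by have := @w_side _ _ _ _ _ _ W c.1 c.2; rewrite l1 l2 h3 eqxx => /(_ isT h2).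
Qed.

Let inner x c := [&& exc x, (c.1 <= x.1)%N & (x.2 <= c.2)%N].

Let un_diff c i : exc c -> rise i -> cov c i ->
  un c.1 - un i = \sum_(x | inner x c && strict x i) al x.
Proof.
move=> ec r ci; have E : forall p q : R, -1 - p - (-1 - q) = q - p by move=> *; ring.
rewrite /un E -sumrB [RHS]big_mkcond.
suff main x : ((strict x i)%:R - (strict x c.1)%:R) * al x = if inner x c && strict x i then al x else 0.
  by apply: eq_bigr => x _; rewrite -mulrBl main.
rewrite /inner; have [ex|nx] := boolP (exc x); last by rewrite (al_nexc nx) mulr0 /=.
have [h1 h2 h3 h4] := excP ec; have [g1 g2 g3 g4] := excP ex.
case/andP: (ci) => _ ci'; rewrite /Submission.strict ex /=.
have [l|l] : (x.1 < c.1)%N \/ (c.1 <= x.1)%N by lia.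
  have -> : (x.1 < i < x.2)%N = (x.1 < c.1 < x.2)%N.
    apply/idP/idP => hx; first lia.
    by have := laminar_strict W ex ec l; lia.
  by rewrite subrr mul0r leqNgt l.
rewrite (_ : (x.1 < c.1 < x.2)%N = false) ?subr0; last lia.
case hx: (x.1 < i < x.2)%N; rewrite ?mul0r ?andbF // mul1r andbT /=.
suff -> : (x.2 <= c.2)%N by rewrite l.
have [F|l'] := eqVneq (c.1 : nat) x.1; first by rewrite (exc_uniq ec ex F).
by apply: (laminar W ec ex); lia.
Qed.

(** The two occurrences can lie on one point only if the slope changes by [un c.1] times the gain.
    The rises inside use lower values of [u]; the discrepancy adds up depth times gain over [c] and
    the excursions nested in it, and by [al_own] this is the drop of all fans covered by [c]. *)
Let exc_loop c : exc c -> xn c.1 - xn c.2 = un c.1 * D c.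
Proof.
move=> ec; have [h1 h2 h3 h4] := excP ec.
rewrite xn_range ?exc_side //; last lia.
have st i : (c.1 <= i < c.2)%N -> stp i by move=> hi; apply: (cov_stp W (c := c)); rewrite /Submission.cov ec.
have DE : D c = \sum_(i < N | rise i && cov c i) Dl (kk i).
  rewrite /D -(telescope_rise W b (n := c.1) (m := c.2)) //; last lia.
  by apply: eq_bigl => i; rewrite /Submission.cov ec.
have -> : \sum_(l < N | (c.1 <= l < c.2)%N) stepd l =
    \sum_(i < N | fan i && cov c i) del i + \sum_(i < N | rise i && cov c i) un i * Dl (kk i).
  rewrite [X in X + _]big_mkcond [X in _ + X]big_mkcond -big_split [LHS]big_mkcond /=.
  apply: eq_bigr => i _; rewrite /Submission.cov ec /stepd /=; case: ifP => ci; last by rewrite !andbF addr0.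
  by rewrite !andbT; congr (_ + _); case: ifP; rewrite ?mul1r ?mul0r.
rewrite DE mulr_sumr.
suff E : \sum_(i < N | rise i && cov c i) un c.1 * Dl (kk i) -
    \sum_(i < N | rise i && cov c i) un i * Dl (kk i) = \sum_(i < N | fan i && cov c i) del i.
  by rewrite -E subrK.
rewrite -sumrB.
have icov x i : inner x c -> cov c i && strict x i = strict x i.
  by case/and3P=> ex l1 l2; rewrite /Submission.strict /Submission.cov ex ec /=; lia.
have icov2 x (i : nat) : inner x c -> cov x i -> cov c i.
  by case/and3P=> ex l1 l2 /andP[_ hx]; rewrite /Submission.cov ec /=; lia.
transitivity (\sum_(i < N | rise i && cov c i) \sum_(x | inner x c && strict x i) al x * Dl (kk i)).
  by apply: eq_bigr => i /andP[r ci]; rewrite -mulrBl un_diff // mulr_suml.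
rewrite (exchange_big_dep (fun x => inner x c)) /=; last by move=> i x _ /andP[].
transitivity (\sum_(x | inner x c) \sum_(i < N | fan i && own x i) del i).
  apply: eq_bigr => x ix; case/and3P: (ix) => ex _ _.
  rewrite -(al_own ex) -(rstrict ex) mulr_sumr; apply: eq_bigl => i; rewrite ix /=.
  by case: (rise i) => //=; apply: icov.
rewrite (exchange_big_dep (fun i : 'I_N => fan i && cov c i)) /=.
  apply: eq_bigr => i /andP[f ci]; have [x ox [l1 l2]] := own_exists W ci.
  rewrite (big_pred1 x) // => x'; rewrite f /=; apply/andP/eqP => [[_ ox']|->].
    exact: own_uniq ox' ox.
  by rewrite /inner (own_exc ox) l1 l2.
move=> x i ix /andP[-> /own_cov ox] /=; exact: icov2 ix ox.
Qed.

(** All occurrences of a label describe the same dual point, so the values [uL] and [vL] do not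
    depend on the occurrence that is picked. The proof goes from one occurrence to the next, by a
    rise or by an excursion. *)
Let xn_lab n m : (n <= m <= N)%N -> lab n = lab m ->
  xn m = xn n - un n * (b (kk m) - b (kk n)).
Proof.
move: {-1}(m - n)%N (leqnn (m - n)) => s; elim: s n m => [|s IH] n m ms nm E.
  by rewrite (_ : m = n) ?subrr ?mulr0 ?subr0 //; lia.
have [->|nem] := eqVneq n m; first by rewrite subrr mulr0 subr0.
have ex : exists p, (n < p <= m)%N && (lab p == lab n) by exists m; rewrite E eqxx andbT; lia.
case: (ex_minnP ex) => p /andP[np /eqP Ep] pmin.
have IHp := IH p m ltac:(lia) ltac:(lia) (etrans Ep E).
have unp := @un_lab n p ltac:(lia) (esym Ep).
suff step : xn p = xn n - un n * (b (kk p) - b (kk n)) by rewrite IHp step -unp; ring.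
have [p1|p1] := eqVneq p n.+1.
  have s1 : stp n.
    rewrite /Submission.stp; apply/andP; split; first lia.
    apply/eqP => nJ; have := @w_side _ _ _ _ _ _ W n p; rewrite Ep eqxx nJ p1 nJ leqnn ltnSn.
    by move=> /(_ isT ltac:(lia)).
  have r : rise n.
    case/orP: (stp_case W s1) => /andP[] // f _; have := fan_lab W f.
    by rewrite -p1 Ep eqxx.
  have := xn_step s1; rewrite /stepd r (negPf (rise_not_fan r)) mul0r mul1r add0r p1 (rise_kk r) /Dl.
  lra.
have pN : (p < N.+1)%N by lia. have nN : (n < N.+1)%N by lia.
pose c : I2 := (Ordinal nN, Ordinal pN).
have ec : exc c.
  apply/and3P; split; [rewrite /=; lia|by rewrite /= Ep|].
  apply/forallP => i; apply/implyP => /= hi; apply/negP => /eqP Ei.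
  by have := pmin i; rewrite Ei eqxx andbT => /(_ ltac:(lia)); lia.
by have := exc_loop ec; rewrite /D /=; lra.
Qed.

Let uL p : R := if [pick i : 'I_N.+1 | lab i == p] is Some i then un i else -1.
Let vL p : R := if [pick i : 'I_N.+1 | lab i == p] is Some i then xn i + un i * b (kk i) else 0.

Let uLE n : (n <= N)%N -> uL (lab n) = un n.
Proof.
move=> nN; rewrite /uL; case: pickP => [i /eqP E|/(_ (Ordinal (nN : (n < N.+1)%N)))]; last by rewrite eqxx.
have iN : (i <= N)%N by rewrite -ltnS.
have [l|l] := leqP i n; first by apply: un_lab => //; rewrite l.
by symmetry; apply: un_lab => //; rewrite ltnW.
Qed.

Let xiE n : (n <= N)%N -> xi kk lab b uL vL n = xn n.
Proof.
move=> nN; rewrite /xi uLE // /vL; case: pickP => [i /eqP E|/(_ (Ordinal (nN : (n < N.+1)%N)))]; last by rewrite eqxx.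
have iN : (i <= N)%N by rewrite -ltnS.
have [l|l] := leqP i n.
  by rewrite (xn_lab (n := i) (m := n)) ?l // (un_lab (n := i) (m := n)) ?l //; ring.
have l' := ltnW l; rewrite (xn_lab (n := n) (m := i)) ?l' // -(un_lab (n := n) (m := i)) ?l' //; ring.
Qed.

Let flowE k : flow N J kk lab uL k = fl k.
Proof. by apply: eq_bigr => i _; rewrite uLE // ltnW. Qed.

Let fan_sum (Q : pred nat) : \sum_(i < N | fan i && Q (bt i)) del i =
  \sum_(k < M) (2^-1 * (Q (beta k))%:R + 2^-1 * (Q (beta k.+1))%:R) * (fl k * Dl k)
  + (Q (beta 0))%:R + (Q (beta M))%:R.
Proof.
rewrite /del /MB /ends; under eq_bigr do rewrite mulrDr mulrDr mulr_sumr.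
rewrite !big_split /= -addrA; congr (_ + _); last by rewrite !wsum.
rewrite exchange_big /=; apply: eq_bigr => k _; rewrite -hsum // mulr_suml.
by apply: eq_bigr => i _; ring.
Qed.

Let xn0 : xn 0%N = 0.
Proof. by rewrite /xn /base leq0n big_pred0 ?subr0 // => i; rewrite ltn0. Qed.

Let xnJ1 : xn J.+1 = 1.
Proof. by rewrite /xn /base ltnn addrK. Qed.

Let topE k : top_sum N J M kk lab b uL vL k =
  1 - \sum_(i < N | fan i && (kk i <= k)%N) del i + \sum_(j < M | (j < k)%N) fl j * Dl j.
Proof.
rewrite /top_sum !xiE //; last exact: w_JN W.
rewrite xn0 xnJ1 add0r; congr (_ - _ + _); last by apply: eq_bigr => j _; rewrite flowE.
apply: eq_bigr => i /andP[f _]; rewrite /dlt !xiE ?xn_fan //; exact: ltnW.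
Qed.

Lemma solution_drawn : drawn N J kk lab SS b uL vL.
Proof.
have JN := w_JN W.
split.
- by move=> i iN; rewrite uLE.
- move=> i f; have iN : (i < N)%N by case/andP: f => /andP[].
  by rewrite (xiE iN) (xiE (ltnW iN)) -subr_gt0 xn_fan // del_gt0.
- by rewrite !xiE // xn0 xnJ1 add0r ltr01.
- rewrite (top_sum_last W) topE.
  rewrite (eq_bigl (fun i : 'I_N => fan i && predT (bt i))); last first.
    by move=> i; rewrite (kk_le W) //= ltnW.
  rewrite (fan_sum predT).
  have -> : \sum_(k < M) (2^-1 * (predT (beta k))%:R + 2^-1 * (predT (beta k.+1))%:R) * (fl k * Dl k) =
      \sum_(k < M) fl k * Dl k by apply: eq_bigr => k _ /=; field.
  have -> : \sum_(j < M | (j < M)%N) fl j * Dl j = \sum_(k < M) fl k * Dl k.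
    by apply: eq_bigl => j; rewrite ltn_ord.
  by rewrite /=; lra.
move=> n m rn rm nJm E nS; have kM := rise_lt W rn.
rewrite (top_sumE W _ _ _ rn rm) // (bot_sumE W _ _ _ rn rm) // bot_top //.
set k := kk n in nS kM *.
have bS : beta k.+1 = (beta k).+1 by rewrite betaS nS addn1.
(* Even splitting means that an unjoined gap is entered at minus half of its flow and left at plus
   half, which gives both signs. *)
suff -> : top_sum N J M kk lab b uL vL k = - 2^-1 * (fl k * Dl k).
  rewrite flowE; have := mulr_gt0 (fl_gt0 kM) (Dl_gt0 kM); rewrite /Dl; lra.
rewrite topE (eq_bigl (fun i : 'I_N => fan i && (fun B => B <= beta k)%N (bt i))); last first.
  move=> i; congr (_ && _); rewrite /bt; apply/idP/idP => [|hb]; first exact: beta_mono.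
  by rewrite leqNgt; apply/negP => /(beta_mono SS); lia.
rewrite (fan_sum (fun B => B <= beta k)%N) /= (beta_mono SS (leq0n k)) //.
have -> : (beta M <= beta k)%N = false by have := beta_mono SS kM; lia.
rewrite (bigID (fun j : 'I_M => (j < k)%N)) /=.
have -> : \sum_(j < M | (j < k)%N) (2^-1 * (beta j <= beta k)%N%:R + 2^-1 * (beta j.+1 <= beta k)%N%:R) * (fl j * Dl j)
    = \sum_(j < M | (j < k)%N) fl j * Dl j.
  by apply: eq_bigr => j jk; rewrite (beta_mono SS (ltnW jk)) // (beta_mono SS jk) //=; field.
set S1 := \sum_(j < M | (j < k)%N) fl j * Dl j.
rewrite (bigD1 (Ordinal kM)) /= ?ltnn // leqnn bS ltnn big1 /= => [|j /andP[jk]]; first by field.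
rewrite -val_eqE /= => jk'; have lt : (k < j)%N by lia.
have := beta_mono SS lt; have := beta_mono SS (leqW lt); rewrite bS => h1 h2.
have -> : (beta j <= beta k)%N = false by lia.
have -> : (beta j.+1 <= beta k)%N = false by have := beta_mono SS (leqnSn j); lia.
by rewrite !mulr0 addr0 mul0r.
Qed.

(** An excursion around [i.-1] cannot end at the first occurrence of a label, so it is still around
    [i]; one that is around [i] only must start at [i.-1]. *)
Let un_first i : (0 < i <= N)%N -> (forall j, (j < i)%N -> lab j != lab i) ->
  un i <= un i.-1 /\ (un i < un i.-1 -> exists2 c, exc c & c.1 = i.-1 :> nat /\ (i < c.2)%N).
Proof.
move=> iN first_.
have sub c : strict c i.-1 -> strict c i.
  case/andP=> ec hc; have [h1 h2 h3 h4] := excP ec; rewrite /Submission.strict ec /=.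
  have : i != c.2 by apply/eqP => ic; have := first_ c.1 ltac:(lia); rewrite ic h3 eqxx.
  lia.
have term c : (strict c i.-1)%:R * al c <= (strict c i)%:R * al c.
  by rewrite ler_wpM2r // ler_nat; case s: (strict c i.-1) => //; rewrite sub.
split; first by rewrite /un lerD2l lerN2; apply: ler_sum => c _.
move=> lt; apply: NNPP => no; move: lt; rewrite ltNge => /negP; apply.
have sup c : strict c i -> strict c i.-1.
  case/andP=> ec hc; rewrite /Submission.strict ec /=.
  have : c.1 != i.-1 :> nat by apply/eqP => ci; apply: no; exists c => //; split=> //; lia.
  lia.
rewrite /un lerD2l lerN2; apply: ler_sum => c _; rewrite ler_wpM2r // ler_nat.
by case s: (strict c i) => //; rewrite sup.
Qed.

Let un_last j : (j < N)%N -> (forall l, (j < l <= N)%N -> lab l != lab j) ->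
  un j <= un j.+1 /\ (un j < un j.+1 -> exists2 c, exc c & c.2 = j.+1 :> nat /\ (c.1 < j)%N).
Proof.
move=> jN last_.
have sub c : strict c j.+1 -> strict c j.
  case/andP=> ec hc; have [h1 h2 h3 h4] := excP ec; rewrite /Submission.strict ec /=.
  have : j != c.1 by apply/eqP => jc; have := last_ c.2 ltac:(lia); rewrite jc h3 eqxx.
  lia.
have term c : (strict c j.+1)%:R * al c <= (strict c j)%:R * al c.
  by rewrite ler_wpM2r // ler_nat; case s: (strict c j.+1) => //; rewrite sub.
split; first by rewrite /un lerD2l lerN2; apply: ler_sum => c _.
move=> lt; apply: NNPP => no; move: lt; rewrite ltNge => /negP; apply.
have sup c : strict c j -> strict c j.+1.
  case/andP=> ec hc; rewrite /Submission.strict ec /=.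
  have : c.2 != j.+1 :> nat by apply/eqP => ci; apply: no; exists c => //; split=> //; lia.
  lia.
rewrite /un lerD2l lerN2; apply: ler_sum => c _; rewrite ler_wpM2r // ler_nat.
by case s: (strict c j) => //; rewrite sup.
Qed.

(** If both neighbours are strictly farther from the line, an excursion starts at [i.-1] and another
    one ends at [j.+1]. Each contains all positions from [i] to [j], and by [w_nc] they carry the
    same label. *)
Lemma solution_hull i j : (0 < i <= j)%N -> (j < N)%N -> lab i = lab j ->
  (forall l, (l < i)%N -> lab l != lab i) -> (forall l, (j < l <= N)%N -> lab l != lab i) ->
  [/\ uL (lab i) <= uL (lab i.-1), uL (lab i) <= uL (lab j.+1) &
   uL (lab i) < uL (lab i.-1) -> uL (lab i) < uL (lab j.+1) -> lab i.-1 = lab j.+1].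
Proof.
move=> ij jN E fi la; rewrite E in la; rewrite !uLE; [|lia..].
have unij : un i = un j by apply: un_lab => //; lia.
have [f1_ f2] := @un_first i ltac:(lia) fi; have [l1 l2] := un_last jN la.
rewrite -unij in l1 l2; split=> // /f2[c ec [c1 c2]] /l2[z ez [z2 z1]].
have [h1 h2 h3 h4] := excP ec; have [g1 g2 g3 g4] := excP ez.
have cj : (j < c.2)%N.
  rewrite ltnNge; apply/negP => hc.
  have cj : c.2 != j :> nat.
    by apply/eqP => cj; have := h4 i; rewrite E -cj h3 eqxx => /(_ ltac:(lia)).
  have F := w_nc W (i := c.1) (j := i) (k := c.2) (l := j) ltac:(lia) ltac:(lia) h3 E.
  by have := h4 i; rewrite -F eqxx => /(_ ltac:(lia)).
have zi : (z.1 < i)%N.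
  rewrite ltnNge; apply/negP => hc.
  have zi : z.1 != i :> nat.
    by apply/eqP => zi; have := g4 j; rewrite -E -zi eqxx => /(_ ltac:(lia)).
  have F := w_nc W (i := i) (j := z.1) (k := j) (l := z.2) ltac:(lia) ltac:(lia) E g3.
  by have := g4 j; rewrite -E F eqxx => /(_ ltac:(lia)).
rewrite -c1 -z2 -g3.
have [zc|zc] := eqVneq (z.1 : nat) c.1; first by rewrite zc.
have [cz|cz] := eqVneq (c.2 : nat) z.2; first by rewrite h3 cz g3.
have a1 : (z.1 < c.1 < z.2)%N by clear -zi zc c1 z2 ij; lia.
have a2 : (z.2 < c.2 <= N)%N by clear -cj cz z2 h2; lia.
by rewrite (w_nc W a1 a2 g3 h3).
Qed.

End Solution.

(* Re-drawing the word at the heights b: the slopes at each contact vertex of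
   the line are consumed by the fan steps of its block in equal shares, and the
   resulting linear system for the depths of the excursions is an M-matrix
   because the original drawing excludes closed classes. *)
Theorem transport : exists u v, drawn N J kk lab SS b u v /\
  forall i j, (0 < i <= j)%N -> (j < N)%N -> lab i = lab j ->
  (forall l, (l < i)%N -> lab l != lab i) -> (forall l, (j < l <= N)%N -> lab l != lab i) ->
  [/\ u (lab i) <= u (lab i.-1), u (lab i) <= u (lab j.+1) &
   u (lab i) < u (lab i.-1) -> u (lab i) < u (lab j.+1) -> lab i.-1 = lab j.+1].
Proof.
have [al [a0 an aE]] := solution.
eexists; eexists; split; first exact: (solution_drawn a0 an aE).
exact: (solution_hull a0).
Qed.

End Transport.

(** * The neighbours of the line *)

Section Reflection.
Variables (R : realType) (V : finType) (d : V -> point R) (adj : rel V).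

Definition refl v : point R := (- (d v).1, (d v).2).

Lemma cr_refl a b c : cr (refl a) (refl b) (refl c) = - cr (d a) (d b) (d c).
Proof. by rewrite /cr /=; ring. Qed.

Lemma on_seg_refl a b c : on_seg (d a) (d b) (d c) -> on_seg (refl a) (refl b) (refl c).
Proof. by move=> [t [t01 [e1 e2]]]; exists t; split=> //=; rewrite e1 e2; split; ring. Qed.

Lemma triang_refl o1 o2 o3 : triang d adj o1 o2 o3 -> triang refl adj o2 o1 o3.
Proof.
case=> sadj iadj pd max a12 a23 a31 D inn; split=> //.
- by apply: plane_reflect pd => u; rewrite /refl.
- move=> u v uv nuv; case: (max u v uv nuv) => [[w [wu wv /on_seg_refl h]]|[a [b /andP[ab /andP[c1 c2]]]]].
    by left; exists w.
  by right; exists a, b; rewrite ab /pcross !cr_refl !mulrNN c1 c2.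
- by rewrite sadj.
- by rewrite sadj.
- by rewrite sadj.
- by rewrite cr_refl cr_swap12 opprK.
move=> v v2 v1 v3; have [h1 h2 h3] := inn v v1 v2 v3.
by split; rewrite cr_refl cr_swap12 opprK.
Qed.

Lemma face_refl a b c : face refl adj a b c -> symmetric adj -> face d adj b a c.
Proof.
move=> /faceP[ab bc ca D e] sadj; apply/and5P; split; rewrite 1?sadj //.
  by rewrite -oppr_lt0 -cr_swap12 -oppr_gt0 -cr_refl.
apply/forallP => z; apply/implyP; rewrite !inE !negb_or => /and3P[zb za zc].
apply/negP => /and3P[h1 h2 h3]; apply: (e z za zb zc).
- by rewrite cr_refl cr_swap12 opprK.
- by rewrite cr_refl cr_swap12 opprK.
by rewrite cr_refl cr_swap12 opprK.
Qed.

End Reflection.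

(* The line x = 0 meets the triangulation in the vertices s 0, ..., s M from
   bottom to top, and every face lying on both of its sides has one of them. *)
Record axis (R : realType) (V : finType) (d : V -> point R) (adj : rel V)
    (A B C : V) (M : nat) (s : nat -> V) : Prop := Axis {
  ax_tri : triang d adj A B C;
  ax_left : (d A).1 < 0;
  ax_right : 0 < (d B).1;
  ax_on : forall k, (k <= M)%N -> (d (s k)).1 = 0;
  ax_inner : forall k, (k <= M)%N -> ~~ outer A B C (s k);
  ax_all : forall v, (d v).1 = 0 -> exists2 k, (k <= M)%N & v = s k;
  ax_inc : forall j k, (j < k <= M)%N -> (d (s j)).2 < (d (s k)).2;
  ax_face : forall a b c, face d adj a b c -> (d a).1 < 0 -> 0 < (d b).1 -> (d c).1 = 0 }.

(** * The walk along one side of the line *)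

Section Walk.
Variables (R : realType) (V : finType) (d : V -> point R) (adj : rel V).
Variables (A B C : V) (M : nat) (s : nat -> V).
Hypothesis Hax : axis d adj A B C M s.
Notation X a b c := (cr (d a) (d b) (d c)).
Notation face := (face d adj).
Notation left v := ((d v).1 < 0).
Notation right v := (0 < (d v).1).
Notation y k := (d (s k)).2.
Let T : triang d adj A B C := ax_tri Hax.
Let Aleft : left A := ax_left Hax.
Let Bright : right B := ax_right Hax.
Let s_on : forall k, (k <= M)%N -> (d (s k)).1 = 0 := ax_on Hax.
Let s_inner : forall k, (k <= M)%N -> ~~ outer A B C (s k) := ax_inner Hax.
Let s_all : forall v, (d v).1 = 0 -> exists2 k, (k <= M)%N & v = s k := ax_all Hax.
Let y_inc : forall j k, (j < k <= M)%N -> y j < y k := ax_inc Hax.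
Let Rprop : forall a b c, face a b c -> left a -> right b -> (d c).1 = 0 := ax_face Hax.

Definition inc k p := [&& (k <= M)%N, adj (s k) p & left p].

Lemma cr_line k j p : (k <= M)%N -> (j <= M)%N -> X (s k) (s j) p = (y k - y j) * (d p).1.
Proof. by move=> kM jM; rewrite /cr !s_on //; ring. Qed.

Lemma cr_from k p q : (k <= M)%N ->
  X (s k) p q = (d p).1 * ((d q).2 - y k) - ((d p).2 - y k) * (d q).1.
Proof. by move=> kM; rewrite /cr s_on //; ring. Qed.

Lemma y_lt j k : (j <= M)%N -> (k <= M)%N -> (y j < y k) = (j < k)%N.
Proof.
move=> jM kM; have [h|h|->] := ltngtP j k; last by rewrite ltxx.
  by rewrite y_inc // h.
by apply/negbTE; rewrite -leNgt ltW // y_inc // h.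
Qed.

(** A lower line vertex above the edge [a b] would lie in the triangle. *)
Lemma on_line_face a k b z : (k <= M)%N -> left a -> right b ->
  face a b (s k) -> (z <= M)%N -> 0 <= X a b (s z) -> (k <= z)%N.
Proof.
move=> kM la rb f zM h; rewrite leqNgt; apply/negP => zk.
have [_ _ _ _ e] := faceP f; have yzk : y z < y k by rewrite y_lt.
apply: (e (s z)) => //.
- by apply: contraTneq la => <-; rewrite s_on // ltxx.
- by apply: contraTneq rb => <-; rewrite s_on // ltxx.
- by apply: contraTneq yzk => ->; rewrite ltxx.
- rewrite -(cr_cyc (d b)) cr_line // mulr_ge0 ?(ltW rb) // subr_ge0 ltW //.
by rewrite cr_swap cr_line // -mulrN mulr_ge0 // ?subr_ge0 ?oppr_ge0 ltW.
Qed.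

Lemma walk_start : face A B (s 0%N).
Proof.
have [n1 n2 n3] := outer_neq T.
have [w fw] := facet_exists T (tri_o12 T).
have f : face A B w.
  case/orP: fw => // /ogonP[][e1 e2 _]; first by rewrite e2 eqxx in n2.
    by rewrite e1 eqxx in n3.
  by rewrite e1 eqxx in n1.
have [k kM wE] := s_all (Rprop f Aleft Bright); rewrite wE in f.
suff -> : s 0%N = s k by [].
congr s; symmetry; apply/eqP; rewrite -leqn0; apply: (on_line_face kM Aleft Bright f) => //.
have := s_inner (leq0n M); rewrite /outer !inE !negb_or => /and3P[h1 h2 h3].
by have [h _ _] := tri_in T h1 h2 h3; apply: ltW.
Qed.

(** The face above the edge from [s k] to [p] decides: a left third vertex continues the fan, a
    third vertex on the line is the next one there, and behind a right one the face across [p q] has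
    the next line vertex, unless [p q] is on the boundary. *)
Lemma walk_step k p : inc k p ->
  [\/ exists2 q, face p (s k) q & left q,
    (k < M)%N /\ adj (s k.+1) p /\ (adj (s k) (s k.+1) \/
      exists q, [/\ right q, face p (s k) q & face p q (s k.+1)]) |
    k = M /\ exists q w, [/\ right q, face p (s k) q & ogon A B C p q w]].
Proof.
case/and3P=> kM kp lp; have pk : adj p (s k) by rewrite (tri_sym T).
have [q fq] := facet_exists T pk.
have f : face p (s k) q.
  have iv := s_inner kM; rewrite facet_cyc in fq; have := facet_inner iv fq.
  by rewrite -face_cyc.
have [_ sq qp D e] := faceP f.
have ps z : (z <= M)%N -> s z != p.
  by move=> zM; apply: contraTneq lp => <-; rewrite s_on // ltxx.
have [lq|rq|oq] := ltgtP (d q).1 0; first by apply: Or31; exists q.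
- have qs z : (z <= M)%N -> s z != q.
    by move=> zM; apply: contraTneq rq => <-; rewrite s_on // ltxx.
  have tri_k z : (k < z <= M)%N -> 0 <= X q p (s z) -> False.
    move=> /andP[kz zM] h; have yz : y k < y z by rewrite y_lt.
    apply: (e (s z)) => //; [exact: ps| |exact: qs| |].
    - by apply: contraTneq yz => ->; rewrite ltxx.
    - by rewrite -(cr_cyc (d p)) cr_line // -mulrNN mulr_ge0 // ?oppr_ge0 ?subr_le0 ltW //.
    by rewrite cr_swap cr_line // -mulNr mulr_ge0 // ?oppr_ge0 ?subr_le0 ltW.
  have pq : adj p q by rewrite (tri_sym T).
  have [w fw] := facet_exists T pq.
  case/orP: fw => [fw|og]; last first.
    apply: Or33; split; last by exists q, w.
    apply/eqP; rewrite eqn_leq kM leqNgt; apply/negP => kM'.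
    apply: (tri_k k.+1); first by rewrite ltnSn.
    by rewrite cr_swap12 oppr_ge0 (ogon_side T _ og).
  have [j jM wE] := s_all (Rprop fw lp rq); subst w.
  have [_ _ _ Dw _] := faceP fw.
  have lin z : (z <= M)%N -> X p q (s z) = X p q (s j) + ((d q).1 - (d p).1) * (y z - y j).
    by move=> zM; rewrite /cr !s_on //; ring.
  have kj : (k < j)%N.
    rewrite -y_lt // -subr_lt0; have xpq : 0 < (d q).1 - (d p).1 by lra.
    rewrite -(pmulr_rlt0 _ xpq).
    have D' : X p q (s k) < 0 by rewrite -oppr_gt0 -cr_swap.
    by move: (lin k kM) D' Dw; lra.
  have jE : j = k.+1.
    apply/eqP; rewrite eqn_leq kj andbT leqNgt; apply/negP => h.
    have k1M : (k.+1 <= M)%N by apply: leq_trans jM; apply: ltnW.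
    have [h1|h1] := leP 0 (X p q (s k.+1)).
      by have := on_line_face jM lp rq fw k1M h1; rewrite leqNgt h.
    by apply: (tri_k k.+1); rewrite ?ltnSn // cr_swap12 oppr_ge0 ltW.
  subst j; apply: Or32; split=> //; split; last by right; exists q.
  by have [_ _ h _ _] := faceP fw.
have [j jM qE] := s_all oq; subst q.
have kj : (k < j)%N.
  rewrite -y_lt // -subr_lt0 -(nmulr_rgt0 _ lp) mulrC.
  by rewrite -cr_line // cr_cyc.
have jE : j = k.+1.
  apply/eqP; rewrite eqn_leq kj andbT leqNgt; apply/negP => h.
  have k1M : (k.+1 <= M)%N by apply: leq_trans jM; apply: ltnW.
  have y1 : y k < y k.+1 by rewrite y_lt.
  have y2 : y k.+1 < y j by rewrite y_lt.
  apply: (tri_vert T sq (w := s k.+1)).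
  - by apply: contraTneq y1 => ->; rewrite ltxx.
  - by apply: contraTneq y2 => ->; rewrite ltxx.
  have yn : y j - y k != 0 by rewrite gt_eqF // subr_gt0 y_lt.
  have yp : 0 < y j - y k by rewrite subr_gt0 y_lt.
  apply/on_segP; exists ((y k.+1 - y k) / (y j - y k)); split.
    by rewrite divr_ge0 ?(ltW yp) ?subr_ge0 ?(ltW y1) //= ler_pdivrMr // mul1r lerD2r ltW.
  by apply: point_eq; rewrite /lerp /= ?s_on //; field.
subst j; apply: Or32; split=> //; split; [by rewrite (tri_sym T) (tri_sym T) | by left].
Qed.

Definition wstep (i j : nat * V) :=
  [/\ inc i.1 i.2, inc j.1 j.2 &
   j.1 = i.1 /\ face i.2 (s i.1) j.2 \/
   [/\ j.1 = i.1.+1, j.2 = i.2, (i.1 < M)%N & adj (s i.1) (s j.1) \/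
     exists q, [/\ right q, face i.2 (s i.1) q & face i.2 q (s j.1)]]].

Definition wend (i : nat * V) :=
  i.1 = M /\ inc i.1 i.2 /\ exists q w, [/\ right q, face i.2 (s i.1) q & ogon A B C i.2 q w].

Lemma inc_inj_above k p q : inc k p -> face p (s k) q -> left q -> inc k q /\
  (d p).1 * ((d q).2 - y k) < ((d p).2 - y k) * (d q).1.
Proof.
case/and3P=> kM kp lp f lq; have [_ sq _ D _] := faceP f.
split; first by rewrite /inc kM sq lq.
by rewrite -subr_lt0 -cr_from //; rewrite cr_swap12 oppr_lt0.
Qed.

Definition slope k p := ((d p).2 - y k) / (d p).1.

Lemma slope_fan k p q : inc k p -> face p (s k) q -> left q -> slope k q < slope k p.
Proof.
move=> ip f lq; have [_ h] := inc_inj_above ip f lq; case/and3P: ip => kM kp lp.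
by rewrite /slope ltr_ndivrMr // mulrAC ltr_ndivrMr // mulrC.
Qed.

(** Either [k] grows, or the slope at [s k] decreases and with it the number [rk] of edges of
    smaller slope; the factor [#|V|.+1] makes the measure lexicographic. *)
Lemma walk_exists k p : inc k p ->
  exists (n : nat) (f : nat -> nat * V), [/\ f 0%N = (k, p), forall i, (i < n)%N -> wstep (f i) (f i.+1) & wend (f n)].
Proof.
pose rk k p := #|[pred q | inc k q & slope k q < slope k p]|.
move: {-1}((M - k) * #|V|.+1 + rk k p)%N (leqnn ((M - k) * #|V|.+1 + rk k p)%N) => m.
elim/ltn_ind: m k p => m IH k p le ip.
have rkV k' q : (rk k' q <= #|V|)%N by apply: max_card.
have cons k' q : wstep (k, p) (k', q) -> ((M - k') * #|V|.+1 + rk k' q < (M - k) * #|V|.+1 + rk k p)%N ->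
    exists (n : nat) (f : nat -> nat * V), [/\ f 0%N = (k, p), forall i, (i < n)%N -> wstep (f i) (f i.+1) & wend (f n)].
  move=> st lt; have [_ iq _] := st.
  have [n [f [f0 fs fe]]] := IH _ (leq_trans lt le) k' q (leqnn _) iq.
  exists n.+1, (fun i => if i is i'.+1 then f i' else (k, p)); split=> // -[|i] h; first by rewrite f0.
  exact: fs.
case: (walk_step ip) => [[q fq lq]|[kM [a1 h]]|[kM [q [w [rq fq og]]]]].
- have [iq _] := inc_inj_above ip fq lq; have sl := slope_fan ip fq lq.
  apply: (cons k q); first by split=> //; left.
  rewrite ltn_add2l; apply/proper_card/properP; split.
    by apply/subsetP => z; rewrite !inE => /andP[-> /lt_trans->].
  by exists q; rewrite !inE iq //= ltxx.
- case/and3P: (ip) => _ _ lp; apply: (cons k.+1 p).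
    by split=> //=; [rewrite /inc kM a1 lp|right; split].
  have := rkV k.+1 p; rewrite -(subnSK kM) mulSn; lia.
by exists 0%N, (fun=> (k, p)); split=> //; split=> //; split=> //; exists q, w.
Qed.


(** The edge from [s k] to the vertex [q], at least as far out as [p], passes above [p], while [p]
    is joined to the higher [s l]. *)
Lemma crossing_up k l p q : (k < l <= M)%N -> adj (s k) q -> adj (s l) p -> left p ->
  (d q).1 <= (d p).1 -> ((d q).2 - y k) * (d p).1 < ((d p).2 - y k) * (d q).1 -> False.
Proof.
move=> /andP[kl lM] kq lp xp xqp H; have kM : (k <= M)%N by apply: leq_trans lM; apply: ltnW.
have ykl : y k < y l by rewrite y_lt.
have xq : left q by apply: le_lt_trans xp.
have /negP[] := pd_not_pcross (tri_pd T) lp kq.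
have h0 : 0 < (y k - y l) * (d p).1 by rewrite nmulr_lgt0 // subr_lt0.
have h0' : 0 < (y k - y l) * (d q).1 by rewrite nmulr_lgt0 // subr_lt0.
have h1 : 0 <= (y k - y l) * ((d q).1 - (d p).1) by rewrite nmulr_rge0 ?subr_le0 ?subr_lt0.
apply/andP; split.
  rewrite cr_swap cr_line // (cr_from _ _ lM) pmulr_rlt0; last by move: h0; lra.
  by move: H h1; lra.
rewrite cr_swap cr_line // (cr_from _ _ kM) nmulr_rlt0; last by move: h0'; lra.
by move: H; lra.
Qed.

Lemma crossing_down k l p q : (l < k <= M)%N -> adj (s k) q -> adj (s l) p -> left p ->
  (d q).1 <= (d p).1 -> ((d p).2 - y k) * (d q).1 < ((d q).2 - y k) * (d p).1 -> False.
Proof.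
move=> /andP[kl kM] kq lp xp xqp H; have lM : (l <= M)%N by apply: leq_trans kM; apply: ltnW.
have ykl : y l < y k by rewrite y_lt.
have xq : left q by apply: le_lt_trans xp.
have /negP[] := pd_not_pcross (tri_pd T) lp kq.
have h0 : 0 < (y l - y k) * (d p).1 by rewrite nmulr_lgt0 // subr_lt0.
have h0' : 0 < (y l - y k) * (d q).1 by rewrite nmulr_lgt0 // subr_lt0.
have h1 : 0 <= (y l - y k) * ((d q).1 - (d p).1) by rewrite nmulr_rge0 ?subr_le0 ?subr_lt0.
apply/andP; split.
  rewrite cr_swap cr_line // (cr_from _ _ lM) nmulr_rlt0; last by move: h0; lra.
  by move: H h1; lra.
rewrite cr_swap cr_line // (cr_from _ _ kM) pmulr_rlt0; last by move: h0'; lra.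
by move: H; lra.
Qed.

Lemma crossing_eq k p q : (k <= M)%N -> adj (s k) q -> left p -> p != q ->
  (d q).1 <= (d p).1 -> ((d q).2 - y k) * (d p).1 = ((d p).2 - y k) * (d q).1 -> False.
Proof.
move=> kM kq xp pq xqp H; have xq : left q by apply: le_lt_trans xp.
have ps : p != s k by apply: contraTneq xp => ->; rewrite s_on // ltxx.
apply: (tri_vert T kq ps pq); have xqn : (d q).1 != 0 by rewrite lt_eqF.
apply/on_segP; exists ((d p).1 / (d q).1); split.
  rewrite -mulrNN -invrN divr_ge0 ?oppr_ge0 ?(ltW xp) ?(ltW xq) //=.
  by rewrite ler_pdivrMr ?oppr_gt0 // mul1r lerN2.
apply: point_eq; rewrite /lerp /= ?s_on //; first by field.
apply: (mulIf xqn); transitivity (y k * (d q).1 + ((d q).2 - y k) * (d p).1); last by field.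
by rewrite H; ring.
Qed.

Section Path.
Variables (n : nat) (f : nat -> nat * V).
Hypothesis fs : forall i, (i < n)%N -> wstep (f i) (f i.+1).
Hypothesis fe : wend (f n).
Notation k_ i := (f i).1.
Notation l_ i := (f i).2.

Lemma path_inc i : (i <= n)%N -> inc (k_ i) (l_ i).
Proof.
rewrite leq_eqVlt => /orP[/eqP->|h]; first by case: fe => _ [].
by have [] := fs h.
Qed.

Lemma path_slope i : (i < n)%N -> k_ i.+1 = k_ i -> slope (k_ i) (l_ i.+1) < slope (k_ i) (l_ i).
Proof.
move=> h E; have [i1 i2 [[_ fc]|[E2 _ _ _]]] := fs h; last by move: E; rewrite E2; lia.
by apply: slope_fan => //; case/and3P: i2.
Qed.

Lemma path_step i : (i < n)%N -> k_ i.+1 = k_ i /\ l_ i.+1 != l_ i \/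
  k_ i.+1 = (k_ i).+1 /\ l_ i.+1 = l_ i.
Proof.
move=> h; have [i1 i2 [[E _]|[E2 E3 _ _]]] := fs h; last by right.
left; split=> //; apply/eqP => El; have := path_slope h E; rewrite El ltxx //.
Qed.

Lemma path_mono i j : (i <= j <= n)%N -> (k_ i <= k_ j)%N.
Proof.
elim: j => [|j IH] h; first by rewrite (_ : i = 0%N) //; lia.
have [->//|l] := eqVneq i j.+1.
apply: leq_trans (IH _) _; first lia.
have jn : (j < n)%N by lia.
by case: (path_step jn) => -[-> _].
Qed.

Lemma path_order i j : (i < j <= n)%N -> k_ i = k_ j -> slope (k_ i) (l_ j) < slope (k_ i) (l_ i).
Proof.
elim: j => [|j IH] h E; first lia.
have jn : (j < n)%N by lia.
have m1 := @path_mono i j ltac:(lia).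
have Ej : k_ j = k_ i by have := path_step jn; rewrite E; case=> -[h1 _]; move: m1; rewrite ?E h1; lia.
have sj : slope (k_ i) (l_ j.+1) < slope (k_ i) (l_ j).
  by rewrite -Ej; apply: path_slope => //; rewrite -E Ej.
have [eij|l] := eqVneq i j; first by move: sj; rewrite eij.
by apply: (lt_trans sj); apply: IH; [lia | rewrite Ej].
Qed.

Lemma path_inc_label i j : (i < j <= n)%N -> l_ i = l_ j -> (k_ i < k_ j)%N.
Proof.
move=> h E; have := @path_mono i j ltac:(lia); rewrite leq_eqVlt => /orP[/eqP Ek|//].
by have := path_order h Ek; rewrite E ltxx.
Qed.

Lemma slope_lt k p q : left p -> left q -> (slope k p < slope k q) =
  (((d p).2 - y k) * (d q).1 < ((d q).2 - y k) * (d p).1).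
Proof. by move=> lp lq; rewrite /slope ltr_ndivrMr // mulrAC ltr_ndivrMr // [in RHS]mulrC mulrC. Qed.

(** An edge to a vertex at least as far from the line would pass above or below the repeated vertex
    and cross its edge to the later or to the earlier line vertex, or contain it. *)
Lemma path_nested i j l : (i < j < l)%N -> (l <= n)%N -> l_ i = l_ l -> l_ j != l_ i ->
  (d (l_ i)).1 < (d (l_ j)).1.
Proof.
move=> h ln E ne; rewrite ltNge; apply/negP => x.
have [hi hj hij] : [/\ (i <= n)%N, (j <= n)%N & (i <= j <= n)%N] by split; clear -h ln; lia.
have [hjl hij' hjl'] : [/\ (j <= l <= n)%N, (i < j <= n)%N & (j < l <= n)%N] by split; clear -h ln; lia.
have /and3P[iM ai li] := path_inc hi.
have /and3P[jM aj lj] := path_inc hj.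
have /and3P[lM al ll] := path_inc (i := l) ln.
rewrite -E in al.
have ij := path_mono hij; have jl := path_mono hjl.
have [c|c|c] := ltgtP (((d (l_ j)).2 - y (k_ j)) * (d (l_ i)).1) (((d (l_ i)).2 - y (k_ j)) * (d (l_ j)).1).
- have [e|ne'] := eqVneq (k_ j) (k_ l).
    have := path_order hjl' e; rewrite -E slope_lt // => c'.
    by have := lt_trans c c'; rewrite ltxx.
  by apply: (@crossing_up (k_ j) (k_ l) (l_ i) (l_ j)) => //; rewrite lM andbT ltn_neqAle ne'.
- have [e|ne'] := eqVneq (k_ i) (k_ j).
    have := path_order hij' e; rewrite e slope_lt // => c'.
    by have := lt_trans c c'; rewrite ltxx.
  by apply: (@crossing_down (k_ j) (k_ i) (l_ i) (l_ j)) => //; rewrite jM andbT ltn_neqAle ne'.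
by apply: (@crossing_eq (k_ j) (l_ i) (l_ j)) => //; rewrite eq_sym.
Qed.

Lemma path_noncrossing i j k l : (i < j < k)%N -> (k < l <= n)%N ->
  l_ i = l_ k -> l_ j = l_ l -> l_ i = l_ j.
Proof.
move=> h1 h2 e1 e2; apply/eqP/negPn/negP => ne.
have := @path_nested i j k h1 ltac:(lia) e1; rewrite eq_sym => /(_ ne) x1.
have := @path_nested j k l ltac:(lia) ltac:(lia) e2; rewrite -e1 => /(_ ne) x2.
by have := lt_trans x1 x2; rewrite ltxx.
Qed.

End Path.

End Walk.

Lemma axis_refl (R : realType) (V : finType) (d : V -> point R) (adj : rel V)
    (A B C : V) (M : nat) (s : nat -> V) : axis d adj A B C M s -> axis (refl d) adj B A C M s.
Proof.
case=> T lA rB on_ inn all_ inc_ R_; split=> //=.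
- exact: triang_refl.
- by rewrite oppr_lt0.
- by rewrite oppr_gt0.
- by move=> k kM; rewrite on_ ?oppr0.
- move=> k kM; have := inn k kM; rewrite /outer !inE !negb_or => /and3P[-> ->].
  by move=> ->.
- by move=> v /eqP; rewrite oppr_eq0 => /eqP; apply: all_.
move=> a b c f; rewrite oppr_lt0 oppr_gt0 => ra lb.
by rewrite (R_ _ _ _ (face_refl f (tri_sym T)) lb ra) oppr0.
Qed.

(** * The word of a triangulation with an axis *)

Section Contact.
Variables (R : realType) (V : finType) (d : V -> point R) (adj : rel V).
Variables (o1 o2 o3 : V) (M : nat) (s : nat -> V).
Hypothesis H : axis d adj o1 o2 o3 M s.
Hypothesis left3 : (d o3).1 < 0.
Notation X a b c := (cr (d a) (d b) (d c)).
Notation face := (face d adj).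
Notation left v := ((d v).1 < 0).
Notation right v := (0 < (d v).1).

Definition height k := (d (s k)).2.
Definition dual_u v : R := if left v then (d v).1^-1 else - (d v).1^-1.
Definition dual_v v : R := if left v then (d v).2 / (d v).1 else - ((d v).2 / (d v).1).
Definition joined k := adj (s k) (s k.+1).

Record contact N J (kk : nat -> nat) (lab : nat -> V) : Prop := Contact {
  ct_word : is_word N J M kk lab;
  ct_drawn : drawn N J kk lab joined height dual_u dual_v;
  ct_adj : forall i, (i <= N)%N -> adj (s (kk i)) (lab i);
  ct_left : forall i, (i <= J)%N -> left (lab i);
  ct_right : forall i, (J < i <= N)%N -> right (lab i);
  ct_fan : forall i, fan N J kk i -> adj (lab i) (lab i.+1);
  ct_ends : [/\ lab 0%N = o1, lab J = o3, lab J.+1 = o2 & lab N = o2] }.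

Let T := ax_tri H.
Let Hr := axis_refl H.

Lemma slope_left k p : left p -> slope d s k p = dual_v p - dual_u p * height k.
Proof. by move=> lp; rewrite /slope /dual_u /dual_v lp /height; field; rewrite lt_eqF. Qed.

Lemma slope_right k p : right p -> slope (refl d) s k p = dual_v p - dual_u p * height k.
Proof.
move=> rp; rewrite /slope /dual_u /dual_v ltNge (ltW rp) /height /=; field.
by rewrite gt_eqF.
Qed.

Lemma dual_u_lt0 p : left p \/ right p -> dual_u p < 0.
Proof.
case=> h; rewrite /dual_u; first by rewrite h invr_lt0.
by rewrite (ltNge (d p).1) (ltW h) /= oppr_lt0 invr_gt0.
Qed.

(* p left and q right of s k: the angle below (above) s k is less than pi. *)
Lemma slope_sum k p q : (k <= M)%N -> left p -> right q ->
  (slope d s k p + slope (refl d) s k q < 0) = (0 < X (s k) q p) /\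
  (0 < slope d s k p + slope (refl d) s k q) = (0 < X (s k) p q).
Proof.
move=> kM lp rq; have n : (d p).1 * (d q).1 < 0 by rewrite nmulr_rlt0.
have E : (slope d s k p + slope (refl d) s k q) * ((d p).1 * (d q).1) = X (s k) q p.
  have np : (d p).1 != 0 by rewrite lt_eqF.
  have nq : (d q).1 != 0 by rewrite gt_eqF.
  by rewrite (cr_from H) // /slope /=; field; rewrite ?np ?nq.
split; first by rewrite -E nmulr_lgt0.
by rewrite cr_swap oppr_gt0 -E nmulr_llt0.
Qed.

(** The left word is the walk in the drawing, the right one the walk in its mirror image. At an
    unjoined gap both walks pass the same edge across the line, and the two signs of [dr_mid] are
    the orientations of the two faces on that edge. *)
Lemma contact_exists : exists N J kk lab, contact N J kk lab.
Proof.
have [n12 n23 n31] := outer_neq T.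
have f0 := walk_start H; have [a12 a2s as1 D0 _] := faceP f0.
have i1 : inc d adj M s 0 o1 by rewrite /inc leq0n as1 (ax_left H).
have i2 : inc (refl d) adj M s 0 o2.
  by rewrite /inc leq0n (tri_sym T) a2s /= oppr_lt0 (ax_right H).
have [n1 [f1 [f10 f1s f1e]]] := walk_exists H i1.
have [n2 [f2 [f20 f2s f2e]]] := walk_exists Hr i2.
pose W i := if (i <= n1)%N then f1 i else f2 (i - n1.+1)%N.
pose N := (n1.+1 + n2)%N.
pose kk i := (W i).1; pose lab i := (W i).2.
have WL i : (i <= n1)%N -> W i = f1 i by rewrite /W => ->.
have WR i : W (n1.+1 + i)%N = f2 i by rewrite /W leqNgt leq_addr /= addKn.
have WR' i : (n1 < i)%N -> W i = f2 (i - n1.+1)%N by move=> h; rewrite /W leqNgt h.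
have incL i : (i <= n1)%N -> inc d adj M s (kk i) (lab i).
  by move=> h; rewrite /kk /lab WL //; apply: path_inc f1s f1e _ h.
have incR i : (n1 < i <= N)%N -> inc (refl d) adj M s (kk i) (lab i).
  move=> h; rewrite /kk /lab WR'; last by case/andP: h.
  by apply: (path_inc f2s f2e); move: h; rewrite /N; clear; lia.
have lL i : (i <= n1)%N -> left (lab i) by move=> /incL/and3P[].
have rR i : (n1 < i <= N)%N -> right (lab i) by move=> /incR/and3P[_ _] /=; rewrite oppr_lt0.
have stL i : (i < n1)%N -> wstep d adj M s (kk i, lab i) (kk i.+1, lab i.+1).
  move=> h; rewrite /kk /lab !WL ?(ltnW h) // -!surjective_pairing; exact: f1s.
have stR i : (n1 < i < N)%N -> wstep (refl d) adj M s (kk i, lab i) (kk i.+1, lab i.+1).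
  move=> h; have -> : i = (n1.+1 + (i - n1.+1))%N by move: h; clear; lia.
  rewrite /kk /lab -addnS !WR -!surjective_pairing; apply: f2s.
  by move: h; rewrite /N; clear; lia.
have side i j : (i <= n1)%N -> (n1 < j <= N)%N -> lab i != lab j.
  by move=> /lL h1 /rR h2; apply: contraTneq h1 => ->; rewrite -leNgt ltW.
have step i : stp N n1 i -> kk i.+1 = kk i /\ lab i.+1 != lab i \/ kk i.+1 = (kk i).+1 /\ lab i.+1 = lab i.
  rewrite /stp => /andP[iN iJ]; have [h|h] := ltnP i n1.
    by rewrite /kk /lab !WL ?(ltnW h) //; apply: (path_step H f1s).
  have h1 : (n1 < i)%N by rewrite ltn_neqAle eq_sym iJ.
  have -> : i = (n1.+1 + (i - n1.+1))%N by rewrite subnKC.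
  rewrite /kk /lab -addnS !WR; apply: (path_step Hr f2s).
  by move: h1 iN; rewrite /N; clear; lia.
have k_end1 : kk n1 = M by rewrite /kk WL //; case: f1e.
have k_endN : kk N = M by rewrite /kk /N WR; case: f2e.
have word : is_word N n1 M kk lab.
  split=> //.
  - by rewrite /N addSn ltnS leq_addr.
  - by rewrite /kk WL // f10.
  - by rewrite /kk -[n1.+1]addn0 WR f20.
  - by move=> i j /andP[h1 h2] h3; apply: side; rewrite // h2.
  - move=> i j k l h1 h2 e1 e2; have [h|h] := leqP i n1.
      have hk : (k <= n1)%N.
        rewrite leqNgt; apply/negP => hk; have := side i k h; rewrite e1 eqxx hk /=.
        by move/(_ ltac:(clear -h2; lia)).
      have hj : (j <= n1)%N by clear -h1 hk; lia.
      have hl : (l <= n1)%N.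
        rewrite leqNgt; apply/negP => hl; have := side j l hj; rewrite e2 eqxx hl /=.
        by move/(_ ltac:(clear -h2; lia)).
      move: e1 e2; rewrite /lab !WL //; apply: (path_noncrossing H f1s f1e) => //.
      by rewrite hl andbT; clear -h2; lia.
    have hj : (n1 < j)%N by clear -h1 h; lia.
    have hk : (n1 < k)%N by clear -h1 h; lia.
    have hl : (n1 < l)%N by clear -h2 hk; lia.
    move: e1 e2; rewrite /lab !WR' //; apply: (path_noncrossing Hr f2s f2e).
      by clear -h1 h; lia.
    by clear -h2 hk; rewrite /N in h2; lia.
  move=> i j h e; have [hi|hi] := leqP i n1.
    have hj : (j <= n1)%N.
      rewrite leqNgt; apply/negP => hj; have := side i j hi; rewrite e eqxx hj /=.
      by move/(_ ltac:(clear -h; lia)).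
    move: e; rewrite /lab /kk !WL //; apply: (path_inc_label H f1s).
    by rewrite hj andbT; clear -h; lia.
  have hj : (n1 < j)%N by clear -h hi; lia.
  move: e; rewrite /lab /kk !WR' //; apply: (path_inc_label Hr f2s).
  by clear -h hi; rewrite /N in h; lia.
have xiL i : (i <= n1)%N -> xi kk lab height dual_u dual_v i = slope d s (kk i) (lab i).
  by move=> h; rewrite slope_left ?lL.
have xiR i : (n1 < i <= N)%N -> xi kk lab height dual_u dual_v i = slope (refl d) s (kk i) (lab i).
  by move=> h; rewrite slope_right ?rR.
have kM i : (i <= N)%N -> (kk i <= M)%N.
  move=> h; have [h'|h'] := leqP i n1; first by case/and3P: (incL _ h').
  by case/and3P: (incR i (introT andP (conj h' h))).
have ends : [/\ lab 0%N = o1, lab n1 = o3, lab n1.+1 = o2 & lab N = o2].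
  split; first by rewrite /lab WL // f10.
  - have [_ [i [q [w [rq _ og]]]]] := f1e; have li := lL n1 (leqnn _).
    rewrite /lab WL //; case/ogonP: og => -[e1 e2 _]; rewrite e1 //.
      by move: rq; rewrite e2 ltNge ltW.
    by move: li; rewrite /lab WL // e1 ltNge ltW // (ax_right H).
  - by rewrite /lab -[n1.+1]addn0 WR f20.
  have [_ [i [q [w [rq _ og]]]]] := f2e.
  have ri : right (lab N) by apply: rR; rewrite leqnn andbT /N; clear; lia.
  move: ri; rewrite /lab /N WR; case/ogonP: og => -[e1 e2 _]; rewrite e1 //.
    by rewrite ltNge ltW.
  by rewrite ltNge (ltW (ax_left H)).
have [e1 e2 e3 e4] := ends.
have nN : (n1 < N)%N by rewrite /N; clear; lia.
have nN' : (n1 < N <= N)%N by rewrite leqnn andbT.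
have nJ : (n1 < n1.+1 <= N)%N by rewrite ltnSn.
exists N, n1, kk, lab; split=> //.
- split.
  + move=> i iN; apply: dual_u_lt0; have [h|h] := leqP i n1; [left|right].
      exact: lL.
    by apply: rR; rewrite h.
  + move=> i /andP[st /eqP E]; case/andP: (st) => iN iJ; have [h|h] := ltnP i n1.
      rewrite !xiL ?(ltnW h) // E /kk /lab !WL ?(ltnW h) //; apply: (path_slope H f1s h).
      by move: E; rewrite /kk !WL ?(ltnW h).
    have h1 : (n1 < i)%N by rewrite ltn_neqAle eq_sym iJ.
    rewrite !xiR ?h1 ?(ltnW iN) ?(leqW h1) ?iN // E; move: E.
    have -> : i = (n1.+1 + (i - n1.+1))%N by rewrite subnKC.
    rewrite /kk /lab -addnS !WR => E; apply: (path_slope Hr f2s) => //.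
    by move: h1 iN; rewrite /N; clear; lia.
  + rewrite xiL // xiR // (w_k0 word) (w_kJ1 word) e1 e3.
    have [_ ->] := slope_sum (leq0n M) (ax_left H) (ax_right H).
    by rewrite -(cr_cyc (d (s 0%N))).
  + rewrite xiL // xiR // k_end1 k_endN e2 e4.
    have [-> _] := slope_sum (leqnn M) left3 (ax_right H).
    have [_ [i [q [w [rq fq og]]]]] := f1e.
    have qo : q = o2.
      case/ogonP: og => -[e5 e6 _]; rewrite e6 //.
        by move: rq; rewrite e6 ltNge ltW.
      by move: rq; rewrite e6 ltNge (ltW (ax_left H)).
    have [_ _ _ D _] := faceP fq.
    have k1 : (f1 n1).1 = M by rewrite -k_end1 /kk WL.
    have l1 : (f1 n1).2 = o3 by rewrite -e2 /lab WL.
    by move: D; rewrite qo k1 l1 (cr_cyc (d o3)).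
  move=> i j ri rj /andP[iJ Jj] kij nSS.
  have jN : (j < N)%N by case/andP: rj => /andP[].
  have iM := rise_lt word ri.
  have ki : kk i.+1 = (kk i).+1 := rise_kk ri.
  have kj : kk j.+1 = (kk i).+1 by rewrite (rise_kk rj) kij.
  have [_ _ [[E _]|[_ li _ [a|[q [rq fq fq']]]]]] := stL i iJ; first by move: E; rewrite /= ki; clear; lia.
    by move: nSS; rewrite /joined -ki a.
  have [_ _ [[E _]|[_ lj _ [a|[r [rr fr fr']]]]]] := stR j (introT andP (conj Jj jN)).
  + by move: E; rewrite /= kj kij; clear; lia.
  + by move: nSS; rewrite /joined -kj kij a.
  move: fq fq' fr fr' rr li lj; rewrite /= -kij kj ki oppr_gt0 => fq fq' fr fr' rr li lj.
  have {}fr := face_refl fr (tri_sym T).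
  have lp := lL i (ltnW iJ).
  have rp : right (lab j) by apply: rR; rewrite Jj ltnW.
  have fa : facet d adj o1 o2 o3 (s (kk i)) q (lab i) by rewrite /facet -(face_cyc d adj (lab i)) fq.
  have fb : facet d adj o1 o2 o3 (s (kk i)) (lab j) r by rewrite /facet fr.
  have s0 : (d (s (kk i))).1 = 0 by apply: (ax_on H); apply: ltnW.
  (* Going counterclockwise around the line vertex, only one facet passes from the right side to the
     left side; hence the faces found by the two walks coincide. *)
  have qj : q = lab j.
    apply: (up_uniq (p := fun z => - z.1) T _ fa fb); rewrite ?oppr_lt0 ?oppr_gt0 //.
    by move=> a b c; rewrite /cr s0; ring.
  have jn : (n1 < j.+1 <= N)%N by rewrite jN andbT leqW.
  rewrite xiL ?(ltnW iJ) // xiR ?Jj ?(ltnW jN) // -kij xiL // xiR // kj ki li lj.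
  have [h1 _] := slope_sum (ltnW iM) lp rp; have [_ h2] := slope_sum iM lp rp.
  rewrite h1 h2 -qj; have [_ _ _ D1 _] := faceP fq; have [_ _ _ D2 _] := faceP fq'.
  by rewrite (cr_cyc (d (lab i))) D1 -(cr_cyc (d (s (kk i).+1))) D2.
- move=> i iN; have [h|h] := leqP i n1; first by case/and3P: (incL i h).
  by case/and3P: (incR i (introT andP (conj h iN))).
move=> i fi; have kE := fan_kk fi; case/andP: fi => /andP[iN iJ] _.
have [h|h] := ltnP i n1.
  have [_ _ [[_ f]|[E _ _ _]]] := stL i h; last by move: E; rewrite /= kE; clear; lia.
  by have [_ _ h3 _ _] := faceP f; rewrite (tri_sym T).
have h1 : (n1 < i)%N by rewrite ltn_neqAle eq_sym iJ.
have [_ _ [[_ f]|[E _ _ _]]] := stR i (introT andP (conj h1 iN)); last by move: E; rewrite /= kE; clear; lia.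
by have [_ _ h3 _ _] := faceP f; rewrite (tri_sym T).
Qed.

End Contact.

(** * Harmonic positions *)

Section Harmonic.
Variables (R : realType) (V : finType).
Implicit Types (Free : pred V) (L : V -> V -> R) (z g : V -> R).

Definition stochastic Free L := forall v, Free v -> (forall a, 0 <= L v a) /\ \sum_a L v a = 1.

Definition harmonic Free L z := forall v, Free v -> z v = \sum_a L v a * z a.

(* Every vertex of Free is joined to the complement along positive weights. *)
Definition grounded Free L := forall K : pred V, (exists v, K v) -> (forall v, K v -> Free v) ->
  (forall v a, K v -> 0 < L v a -> K a) -> False.

(** At a maximum that exceeds [C] all vertices of positive weight are maxima as well, so the set of
    maxima contradicts [grounded]. *)
Lemma max_principle Free L z C : stochastic Free L -> grounded Free L -> harmonic Free L z ->
  (forall v, ~~ Free v -> z v <= C) -> forall v, z v <= C.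
Proof.
move=> st gr hz hC v; rewrite leNgt; apply/negP => Cv.
case: (@Order.TotalTheory.arg_maxP _ _ _ v xpredT z isT) => m _ mmax.
have {}mmax w : z w <= z m by apply: mmax.
have Cm : C < z m by apply: lt_le_trans Cv (mmax v).
have free w : z w = z m -> Free w.
  by move=> E; apply/negPn/negP => nF; have := hC w nF; rewrite E leNgt Cm.
apply: (gr (fun w => z w == z m)); first by exists m.
  by move=> w /eqP; apply: free.
move=> w a /eqP E La; have Fw := free w E; have [L0 L1] := st w Fw.
have S0 : \sum_x L w x * (z m - z x) = 0.
  under eq_bigr do rewrite mulrBr.
  by rewrite sumrB -mulr_suml L1 mul1r -hz // E subrr.
have /eqP := S0; rewrite psumr_eq0 => [/allP/(_ a)|x _]; last by rewrite mulr_ge0 // subr_ge0.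
rewrite mem_index_enum => /(_ isT) /=; rewrite mulf_eq0 (gt_eqF La) /= subr_eq0.
by move=> /eqP->.
Qed.

Lemma harmonic_opp Free L z : harmonic Free L z -> harmonic Free L (fun v => - z v).
Proof. by move=> hz v Fv; rewrite hz // -sumrN; apply: eq_bigr => a _; rewrite mulrN. Qed.

Lemma harmonic_bound Free L z C : stochastic Free L -> grounded Free L -> harmonic Free L z ->
  (forall v, ~~ Free v -> `|z v| <= C) -> forall v, `|z v| <= C.
Proof.
move=> st gr hz hC v; rewrite ler_norml; apply/andP; split.
  rewrite lerNl; apply: (max_principle st gr (harmonic_opp hz)) => w nF.
  by apply: le_trans (hC w nF); rewrite -normrN ler_norm.
by apply: (max_principle st gr hz) => w nF; apply: le_trans (hC w nF); rewrite ler_norm.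
Qed.

Let opr Free L c x : R := if Free c then (c == x)%:R - L c x else (c == x)%:R.

Lemma oprE Free L z c : \sum_x opr Free L c x * z x =
  if Free c then z c - \sum_x L c x * z x else z c.
Proof.
have diag : \sum_x (c == x)%:R * z x = z c.
  rewrite (bigD1 c) //= eqxx mul1r big1 ?addr0 // => x xc.
  by rewrite eq_sym (negPf xc) mul0r.
rewrite /opr; case: (Free c) => //.
by under eq_bigr do rewrite mulrBl; rewrite sumrB diag.
Qed.

Lemma opr_inj Free L z : stochastic Free L -> grounded Free L ->
  (forall c, \sum_x opr Free L c x * z x = 0) -> forall c, z c = 0.
Proof.
move=> st gr zE c; apply/normr0_eq0/eqP; rewrite eq_le normr_ge0 andbT.
apply: (harmonic_bound st gr) => [v Fv|v nF].
  by have := zE v; rewrite oprE Fv => /eqP; rewrite subr_eq0 => /eqP.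
by have := zE v; rewrite oprE (negPf nF) => ->; rewrite normr0.
Qed.

Lemma harmonic_solve Free L g : stochastic Free L -> grounded Free L ->
  exists z, harmonic Free L z /\ forall v, ~~ Free v -> z v = g v.
Proof.
move=> st gr.
have [z zE] := solve_linear (fun z => @opr_inj Free L z st gr) (fun v => if Free v then 0 else g v).
exists z; split=> v Fv; have := zE v; rewrite oprE.
  by rewrite Fv => /eqP; rewrite subr_eq0 => /eqP.
by rewrite (negPf Fv).
Qed.

(** [Y] is the Green function, the inverse of the operator; it expresses [z] by its defect [r], and
    [K] is the sum of its absolute values. *)
Lemma green_bound Free L : stochastic Free L -> grounded Free L -> exists K : R, 0 <= K /\
  forall z B, (forall v, Free v -> `|z v - \sum_a L v a * z a| <= B) ->
    (forall v, ~~ Free v -> `|z v| <= B) -> forall v, `|z v| <= K * B.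
Proof.
move=> st gr; have inj z := @opr_inj Free L z st gr.
have [Y YE] : exists Y : V -> V -> R, forall c v, \sum_x opr Free L v x * Y c x = (c == v)%:R.
  by apply: (@fin_all_exists _ (fun _ => V -> R)
    (fun c y => forall v, \sum_x opr Free L v x * y x = (c == v)%:R)) => c; apply: solve_linear.
exists (\sum_c \sum_v `|Y c v|); split; first by apply: sumr_ge0 => c _; apply: sumr_ge0.
move=> z B h1 h2 v.
pose r c := \sum_x opr Free L c x * z x.
have rB c : `|r c| <= B.
  by rewrite /r oprE; case Fc: (Free c); [apply: h1 | apply: h2; rewrite Fc].
have zE x : z x = \sum_c r c * Y c x.
  apply/eqP; rewrite -subr_eq0; apply/eqP; apply: (inj (fun x => z x - \sum_c r c * Y c x)) => w.
  under eq_bigr do rewrite mulrBr; rewrite sumrB -/(r w); apply/eqP; rewrite subr_eq0; apply/eqP.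
  transitivity (\sum_c r c * (c == w)%:R).
    rewrite (bigD1 w) //= eqxx mulr1 big1 ?addr0 // => c cw; by rewrite (negPf cw) mulr0.
  under eq_bigr do rewrite -YE mulr_sumr.
  rewrite exchange_big /=; apply: eq_bigr => x' _; rewrite mulr_sumr.
  by apply: eq_bigr => c _; ring.
rewrite zE; apply: le_trans (ler_norm_sum _ _ _) _; rewrite mulr_suml; apply: ler_sum => c _.
rewrite normrM mulrC; apply: ler_pM => //.
by rewrite (bigD1 v) //= lerDl sumr_ge0.
Qed.

End Harmonic.

(** * Open conditions at a vertex of the line *)

Section Star.
Variable R : realType.
Implicit Types s p q r : point R.

(* The positive span of the vectors to p and q (and r) contains a downward
   vector. *)
Definition spans_down s p q r := 0 < cr s p q \/ 0 < cr s p r /\ 0 < cr s r q.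

(** The functional is nonnegative on the vectors to the three points, hence on the downward vector
    that they span. *)
Lemma down_nonpos s p q r (al be : R) : p.1 < s.1 -> s.1 < q.1 -> spans_down s p q r ->
  lin al be s <= lin al be p -> lin al be s <= lin al be q -> lin al be s <= lin al be r -> be <= 0.
Proof.
have two a c : a.1 < s.1 -> s.1 < c.1 -> 0 < cr s a c ->
    lin al be s <= lin al be a -> lin al be s <= lin al be c -> be <= 0.
  move=> h1 h2 h3 h4 h5; rewrite -oppr_ge0 -(pmulr_rge0 _ h3).
  have -> : cr s a c * - be = (c.1 - s.1) * (lin al be a - lin al be s) + (s.1 - a.1) * (lin al be c - lin al be s).
    by rewrite /lin /cr; ring.
  by rewrite addr_ge0 // mulr_ge0 // subr_ge0 // ltW.
move=> ps sq [c|[c1 c2]] fp fq fr; first exact: two c fp fq.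
have [rs|sr|E] := ltgtP r.1 s.1; [exact: two c2 fr fq|exact: two c1 fp fr|].
move: c1; have -> : cr s p r = (s.1 - p.1) * (s.2 - r.2) by rewrite /cr E; ring.
rewrite pmulr_rgt0 ?subr_gt0 // => rs.
move: fr; rewrite -subr_ge0 (_ : _ - _ = (r.2 - s.2) * be); last by rewrite /lin E; ring.
by rewrite nmulr_rge0 // subr_lt0.
Qed.

Lemma up_nonneg s p q r (al be : R) : p.1 < s.1 -> s.1 < q.1 ->
  0 < cr s q p \/ 0 < cr s q r /\ 0 < cr s r p ->
  lin al be s <= lin al be p -> lin al be s <= lin al be q -> lin al be s <= lin al be r -> 0 <= be.
Proof.
pose m (x : point R) : point R := (x.1, - x.2) => ps sq c fp fq fr.
have lm x : lin al (- be) (m x) = lin al be x by rewrite /lin /=; ring.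
have cm a b c0 : cr (m a) (m b) (m c0) = cr a c0 b by rewrite /cr /=; ring.
rewrite -oppr_le0; apply: (@down_nonpos (m s) (m p) (m q) (m r) al); rewrite ?lm //.
by rewrite /spans_down !cm; case: c => [|[]]; [left|right].
Qed.

Definition close e p q := `|p.1 - q.1| <= e /\ `|p.2 - q.2| <= e.

Lemma mul_close (x y x' y' e : R) : 0 < e <= 1 -> `|x' - x| <= e -> `|y' - y| <= e ->
  `|x' * y' - x * y| <= e * (`|x| + `|y| + 1).
Proof.
move=> /andP[e0 e1] h1 h2.
have -> : x' * y' - x * y = (x' - x) * y + x * (y' - y) + (x' - x) * (y' - y) by ring.
apply: le_trans (ler_normD _ _) _; apply: (@le_trans _ _ ((e * `|y| + `|x| * e) + e * 1)); last by lra.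
apply: lerD; last by rewrite normrM ler_pM // (le_trans h2).
apply: le_trans (ler_normD _ _) _; rewrite !normrM.
by apply: lerD; [rewrite ler_wpM2r | rewrite ler_wpM2l].
Qed.

Lemma cr_close s p q : 0 < cr s p q -> small (fun e => forall s' p' q',
  close e s' s -> close e p' p -> close e q' q -> 0 < cr s' p' q').
Proof.
move=> c0; pose S := `|p.1 - s.1| + `|q.2 - s.2| + 1 + (`|p.2 - s.2| + `|q.1 - s.1| + 1).
have [e1 [e10 h]] := lin_pos_small (- (2 * S)) c0.
exists (Num.min e1 2^-1); split; first by rewrite lt_min e10 invr_gt0 ltr0n.
move=> e; rewrite lt_min => /and3P[e0 ee1 e2] s' p' q' [s1 s2] [p1 p2] [q1 q2].
have e01 : 0 < 2 * e <= 1.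
  by rewrite mulr_gt0 //= mulrC -ler_pdivlMr // mul1r ltW.
have d (a b a' b' : R) : `|a' - a| <= e -> `|b' - b| <= e -> `|(a' - b') - (a - b)| <= 2 * e.
  move=> ha hb; rewrite (_ : _ - _ = (a' - a) - (b' - b)); last by ring.
  by apply: le_trans (ler_normB _ _) _; lra.
have M1 := mul_close e01 (d _ _ _ _ p1 s1) (d _ _ _ _ q2 s2).
have M2 := mul_close e01 (d _ _ _ _ p2 s2) (d _ _ _ _ q1 s1).
have := h e; rewrite e0 ee1 => /(_ isT); rewrite /cr /S.
move: M1 M2; rewrite !ler_norml => /andP[M1 _] /andP[_ M2]; move: M1 M2.
by rewrite /cr; set A := _ * (_ + _ + 1); set B := _ * (_ + _ + 1); rewrite /A /B; lra.
Qed.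

Lemma lt_close p q : p.1 < q.1 -> small (fun e => forall p' q', close e p' p -> close e q' q -> p'.1 < q'.1).
Proof.
move=> pq; exists ((q.1 - p.1) / 2); split; first by lra.
move=> e /andP[e0 e1] p' q' [h1 _] [h2 _]; move: h1 h2; rewrite !ler_norml; lra.
Qed.

End Star.

(** * Convex combinations in dual coordinates *)

Section Barycentre.
Variable R : realType.

(** [al] and [be] balance the slopes seen from [(0, b)]. Passing from [(u, v)] back to
    [(1 / u, v / u)] multiplies them by [um / u] and [up / u]; what is missing to 1 goes to [(0, b)]
    and is nonnegative because both neighbours are at least as far out. *)
Lemma dual_segment (u v um vm up vp b : R) : u < 0 -> um < 0 -> up < 0 -> u <= um -> u <= up ->
    v - u * b < vm - um * b -> vp - up * b < v - u * b ->
  exists c1 c2 c3, [/\ [/\ 0 < c1, 0 <= c2 & 0 < c3], c1 + c2 + c3 = 1,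
    c1 / um + c3 / up = u^-1, c1 * (vm / um) + c2 * b + c3 * (vp / up) = v / u &
    u < um \/ u < up -> 0 < c2].
Proof.
move=> u0 um0 up0 h1 h2 h3 h4; pose g := (vm - um * b) - (vp - up * b).
have g0 : 0 < g by rewrite /g; lra.
pose al := ((v - u * b) - (vp - up * b)) / g; pose be := ((vm - um * b) - (v - u * b)) / g.
have al0 : 0 < al by rewrite /al divr_gt0 // subr_gt0.
have be0 : 0 < be by rewrite /be divr_gt0 // subr_gt0.
have gn : g != 0 by rewrite gt_eqF.
have un : u != 0 by rewrite lt_eqF.
have umn : um != 0 by rewrite lt_eqF.
have upn : up != 0 by rewrite lt_eqF.
have ab : al + be = 1 by move: gn; rewrite /al /be /g => gn; field.
have abv : al * (vm - um * b) + be * (vp - up * b) = v - u * b.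
  by move: gn; rewrite /al /be /g => gn; field.
have E : al * um + be * up - u = al * (um - u) + be * (up - u).
  by rewrite -[X in _ - X]mul1r -ab; ring.
have neg (x y : R) : x < 0 -> y < 0 -> 0 < x / y.
  by move=> x0 y0; rewrite nmulr_rgt0 // invr_lt0.
exists (al * (um / u)), ((al * um + be * up - u) / - u), (be * (up / u)); split.
- split; [by apply: mulr_gt0 => //; apply: neg | | by apply: mulr_gt0 => //; apply: neg].
  by rewrite E divr_ge0 ?oppr_ge0 ?(ltW u0) // addr_ge0 // mulr_ge0 ?subr_ge0 // ltW.
- by field.
- by rewrite -[RHS]mul1r -ab; field; rewrite un umn upn.
- have -> : v / u = (al * (vm - um * b) + be * (vp - up * b) + u * b) / u by rewrite abv; congr (_ / _); ring.
  by field; rewrite un umn upn.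
have ge1 : 0 <= al * (um - u) by rewrite mulr_ge0 ?subr_ge0 // ltW.
have ge2 : 0 <= be * (up - u) by rewrite mulr_ge0 ?subr_ge0 // ltW.
case=> h; rewrite E divr_gt0 ?oppr_gt0 //.
  by apply: ltr_pwDl => //; apply: mulr_gt0; rewrite ?subr_gt0.
by apply: ltr_wpDl => //; apply: mulr_gt0; rewrite ?subr_gt0.
Qed.

(** The case in which both outer neighbours are one vertex: the point lies above the segment from
    [(0, b)] to it and below the one from [(0, b')]. *)
Lemma dual_triangle (u v uw vw b b' : R) : u < 0 -> uw < 0 -> u < uw ->
    v - u * b < vw - uw * b -> vw - uw * b' < v - u * b' ->
  exists c1 c2 c3, [/\ [/\ 0 < c1, 0 < c2 & 0 < c3], c1 + c2 + c3 = 1,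
    c1 / uw = u^-1 & c1 * (vw / uw) + c2 * b + c3 * b' = v / u].
Proof.
move=> u0 uw0 h1 h2 h3.
have bb : 0 < b' - b.
  have : 0 < (uw - u) * (b' - b).
    by rewrite (_ : _ * _ = ((vw - uw * b) - (v - u * b)) + ((v - u * b') - (vw - uw * b'))); [lra | ring].
  by rewrite pmulr_rgt0 // subr_gt0.
have un : u != 0 by rewrite lt_eqF.
have uwn : uw != 0 by rewrite lt_eqF.
have bn : b' - b != 0 by rewrite gt_eqF.
exists (uw / u), (((v - u * b') - (vw - uw * b')) / (b' - b) / - u),
  (((vw - uw * b) - (v - u * b)) / (b' - b) / - u).
have nu : 0 < - u by rewrite oppr_gt0.
split.
- split; first by rewrite nmulr_rgt0 // invr_lt0.
    by apply: divr_gt0 => //; apply: divr_gt0 => //; rewrite subr_gt0.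
  by apply: divr_gt0 => //; apply: divr_gt0 => //; rewrite subr_gt0.
- by field; rewrite bn un.
- by field; rewrite un uwn.
by field; rewrite bn uwn un.
Qed.

(** A sum of three point masses, since the three vertices may coincide. *)
Lemma three_weights (V : finType) (a1 a2 a3 : V) (c1 c2 c3 : R) :
    0 <= c1 -> 0 <= c2 -> 0 <= c3 ->
  exists w : V -> R, [/\ forall a, 0 <= w a, forall a, 0 < w a -> [\/ a = a1, a = a2 | a = a3],
    forall z : V -> R, \sum_a w a * z a = c1 * z a1 + c2 * z a2 + c3 * z a3 &
    [/\ 0 < c1 -> 0 < w a1, 0 < c2 -> 0 < w a2 & 0 < c3 -> 0 < w a3]].
Proof.
move=> c10 c20 c30; pose t (c : R) x a : R := if a == x :> V then c else 0.
have t0 c x a : 0 <= c -> 0 <= t c x a by rewrite /t; case: ifP.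
have tx c x : t c x x = c by rewrite /t eqxx.
exists (fun a => t c1 a1 a + t c2 a2 a + t c3 a3 a); split.
- by move=> a; rewrite !addr_ge0 // t0.
- move=> a; rewrite /t; case: eqP => [->|_]; first by constructor 1.
  case: eqP => [->|_]; first by constructor 2.
  by case: eqP => [->|_]; [constructor 3 | rewrite !addr0 ltxx].
- move=> z; have ts c x : \sum_a t c x a * z a = c * z x.
    by rewrite (bigD1 x) //= tx big1 ?addr0 // => a /negPf xa; rewrite /t xa mul0r.
  by under eq_bigr do rewrite !mulrDl; rewrite !big_split /= !ts.
by split=> h; [rewrite -addrA ltr_pwDl ?addr_ge0 ?t0 ?tx | rewrite addrAC ltr_wpDl ?addr_ge0 ?t0 ?tx
  | rewrite ltr_wpDl ?addr_ge0 ?t0 ?tx].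
Qed.

End Barycentre.

Section Hull.
Variables (R : realType) (V : finType) (d : V -> point R) (adj : rel V).
Variables (o1 o2 o3 : V) (M : nat) (s : nat -> V).
Hypothesis H : axis d adj o1 o2 o3 M s.
Variables (N J : nat) (kk : nat -> nat) (lab : nat -> V).
Hypothesis Ct : contact d adj o1 o2 o3 M s N J kk lab.
Variables (b : nat -> R) (u v : V -> R).
Hypothesis D : drawn N J kk lab (joined adj s) b u v.
Hypothesis conv : forall i j, (0 < i <= j)%N -> (j < N)%N -> lab i = lab j ->
  (forall l, (l < i)%N -> lab l != lab i) -> (forall l, (j < l <= N)%N -> lab l != lab i) ->
  [/\ u (lab i) <= u (lab i.-1), u (lab i) <= u (lab j.+1) &
   u (lab i) < u (lab i.-1) -> u (lab i) < u (lab j.+1) -> lab i.-1 = lab j.+1].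
Let T := ax_tri H.
Let W := ct_word Ct.

Definition side p : R := if (d p).1 < 0 then 1 else - 1.

Definition place p : point R :=
  if [pick k : 'I_M.+1 | s k == p] is Some k then (0, b k) else (side p / u p, v p / u p).

Lemma s_inj j k : (j <= M)%N -> (k <= M)%N -> s j = s k -> j = k.
Proof.
move=> jM kM E; have [h|h|//] := ltngtP j k.
  by have := ax_inc H (j := j) (k := k); rewrite h kM E ltxx => /(_ isT).
by have := ax_inc H (j := k) (k := j); rewrite h jM E ltxx => /(_ isT).
Qed.

Lemma place_s k : (k <= M)%N -> place (s k) = (0, b k).
Proof.
move=> kM; rewrite /place; case: pickP => [j /eqP|/(_ (Ordinal (n := M.+1) (m := k) kM))].
  by move/s_inj => ->//; rewrite -ltnS.
by rewrite eqxx.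
Qed.

Lemma lab_off i : (i <= N)%N -> (d (lab i)).1 != 0.
Proof.
move=> iN; have [h|h] := leqP i J; first by rewrite lt_eqF // (ct_left Ct).
by rewrite gt_eqF // (ct_right Ct) // h.
Qed.

Lemma place_off p : (d p).1 != 0 -> place p = (side p / u p, v p / u p).
Proof.
move=> p0; rewrite /place; case: pickP => // k /eqP E.
by move: p0; rewrite -E (ax_on H) ?eqxx // -ltnS.
Qed.

Lemma side_lab i j : (i <= N)%N -> (j <= N)%N -> (i <= J)%N = (j <= J)%N -> side (lab i) = side (lab j).
Proof.
move=> iN jN E; rewrite /side; have [h|h] := leqP i J.
  by rewrite !(ct_left Ct) // -E.
have h' : (J < j)%N by rewrite ltnNge -E -ltnNge.
by rewrite !ltNge !ltW // (ct_right Ct) ?h ?h'.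
Qed.

Definition movable p := ~~ outer o1 o2 o3 p && ((d p).1 != 0).

Definition known a := (exists2 k, (k <= M)%N & a = s k) \/ exists2 i, (i <= N)%N & a = lab i.

Definition hull p (w : V -> R) := [/\ forall a, 0 <= w a, forall a, 0 < w a -> adj p a /\ known a, \sum_a w a = 1,
  \sum_a w a * (place a).1 = (place p).1 & \sum_a w a * (place a).2 = (place p).2].

(* Let i and j be the first and the last position of the label.  The fans at
   these ends make lab i.-1 and lab j.+1 its neighbours, and these two together
   with s_(kk i) and s_(kk j) surround it. *)
Lemma hull_exists i0 : (i0 <= N)%N -> movable (lab i0) ->
  exists2 w, hull (lab i0) w & (exists2 k, (k <= M)%N & 0 < w (s k)) \/
    exists i, [/\ (i <= N)%N, 0 < w (lab i) & (place (lab i0)).2 < (place (lab i)).2].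
Proof.
move=> i0N /andP[nout _]; have [e0 eJ eJ1 eN] := ct_ends Ct; have JN := w_JN W.
pose P := [pred i | (i <= N)%N && (lab i == lab i0)].
have exP : exists i, P i by exists i0; rewrite /= i0N eqxx.
have ub i : P i -> (i <= N)%N by case/andP.
case: (ex_minnP exP) => i /andP[iN /eqP Ei] imin.
case: (ex_maxnP exP ub) => j /andP[jN /eqP Ej] jmax.
have ij : (i <= j)%N by apply: imin; rewrite /= jN Ej eqxx.
rewrite -Ei in nout |- *; rewrite -Ei in Ej.
have first l : (l < i)%N -> lab l != lab i.
  move=> li; apply/eqP => E; have := imin l; rewrite /= E Ei eqxx andbT => /(_ _); lia.
have last l : (j < l <= N)%N -> lab l != lab i.
  move=> /andP[jl lN]; apply/eqP => E; have := jmax l; rewrite /= E Ei eqxx andbT => /(_ _); lia.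
have out x : x = o1 \/ x = o2 \/ x = o3 -> outer o1 o2 o3 x.
  by case=> [->|[->|->]]; rewrite /outer !inE eqxx ?orbT.
have i0' : i != 0%N by apply: contraNneq nout => ->; apply: out; auto.
have iJ1 : i != J.+1 by apply: contraNneq nout => ->; apply: out; auto.
have jJ : j != J by apply: contraNneq nout => E; rewrite -Ej E; apply: out; auto.
have jN' : j != N by apply: contraNneq nout => E; rewrite -Ej E; apply: out; auto.
have fi : fan N J kk i.-1.
  have st : stp N J i.-1 by rewrite /stp; apply/andP; split; lia.
  have pi : i.-1.+1 = i by lia.
  rewrite /fan st; case: (w_stp W st) => -[->]; rewrite ?eqxx // pi => E.
  by have := first i.-1; rewrite E eqxx => /(_ _); lia.
have fj : fan N J kk j.
  have st : stp N J j by rewrite /stp; apply/andP; split; lia.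
  rewrite /fan st; case: (w_stp W st) => -[->]; rewrite ?eqxx // => E.
  by have := last j.+1; rewrite E Ej eqxx => /(_ _); lia.
have pi : i.-1.+1 = i by lia.
have i1N : (i.-1 <= N)%N by lia.
have j1N : (j.+1 <= N)%N by lia.
have adjm : adj (lab i) (lab i.-1) by rewrite (tri_sym T) -{2}pi; apply: (ct_fan Ct).
have adjp : adj (lab i) (lab j.+1) by rewrite -Ej; apply: (ct_fan Ct).
have adji : adj (lab i) (s (kk i)) by rewrite (tri_sym T); apply: (ct_adj Ct).
have adjj : adj (lab i) (s (kk j)) by rewrite -Ej (tri_sym T); apply: (ct_adj Ct).
have iM := kk_le W iN; have jM := kk_le W jN.
have lo : v (lab i) - u (lab i) * b (kk i) < v (lab i.-1) - u (lab i.-1) * b (kk i).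
  by have := dr_fan D fi; rewrite pi /Submission.xi -(fan_kk fi) pi.
have hi : v (lab j.+1) - u (lab j.+1) * b (kk j) < v (lab i) - u (lab i) * b (kk j).
  by have := dr_fan D fj; rewrite /Submission.xi (fan_kk fj) Ej.
have [um up both] : [/\ u (lab i) <= u (lab i.-1), u (lab i) <= u (lab j.+1) &
   u (lab i) < u (lab i.-1) -> u (lab i) < u (lab j.+1) -> lab i.-1 = lab j.+1].
  by apply: conv => //; clear -i0' ij jN' jN; lia.
have sij : (i <= J)%N = (j <= J)%N.
  apply/idP/idP => [h|h]; last by clear -h ij; lia.
  by rewrite leqNgt; apply/negP => h'; have := w_side W (i := i) (j := j); rewrite h h' Ej eqxx => /(_ isT jN).
have sm : side (lab i.-1) = side (lab i) by apply: side_lab => //; clear -i0' iJ1; lia.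
have sp : side (lab j.+1) = side (lab i) by apply: side_lab => //; rewrite sij; clear -jJ; lia.
have u0 := dr_neg D iN; have um0 := dr_neg D i1N; have up0 := dr_neg D j1N.
have pl : place (lab i) = (side (lab i) / u (lab i), v (lab i) / u (lab i)) := place_off (lab_off iN).
have plm : place (lab i.-1) = (side (lab i) / u (lab i.-1), v (lab i.-1) / u (lab i.-1)).
  by rewrite (place_off (lab_off i1N)) sm.
have plp : place (lab j.+1) = (side (lab i) / u (lab j.+1), v (lab j.+1) / u (lab j.+1)).
  by rewrite (place_off (lab_off j1N)) sp.
have {}adjm : adj (lab i) (lab i.-1) /\ known (lab i.-1) by split=> //; right; exists i.-1.
have {}adjp : adj (lab i) (lab j.+1) /\ known (lab j.+1) by split=> //; right; exists j.+1.
have {}adji : adj (lab i) (s (kk i)) /\ known (s (kk i)) by split=> //; left; exists (kk i).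
have {}adjj : adj (lab i) (s (kk j)) /\ known (s (kk j)) by split=> //; left; exists (kk j).
have fin a1 a2 a3 c1 c2 c3 : adj (lab i) a1 /\ known a1 -> adj (lab i) a2 /\ known a2 ->
    adj (lab i) a3 /\ known a3 ->
    [/\ 0 <= c1, 0 <= c2 & 0 <= c3] -> c1 + c2 + c3 = 1 ->
    c1 * (place a1).1 + c2 * (place a2).1 + c3 * (place a3).1 = (place (lab i)).1 ->
    c1 * (place a1).2 + c2 * (place a2).2 + c3 * (place a3).2 = (place (lab i)).2 ->
    exists2 w, hull (lab i) w & [/\ 0 < c1 -> 0 < w a1, 0 < c2 -> 0 < w a2 & 0 < c3 -> 0 < w a3].
  move=> h1 h2 h3 [c10 c20 c30] c1E E1 E2; have [w [w0 wa wz wp]] := three_weights a1 a2 a3 c10 c20 c30.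
  exists w => //; split=> //; rewrite ?wz //; first by move=> a /wa[] ->.
  by rewrite -c1E -[c1 in RHS]mulr1 -[c2 in RHS]mulr1 -[c3 in RHS]mulr1 -(wz (fun=> 1));
     apply: eq_bigr => a _; rewrite mulr1.
have seg k : (k <= M)%N -> adj (lab i) (s k) /\ known (s k) ->
    v (lab i) - u (lab i) * b k < v (lab i.-1) - u (lab i.-1) * b k ->
    v (lab j.+1) - u (lab j.+1) * b k < v (lab i) - u (lab i) * b k ->
    exists2 w, hull (lab i) w & 0 < w (lab j.+1) /\
     (u (lab i) < u (lab i.-1) \/ u (lab i) < u (lab j.+1) -> 0 < w (s k)).
  move=> kM ak h1 h2.
  have [c1 [c2 [c3 [[c10 c20 c30] c1E E1 E2 c2p]]]] := dual_segment u0 um0 up0 um up h1 h2.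
  have [|||w hw [_ w2 w3]] := fin (lab i.-1) (s k) (lab j.+1) c1 c2 c3 adjm ak adjp _ c1E.
  - by split; rewrite // ltW.
  - by rewrite plm plp pl place_s //= -E1; ring.
  - by rewrite plm plp pl place_s //= -E2.
  by exists w => //; split; [apply: w3 | move/c2p/w2].
have un : u (lab i) != 0 by rewrite lt_eqF.
have upn : u (lab j.+1) != 0 by rewrite lt_eqF.
(* An upper neighbour at the same distance lies strictly higher. This alternative is what later
   excludes a set of labels closed under the weights. *)
have [E|pne] := eqVneq (u (lab j.+1)) (u (lab i)).
  have vl : v (lab j.+1) < v (lab i) by move: hi; rewrite E ltrD2r.
  have [|w hw [wp _]] := seg (kk i) iM adji lo; first by rewrite E ltrD2r.
  exists w => //; right; exists j.+1; split=> //; rewrite pl plp /= E.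
  by rewrite ltr_nM2r // invr_lt0.
have {pne}up' : u (lab i) < u (lab j.+1) by rewrite lt_def pne.
have [E|mne] := eqVneq (u (lab i.-1)) (u (lab i)).
  have [|w hw [_ ws]] := seg (kk j) jM adjj _ hi; first by move: lo; rewrite E !ltrD2r.
  by exists w => //; left; exists (kk j) => //; apply: ws; right.
have {mne}um' : u (lab i) < u (lab i.-1) by rewrite lt_def mne.
have Ew := both um' up'.
rewrite -Ew in hi.
have [c1 [c2 [c3 [[c10 c20 c30] c1E E1 E2]]]] := dual_triangle u0 um0 um' lo hi.
have [|||w hw [_ w2 _]] := fin (lab i.-1) (s (kk i)) (s (kk j)) c1 c2 c3 adjm adji adjj _ c1E.
- by split; rewrite ltW.
- by rewrite plm pl !place_s //= -E1; ring.
- by rewrite plm pl !place_s.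
by exists w => //; left; exists (kk i) => //; apply: w2.
Qed.

End Hull.

Lemma small_scale (R : realType) (P : R -> Prop) (K : R) : 0 < K -> small P -> small (fun e => P (e * K)).
Proof.
move=> K0 [e0 [h0 h]]; exists (e0 / K); split; first exact: divr_gt0.
by move=> e /andP[e1]; rewrite ltr_pdivlMr // => e2; apply: h; rewrite mulr_gt0.
Qed.

Section Mix.
Variables (R : realType) (V : finType) (Free : pred V) (L U : V -> V -> R).
Hypotheses (stL : stochastic Free L) (stU : stochastic Free U).

Definition mix (e : R) v a := (1 - e) * L v a + e * U v a.

Lemma mix_stochastic e : 0 < e < 1 -> stochastic Free (mix e).
Proof.
move=> /andP[e0 e1] v Fv; have [l0 l1] := stL Fv; have [u0 u1] := stU Fv; split=> [a|].
  by rewrite addr_ge0 // mulr_ge0 // ltW // subr_gt0.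
by rewrite big_split /= -!mulr_sumr l1 u1; ring.
Qed.

Lemma mean_bound (W : V -> V -> R) (x : V -> R) C v : stochastic Free W -> Free v ->
  (forall a, `|x a| <= C) -> `|\sum_a W v a * x a| <= C.
Proof.
move=> st Fv xC; have [w0 w1] := st v Fv; apply: le_trans (ler_norm_sum _ _ _) _.
rewrite -[leRHS]mul1r -w1 mulr_suml; apply: ler_sum => a _.
by rewrite normrM ger0_norm // ler_wpM2l.
Qed.

(** The solution for the mixed weights satisfies the equations of [L] up to a defect of order [e],
    and [green_bound] turns the defect into a distance. *)
Lemma harmonic_perturb C : grounded Free L ->
    (forall e, 0 < e < 1 -> grounded Free (mix e)) -> 0 <= C ->
  exists K, 0 < K /\ forall e x x1, 0 < e < 1 -> harmonic Free L x1 -> harmonic Free (mix e) x ->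
    (forall v, ~~ Free v -> `|x v| <= C /\ `|x v - x1 v| <= e * C) ->
    forall v, `|x v - x1 v| <= e * K.
Proof.
move=> gL gM C0; have [K [K0 hK]] := green_bound stL gL.
exists (K * (2 * C) + 1); split; first by rewrite ltr_wpDl // !mulr_ge0.
move=> e x x1 e01 hx1 hx bd v; have /andP[e0 e1] := e01.
have xC := harmonic_bound (mix_stochastic e01) (gM e e01) hx (fun v nF => (bd v nF).1).
apply: le_trans (hK (fun v => x v - x1 v) (e * (2 * C)) _ _ v) _.
- move=> w Fw; under eq_bigr do rewrite mulrBr.
  rewrite sumrB -(hx1 w Fw) hx // opprB addrA subrK.
  have -> : \sum_a mix e w a * x a - \sum_a L w a * x a = e * (\sum_a U w a * x a - \sum_a L w a * x a).
    rewrite -!sumrB mulr_sumr; apply: eq_bigr => a _; rewrite /mix; ring.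
  rewrite normrM gtr0_norm // ler_pM2l //.
  apply: le_trans (ler_normB _ _) _; rewrite mulr2n mulrDl mul1r.
  by apply: lerD; apply: mean_bound.
- move=> w nF; have [_ h] := bd w nF; apply: le_trans h _.
  by rewrite ler_pM2l // mulr2n mulrDl mul1r lerDl.
by rewrite mulrDr mulr1 mulrCA lerDl ltW.
Qed.

End Mix.

(** * Positions with prescribed vertices on the line *)

Section Pinned.
Variables (R : realType) (V : finType) (d : V -> point R) (adj : rel V).
Variables (o1 o2 o3 : V) (M : nat) (s : nat -> V).
Hypothesis H : axis d adj o1 o2 o3 M s.
Let T := ax_tri H.
Notation Free := (movable d o1 o2 o3).

Definition star (D : V -> point R) v := forall al be,
  (forall a, adj v a -> lin al be (D v) <= lin al be (D a)) ->
  forall a, adj v a -> lin al be (D a) = lin al be (D v).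

Lemma adj_closed_False (K : pred V) : (exists v, K v) -> (forall v, K v -> Free v) ->
  (forall v a, K v -> adj v a -> K a) -> False.
Proof.
move=> [v Kv] KF cl; have := KF v Kv => /andP[nv _].
have [K1 _ _] := reach_outer T (ex_intro2 _ _ v Kv nv) (fun v a Kv _ => @cl v a Kv).
by have := KF _ K1; rewrite /movable /outer inE eqxx.
Qed.

(** For a functional with a minimum at [v] the downward span gives [be <= 0] and the upward one
    [0 <= be]; the neighbours on the two sides then force [al] to be 0. *)
Lemma star_of_spans D v A B r A' B' r' : adj v A -> adj v B -> adj v r -> adj v A' -> adj v B' -> adj v r' ->
  (D A).1 < (D v).1 -> (D v).1 < (D B).1 -> spans_down (D v) (D A) (D B) (D r) ->
  (D A').1 < (D v).1 -> (D v).1 < (D B').1 ->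
  0 < cr (D v) (D B') (D A') \/ 0 < cr (D v) (D B') (D r') /\ 0 < cr (D v) (D r') (D A') -> star D v.
Proof.
move=> vA vB vr vA' vB' vr' xA xB down xA' xB' up al be h a va.
have b0 : be = 0.
  apply/eqP; rewrite eq_le (down_nonpos xA xB down (h A vA) (h B vB) (h r vr)).
  exact: up_nonneg xA' xB' up (h A' vA') (h B' vB') (h r' vr').
have a0 : al = 0.
  apply/eqP; rewrite eq_le; apply/andP; split.
    have := h A vA; rewrite -subr_ge0 /lin b0 (_ : _ - _ = ((D A).1 - (D v).1) * al); last by ring.
    by rewrite nmulr_rge0 // subr_lt0.
  have := h B vB; rewrite -subr_ge0 /lin b0 (_ : _ - _ = ((D B).1 - (D v).1) * al); last by ring.
  by rewrite pmulr_rge0 // subr_gt0.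
by rewrite /lin a0 b0; ring.
Qed.

Lemma free_star D L v : Free v -> (forall a, 0 <= L a) -> (forall a, 0 < L a = adj v a) -> \sum_a L a = 1 ->
  (D v).1 = \sum_a L a * (D a).1 -> (D v).2 = \sum_a L a * (D a).2 -> star D v.
Proof.
move=> Fv L0 La L1 E1 E2 al be h a va.
have S0 : \sum_x L x * (lin al be (D x) - lin al be (D v)) = 0.
  under eq_bigr do rewrite mulrBr.
  rewrite sumrB -mulr_suml L1 mul1r {2}/lin E1 E2.
  apply/eqP; rewrite subr_eq0; apply/eqP; rewrite !mulr_sumr -big_split /=.
  by apply: eq_bigr => x _; rewrite /lin; ring.
have /eqP := S0; rewrite psumr_eq0 => [/allP/(_ a)|x _].
  rewrite mem_index_enum => /(_ isT) /=; rewrite mulf_eq0 => /orP[/eqP Z|].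
    by have := La a; rewrite va Z ltxx.
  by rewrite subr_eq0 => /eqP.
have := L0 x; rewrite le_eqVlt => /orP[/eqP<-|p]; first by rewrite mul0r.
by rewrite mulr_ge0 // subr_ge0 h // -La.
Qed.

Section Targets.
Variables (N J : nat) (kk : nat -> nat) (lab : nat -> V).
Hypothesis Ct : contact d adj o1 o2 o3 M s N J kk lab.
Variables (b : nat -> R) (u v : V -> R).
Hypothesis D : drawn N J kk lab (joined adj s) b u v.
Hypothesis binc : increasing M b.
Let W := ct_word Ct.
Notation place := (place d M s b u v).

Lemma place_left i : (i <= J)%N -> place (lab i) = ((u (lab i))^-1, v (lab i) / u (lab i)).
Proof.
move=> iJ; have iN : (i <= N)%N by have := w_JN W; lia.
by rewrite (place_off H) ?(lab_off Ct) // /side (ct_left Ct) // mul1r.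
Qed.

Lemma place_right i : (J < i <= N)%N -> place (lab i) = (- (u (lab i))^-1, v (lab i) / u (lab i)).
Proof.
move=> iJ; have iN : (i <= N)%N by lia.
by rewrite (place_off H) ?(lab_off Ct) // /side ltNge (ltW (ct_right Ct iJ)) mulN1r.
Qed.

(** Up to a positive factor the orientation is the slope sum, which is how the conditions of [drawn]
    become geometric. *)
Lemma cr_place n m k : (n <= J < m)%N -> (m <= N)%N -> kk n = k -> kk m = k ->
  cr (place (s k)) (place (lab n)) (place (lab m)) =
  (xi kk lab b u v n + xi kk lab b u v m) / (u (lab n) * u (lab m)).
Proof.
move=> h mN kn km; have nN : (n <= N)%N by lia.
have kM : (k <= M)%N by rewrite -kn (kk_le W).
rewrite (place_s H) // place_left ?place_right; [|lia|lia].
have un := dr_neg D nN; have um := dr_neg D mN.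
by rewrite /cr /xi kn km /=; field; rewrite !lt_eqF.
Qed.

Lemma u_pos n m : (n <= N)%N -> (m <= N)%N -> 0 < u (lab n) * u (lab m).
Proof. by move=> nN mN; rewrite nmulr_rgt0 ?(dr_neg D). Qed.

Definition reach k A := adj (s k) A /\ known M s N lab A.

Lemma sides n m k : (n <= J < m)%N -> (m <= N)%N -> kk n = k -> kk m = k -> 
  [/\ reach k (lab n), reach k (lab m), (place (lab n)).1 < (place (s k)).1 &
    (place (s k)).1 < (place (lab m)).1].
Proof.
move=> h mN kn km; have nN : (n <= N)%N by lia.
have kM : (k <= M)%N by rewrite -kn (kk_le W).
rewrite (place_s H) // place_left ?place_right; [|lia|lia]; split => /=.
- by split; [rewrite -kn; apply: (ct_adj Ct) | right; exists n].
- by split; [rewrite -km; apply: (ct_adj Ct) | right; exists m].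
- by rewrite invr_lt0 (dr_neg D).
by rewrite oppr_gt0 invr_lt0 (dr_neg D).
Qed.

(** At the bottom vertex and above an unjoined gap the two lowest edges at [s k] have a positive
    slope sum; above a joined gap [s k.-1] is itself a neighbour straight below. *)
Lemma spans_down_at k : (k <= M)%N -> exists A B r, [/\ reach k A, reach k B & reach k r] /\
  [/\ (place A).1 < (place (s k)).1, (place (s k)).1 < (place B).1 &
   spans_down (place (s k)) (place A) (place B) (place r)].
Proof.
move=> kM; have JN := w_JN W.
have main n m : (n <= J < m)%N -> (m <= N)%N -> kk n = k -> kk m = k ->
    0 < xi kk lab b u v n + xi kk lab b u v m \/ ((0 < k)%N /\ adj (s k) (s k.-1)) -> 
    exists A B r, [/\ reach k A, reach k B & reach k r] /\
  [/\ (place A).1 < (place (s k)).1, (place (s k)).1 < (place B).1 &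
   spans_down (place (s k)) (place A) (place B) (place r)].
  move=> h mN kn km; have [a1 a2 x1 x2] := sides h mN kn km.
  have nN : (n <= N)%N by clear -h mN; lia.
  case=> [p|[k0 p]].
    exists (lab n), (lab m), (lab n); split=> //; split=> //; left.
    by rewrite (cr_place h mN kn km) divr_gt0 // u_pos.
  have bb : b k.-1 < b k by rewrite -{2}(ltn_predK k0) binc // (ltn_predK k0).
  have k1M : (k.-1 <= M)%N by clear -kM; lia.
  exists (lab n), (lab m), (s k.-1); split; first by split=> //; split=> //; left; exists k.-1.
  split=> //; right.
  move: x1 x2; rewrite !(place_s H) // /cr /= => x1 x2.
  by split; nra.
have [k0|k0] := posnP k.
  have dl := dr_low D; apply: (main 0%N J.+1); rewrite ?leqnn //; try (by left).
    by rewrite k0 (w_k0 W).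
  by rewrite k0 (w_kJ1 W).
have [|n [m [rn rm h kn km]]] := rises_at W (k := k.-1); first by rewrite (ltn_predK k0).
have [n1 m1] : kk n.+1 = k /\ kk m.+1 = k by rewrite (rise_kk rn) (rise_kk rm) kn km (ltn_predK k0).
have [h1 mN] : (n.+1 <= J < m.+1)%N /\ (m.+1 <= N)%N.
  by case/andP: rm => /andP[mN _] _; clear -h mN; split; lia.
apply: (main n.+1 m.+1) => //; have [jd|nj] := boolP (joined adj s k.-1).
  right; split=> //; move: jd; rewrite /joined (ltn_predK k0) => jd.
  by rewrite (tri_sym T).
left; have [] := dr_mid D rn rm h _ _; rewrite ?kn ?km //.
Qed.

Lemma spans_up_at k : (k <= M)%N -> exists A B r, [/\ reach k A, reach k B & reach k r] /\
  [/\ (place A).1 < (place (s k)).1, (place (s k)).1 < (place B).1 &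
   0 < cr (place (s k)) (place B) (place A) \/
   0 < cr (place (s k)) (place B) (place r) /\ 0 < cr (place (s k)) (place r) (place A)].
Proof.
move=> kM; have JN := w_JN W.
have main n m : (n <= J < m)%N -> (m <= N)%N -> kk n = k -> kk m = k ->
    xi kk lab b u v n + xi kk lab b u v m < 0 \/ ((k < M)%N /\ adj (s k) (s k.+1)) ->
    exists A B r, [/\ reach k A, reach k B & reach k r] /\
  [/\ (place A).1 < (place (s k)).1, (place (s k)).1 < (place B).1 &
   0 < cr (place (s k)) (place B) (place A) \/
   0 < cr (place (s k)) (place B) (place r) /\ 0 < cr (place (s k)) (place r) (place A)].
  move=> h mN kn km; have [a1 a2 x1 x2] := sides h mN kn km.
  have nN : (n <= N)%N by clear -h mN; lia.
  case=> [p|[k0 p]].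
    exists (lab n), (lab m), (lab n); split=> //; split=> //; left.
    by rewrite cr_swap oppr_gt0 (cr_place h mN kn km) ltr_pdivrMr ?u_pos // mul0r.
  exists (lab n), (lab m), (s k.+1); split; first by split=> //; split=> //; left; exists k.+1.
  split=> //; right; have bb := binc k0.
  move: x1 x2; rewrite !(place_s H) // /cr /= => x1 x2.
  by split; nra.
move: (kM); rewrite leq_eqVlt => /orP[/eqP k0|k0].
  have dl := dr_high D; apply: (main J N); rewrite ?leqnn //; try (by left).
    by rewrite k0 (w_kJ W).
  by rewrite k0 (w_kN W).
have [n [m [rn rm h kn km]]] := rises_at W k0.
have [h1 mN] : (n <= J < m)%N /\ (m <= N)%N.
  by case/andP: rm => /andP[mN _] _; clear -h mN; split; lia.
apply: (main n m) => //; have [jd|nj] := boolP (joined adj s k); first by right.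
left; have [] := dr_mid D rn rm h _ _; rewrite ?kn ?km //.
Qed.

(** By [dr_low] the line through [o1] and [o2] meets the axis below [b 0], and by [dr_high] the one
    through [o3] and [o2] meets it above [b M], so the lines differ. *)
Lemma outer_noncollinear : cr (place o1) (place o2) (place o3) != 0.
Proof.
have [e0 eJ eJ1 eN] := ct_ends Ct; have JN := w_JN W.
have h1 := dr_low D; have h2 := dr_high D.
move: h1 h2; rewrite /xi e0 eJ eJ1 eN (w_k0 W) (w_kJ W) (w_kJ1 W) (w_kN W) => h1 h2.
have := dr_neg D (leq0n N); have := dr_neg D (ltnW JN); have := dr_neg D JN; rewrite e0 eJ eJ1 => u2 u3 u1.
have := place_left (leq0n J); have := place_left (leqnn J); have := @place_right J.+1.
rewrite leqnn JN e0 eJ eJ1 => /(_ isT) -> -> ->.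
have b0M : b 0%N <= b M.
  have [->//|M0] := posnP M; apply: ltW; elim: M M0 binc => // m IH _ inc.
  have [->|m0] := posnP m; first exact: inc.
  apply: lt_trans (IH m0 _) (inc m _) => // k km; apply: inc; lia.
have n1 : u o1 != 0 by rewrite lt_eqF.
have n2 : u o2 != 0 by rewrite lt_eqF.
have n3 : u o3 != 0 by rewrite lt_eqF.
have -> : cr ((u o1)^-1, v o1 / u o1) (- (u o2)^-1, v o2 / u o2) ((u o3)^-1, v o3 / u o3) =
  ((v o1 + v o2) * (u o3 + u o2) - (v o3 + v o2) * (u o1 + u o2)) / (u o1 * u o2 * u o3).
  by rewrite /cr /=; field; rewrite n1 n2 n3.
rewrite mulf_neq0 ?invr_neq0 ?mulf_neq0 // lt_eqF //.
set P := - (u o1 + u o2); set Q := - (u o3 + u o2).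
have P0 : 0 < P by rewrite /P; move: u1 u2; lra.
have Q0 : 0 < Q by rewrite /Q; move: u3 u2; lra.
set p := v o1 + v o2; set q := v o3 + v o2.
have hp : 0 < p + P * b 0%N by move: h1; rewrite /p /P; lra.
have hq : q + Q * b M < 0 by move: h2; rewrite /q /Q; lra.
have -> : p * (u o3 + u o2) - q * (u o1 + u o2) =
  P * (q + Q * b M) - Q * (p + P * b 0%N) - P * Q * (b M - b 0%N) by rewrite /P /Q; ring.
have t1 : P * (q + Q * b M) < 0 by rewrite pmulr_rlt0.
have t2 : 0 < Q * (p + P * b 0%N) by rewrite pmulr_rgt0.
have t3 : 0 <= P * Q * (b M - b 0%N) by rewrite mulr_ge0 ?subr_ge0 // mulr_ge0 // ltW.
move: t1 t2 t3; lra.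
Qed.

End Targets.

End Pinned.

Lemma spans_close (R : realType) (s p q s1 p1 q1 s2 p2 q2 : point R) :
    0 < cr s p q \/ 0 < cr s1 p1 q1 /\ 0 < cr s2 p2 q2 ->
  small (fun e => forall s' p' q' s1' p1' q1' s2' p2' q2' : point R,
    close e s' s -> close e p' p -> close e q' q -> close e s1' s1 -> close e p1' p1 -> close e q1' q1 ->
    close e s2' s2 -> close e p2' p2 -> close e q2' q2 ->
    0 < cr s' p' q' \/ 0 < cr s1' p1' q1' /\ 0 < cr s2' p2' q2').
Proof.
case=> [h|[h1 h2]].
  by apply: small_sub (cr_close h) => e _ c s' p' q' s1' p1' q1' s2' p2' q2' *; left; apply: c.
apply: small_sub (small_and (cr_close h1) (cr_close h2)) => e _ [c1 c2] s' p' q' s1' p1' q1' s2' p2' q2' *.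
by right; split; [apply: c1 | apply: c2].
Qed.

Section Pinned.
Variables (R : realType) (V : finType) (d : V -> point R) (adj : rel V).
Variables (o1 o2 o3 : V) (M : nat) (s : nat -> V).
Hypothesis H : axis d adj o1 o2 o3 M s.
Hypothesis left3 : (d o3).1 < 0.
Let T := ax_tri H.
Notation Free := (movable d o1 o2 o3).

Let U p x : R := (adj p x)%:R / #|adj p|%:R.

Let nb_gt0 p : Free p -> (0 < #|adj p|)%N.
Proof.
case/andP=> pn _.
have [|x px _] := interior_surrounded T pn (al := 1) (be := 0); first by left; rewrite oner_neq0.
by apply/card_gt0P; exists x.
Qed.

Let U_gt0 p x : Free p -> 0 < U p x = adj p x.
Proof.
by move=> Fp; rewrite /U; case: (adj p x); rewrite ?mul0r ?ltxx // divr_gt0 // ltr0n nb_gt0.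
Qed.

Let stU : stochastic Free U.
Proof.
move=> p Fp; split=> [x|]; first by rewrite divr_ge0.
by rewrite -mulr_suml -natr_sum -big_mkcond sum1_card divff // pnatr_eq0 -lt0n nb_gt0.
Qed.

Lemma star_open (P : V -> point R) k A B r A' B' r' :
    [/\ adj (s k) A, adj (s k) B & adj (s k) r] -> [/\ adj (s k) A', adj (s k) B' & adj (s k) r'] ->
    (P A).1 < (P (s k)).1 -> (P (s k)).1 < (P B).1 -> spans_down (P (s k)) (P A) (P B) (P r) ->
    (P A').1 < (P (s k)).1 -> (P (s k)).1 < (P B').1 ->
    0 < cr (P (s k)) (P B') (P A') \/ 0 < cr (P (s k)) (P B') (P r') /\ 0 < cr (P (s k)) (P r') (P A') ->
  small (fun e => forall D : V -> point R, (forall v, close e (D v) (P v)) -> star adj D (s k)).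
Proof.
move=> [a1 a2 a3] [a4 a5 a6] h1 h2 h3 h4 h5 h6.
have := small_and (small_and (lt_close h1) (lt_close h2)) (small_and (lt_close h4) (lt_close h5)).
move=> /(small_and (small_and (spans_close h3) (spans_close h6))).
apply: small_sub => e _ [[c3 c6] [[c1 c2] [c4 c5]]] D cl.
apply: (star_of_spans a1 a2 a3 a4 a5 a6); [exact: c1 | exact: c2 | | exact: c4 | exact: c5 | exact: c6].
exact: c3.
Qed.

(* The weights L0 keep the contact vertices in place but may vanish; mixing in a
   little of the uniform weights U makes all of them positive and moves the
   harmonic solution only slightly, so that the open condition at each s k is
   not lost. *)
Theorem pinned_stars (a b : nat -> R) : increasing M b -> exists e D, 0 < e /\
  [/\ forall k, (k <= M)%N -> D (s k) = (e * a k, b k),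
    forall v, ~~ outer o1 o2 o3 v -> star adj D v & cr (D o1) (D o2) (D o3) != 0].
Proof.
move=> binc; have [N [J [kk [lab Ct]]]] := contact_exists H left3.
have hinc : increasing M (height d s) by move=> k kM; apply: (ax_inc H); rewrite ltnSn.
have [u [v [D conv]]] := transport (ct_word Ct) hinc (ct_drawn Ct) binc.
pose pl := place d M s b u v.
pose K : pred V := fun p => [exists i : 'I_N.+1, lab i == p].
have KP p : K p -> exists2 i, (i <= N)%N & p = lab i.
  by move=> /existsP[i /eqP<-]; exists i => //; rewrite -ltnS.
have KI i : (i <= N)%N -> K (lab i).
  by move=> iN; apply/existsP; exists (Ordinal (n := N.+1) (m := i) iN).
have s_nF k : (k <= M)%N -> ~~ Free (s k).
  by move=> kM; rewrite negb_and negbK (ax_on H) ?eqxx ?orbT.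
have [L0 L0P] : exists L0 : V -> V -> R, forall p, Free p ->
  [/\ (forall x, 0 <= L0 p x) /\ \sum_x L0 p x = 1, forall x, 0 < L0 p x -> adj p x,
   K p -> hull d adj M s N lab b u v p (L0 p) /\ ((exists2 k, (k <= M)%N & 0 < L0 p (s k)) \/
    exists i, [/\ (i <= N)%N, 0 < L0 p (lab i) & (pl p).2 < (pl (lab i)).2]) &
   ~~ K p -> forall x, adj p x -> 0 < L0 p x].
  apply: (@fin_all_exists _ (fun _ => V -> R) (fun p w => Free p ->
    [/\ (forall x, 0 <= w x) /\ \sum_x w x = 1, forall x, 0 < w x -> adj p x,
     K p -> hull d adj M s N lab b u v p w /\ ((exists2 k, (k <= M)%N & 0 < w (s k)) \/
      exists i, [/\ (i <= N)%N, 0 < w (lab i) & (pl p).2 < (pl (lab i)).2]) &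
     ~~ K p -> forall x, adj p x -> 0 < w x])) => p.
  have [Fp|nF] := boolP (Free p); last by exists (fun=> 0).
  have [Kp|nK] := boolP (K p).
    have [i iN pE] := KP p Kp; rewrite pE in Fp.
    have [w hw alt] := hull_exists H Ct D conv iN Fp.
    by exists w => _; rewrite pE; case: (hw) => w0 wa w1 _ _; split=> // x /wa[].
  exists (U p) => _; split=> //; first exact: stU.
    by move=> x; rewrite U_gt0.
  by move=> _ x px; rewrite U_gt0.
have st0 : stochastic Free L0 by move=> p /L0P[].
(* In a set closed under the weights a highest label would lead to the line or to a higher label. A
   closed set without labels has positive weights on all edges, so it is closed under adjacency. *)
have gr0 : grounded Free L0.
  move=> Q [q Qq] QF Qcl.
  have [/existsP[m0 Qm0]|/existsPn no] := boolP [exists p, Q p && K p].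
    case: (@Order.TotalTheory.arg_maxP _ _ _ m0 (fun p => Q p && K p) (fun p => (pl p).2) Qm0) => m /andP[Qm Km] mmax.
    have [_ _ /(_ Km)[_ [[k kM p]|[i [iN p lt]]]] _] := L0P m (QF m Qm).
      by have := QF _ (Qcl m _ Qm p); rewrite (negPf (s_nF k kM)).
    have : (pl (lab i)).2 <= (pl m).2 by apply: mmax; rewrite (Qcl m _ Qm p) KI.
    by rewrite leNgt lt.
  apply: (adj_closed_False H (K := Q)) => //; first by exists q.
  move=> p x Qp px; apply: (Qcl p x Qp); have [_ _ _ h] := L0P p (QF p Qp).
  by apply: h => //; have := no p; rewrite Qp.
(* The movable vertices that are not labels. Labels already are barycentres of the targets [pl], so
   solving for [hid] alone yields an [L0]-harmonic map that attains all targets. *)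
pose hid : pred V := fun p => Free p && ~~ K p.
have st1 : stochastic hid L0 by move=> p /andP[Fp _]; apply: st0.
have gr1 : grounded hid L0.
  by move=> Q Qe QF; apply: gr0 => // p /QF/andP[].
have kn p : known M s N lab p -> ~~ hid p.
  by rewrite negb_and; case=> -[k kM ->]; [rewrite s_nF | rewrite negbK KI ?orbT].
have harm (c : point R -> R) : c = fst \/ c = snd -> exists z, harmonic Free L0 z /\ forall p, ~~ hid p -> z p = c (pl p).
  move=> cE; have [z [hz ze]] := harmonic_solve (fun p => c (pl p)) st1 gr1.
  exists z; split=> // p Fp; have [Kp|nK] := boolP (K p); last by apply: hz; rewrite /hid Fp.
  have [[L00 _] _ /(_ Kp)[[_ wk _ E1 E2] _] _] := L0P p Fp.
  rewrite ze; last by rewrite /hid Kp andbF.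
  transitivity (\sum_x L0 p x * c (pl x)); first by case: cE => ->.
  apply: eq_bigr => x _; have := L00 x; rewrite le_eqVlt => /orP[/eqP<-|px]; first by rewrite !mul0r.
  by have [_ /kn/ze->] := wk x px.
have [z1 [hz1 z1E]] := harm fst (or_introl erefl).
have [z2 [hz2 z2E]] := harm snd (or_intror erefl).
pose D1 p : point R := (z1 p, z2 p).
have D1E p : ~~ hid p -> D1 p = pl p.
  by move=> np; rewrite /D1 z1E // z2E //; case: (pl p).
have D1s k : (k <= M)%N -> D1 (s k) = pl (s k) by move=> kM; apply/D1E/kn; left; exists k.
have mixP e p x : 0 < e < 1 -> Free p -> 0 < mix L0 U e p x = adj p x.
  move=> /andP[e0 e1] Fp; have [[l0 _] la _ _] := L0P p Fp; have [u0 _] := stU Fp.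
  rewrite /mix; have [px|npx] := boolP (adj p x).
    by apply: ltr_wpDl; [rewrite mulr_ge0 // subr_ge0 ltW | rewrite mulr_gt0 // U_gt0].
  have -> : L0 p x = 0 by apply/eqP; rewrite eq_le l0 andbT leNgt; apply: contra npx; apply: la.
  have -> : U p x = 0 by apply/eqP; rewrite eq_le u0 andbT leNgt U_gt0.
  by rewrite !mulr0 addr0 ltxx.
have grM e : 0 < e < 1 -> grounded Free (mix L0 U e).
  move=> e01 Q Qe QF Qcl; apply: (adj_closed_False H Qe QF) => p x Qp px.
  by apply: (Qcl p x Qp); rewrite mixP // QF.
(* Bounds the boundary values and also the [a k], because replacing abscissa 0 by [e * a k] must
   change the boundary by at most [e * C]. *)
pose C := \sum_p `|(pl p).1| + \sum_p `|(pl p).2| + \sum_(k < M.+1) `|a k|.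
have S1 : 0 <= \sum_p `|(pl p).1| by apply: sumr_ge0.
have S2 : 0 <= \sum_p `|(pl p).2| by apply: sumr_ge0.
have S3 : 0 <= \sum_(k < M.+1) `|a k| by apply: sumr_ge0.
have C0 : 0 <= C by rewrite !addr_ge0.
have C1 p : `|(pl p).1| <= C.
  by rewrite /C -addrA (bigD1 p) //= -addrA lerDl !addr_ge0 ?sumr_ge0.
have C2 p : `|(pl p).2| <= C.
  by rewrite /C addrAC addrC (bigD1 p) //= -addrA lerDl !addr_ge0 ?sumr_ge0.
have C3 (k : 'I_M.+1) : `|a k| <= C.
  by rewrite /C addrC (bigD1 k) //= -addrA lerDl !addr_ge0 ?sumr_ge0.
have [K1 [K10 pert]] := harmonic_perturb st0 stU gr0 grM C0.
have sm1 (k : 'I_M.+1) : small (fun e => forall D : V -> point R, (forall p, close e (D p) (D1 p)) -> star adj D (s k)).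
  have kM : (k <= M)%N by rewrite -ltnS.
  have [A [B [r [[[a1 k1] [a2 k2] [a3 k3]] [h1 h2 h3]]]]] := spans_down_at H Ct D binc kM.
  have [A' [B' [r' [[[a4 k4] [a5 k5] [a6 k6]] [h4 h5 h6]]]]] := spans_up_at H Ct D binc kM.
  by apply: (@star_open D1 k A B r A' B' r') => //; rewrite /spans_down D1s // !D1E //; apply: kn.
have lt1 : small (fun e : R => e < 1) by exists 1; split=> // e /andP[].
have [e [e0 [e1 st]]] := small_ex (small_and lt1 (small_scale K10 (small_all sm1))).
have e01 : 0 < e < 1 by rewrite e0.
pose g1 p := if [pick k : 'I_M.+1 | s k == p] is Some k then e * a k else (pl p).1.
have stM := mix_stochastic st0 stU e01.
have [x [hx xE]] := harmonic_solve g1 stM (grM e e01).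
have [y [hy yE]] := harmonic_solve (fun p => (pl p).2) stM (grM e e01).
have nFh p : ~~ Free p -> ~~ hid p by apply: contra => /andP[].
have cx : forall p, `|x p - z1 p| <= e * K1.
  apply: pert => // p nF; rewrite xE // z1E ?nFh // /g1; case: pickP => [k /eqP<-|_]; last first.
    by rewrite subrr normr0 mulr_ge0 // ltW.
  rewrite /pl (place_s H) -1?ltnS // subr0 normrM gtr0_norm // ler_pM2l //; split=> //.
  by apply: le_trans (C3 k); rewrite ler_piMl // ltW.
have cy : forall p, `|y p - z2 p| <= e * K1.
  apply: pert => // p nF; rewrite yE // z2E ?nFh // subrr normr0 mulr_ge0 //; last exact: ltW.
exists e, (fun p => (x p, y p)); split=> //; split.
- move=> k kM; rewrite xE ?s_nF // yE ?s_nF // /pl (place_s H) //; congr pair.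
  rewrite /g1; case: pickP => [j /eqP/(s_inj H) ->//|/(_ (Ordinal (n := M.+1) (m := k) kM))].
    by rewrite -ltnS.
  by rewrite eqxx.
- move=> p np; have [p0|p0] := eqVneq (d p).1 0.
    have [k kM ->] := ax_all H p0; apply: (st (Ordinal (n := M.+1) (m := k) kM) (fun p => (x p, y p))).
    by move=> q; split; [apply: cx | apply: cy].
  have Fp : Free p by rewrite /movable np.
  have [m0 m1] := stM p Fp.
  by apply: (free_star (L := mix L0 U e p) Fp m0 _ m1); [move=> z; apply: mixP | apply: hx | apply: hy].
have oF o : outer o1 o2 o3 o -> (d o).1 != 0 -> (x o, y o) = pl o.
  move=> oo dn; have nF : ~~ Free o by rewrite negb_and negbK oo.
  rewrite xE // yE // /g1; case: pickP => [k /eqP E|_]; last by case: (pl o).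
  by move: dn; rewrite -E (ax_on H) ?eqxx // -ltnS.
rewrite !oF ?(outer_noncollinear H Ct D binc) ?(lt_eqF (ax_left H)) ?(gt_eqF (ax_right H)) ?(lt_eqF left3) //;
  by rewrite /outer !inE eqxx ?orbT.
Qed.

End Pinned.

(** * Triangulating along the line *)

Section BigTriangle.
Variables (R : realType) (V : finType) (d : V -> point R).

(** All other vertices are strictly on the inner side of each boundary segment, so nothing can block
    it and maximality makes it an edge. *)
Lemma triang_in_big (e : rel V) o1 o2 o3 : symmetric e -> irreflexive e -> plane_drawing e d ->
    o1 != o2 -> o2 != o3 -> o3 != o1 -> 0 < cr (d o1) (d o2) (d o3) ->
    (forall v, v != o1 -> v != o2 -> v != o3 ->
      [/\ 0 < cr (d o1) (d o2) (d v), 0 < cr (d o2) (d o3) (d v) & 0 < cr (d o3) (d o1) (d v)]) ->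
  exists2 adj, subrel e adj & triang d adj o1 o2 o3.
Proof.
move=> es ei ep n12 n23 n31 pos inn; have [adj [as_ ai sub pd mx]] := maximal_plane es ei ep.
have side u v : u != v -> (forall w, w != u -> w != v -> 0 < cr (d u) (d v) (d w)) -> adj u v.
  move=> uv h; have ge w : 0 <= cr (d u) (d v) (d w).
    have [->|wu] := eqVneq w u; first by rewrite cr_aba.
    by have [->|wv] := eqVneq w v; [rewrite cr_abb | apply/ltW/h].
  apply/negPn/negP => nuv; case: (mx u v uv nuv) => [[w [wu wv /on_seg_cr E]]|[a [b /andP[_ /andP[c _]]]]].
    by have := h w wu wv; rewrite E ltxx.
  by move: c; rewrite ltNge mulr_ge0.
exists adj => //; split=> //; apply: side => // w w1 w2.
- by have [->//|w3] := eqVneq w o3; have [] := inn w w1 w2 w3.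
- by have [->|w3] := eqVneq w o1; [rewrite cr_cyc | have [] := inn w w3 w1 w2].
by have [->|w3] := eqVneq w o2; [rewrite -cr_cyc | have [] := inn w w2 w3 w1].
Qed.

Variables (adj : rel V) (o1 o2 o3 : V).
Hypothesis T : triang d adj o1 o2 o3.
Notation X a b c := (cr (d a) (d b) (d c)).

Let axis_pt (h : R) : point R := (0, h).

Lemma avoid_between (t1 t2 : R) (B : seq R) : t1 < t2 -> exists h, t1 < h < t2 /\ h \notin B.
Proof.
move=> t12; have [m [m0 mB]] := avoid_finite [seq (t2 - t1) / (x - t1) - 1 | x <- B].
have m1 : 0 < 1 + m by lra.
exists (t1 + (t2 - t1) / (1 + m)); split.
  have q0 : 0 < (t2 - t1) / (1 + m) by rewrite divr_gt0 // subr_gt0.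
  have q1 : (t2 - t1) / (1 + m) < t2 - t1 by rewrite ltr_pdivrMr // ltr_pMr ?subr_gt0 //; lra.
  by apply/andP; split; lra.
apply: contra mB => hB; apply/mapP; exists (t1 + (t2 - t1) / (1 + m)) => //.
by field; rewrite !gt_eqF //=; lra.
Qed.

Let tri a b c (p : point R) := [/\ 0 <= cr (d a) (d b) p, 0 <= cr (d b) (d c) p & 0 <= cr (d c) (d a) p].

Let tri_lerp a b c t p q : 0 <= t <= 1 -> tri a b c p -> tri a b c q -> tri a b c (lerp t p q).
Proof.
move=> /andP[t0 t1] [p1 p2 p3] [q1 q2 q3]; rewrite /tri !cr_lerp.
by split; rewrite addr_ge0 // mulr_ge0 // subr_ge0.
Qed.

Lemma axis_crossing p q : (d p).1 < 0 -> 0 < (d q).1 -> exists t h, 0 < t < 1 /\ lerp t (d p) (d q) = axis_pt h.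
Proof.
move=> p0 q0; have D : 0 < (d q).1 - (d p).1 by lra.
exists (- (d p).1 / ((d q).1 - (d p).1)); eexists; split; last first.
  by apply: point_eq => /=; [field; rewrite gt_eqF | reflexivity].
by rewrite divr_gt0 //= ?oppr_gt0 // ltr_pdivrMr // mul1r; lra.
Qed.

Let crossed t := exists p q, [/\ adj p q, (d p).1 != 0, (d q).1 != 0 & on_seg (d p) (d q) (axis_pt t)].

(** [h] avoids the finitely many points where lines through two vertices cross the axis. An edge
    along the axis containing [h] would also contain [t1], as no vertex on the axis lies between
    [t1] and [t2]; but [t1] is on an edge with both ends off the axis. *)
Lemma good_height a b c C t1 t2 : face d adj a b c -> (d a).1 != 0 -> (d b).1 != 0 -> (d c).1 != 0 ->
    t1 < t2 -> - C <= t1 -> t2 <= C -> tri a b c (axis_pt t1) -> tri a b c (axis_pt t2) ->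
    crossed t1 ->
  exists h, [/\ - C < h < C, forall u v, adj u v -> ~ on_seg (d u) (d v) (axis_pt h),
    forall u, d u <> axis_pt h & tri a b c (axis_pt h)].
Proof.
move=> f a0 b0 c0 t12 tC1 tC2 T1 T2 [p [q [pq p0 q0 opq]]]; have [_ _ _ _ emp] := faceP f.
have D : t2 - t1 != 0 by rewrite subr_eq0 gt_eqF.
have mid t : t1 <= t <= t2 -> tri a b c (axis_pt t).
  move=> /andP[h1 h2]; have -> : axis_pt t = lerp ((t - t1) / (t2 - t1)) (axis_pt t1) (axis_pt t2).
    by apply: point_eq => /=; [ring | field].
  apply: tri_lerp => //; rewrite divr_ge0 ?subr_ge0 ?(ltW t12) //= ler_pdivrMr ?subr_gt0 // mul1r.
  by rewrite lerD2r.
have nov z : (d z).1 = 0 -> (d z).2 < t1 \/ t2 < (d z).2.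
  move=> z0; have [h1|h1] := ltP (d z).2 t1; first by left.
  have [h2|h2] := ltP t2 (d z).2; first by right.
  have zE : d z = axis_pt (d z).2 by apply: point_eq.
  have [h3 h4 h5] := mid (d z).2 (introT andP (conj h1 h2)); rewrite -zE in h3 h4 h5.
  by exfalso; apply: (emp z) => //; [apply: contraNneq a0|apply: contraNneq b0|apply: contraNneq c0] => <-; rewrite z0.
have [h [/andP[h1 h2] hB]] := avoid_between
  [seq (d z.1).2 + ((d z.2).2 - (d z.1).2) * (- (d z.1).1 / ((d z.2).1 - (d z.1).1)) | z : V * V] t12.
have noedge u v : adj u v -> ~ on_seg (d u) (d v) (axis_pt h).
  move=> uv ouv; have [E|n] := eqVneq (d u).1 (d v).1; last first.
    case: ouv => t [t01 /= [e1 e2]]; case/negP: hB; apply/mapP; exists (u, v); first by rewrite mem_enum.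
    have n' : (d v).1 - (d u).1 != 0 by rewrite subr_eq0 eq_sym.
    rewrite e2 /=; have -> : t = - (d u).1 / ((d v).1 - (d u).1); last by ring.
    by apply: (mulIf n'); rewrite mulfVK // mulrBr; lra.
  case: ouv => t [/andP[t0 t'] /= [e1 e2]]; have u0 : (d u).1 = 0 by move: e1; rewrite -E; lra.
  have v0 : (d v).1 = 0 by rewrite -E.
  have [s s01 sE] : exists2 s, 0 <= s <= 1 & t1 = (1 - s) * (d u).2 + s * (d v).2.
    have Du : (d u).2 != (d v).2.
      apply/eqP => E2; have := tri_d_neq T (adj_neq T uv); rewrite (point_eq E E2) eqxx //.
    exists ((t1 - (d u).2) / ((d v).2 - (d u).2)); last by field; rewrite subr_eq0 eq_sym.
    have [hu|hu] := nov u u0; have [hv|hv] := nov v v0.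
    - by exfalso; move: h1; rewrite e2; nra.
    - have D' : 0 < (d v).2 - (d u).2 by lra.
      by rewrite divr_ge0 ?ler_pdivrMr //=; lra.
    - have D' : (d v).2 - (d u).2 < 0 by lra.
      by rewrite ler_ndivrMr // -mulrNN -invrN divr_ge0 //=; lra.
    by exfalso; move: h2; rewrite e2; nra.
  have o1' : on_seg (d u) (d v) (axis_pt t1).
    by exists s; split=> //=; rewrite u0 v0 -sE; split; [ring|].
  have offu z : z = u \/ z = v -> z = p \/ z = q -> False.
    by case=> -> [] E'; move: p0 q0; rewrite -E' ?u0 ?v0 eqxx.
  case: (pd_meet (tri_pd T) uv pq o1' opq) => [E'|[z [z1 z2 _]]]; last exact: offu z z1 z2.
  have : u \in [set p; q] by rewrite -E' !inE eqxx.
  by rewrite !inE => /orP[] /eqP E2; apply: (offu u); auto.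
exists h; split=> //; first by apply/andP; split; lra.
- move=> u uE; case/negP: hB; apply/mapP; exists (u, u); first by rewrite mem_enum.
  by rewrite /= !subrr mul0r addr0 uE.
by apply: mid; rewrite !ltW.
Qed.

(** The axis cuts the face in a segment with one end on [a b] and the other on a second side. The
    bound on the vertices passes to convex combinations and at [x = 0] reads [- C <= h <= C]. *)
Lemma dummy_height a b c C : (forall v, (d v).2 <= C - (d v).1 /\ - (d v).2 <= C - (d v).1) ->
    face d adj a b c -> (d a).1 < 0 -> 0 < (d b).1 -> (d c).1 != 0 ->
  exists h, [/\ - C < h < C, forall u v, adj u v -> ~ on_seg (d u) (d v) (axis_pt h),
    forall u, d u <> axis_pt h & tri a b c (axis_pt h)].
Proof.
move=> bd f a0 b0 c0; have [ab bc ca pos _] := faceP f.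
have Ta : tri a b c (d a) by rewrite /tri cr_aba cr_abb cr_cyc; split=> //; apply: ltW.
have Tb : tri a b c (d b) by rewrite /tri cr_aba cr_abb -cr_cyc; split=> //; apply: ltW.
have Tc : tri a b c (d c) by rewrite /tri cr_aba cr_abb; split=> //; apply: ltW.
have tC t p q h : 0 < t < 1 -> lerp t (d p) (d q) = axis_pt h -> - C <= h <= C.
  move=> /andP[t0 t1] [e1 e2]; have [p1 p2] := bd p; have [q1 q2] := bd q.
  by rewrite -e2; apply/andP; split; nra.
have [t [h1 [t01 E1]]] := axis_crossing a0 b0.
have [p [q [s [h2 [s01 E2 pq [p0 q0 Tpq] c2]]]]] : exists p q s h2, [/\ 0 < s < 1, lerp s (d p) (d q) = axis_pt h2,
    adj p q, [/\ (d p).1 != 0, (d q).1 != 0 & tri a b c (d p) /\ tri a b c (d q)] & 0 < cr (d a) (d b) (axis_pt h2)].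
  have [cl|cr_|E] := ltgtP (d c).1 0; last by rewrite E eqxx in c0.
    have [s [h2 [/andP[s0 s1] E2]]] := axis_crossing cl b0; exists c, b, s, h2; split=> //; first by rewrite s0.
    - by rewrite (tri_sym T).
    - by split=> //; rewrite gt_eqF.
    by rewrite -E2 cr_lerp cr_abb mulr0 addr0 mulr_gt0 // subr_gt0.
  have [s [h2 [/andP[s0 s1] E2]]] := axis_crossing a0 cr_; exists a, c, s, h2; split=> //; first by rewrite s0.
  - by rewrite (tri_sym T).
  - by split=> //; rewrite lt_eqF.
  by rewrite -E2 cr_lerp cr_aba mulr0 add0r mulr_gt0.
have T1 : tri a b c (axis_pt h1) by rewrite -E1; apply: tri_lerp => //; case/andP: t01 => *; rewrite !ltW.
have T2 : tri a b c (axis_pt h2).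
  by rewrite -E2; apply: tri_lerp; rewrite ?Tpq.1 ?Tpq.2 //; case: Tpq => //; case/andP: s01 => *; rewrite !ltW.
have X1 : crossed h1.
  exists a, b; split=> //; rewrite ?(lt_eqF a0) ?(gt_eqF b0) //.
  by rewrite -E1; apply: on_seg_lerp; case/andP: t01 => *; rewrite !ltW.
have X2 : crossed h2.
  exists p, q; split=> //.
  by rewrite -E2; apply: on_seg_lerp; case/andP: s01 => *; rewrite !ltW.
have /andP[l1 r1] := tC t a b h1 t01 E1; have /andP[l2 r2] := tC s p q h2 s01 E2.
have an : (d a).1 != 0 by rewrite lt_eqF.
have bn : (d b).1 != 0 by rewrite gt_eqF.
have [lt|lt|E] := ltgtP h1 h2.
- exact: good_height f an bn c0 lt l1 r2 T1 T2 X1.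
- exact: good_height f an bn c0 lt l2 r1 T2 T1 X2.
by move: c2; rewrite -E -E1 cr_lerp cr_aba cr_abb !mulr0 addr0 ltxx.
Qed.

End BigTriangle.

Lemma plane_extend (R : realType) (U V : finType) (i : U -> V) (e : rel U) (d : U -> point R)
    (e' : rel V) (d' : V -> point R) :
  (forall u, d' (i u) = d u) -> plane_drawing e d -> injective d' ->
  (forall x y, e' x y -> exists u v, [/\ x = i u, y = i v & e u v]) ->
  (forall w u v, (forall z, w != i z) -> e u v -> ~ on_seg (d u) (d v) (d' w)) ->
  plane_drawing e' d'.
Proof.
move=> dE pd inj e'E iso; split=> //; split.
  move=> x y w /e'E[u [v [-> -> uv]]] wu wv; rewrite !dE.
  have [/existsP[z /eqP E]|/existsPn nz] := boolP [exists z, w == i z]; last exact: iso.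
  rewrite E dE; case: pd => _ [h _]; apply: h => //.
    by apply: contraNneq wu => <-; rewrite E.
  by apply: contraNneq wv => <-; rewrite E.
move=> x y z w p /e'E[a [b [-> -> ab]]] /e'E[c [f [-> -> cf]]] nE; rewrite !dE => p1 p2.
case: (pd_meet pd ab cf p1 p2) => [E|[v [v1 v2 pE]]].
  by case/eqP: nE; rewrite -!imset_set1 -!imsetU E.
exists (i v); last by rewrite dE.
by apply/andP; rewrite !inE; split; [case: v1 => ->|case: v2 => ->]; rewrite eqxx ?orbT.
Qed.

Lemma sorted_enum (R : realType) (V : finType) (f : V -> R) (A : pred V) :
    {in A &, injective f} -> (exists v, A v) ->
  exists M s, [/\ #|A| = M.+1, forall k, (k <= M)%N -> A (s k),
    forall v, A v -> exists2 k, (k <= M)%N & v = s k &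
    forall j k, (j < k <= M)%N -> f (s j) < f (s k)].
Proof.
move=> finj [v0 Av0]; pose le x y := f x <= f y.
pose l := sort le (enum A).
have lA v : (v \in l) = A v by rewrite mem_sort mem_enum.
have l0 : (0 < size l)%N by have := lA v0; rewrite Av0; case: (l).
have ls : (size l).-1.+1 = size l by rewrite prednK.
have let_ : transitive le by move=> y x z; apply: le_trans.
have srt : sorted le l by apply: sort_sorted => x y; apply: le_total.
exists (size l).-1, (nth v0 l); split.
- by rewrite ls size_sort -cardE.
- by move=> k kM; rewrite -lA mem_nth // -ls ltnS.
- by move=> v Av; exists (index v l); rewrite ?nth_index ?lA // -ltnS ls index_mem lA.
move=> j k /andP[jk kM]; have kl : (k < size l)%N by rewrite -ls ltnS.
have jl := ltn_trans jk kl.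
rewrite lt_neqAle; apply/andP; split; last first.
  by apply: (sorted_leq_nth let_ _ _ srt) => //; [move=> x; exact: lexx | apply: ltnW].
apply/eqP => /finj E; have := E; rewrite -!topredE /= -!lA !mem_nth // => /(_ isT isT)/eqP.
by rewrite nth_uniq ?(ltn_eqF jk) // /l sort_uniq enum_uniq.
Qed.

Section Frame.
Variables (R : realType) (T : finType) (e : rel T) (d : T -> point R).
Hypotheses (e_sym : symmetric e) (e_irr : irreflexive e) (pd : plane_drawing e d).
Hypothesis axis0 : exists v, (d v).1 = 0.

Let r : R := 1 + \sum_v `|(d v).1| + \sum_v `|(d v).2|.

Let r_gt0 : 0 < r.
Proof. by rewrite /r -addrA ltr_pwDl // addr_ge0 // sumr_ge0. Qed.

Let bound1 v : - r < (d v).1 < r.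
Proof.
have S1 : 0 <= \sum_(w | w != v) `|(d w).1| by apply: sumr_ge0.
have S2 : 0 <= \sum_w `|(d w).2| by apply: sumr_ge0.
rewrite -ltr_norml /r (bigD1 v) //=; move: S1 S2; lra.
Qed.

Let bound2 v : - r < (d v).2 < r.
Proof.
have S1 : 0 <= \sum_w `|(d w).1| by apply: sumr_ge0.
have S2 : 0 <= \sum_(w | w != v) `|(d w).2| by apply: sumr_ge0.
rewrite -ltr_norml /r (bigD1 v (F := fun w => `|(d w).2|)) //=; move: S1 S2; lra.
Qed.

Let V1 := option (option (option T)).

(** The corners of the triangle with sides [x = - 2 r], [y = 4 r - x] and [y = x - 4 r], which
    contains the square of half-side [r]. Two corners are on the left of the axis. *)
Let d1 (v : V1) : point R := match v with
  | None => (- (2 * r), - (6 * r)) | Some None => (4 * r, 0)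
  | Some (Some None) => (- (2 * r), 6 * r) | Some (Some (Some u)) => d u end.

Let e1 (x y : V1) := match x, y with
  | Some (Some (Some u)), Some (Some (Some v)) => e u v | _, _ => false end.

Let framed (p : point R) := - (2 * r) < p.1 /\ - (4 * r - p.1) < p.2 < 4 * r - p.1.

Let framed_in p : framed p -> [/\ 0 < cr (d1 None) (d1 (Some None)) p,
  0 < cr (d1 (Some None)) (d1 (Some (Some None))) p & 0 < cr (d1 (Some (Some None))) (d1 None) p].
Proof.
move=> [h1 /andP[h2 h3]]; rewrite /cr /=.
have r6 : 0 < 6 * r by rewrite mulr_gt0.
split.
- rewrite (_ : _ - _ = 6 * r * (p.2 + (4 * r - p.1))); last by ring.
  by rewrite mulr_gt0 //; lra.
- rewrite (_ : _ - _ = 6 * r * (4 * r - p.1 - p.2)); last by ring.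
  by rewrite mulr_gt0 //; lra.
rewrite (_ : _ - _ = 6 * r * (2 * (p.1 + 2 * r))); last by ring.
by rewrite mulr_gt0 //; lra.
Qed.

Let d_framed u : framed (d u).
Proof.
have /andP[a1 a2] := bound1 u; have /andP[b1 b2] := bound2 u; have r0 := r_gt0.
by split; [lra | apply/andP; split; lra].
Qed.

Let frame_pos : 0 < cr (d1 None) (d1 (Some None)) (d1 (Some (Some None))).
Proof.
rewrite /cr /= (_ : _ - _ = 72 * (r * r)); last by ring.
by rewrite !mulr_gt0.
Qed.

Let d1_inj : injective d1.
Proof.
have [inj _] := pd; have r0 := r_gt0.
move=> x y E; have := congr1 fst E; have := congr1 snd E; move: E.
case: x y => [[[u|]|]|] [[[v|]|]|] //= E; first by rewrite (inj u v).
all: try have /andP[a1 a2] := bound1 u.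
all: try have /andP[a1 a2] := bound1 v.
all: by clear E; move=> h1 h2; exfalso; lra.
Qed.

Let plane1 : plane_drawing e1 d1.
Proof.
apply: (@plane_extend _ _ _ (fun u => Some (Some (Some u))) e d) => //.
  by case=> [[[u|]|]|] [[[v|]|]|] //=; exists u, v.
have r0 := r_gt0.
case=> [[[w|]|]|] u v nz uv [t [/andP[t0 t1] /= [h1 h2]]]; first by have := nz w; rewrite eqxx.
all: have /andP[a1 a2] := bound1 u; have /andP[b1 b2] := bound1 v; nra.
Qed.

(** Each face of a first triangulation that crosses the axis without a vertex on it receives an
    isolated vertex there, and the drawing is completed again. By maximality no edge between old
    vertices is new ([back]), so a bad face of the second triangulation would be one of the first
    and contain the vertex added for it. *)
Theorem axis_exists : exists (V : finType) (d2 : V -> point R) (adj : rel V) (o1 o2 o3 : V)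
    (M : nat) (s : nat -> V) (i : T -> V),
  [/\ axis d2 adj o1 o2 o3 M s, (d2 o3).1 < 0, injective i & forall u, ~~ outer o1 o2 o3 (i u)] /\
  (forall u v, e u v -> adj (i u) (i v)) /\ forall u, d2 (i u) = d u.
Proof.
have r0 := r_gt0.
have [adj1 sub1 T1] : exists2 adj1, subrel e1 adj1 & triang d1 adj1 None (Some None) (Some (Some None)).
  apply: triang_in_big => //.
  - by case=> [[[u|]|]|] [[[v|]|]|] //=; apply: e_sym.
  - by case=> [[[u|]|]|] //=; apply: e_irr.
  by case=> [[[u|]|]|] //= _ _ _; apply: framed_in; apply: d_framed.
have bd v : (d1 v).2 <= 4 * r - (d1 v).1 /\ - (d1 v).2 <= 4 * r - (d1 v).1.
  case: v => [[[u|]|]|] /=; [|lra|lra|lra].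
  by have [_ /andP[h1 h2]] := d_framed u; split; lra.
pose bad (t : V1 * V1 * V1) := [&& face d1 adj1 t.1.1 t.1.2 t.2, (d1 t.1.1).1 < 0, 0 < (d1 t.1.2).1
  & (d1 t.2).1 != 0].
pose good (t : V1 * V1 * V1) h := [/\ - (4 * r) < h < 4 * r,
   forall u v, adj1 u v -> ~ on_seg (d1 u) (d1 v) (0, h), forall u, d1 u <> (0, h) &
   [/\ 0 <= cr (d1 t.1.1) (d1 t.1.2) (0, h), 0 <= cr (d1 t.1.2) (d1 t.2) (0, h)
     & 0 <= cr (d1 t.2) (d1 t.1.1) (0, h)]].
have [hf hfP] : exists hf : V1 * V1 * V1 -> R, forall t, bad t -> good t (hf t).
  apply: (@fin_all_exists _ (fun _ => R) (fun t h => bad t -> good t h)) => -[[a b] c].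
  have [/and4P[/= f la rb c0]|nb] := boolP (bad (a, b, c)); last by exists 0.
  by have [h hP] := dummy_height T1 bd f la rb c0; exists h.
(* Without duplicates, distinct indices give distinct new vertices. *)
pose hs := undup [seq hf t | t <- enum bad].
have hsP h : h \in hs -> exists2 t, bad t & h = hf t.
  by rewrite mem_undup => /mapP[t]; rewrite mem_enum => bt ->; exists t.
pose V2 := (V1 + 'I_(size hs))%type.
pose d2 (x : V2) : point R := match x with inl v => d1 v | inr k => (0, hs`_k) end.
pose e2 (x y : V2) := match x, y with inl u, inl v => adj1 u v | _, _ => false end.
have hk (k : 'I_(size hs)) : exists2 t, bad t & hs`_k = hf t by apply/hsP/mem_nth.
have inj2 : injective d2.
  case=> [u|k] [v|j] /=.
  - by move=> /(tri_inj T1)->.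
  - by move=> E; have [t bt Et] := hk j; have [_ _ h _] := hfP t bt; case: (h u); rewrite -Et.
  - by move=> E; have [t bt Et] := hk k; have [_ _ h _] := hfP t bt; case: (h v); rewrite -Et.
  by move=> [/eqP]; rewrite nth_uniq ?undup_uniq // => /eqP/val_inj->.
have pd2 : plane_drawing e2 d2.
  apply: (@plane_extend _ _ _ inl adj1 d1) => //; first exact: tri_pd T1.
    by case=> [u|k] [v|j] //= uv; exists u, v.
  case=> [w|k] u v nz uv; first by have := nz w; rewrite eqxx.
  by have [t bt Et] := hk k; have [_ h _ _] := hfP t bt; rewrite /= Et; apply: h.
have fr2 x : x != inl None -> x != inl (Some None) -> x != inl (Some (Some None)) -> framed (d2 x).
  case: x => [[[[u|]|]|]|k]; rewrite ?eqxx // => _ _ _; first exact: (d_framed u).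
  have [t bt Et] := hk k; have [h _ _ _] := hfP t bt.
  by rewrite /framed /= Et subr0 h; split=> //; lra.
have [adj2 sub2 T2] : exists2 adj2, subrel e2 adj2 &
    triang d2 adj2 (inl None) (inl (Some None)) (inl (Some (Some None))).
  apply: triang_in_big => //.
  - by case=> [u|k] [v|j] //=; apply: (tri_sym T1).
  - by case=> [u|k] //=; apply: (tri_irr T1).
  by move=> x h1 h2 h3; have := framed_in (fr2 x h1 h2 h3).
have back u v : adj2 (inl u) (inl v) -> adj1 u v.
  move=> uv; apply/negPn/negP => nuv; have n : u != v by have := adj_neq T2 uv; rewrite (inj_eq inl_inj).
  case: (tri_max T1 n nuv) => [[w [wu wv o]]|[a [b /andP[ab c]]]].
    by apply: (tri_vert T2 uv (w := inl w)) o; rewrite (inj_eq inl_inj).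
  by have := pd_not_pcross (tri_pd T2) uv (sub2 (inl a) (inl b) ab); rewrite /= c.
have [||M [s [_ s_on s_all s_inc]]] := @sorted_enum R V2 (fun v => (d2 v).2) (fun v => (d2 v).1 == 0).
- by move=> x y /eqP hx /eqP hy E; apply/inj2/point_eq; rewrite ?hx ?hy.
- by have [v v0] := axis0; exists (inl (Some (Some (Some v)))); rewrite /= v0.
exists V2, d2, adj2, (inl None), (inl (Some None)), (inl (Some (Some None))), M, s,
  (fun u => inl (Some (Some (Some u)))); split; last first.
  by split=> // u v uv; apply: sub2; apply: sub1.
split=> //; [|by rewrite /=; lra|by move=> u v []].
split=> //=; [lra|lra| | | |].
- by move=> k kM; apply/eqP/s_on.
- move=> k kM; have := s_on k kM; apply: contraL => /outerP[] -> /=; [rewrite lt_eqF|rewrite gt_eqF|rewrite lt_eqF] => //; lra.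
- by move=> v /eqP; apply: s_all.
move=> a b c f la rb; apply/eqP/negPn/negP => c0; have [ab bc ca pos emp] := faceP f.
case: a b c ab bc ca la rb c0 f pos emp => [a|k] [b|j] [c|l] //= ab bc ca la rb c0 f pos emp;
  try by rewrite ?ltxx ?eqxx in la rb c0.
have f1 : face d1 adj1 a b c.
  rewrite /face !back //= pos /=; apply/forallP => z; apply/implyP.
  rewrite !inE !negb_or => /and3P[za zb zc]; apply/negP => /and3P[h1 h2 h3].
  by apply: (emp (inl z)); rewrite ?(inj_eq inl_inj).
have bt : bad (a, b, c) by rewrite /bad /= f1 la rb c0.
have [_ _ _ [h1 h2 h3]] := hfP _ bt.
have hin : hf (a, b, c) \in hs by rewrite mem_undup; apply/mapP; exists (a, b, c); rewrite ?mem_enum.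
have ki : (index (hf (a, b, c)) hs < size hs)%N by rewrite index_mem.
by apply: (emp (inr (Ordinal ki))) => //=; rewrite nth_index.
Qed.

End Frame.

(** * Prescribing the points *)

Lemma increasing_extension (R : realType) (m : nat) (kp : nat -> nat) (y : nat -> R) :
  (forall j, (j < m)%N -> (kp j < kp j.+1)%N) -> (forall j, (j < m)%N -> y j < y j.+1) ->
  exists b : nat -> R, (forall k, b k < b k.+1) /\ forall j, (j <= m)%N -> b (kp j) = y j.
Proof.
elim: m => [|m IH] kinc yinc.
  exists (fun k => y 0%N + (k%:R - (kp 0%N)%:R)); split=> [k|j]; first by rewrite -natr1; lra.
  by rewrite leqn0 => /eqP->; rewrite subrr addr0.
have [b [binc bE]] := IH (fun j h => kinc j (ltnW h)) (fun j h => yinc j (ltnW h)).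
pose w := (y m.+1 - y m) / ((kp m.+1)%:R - (kp m)%:R).
have D : 0 < (kp m.+1)%:R - (kp m)%:R :> R by rewrite subr_gt0 ltr_nat kinc.
have w0 : 0 < w by rewrite divr_gt0 // subr_gt0 yinc.
have mono j : (j <= m)%N -> (kp j <= kp m)%N.
  move=> jm; elim: m jm kinc {IH yinc bE w D w0} => [|m IH]; first by rewrite leqn0 => /eqP->.
  rewrite leq_eqVlt => /orP[/eqP->//|jm] kinc; apply: leq_trans (IH jm _) (ltnW (kinc m _)) => //.
  by move=> i h; apply: kinc; apply: ltnW.
exists (fun k => if (k <= kp m)%N then b k else y m + (k%:R - (kp m)%:R) * w); split.
  move=> k; have [k1|k1] := leqP k.+1 (kp m); first by rewrite ltnW.
  have [k2|k2] := leqP k (kp m).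
    have -> : k = kp m by lia.
    by rewrite bE // ltrDl mulr_gt0 // subr_gt0 ltr_nat.
  by rewrite ltrD2l ltr_pM2r // ltrD2r ltr_nat.
move=> j; rewrite leq_eqVlt => /orP[/eqP->|jm]; last by rewrite mono // bE.
by rewrite leqNgt kinc //= /w mulrCA divff ?mulr1 ?gt_eqF //; ring.
Qed.

(** [t] only has to avoid the negated slopes of the lines through two of the points. *)
Lemma shear_inj (R : realType) (P : seq (point R)) : uniq P ->
  exists t : R, injective (fun k : 'I_(size P) => (nth (0, 0) P k).2 + t * (nth (0, 0) P k).1).
Proof.
move=> uP; pose p (k : 'I_(size P)) := nth (0, 0) P k.
have pinj : injective p.
  by move=> j k /eqP; rewrite /p nth_uniq // => /eqP/val_inj.
have [t [_ tB]] := avoid_finite [seq - ((p z.1).2 - (p z.2).2) / ((p z.1).1 - (p z.2).1) | z : 'I_(size P) * 'I_(size P)].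
exists t => j k; rewrite -/(p j) -/(p k) => E; apply: pinj.
have [x|n] := eqVneq (p j).1 (p k).1.
  by apply: point_eq => //; move: E; rewrite x => /addIr.
case/negP: tB; apply/mapP; exists (j, k); first by rewrite mem_enum.
have D : (p j).1 - (p k).1 != 0 by rewrite subr_eq0.
by apply: (mulIf D); rewrite /= mulfVK // mulrBr; lra.
Qed.

Theorem theorem4 (R : realType) (T : finType) (e : rel T)
    (e_sym : symmetric e) (e_irr : irreflexive e)
    (G_planar : planar R e) (S : {set T}) (S_col : collinear_set R e S)
    (P : seq (point R)) (P_uniq : uniq P) (P_size : size P = #|S|) :
  universal_point_subset e P.
Proof.
split=> //; split; first by rewrite P_size max_card.
(* [axis_exists] needs a vertex on the axis. If [S] is empty, so is [P], and any plane drawing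
   serves. *)
have [S0|[v0 Sv0]] := set_0Vmem S.
  have [d pd] := G_planar; exists d; split=> // p.
  by move: P_size; rewrite S0 cards0 => /size0nil->.
have [d0 [pd0 [a [b [c [ab0 line]]]]]] := S_col.
(* A similarity of determinant [a ^+ 2 + b ^+ 2] that takes the given line to the axis. *)
pose f (p : point R) : point R := (a * p.1 + b * p.2 - c, a * p.2 - b * p.1).
have N0 : a ^+ 2 + b ^+ 2 != 0.
  by rewrite paddr_eq0 ?sqr_ge0 // !sqrf_eq0 negb_and; apply/orP.
have finj : injective f.
  move=> p q [E1 E2]; apply: point_eq; apply: (mulfI N0).
    transitivity (a * (a * p.1 + b * p.2 - c) - b * (a * p.2 - b * p.1) + a * c); first by ring.
    by rewrite E1 E2; ring.
  transitivity (b * (a * p.1 + b * p.2 - c) + a * (a * p.2 - b * p.1) + b * c); first by ring.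
  by rewrite E1 E2; ring.
have flerp t p q : f (lerp t p q) = lerp t (f p) (f q) by apply: point_eq => /=; ring.
pose d v := f (d0 v).
have pd : plane_drawing e d := plane_affine (fun=> erefl) finj flerp pd0.
have d_inj : injective d by case: pd.
have Sd v : v \in S -> (d v).1 = 0 by move=> Sv; rewrite /= line // subrr.
have [V [d2 [adj [o1 [o2 [o3 [M [s [i]]]]]]]]] := axis_exists e_sym e_irr pd (ex_intro _ v0 (Sd v0 Sv0)).
move=> [[H left3 i_inj i_out] [i_adj i_pos]].
have [||m [ss [ssE ss_S ss_all ss_inc]]] := @sorted_enum R T (fun v => (d v).2) (mem S).
- by move=> x y Sx Sy E; apply/d_inj/point_eq; rewrite // !Sd.
- by exists v0.
have [t tinj] := shear_inj P_uniq.
pose p k := nth (0, 0) P k.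
pose f2 (k : 'I_(size P)) := (p k).2 + t * (p k).1.
have sizeP : size P = m.+1 by rewrite P_size -ssE.
have [||m' [sp [spE _ sp_all sp_inc]]] := @sorted_enum R 'I_(size P) f2 predT.
- by move=> x y _ _; apply: tinj.
- by have P0 : (0 < size P)%N; [rewrite sizeP | exists (Ordinal P0)].
have {spE} mm : m' = m by apply: succn_inj; rewrite -spE -sizeP card_ord.
rewrite {}mm in sp_all sp_inc.
have [kp kpP] : exists kp : 'I_m.+1 -> nat, forall j, (kp j <= M)%N /\ i (ss j) = s (kp j).
  apply: (@fin_all_exists 'I_m.+1 (fun _ => nat) (fun (j : 'I_m.+1) k => (k <= M)%N /\ i (ss j) = s k)) => j.
  have [|k kM E] := ax_all H (v := i (ss j)); last by exists k.
  by rewrite i_pos Sd //; apply: ss_S; rewrite -ltnS.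
pose kq j := kp (inord j).
have kqP j : (j <= m)%N -> (kq j <= M)%N /\ i (ss j) = s (kq j).
  by move=> jm; have := kpP (inord j); rewrite inordK.
have kq_inc j j' : (j < j' <= m)%N -> (kq j < kq j')%N.
  move=> /[dup] /andP[jj jm] /ss_inc lt.
  have [h1 E1] := kqP j (leq_trans (ltnW jj) jm); have [h2 E2] := kqP j' jm.
  rewrite ltnNge leq_eqVlt; apply/negP => /orP[/eqP E|h].
    by move: lt; rewrite -!i_pos E1 E2 E ltxx.
  have := ax_inc H (j := kq j') (k := kq j); rewrite h h1 => /(_ isT).
  by rewrite -E1 -E2 !i_pos ltNge (ltW lt).
(* The vertices of [S] in their order along the line receive the points in the order of their
   sheared heights; heights of other line vertices are interpolated. *)
have [bb [bb_inc bbE]] : exists bb : nat -> R, (forall k, bb k < bb k.+1) /\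
    forall j, (j <= m)%N -> bb (kq j) = f2 (sp j).
  by apply: increasing_extension => j jm; [apply: kq_inc | apply: sp_inc]; rewrite ltnSn.
(* Line vertices that do not come from [S] may have any abscissa; 0 is chosen. *)
pose aa k := if [pick j : 'I_m.+1 | kq j == k] is Some j then (p (sp j)).1 else 0.
have aaE j : (j <= m)%N -> aa (kq j) = (p (sp j)).1.
  move=> jm; rewrite /aa; case: pickP => [j' /eqP E|/(_ (Ordinal (n := m.+1) (m := j) jm))]; last by rewrite eqxx.
  suff -> : j' = j :> nat by [].
  have j'm : (j' <= m)%N by rewrite -ltnS.
  have [h|h|//] := ltngtP j' j; [have := kq_inc j' j | have := kq_inc j j'];
    by rewrite h ?jm ?j'm E ltnn => /(_ isT).
have [ep [D [ep0 [Ds Dstar Dn]]]] := pinned_stars H left3 aa (fun k _ => bb_inc k).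
have pdD := surrounded_plane (ax_tri H) (fun v al be ov h => Dstar v ov al be h) Dn i_inj i_out i_adj.
(* Undoes the contraction by [ep] and then the shear by [t]. *)
pose g (q : point R) : point R := (q.1 / ep, q.2 - t * (q.1 / ep)).
have epn : ep != 0 by rewrite gt_eqF.
exists (fun u => g (D (i u))); split.
  apply: (plane_affine (f := g)) pdD => //.
    move=> x y [/(mulIf (invr_neq0 epn)) E1 E2]; apply: point_eq => //.
    by move: E2; rewrite E1 => /addIr.
  by move=> w x y; apply: point_eq => /=; field.
move=> q /(nthP (0, 0))[l lP <-].
have [j jm E] := sp_all (Ordinal lP) isT.
have [kM is_] := kqP j jm.
exists (ss j); rewrite is_ Ds // bbE // aaE // /g /f2 -E /=.
by apply: point_eq => /=; [rewrite mulrC mulKf | rewrite (mulrC ep) mulfK //; ring].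
Qed.
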